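(* Let $\gamma\in(0,1]$. For every $\varphi\in C^\gamma(\mathbb{R})$, precisely one of the following properties holds. 1. The family $(\beta\varphi)_{\beta\in(0,+\infty)}$ is contained in $\mathcal{I}(\gamma)$, and the function $\beta\mapsto P(\beta\varphi)$ is real-analytic and strictly larger than $\beta\mapsto\beta\varphi(0)$ on $(0,+\infty)$. 2. There is $\beta_*\in(0,+\infty)$ such that for every $\beta\in(0,+\infty)$, the potential $\beta\varphi$ is in $\mathcal{I}(\gamma)$ if $\beta\in(0,\beta_* )$ and outside $\mathcal{I}(\gamma)$ if $\beta\in[\beta_*,+\infty)$. Thus, $\beta_*\varphi$ is in $\mathcal{PT}(\gamma)$, and the function $\beta\mapsto P(\beta\varphi)$ is real-analytic and strictly larger than $\beta\mapsto\beta\varphi(0)$ on $(0,\beta_* )$, it coincides with $\beta\mapsto\beta\varphi(0)$ on $[\beta_*,+\infty)$, and it only fails to be real-analytic on $(0,+\infty)$ at $\beta_*$.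
   Context: Fix $\alpha\in(0,+\infty)$ and let $f\colon[0,1]\to[0,1]$ be the intermittent map given by $f(x)=x(1+x^{\alpha})$ if $x(1+x^{\alpha})\le 1$, and $f(x)=x(1+x^{\alpha})-1$ otherwise. Let $\mathscr{M}$ be the set of Borel probability measures on $[0,1]$ invariant by $f$; for $\nu\in\mathscr{M}$ let $h_\nu$ be its measure-theoretic entropy. For $\gamma\in(0,1]$, $C^{\gamma}(\mathbb{R})$ is the Banach space of real-valued $\gamma$-Hölder continuous functions on $[0,1]$ with norm $\|\varphi\|_\gamma=\|\varphi\|+|\varphi|_\gamma$, where $\|\varphi\|=\sup_{[0,1]}|\varphi|$ and $|\varphi|_\gamma=\sup_{x\ne y}|\varphi(x)-\varphi(y)|/|x-y|^\gamma$. For a continuous $\varphi\colon[0,1]\to\mathbb{R}$ (a potential), the pressure is $P(\varphi)=\sup\{h_\nu+\int\varphi\,d\nu:\nu\in\mathscr{M}\}$, and a Gibbs state of $f$ for $\varphi$ is a measure in $\mathscr{M}$ attaining this supremum. $\delta_0$ is the Dirac mass at $0$. A measure $\nu\in\mathscr{M}$ is exponentially mixing if there are $C\in(0,+\infty)$ and $\rho\in(0,1)$ such that for every bounded measurable $\psi\colon[0,1]\to\mathbb{R}$, every Lipschitz $\tilde\psi\colon[0,1]\to\mathbb{R}$ and every $n\in\mathbb{N}$, $|\int\psi\circ f^n\cdot\tilde\psi\,d\nu-\int\psi\,d\nu\int\tilde\psi\,d\nu|\le C\|\psi\|\,|\tilde\psi|_1\,\rho^n$. The intermittent phase $\mathcal{I}(\gamma)$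 is the set of $\varphi\in C^\gamma(\mathbb{R})$ for which there is an exponentially mixing Gibbs state of strictly positive entropy. The stationary phase $\mathcal{S}(\gamma)$ is the interior in $C^\gamma(\mathbb{R})$ of the set of $\varphi$ for which $\delta_0$ is the unique Gibbs state. The phase transition locus $\mathcal{PT}(\gamma)$ is the common boundary $\partial\mathcal{I}(\gamma)=\partial\mathcal{S}(\gamma)$ in $C^\gamma(\mathbb{R})$ (these two boundaries coincide; when $\alpha<1$ and $\gamma>\alpha$ both are empty). *)

(* Defs.v *)
From HB Require Import structures.
From mathcomp Require Import all_boot all_order all_algebra.
From mathcomp Require Import all_classical all_reals all_analysis.

Set Implicit Arguments.
Unset Strict Implicit.
Unset Printing Implicit Defensive.

Import Order.TTheory GRing.Theory Num.Theory.
Import numFieldNormedType.Exports.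

Local Open Scope classical_set_scope.
Local Open Scope ring_scope.

Definition exactly_one (P Q : Prop) : Prop := (P \/ Q) /\ ~ (P /\ Q).

Definition uitv (R : realType) : Type := set_type (`[0, 1]%classic : set R).

HB.instance Definition _ (R : realType) := Choice.on (uitv R).
HB.instance Definition _ (R : realType) := Topological.on (uitv R).

Fact uitv0_subproof (R : realType) : (0 : R) \in (`[0, 1]%classic : set R).
Proof. by rewrite inE /= in_itv /= lexx ler01. Qed.

Definition uitv0 (R : realType) : uitv R := exist _ 0 (uitv0_subproof R).

HB.instance Definition _ (R : realType) := isPointed.Build (uitv R) (uitv0 R).

(* Borel sigma-algebra of [0, 1]: generated by its relatively open subsets. *)
HB.instance Definition _ (R : realType) :=
  Measurable.copy (uitv R) (g_sigma_algebraType (@open (uitv R))).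

Section uitv_theory.
Variable R : realType.
Implicit Types x y : uitv R.

Lemma uitv_ge0 x : 0 <= set_val x.
Proof. by have /set_mem/itvP-> := valP x. Qed.

Lemma uitv_le1 x : set_val x <= 1.
Proof. by have /set_mem/itvP-> := valP x. Qed.

Lemma uitv_dist_le1 x y : `|set_val x - set_val y| <= 1.
Proof.
have [[x0 x1] [y0 y1]] :=
  (conj (uitv_ge0 x) (uitv_le1 x), conj (uitv_ge0 y) (uitv_le1 y)).
rewrite ler_norml lerBlDr lerBrDr; apply/andP; split.
  by rewrite (le_trans _ x0)// addrC subr_le0.
by rewrite (le_trans x1)// lerDl.
Qed.

Lemma powR_le1 (a : {posnum R}) (z : R) : 0 <= z <= 1 -> z `^ a%:num <= 1.
Proof.
move=> /andP[z0 z1]; have -> : 1 = 1 `^ a%:num :> R by rewrite powR1.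
by apply: ge0_ler_powR; rewrite ?nnegrE.
Qed.

Lemma uitv_dist_neq0 x y : x != y -> set_val x - set_val y != 0.
Proof. by rewrite subr_eq0 !set_valE (inj_eq val_inj). Qed.

End uitv_theory.

Section intermittent_map.
Variables (R : realType) (alpha : {posnum R}).

Definition intermittent_fun (x : R) : R :=
  let y := x * (1 + x `^ alpha%:num) in if y <= 1 then y else y - 1.

Fact intermittent_subproof (x : uitv R) :
  intermittent_fun (set_val x) \in (`[0, 1]%classic : set R).
Proof.
have [x0 x1] := (uitv_ge0 x, uitv_le1 x).
rewrite inE /= in_itv /= /intermittent_fun.
have p0 := powR_ge0 (set_val x) alpha%:num.
have p1 : set_val x `^ alpha%:num <= 1.
  by rewrite powR_le1// x0.
case: ifPn => [->|]; first by rewrite andbT mulr_ge0// addr_ge0.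
rewrite -ltNge => /ltW y1; rewrite subr_ge0 y1 /= lerBlDr.
by rewrite (le_trans (ler_piMl _ x1)) ?addr_ge0// lerD2l.
Qed.

Definition intermittent (x : uitv R) : uitv R :=
  exist _ (intermittent_fun (set_val x)) (intermittent_subproof x).

End intermittent_map.

Section holder_norms.
Variable R : realType.
Implicit Types (g : R) (phi psi : uitv R -> R).

Definition holder_quotients g phi : set R :=
  [set `|phi p.1 - phi p.2| / `|set_val p.1 - set_val p.2| `^ g
    | p in [set p : uitv R * uitv R | p.1 != p.2]].

Definition holder g phi : Prop := has_ubound (holder_quotients g phi).

Definition lipschitz phi : Prop := holder 1 phi.

(* These real suprema are meaningful for bounded, resp. g-Hölder, functions. *)
Definition sup_norm phi : R := sup (range (fun x => `|phi x|)).
Definition holder_seminorm g phi : R := sup (holder_quotients g phi).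

End holder_norms.

Section holder_functions.
Variables (R : realType) (g : {posnum R}).
Implicit Types phi psi : uitv R -> R.

(* Functions whose Hölder seminorm is finite; as 0 < g and [0, 1] is bounded,
   they are continuous and bounded. *)
Definition holder_pred : {pred uitv R -> R} := mem [set phi | holder g%:num phi].

Record holder_space : Type := Holder {
  holder_fun :> uitv R -> R;
  holder_funP : holder_fun \in holder_pred }.

HB.instance Definition _ := [isSub for holder_fun].
HB.instance Definition _ := [Choice of holder_space by <:].

Let dist_pow_gt0 (x y : uitv R) : x != y ->
  0 < `|set_val x - set_val y| `^ g%:num.
Proof. by move=> xy; rewrite powR_gt0// normr_gt0 uitv_dist_neq0. Qed.

Lemma holderP phi : holder g%:num phi <->
  exists2 M, 0 <= M & forall x y, x != y ->
    `|phi x - phi y| <= M * `|set_val x - set_val y| `^ g%:num.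
Proof.
split=> [[M ubM]|[M M0 hM]].
  exists (Num.max 0 M); first by rewrite le_max lexx.
  move=> x y xy; rewrite -ler_pdivrMr ?dist_pow_gt0// le_max.
  by apply/orP; right; apply: ubM; exists (x, y).
exists M => _ [[x y] /= xy <-].
by rewrite ler_pdivrMr ?dist_pow_gt0// hM.
Qed.

Lemma holder_bounded phi : holder g%:num phi ->
  has_ubound (range (fun x => `|phi x|)).
Proof.
move=> /holderP[M M0 hM]; exists (`|phi (uitv0 R)| + M) => _ [x _ <-].
have [->|x0] := eqVneq x (uitv0 R); first by rewrite lerDl.
rewrite -lerBlDl (le_trans (lerB_dist _ _))// (le_trans (hM _ _ x0))//.
by rewrite ler_piMr// powR_le1// normr_ge0 uitv_dist_le1.
Qed.

Lemma holder_submod_closed : submod_closed holder_pred.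
Proof.
split=> [|a phi psi]; rewrite !inE.
  by apply/holderP; exists 0 => // x y _; rewrite subrr normr0 mul0r.
move=> /holderP[M M0 hM] /holderP[N N0 hN]; apply/holderP.
exists (`|a| * M + N) => [|x y xy]; first by rewrite addr_ge0// mulr_ge0.
have -> : (a *: phi + psi) x - (a *: phi + psi) y =
    a * (phi x - phi y) + (psi x - psi y).
  by rewrite mulrBr opprD addrACA.
rewrite (le_trans (ler_normD _ _))// mulrDl lerD ?hN// normrM -mulrA.
by rewrite ler_wpM2l// hM.
Qed.

HB.instance Definition _ := GRing.isSubmodClosed.Build _ _ holder_pred
  holder_submod_closed.
HB.instance Definition _ := [SubChoice_isSubLmodule of holder_space by <:].

Definition holder_norm (phi : holder_space) : R :=
  sup_norm phi + holder_seminorm g%:num phi.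

Let holderW (phi : holder_space) : holder g%:num phi.
Proof. by have := holder_funP phi; rewrite inE. Qed.

Let sup_normP (phi : holder_space) x : `|phi x| <= sup_norm phi.
Proof. by apply: ub_le_sup; [exact/holder_bounded/holderW|exists x]. Qed.

Let seminormP (phi : holder_space) x y : x != y ->
  `|phi x - phi y| / `|set_val x - set_val y| `^ g%:num
    <= holder_seminorm g%:num phi.
Proof. by move=> xy; apply: ub_le_sup; [exact: holderW|exists (x, y)]. Qed.

Let one : uitv R.
Proof. by exists 1; rewrite inE /= in_itv /= lexx ler01. Defined.

Let one_neq0 : one != uitv0 R.
Proof. by rewrite -(inj_eq val_inj) /= oner_neq0. Qed.

Let quot0 phi : holder_quotients g%:num phi !=set0.
Proof. by eexists; exists (one, uitv0 R); first exact: one_neq0. Qed.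

Let range0 phi : range (fun x => `|phi x|) !=set0.
Proof. by eexists; exists (uitv0 R). Qed.

Let seminorm_ge0 (phi : holder_space) : 0 <= holder_seminorm g%:num phi.
Proof.
by apply: le_trans (seminormP phi one_neq0); rewrite divr_ge0// powR_ge0.
Qed.

Fact holder_normD (phi psi : holder_space) :
  holder_norm (phi + psi) <= holder_norm phi + holder_norm psi.
Proof.
rewrite addrACA lerD// ge_sup//.
  move=> _ [x _ <-].
  by rewrite (le_trans (ler_normD _ _))// lerD// sup_normP.
move=> _ [[x y] /= xy <-].
rewrite (le_trans _ (lerD (seminormP phi xy) (seminormP psi xy)))//.
rewrite -mulrDl ler_wpM2r ?invr_ge0 ?powR_ge0//.
have -> : (phi + psi : holder_space) x - (phi + psi : holder_space) y =
  (phi x - phi y) + (psi x - psi y) by rewrite addrACA -opprD.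
exact: ler_normD.
Qed.

Let holder_normZ_le (l : R) (phi : holder_space) :
  holder_norm (l *: phi) <= `|l| * holder_norm phi.
Proof.
rewrite mulrDr lerD// ge_sup//.
  by move=> _ [x _ <-]; rewrite normrM ler_wpM2l// sup_normP.
move=> _ [[x y] /= xy <-].
rewrite (_ : (l *: phi : holder_space) x - (l *: phi : holder_space) y =
  l * (phi x - phi y)); last by rewrite mulrBr.
by rewrite normrM -mulrA ler_wpM2l// seminormP.
Qed.

Fact holder_normZ (l : R) (phi : holder_space) :
  holder_norm (l *: phi) = `|l| * holder_norm phi.
Proof.
apply/eqP; rewrite eq_le holder_normZ_le /=.
have [->|l0] := eqVneq l 0.
  rewrite normr0 mul0r addr_ge0// (le_trans _ (sup_normP _ (uitv0 R)))//.
rewrite -ler_pdivlMl ?normr_gt0// -normfV.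
by rewrite -{1}[phi](scalerK l0) holder_normZ_le.
Qed.

Fact holder_norm_eq0 (phi : holder_space) : holder_norm phi = 0 -> phi = 0.
Proof.
move=> phi0; apply/val_inj/funext => x /=; apply/eqP.
rewrite -normr_le0 -phi0 (le_trans (sup_normP _ x))//.
by rewrite lerDl.
Qed.

HB.instance Definition _ := Lmodule_isNormed.Build R holder_space
  holder_normD holder_normZ holder_norm_eq0.

End holder_functions.

Section entropy.
Context d (T : measurableType d) (R : realType).
Variables (nu : probability T R) (f : T -> T).

(* A finite measurable partition is given by its labelling map [xi : T -> L],
   whose fibres are the (possibly empty) atoms. *)
Definition is_partition (L : finType) (xi : T -> L) : Prop :=
  forall l, measurable (xi @^-1` [set l]).

Definition partition_entropy (L : finType) (xi : T -> L) : R :=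
  - \sum_(l : L) (let p := fine (nu (xi @^-1` [set l])) in p * ln p).

(* The join of the partitions f^{-i}(xi), 0 <= i < n. *)
Definition iterated_join (L : finType) (xi : T -> L) (n : nat) (x : T) :
  {ffun 'I_n -> L} := [ffun i : 'I_n => xi (iter i f x)].

Definition entropy_wrt (L : finType) (xi : T -> L) : R :=
  limn (fun n => partition_entropy (iterated_join xi n) / n%:R).

Definition entropy : \bar R :=
  ereal_sup [set h | exists (k : nat) (xi : T -> 'I_k),
    is_partition xi /\ h = (entropy_wrt xi)%:E].

End entropy.

Section thermodynamics.
Context d (T : measurableType d) (R : realType).
Variable f : T -> T.
Implicit Types (nu : probability T R) (phi : T -> R).

Definition invariant_measure nu : Prop :=
  forall A, measurable A -> pushforward nu f A = nu A.

Definition free_energy phi nu : \bar R :=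
  (entropy nu f + \int[nu]_x (phi x)%:E)%E.

Definition pressure phi : \bar R :=
  ereal_sup [set free_energy phi nu | nu in invariant_measure].

Definition gibbs_state phi nu : Prop :=
  invariant_measure nu /\ free_energy phi nu = pressure phi.

(* Measures are compared on measurable sets, where alone they are meaningful. *)
Definition unique_gibbs_state phi nu : Prop :=
  gibbs_state phi nu /\
  forall mu : probability T R, gibbs_state phi mu ->
    forall A, measurable A -> mu A = nu A.

End thermodynamics.

Definition exponentially_mixing (R : realType) (f : uitv R -> uitv R)
    (nu : probability (uitv R) R) : Prop :=
  exists C rho : R, [/\ 0 < C, 0 < rho < 1 &
    forall psi tpsi : uitv R -> R,
      measurable_fun [set: uitv R] psi -> bounded_fun psi -> lipschitz tpsi ->
      forall n : nat,
      `| \int[nu]_x (psi (iter n f x) * tpsi x)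
         - (\int[nu]_x psi x) * (\int[nu]_x tpsi x) |
      <= C * sup_norm psi * holder_seminorm 1 tpsi * rho ^+ n ].

Definition boundary (T : topologicalType) (A : set T) : set T :=
  closure A `\` interior A.

Section phases.
Variables (R : realType) (alpha g : {posnum R}).
Let f := intermittent alpha.

Definition intermittent_phase : set (holder_space g) :=
  [set phi | exists nu : probability (uitv R) R,
    [/\ gibbs_state f phi nu, exponentially_mixing f nu &
        (0 < entropy nu f)%E]].

Definition stationary_phase : set (holder_space g) :=
  interior [set phi : holder_space g |
    unique_gibbs_state f phi (\d_ (uitv0 R))].

(* The two boundaries are known to coincide, so that their intersection is
   their common value. *)
Definition phase_transition_locus : set (holder_space g) :=
  boundary intermittent_phase `&` boundary stationary_phase.

End phases.

Arguments intermittent_phase {R} alpha g _.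
Arguments stationary_phase {R} alpha g _.
Arguments phase_transition_locus {R} alpha g _.

(* The values of F near x are moreover required to be finite. *)
Definition analytic_at (R : realType) (F : R -> \bar R) (x : R) : Prop :=
  exists (a : nat -> R) (r : R), 0 < r /\
    forall y, `|y - x| < r ->
      F y \is a fin_num /\ pseries a (y - x) @ \oo --> fine (F y).

Definition analytic_on (R : realType) (D : set R) (F : R -> \bar R) : Prop :=
  forall x, D x -> analytic_at F x.

(* Main.v *)
Require Import Defs.
From HB Require Import structures.
From mathcomp Require Import all_boot all_order all_algebra.
From mathcomp Require Import all_classical all_reals all_analysis.
From mathcomp Require Import measurable_realfun.
From mathcomp Require Import ring lra zify.

(* Let [lam] be the infimum of the factors [s] such that [L h <= s h] for some
   bounded function [h >= 1], where [L] is the transfer operator of [phi]. Then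
   [P phi = ln lam]: the inequality [<=] is Gibbs' inequality on cylinders, and
   [lam >= exp (phi 0)] because [0] is fixed by an inverse branch.

   If [lam > exp (phi 0)], the branch at [0] is subdominant: for a suitable
   weight [U], the operator [L] contracts a cone of functions that are Hölder
   up to [U], hence has a spectral gap on Hölder functions. The gap yields an
   exponentially mixing Gibbs state of positive entropy and, by a formal
   perturbation of the leading eigenvalue, the analyticity of the pressure.

   If [lam = exp (phi 0)], normalize [phi 0 = 0]. For an exponentially mixing
   measure of positive entropy, the mass of the cylinder coded by [N] zeros
   decays exponentially in [N]. In the coding of an orbit, replace blocks of
   length [N] by zeros independently at random. If the measure were a Gibbs
   state, the entropy so gained would be subexponentially small in [N], hence
   larger than the loss due to the blocks that already were zero, and this
   contradicts [P phi = 0].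

   So [beta phi] is in the intermittent phase iff [P (beta phi) > beta phi 0]. As
   entropies are nonnegative, the other [beta > 0] form a closed half-line, away
   from [0] because the entropy [ln 2] dominates for small [beta]. At its endpoint
   the pressure is affine on one side only, so it is not analytic there; adding a
   small multiple of [- x ^ gamma] enters the stationary phase. *)

Set Implicit Arguments.
Unset Strict Implicit.
Unset Printing Implicit Defensive.

Import Order.TTheory GRing.Theory Num.Theory.
Import numFieldNormedType.Exports.

Local Open Scope classical_set_scope.
Local Open Scope ring_scope.

(** * Transfer operators of a system with two inverse branches *)

(** The obstacle is the neutral fixed point: the branch [false] has no uniform contraction rate, and
    distortion along words may grow without bound. The weight [U] comes from interpolation. If the
    branch [true] is discounted by a tiny factor, a weight is explicit; geometric means with almost
    eigenfunctions replace the discount by its square root until it reaches the actual contraction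
    rate [s]. In the surgery, the distortion between blocks is measured by [sig], which counts
    visits to the contracting branch and has bounded mean because long runs of zeros are
    exponentially rare; all other errors need only be subexponential in the block length. The decay
    of the runs of zeros follows by testing mixing on the cylinders at [0]: they shrink
    subexponentially, so the Lipschitz constants of cutoffs do not destroy the rate. The operator
    acts on all bounded functions, and its eigenfunctional is only finitely additive; a measure is
    recovered from it through a distribution function. *)

Lemma expr_lt_ex (R : realType) (q e : R) : 0 <= q < 1 -> 0 < e ->
  exists n, q ^+ n < e.
Proof.
move=> /andP[q0 q1] e0; have : (fun n => q ^+ n) @ \oo --> (0 : R).
  by apply: cvg_expr; rewrite ger0_norm.
move=> /cvgrPdist_lt /(_ _ e0)[n _ /(_ n (leqnn n))] /=.
by rewrite sub0r normrN ger0_norm ?exprn_ge0// => ?; exists n.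
Qed.

Lemma expr_gt_ex (R : realType) (q M : R) : 1 < q -> exists n, M < q ^+ n.
Proof.
move=> q1; have q0 : 0 < q by exact: lt_trans q1.
have e0 : 0 < (1 + `|M|)^-1 by rewrite invr_gt0 ltr_pwDl.
have [] := @expr_lt_ex _ q^-1 _ _ e0.
  by rewrite invr_ge0 ltW//= invf_lt1.
move=> n; rewrite exprVn ltf_pV2 ?posrE ?exprn_gt0 ?ltr_pwDl// => Mq.
by exists n; apply: lt_trans Mq; rewrite (le_lt_trans (ler_norm M))// ltrDr.
Qed.

Section transfer.
Variables (R : realType) (X : Type) (g : bool -> X -> X).
Implicit Types (W : bool -> X -> R) (u v : X -> R) (m : (X -> R) -> R).

(** The weight of the preimage [g b x] is indexed by the base point [x], so a weight is just a
    function for each branch. *)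
Definition tr W u x := W false x * u (g false x) + W true x * u (g true x).

Definition bdd u := exists B : R, forall x, `|u x| <= B.

Lemma bdd_ge0 u : bdd u -> exists2 B : R, 0 <= B & forall x, `|u x| <= B.
Proof.
move=> [B uB]; exists `|B| => // x; exact: le_trans (uB x) (ler_norm _).
Qed.

Lemma bddP u a b : (forall x, a <= u x <= b) -> bdd u.
Proof.
move=> uab; exists (`|a| + `|b|) => x; have /andP[ua ub] := uab x.
rewrite ler_norml; have := ler_norm a; have := ler_norm b.
have := ler_norm (- a); rewrite normrN => *.
have := normr_ge0 a; have := normr_ge0 b.
by move=> *; apply/andP; split; lra.
Qed.

Lemma bdd_cst a : bdd (fun=> a).
Proof. by exists `|a|. Qed.

Lemma bdd_lin a u v : bdd u -> bdd v -> bdd (fun x => a * u x + v x).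
Proof.
move=> [B uB] [C vC]; exists (`|a| * B + C) => x.
by rewrite (le_trans (ler_normD _ _))// normrM lerD// ler_wpM2l.
Qed.

Lemma bddM u v : bdd u -> bdd v -> bdd (fun x => u x * v x).
Proof.
move=> [B uB] [C vC]; exists (B * C) => x.
by rewrite normrM ler_pM.
Qed.

Lemma bddZ a u : bdd u -> bdd (fun x => a * u x).
Proof. exact/bddM/bdd_cst. Qed.

Lemma bddD u v : bdd u -> bdd v -> bdd (fun x => u x + v x).
Proof.
move=> bu bv; have := bdd_lin 1 bu bv.
by under eq_fun do rewrite mul1r.
Qed.

Lemma bddB u v : bdd u -> bdd v -> bdd (fun x => u x - v x).
Proof.
move=> bu bv; have := bdd_lin (-1) bv bu.
by under eq_fun do rewrite mulN1r addrC.
Qed.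

Lemma trD W u v x : tr W (fun y => u y + v y) x = tr W u x + tr W v x.
Proof. rewrite /tr; ring. Qed.

Lemma trZ W a u x : tr W (fun y => a * u y) x = a * tr W u x.
Proof. rewrite /tr; ring. Qed.

Lemma trB W u v x : tr W (fun y => u y - v y) x = tr W u x - tr W v x.
Proof. rewrite /tr; ring. Qed.

Lemma iter_trD W n u v x :
  iter n (tr W) (fun y => u y + v y) x = iter n (tr W) u x + iter n (tr W) v x.
Proof.
elim: n x => //= n IH x.
by rewrite (funext IH : _ = fun y => iter n (tr W) u y + iter n (tr W) v y) trD.
Qed.

Lemma iter_trZ W n a u x :
  iter n (tr W) (fun y => a * u y) x = a * iter n (tr W) u x.
Proof.
elim: n x => //= n IH x.
by rewrite (funext IH : _ = fun y => a * iter n (tr W) u y) trZ.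
Qed.

Lemma iter_trB W n u v x :
  iter n (tr W) (fun y => u y - v y) x = iter n (tr W) u x - iter n (tr W) v x.
Proof.
elim: n x => //= n IH x.
by rewrite (funext IH : _ = fun y => iter n (tr W) u y - iter n (tr W) v y) trB.
Qed.

(** A finitely additive probability on all subsets of [X]. The compactness argument below yields
    nothing stronger; [gmeasure] later turns such a functional into a measure. *)
Definition posfun m :=
  [/\ forall a u v, bdd u -> bdd v -> m (fun x => a * u x + v x) = a * m u + m v,
      forall u, bdd u -> (forall x, 0 <= u x) -> 0 <= m u
    & m (fun=> 1) = 1].

Section posfun.
Variables (m : (X -> R) -> R) (pm : posfun m).

Lemma posfun_lin a u v : bdd u -> bdd v ->
  m (fun x => a * u x + v x) = a * m u + m v.
Proof. by case: pm => + _ _; exact. Qed.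

Lemma eq_posfun u v : u =1 v -> m u = m v.
Proof. by move/funext->. Qed.

Lemma posfunD u v : bdd u -> bdd v -> m (fun x => u x + v x) = m u + m v.
Proof.
move=> bu bv; rewrite -[m u]mul1r -posfun_lin//.
by apply: eq_posfun => x; rewrite mul1r.
Qed.

Lemma posfun0 : m (fun=> 0) = 0.
Proof.
have := posfunD (bdd_cst 0) (bdd_cst 0).
rewrite (@eq_posfun _ (fun=> 0)) => [|x]; last by rewrite addr0.
by move=> h; lra.
Qed.

Lemma posfunZ a u : bdd u -> m (fun x => a * u x) = a * m u.
Proof.
move=> bu; rewrite -[RHS]addr0 -posfun0 -posfun_lin//; last exact: bdd_cst.
by apply: eq_posfun => x; rewrite addr0.
Qed.

Lemma posfunB u v : bdd u -> bdd v -> m (fun x => u x - v x) = m u - m v.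
Proof.
move=> bu bv; rewrite [RHS]addrC -mulN1r -posfun_lin//.
by apply: eq_posfun => x; rewrite mulN1r addrC.
Qed.

Lemma posfun_cst a : m (fun=> a) = a.
Proof.
case: pm => _ _ m1; rewrite -[RHS]mulr1 -m1 -posfunZ; last exact: bdd_cst.
by apply: eq_posfun => x; rewrite mulr1.
Qed.

Lemma posfun_ge0 u : bdd u -> (forall x, 0 <= u x) -> 0 <= m u.
Proof. by case: pm => _ + _; exact. Qed.

Lemma posfun_le u v : bdd u -> bdd v -> (forall x, u x <= v x) -> m u <= m v.
Proof.
move=> bu bv uv; rewrite -subr_ge0 -posfunB//.
by apply: posfun_ge0; [exact: bddB|move=> x; rewrite subr_ge0].
Qed.

Lemma posfun_ub u a : bdd u -> (forall x, u x <= a) -> m u <= a.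
Proof.
move=> bu ua; rewrite -[leRHS]posfun_cst.
exact: posfun_le bu (bdd_cst _) _.
Qed.

Lemma posfun_lb u a : bdd u -> (forall x, a <= u x) -> a <= m u.
Proof.
move=> bu ua; rewrite -[leLHS]posfun_cst.
exact: posfun_le (bdd_cst _) bu _.
Qed.

Lemma posfun_norm u B : (forall x, `|u x| <= B) -> `|m u| <= B.
Proof.
move=> uB; have bu : bdd u by exists B.
rewrite ler_norml posfun_ub ?posfun_lb//= => x.
  by have := uB x; rewrite ler_norml => /andP[].
by have := uB x; rewrite ler_norml => /andP[].
Qed.

End posfun.

Section weights.
Variables (W : bool -> X -> R) (c C : R).
Hypothesis c_gt0 : 0 < c.
Hypothesis Wc : forall b x, c <= W b x <= C.

Let W_ge0 b x : 0 <= W b x.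
Proof. by have /andP[+ _] := Wc b x; apply: le_trans; exact: ltW. Qed.

Lemma tr_le u v x : (forall y, u y <= v y) -> tr W u x <= tr W v x.
Proof. by move=> uv; rewrite lerD// ler_wpM2l. Qed.

Lemma tr_ge0 u x : (forall y, 0 <= u y) -> 0 <= tr W u x.
Proof. by move=> u0; rewrite addr_ge0// mulr_ge0. Qed.

Lemma tr_norm u B x : (forall y, `|u y| <= B) -> `|tr W u x| <= 2 * C * B.
Proof.
move=> uB; rewrite (le_trans (ler_normD _ _))// !normrM.
have h b : `|W b x| * `|u (g b x)| <= C * B.
  by rewrite ler_pM// ger0_norm//; have /andP[] := Wc b x.
by have := lerD (h false) (h true); lra.
Qed.

Lemma bdd_tr u : bdd u -> bdd (tr W u).
Proof. by move=> [B uB]; exists (2 * C * B) => x; exact: tr_norm. Qed.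

Lemma bdd_iter_tr n u : bdd u -> bdd (iter n (tr W) u).
Proof. by move=> bu; elim: n => //= n; exact: bdd_tr. Qed.

Lemma iter_tr_le n u v x : (forall y, u y <= v y) ->
  iter n (tr W) u x <= iter n (tr W) v x.
Proof. by move=> uv; elim: n x => //= n IH x; exact: tr_le. Qed.

Lemma iter_tr_ge0 n u x : (forall y, 0 <= u y) -> 0 <= iter n (tr W) u x.
Proof. by move=> u0; elim: n x => //= n IH x; exact: tr_ge0. Qed.

End weights.

Definition superharm W : set R := [set s | 0 < s /\
  exists h M, (forall x, 1 <= h x <= M) /\ forall x, tr W h x <= s * h x].

Definition lam W : R := inf (superharm W).

Section lam.
Variables (x0 : X) (W : bool -> X -> R) (c C : R).
Hypothesis c_gt0 : 0 < c.
Hypothesis Wc : forall b x, c <= W b x <= C.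

Let W_ge0 b x : 0 <= W b x.
Proof. by have /andP[+ _] := Wc b x; apply: le_trans; exact: ltW. Qed.

Lemma superharm_scale s u a b : 0 < s -> 0 < a -> (forall x, a <= u x <= b) ->
  (forall x, tr W u x <= s * u x) -> superharm W s.
Proof.
move=> s0 a0 uab us; split => //.
exists (fun x => a^-1 * u x), (a^-1 * b); split => x.
  have /andP[au ub] := uab x.
  by rewrite ler_pM2l ?invr_gt0// ub andbT -(mulVf (lt0r_neq0 a0)) ler_pM2l ?invr_gt0.
by rewrite trZ mulrCA ler_pM2l ?invr_gt0.
Qed.

Lemma superharm0 : superharm W !=set0.
Proof.
have C0 : 0 < C by have /andP[h1 h2] := Wc false x0; exact: (lt_le_trans c_gt0 (le_trans h1 h2)).
exists (2 * C); split; first lra.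
exists (fun=> 1), 1; split => x; first by rewrite lexx.
rewrite /tr !mulr1; have /andP[_ h1] := Wc false x.
by have /andP[_ h2] := Wc true x; lra.
Qed.

(* Compare [h] with [u] where [h / u] is almost minimal. *)
Lemma superharm_ge s u a b r : 0 < a -> (forall x, a <= u x <= b) ->
  (forall x, r * u x <= tr W u x) -> superharm W s -> r <= s.
Proof.
move=> a0 uab ru [s0 [h [M [hM hs]]]].
rewrite leNgt; apply/negP => sr.
have u0 x : 0 < u x by have /andP[+ _] := uab x; exact: lt_le_trans.
have b0 : 0 < b by have /andP[_ +] := uab x0; exact: lt_le_trans.
have h0 x : 0 < h x by have /andP[+ _] := hM x; exact: lt_le_trans.
have qh : forall n x, (r / s) ^+ n * (b^-1 * u x) <= h x.
  elim=> [|n IH] x.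
    rewrite expr0 mul1r (le_trans _ (proj1 (andP (hM x))))//.
    by rewrite mulrC ler_pdivrMr// mul1r; have /andP[] := uab x.
  rewrite -(ler_pM2l s0); apply: le_trans (hs x).
  apply: (le_trans _ (tr_le c_gt0 Wc x IH)).
  rewrite !trZ.
  have -> : s * ((r / s) ^+ n.+1 * (b^-1 * u x)) = (r / s) ^+ n * (b^-1 * (r * u x)).
    by rewrite exprS; field; rewrite !lt0r_neq0.
  rewrite ler_wpM2l ?exprn_ge0 ?divr_ge0 ?(ltW s0) ?(ltW (lt_trans s0 sr))//.
  by rewrite ler_wpM2l ?invr_ge0 ?(ltW b0).
have q1 : 1 < r / s by rewrite ltr_pdivlMr// mul1r.
have k0 : 0 < b^-1 * u x0 by rewrite mulr_gt0 ?invr_gt0.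
have M0 : 0 < M by have /andP[h1 h2] := hM x0; lra.
have [n] := @expr_gt_ex _ _ (M / (b^-1 * u x0)) q1; rewrite ltr_pdivrMr//.
rewrite ltNge => /negP; apply.
by apply: le_trans (qh n x0) _; have /andP[] := hM x0.
Qed.

Lemma superharm_lb : lbound (superharm W) (2 * c).
Proof.
move=> s; apply: (@superharm_ge _ (fun=> 1) 1 1) => // x.
  by rewrite lexx.
rewrite /tr !mulr1; have /andP[h1 _] := Wc false x.
by have /andP[h2 _] := Wc true x; lra.
Qed.

Lemma lam_ge2c : 2 * c <= lam W.
Proof. by apply: lb_le_inf; [exact: superharm0|exact: superharm_lb]. Qed.

Lemma lam_gt0 : 0 < lam W.
Proof. by apply: lt_le_trans lam_ge2c; rewrite mulr_gt0. Qed.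

Lemma has_inf_superharm : has_inf (superharm W).
Proof. by split; [exact: superharm0|exists (2 * c); exact: superharm_lb]. Qed.

Lemma superharm_lam s : superharm W s -> lam W <= s.
Proof. by move=> Ss; apply: ge_inf => //; have [] := has_inf_superharm. Qed.

Lemma lam_superharm s : lam W < s -> superharm W s.
Proof.
move=> Ws; have := ge_inf.
have [t [t0 [h [M [hM ht]]]] ts] : exists2 t, superharm W t & t < s.
  have e0 : 0 < s - lam W by rewrite subr_gt0.
  have [t St tl] := inf_adherent e0 has_inf_superharm.
  by exists t => //; rewrite (lt_le_trans tl)// /lam addrC subrK.
split; first exact: lt_trans ts.
exists h, M; split => // x; apply: le_trans (ht x) _.
rewrite ler_wpM2r ?ltW//.
by have /andP[+ _] := hM x; apply: lt_le_trans.
Qed.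

Lemma lam_le_eigen u a b r : 0 < r -> 0 < a -> (forall x, a <= u x <= b) ->
  (forall x, tr W u x <= r * u x) -> lam W <= r.
Proof. by move=> *; apply/superharm_lam/(@superharm_scale _ u a b). Qed.

Lemma lam_ge_eigen u a b r : 0 < a -> (forall x, a <= u x <= b) ->
  (forall x, r * u x <= tr W u x) -> r <= lam W.
Proof.
move=> *; apply: lb_le_inf; first exact: superharm0.
by move=> s; exact: (@superharm_ge _ u a b).
Qed.

Lemma lam_ge_fix z : g false z = z -> W false z <= lam W.
Proof.
move=> gz; apply: lb_le_inf; first exact: superharm0.
move=> s [s0 [h [M [hM hs]]]].
have h0 x : 0 < h x by have /andP[+ _] := hM x; exact: lt_le_trans.
rewrite -(ler_pM2r (h0 z)); apply: le_trans (hs z); rewrite /tr gz lerDl.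
by rewrite mulr_ge0// ltW.
Qed.

(** Some [h] with [1 <= h <= M] satisfies [L h <= s h]; compare the constant [1] with [h] and
    iterate. *)
Lemma iter_tr_lam s : lam W < s -> exists2 M : R, 0 < M &
  forall n x, iter n (tr W) (fun=> 1) x <= M * s ^+ n.
Proof.
move=> /lam_superharm[s0 [h [M [hM hs]]]].
have M0 : 0 < M by have /andP[h1 h2] := hM x0; lra.
exists M => // n x.
have H k y : iter k (tr W) h y <= s ^+ k * h y.
  elim: k y => [|k IH] y; first by rewrite expr0 mul1r.
  rewrite iterS; apply: (le_trans (tr_le c_gt0 Wc y IH)).
  by rewrite trZ exprSr -mulrA ler_wpM2l// exprn_ge0// ltW.
apply: (@le_trans _ _ (iter n (tr W) h x)).
  by apply: (iter_tr_le c_gt0 Wc) => y; have /andP[] := hM y.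
apply: le_trans (H n x) _; rewrite mulrC ler_wpM2r ?exprn_ge0 ?(ltW s0)//.
by have /andP[] := hM x.
Qed.

End lam.
End transfer.

Arguments tr_le [R X g W c C].
Arguments tr_ge0 [R X g W c C].
Arguments tr_norm [R X g W c C].
Arguments bdd_tr [R X g W c C].
Arguments bdd_iter_tr [R X g W c C].
Arguments iter_tr_le [R X g W c C].
Arguments iter_tr_ge0 [R X g W c C].
Arguments lam_gt0 [R X g] x0 [W c C].
Arguments lam_ge2c [R X g] x0 [W c C].

(** * Existence of an eigenfunctional *)

Lemma ultra_lim (R : realType) (G : set_system nat) (u : nat -> R) (B : R) :
  UltraFilter G -> (forall n, `|u n| <= B) -> cvg (u @ G).
Proof.
move=> uG uB; have : compact `[- B, B] by exact: segment_compact.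
rewrite compact_ultra => /(_ (u @ G)) [].
- split; first exact: fmap_proper_filter.
  move=> H pH uGH; apply/seteqP; split=> A; last exact: uGH.
  move=> HA; have [//|GA] := in_ultra_setVsetC (u @^-1` A) uG.
  have : H (~` A) by apply: uGH.
  move=> /(filterI HA); rewrite setICr => /filter_not_empty; by [].
- apply: (@filterE _ G) => n /=.
  have := uB n; rewrite ler_norml => ?; by rewrite in_itv.
- by move=> p [_ up]; apply/cvg_ex; exists p.
Qed.

Section patterson.
Variables (R : realType) (X : Type) (g : bool -> X -> X) (x0 : X).
Variables (W : bool -> X -> R) (c C : R).
Hypothesis c_gt0 : 0 < c.
Hypothesis Wc : forall b x, c <= W b x <= C.
Implicit Types (u v : X -> R).

Notation L := (tr g W).
Notation lamW := (lam g W).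

Let lam0 : 0 < lamW. Proof. exact: (lam_gt0 x0 c_gt0 Wc). Qed.

Lemma tr_sum N (a : nat -> R) (F : nat -> X -> R) x :
  L (fun y => \sum_(i < N) a i * F i y) x = \sum_(i < N) a i * L (F i) x.
Proof.
rewrite /tr !mulr_sumr -big_split /=.
by apply: eq_bigr => i _; ring.
Qed.

Let T s N u x := \sum_(n < N) s^-1 ^+ n * iter n L u x.

Let T_tele s N u x : s != 0 ->
  \sum_(n < N) s^-1 ^+ n * iter n.+1 L u x =
  s * (T s N u x + s^-1 ^+ N * iter N L u x - u x).
Proof.
move=> s0; rewrite /T -(big_ord_recr N (fun n => s^-1 ^+ n * iter n L u x)) /=.
rewrite big_ord_recl /= expr0 mul1r addrAC subrr add0r mulr_sumr.
by apply: eq_bigr => i _; rewrite /bump /= add1n exprS !mulrA mulfV// mul1r.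
Qed.

(** Patterson's construction: normalize the truncated series of [s ^- n * iter n L u x] for [s]
    slightly above [lamW]. Under [L] the series telescopes, and the boundary terms are negligible
    once the series of [u = 1] exceeds a large [M] at the base point [x]. *)
Lemma approx_posfun (eps : R) : 0 < eps -> exists nu : (X -> R) -> R,
  [/\ forall a u v, nu (fun x => a * u x + v x) = a * nu u + nu v,
      forall u, (forall x, 0 <= u x) -> 0 <= nu u, nu (fun=> 1) = 1
    & forall u (B : R), (forall x, `|u x| <= B) -> `|nu (L u) - lamW * nu u| <= eps * B].
Proof.
move=> e0; pose M := 1 + 8 * lamW / eps.
have M1 : 1 < M by rewrite ltrDl divr_gt0// mulr_gt0.
have M0 : 0 < M by exact: lt_trans M1.
have Me : 8 * lamW <= eps * M.
  have -> : eps * M = eps + 8 * lamW by rewrite /M; field; rewrite lt0r_neq0.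
  by rewrite lerDr ltW.
(* The excess [s - lamW = lamW / (4 M)] is small enough for two purposes: the eigenvalue error stays
   below [eps / 4], and [s (1 - 1 / (2 M))] is still below [lamW]. *)
pose s := lamW * (1 + (4 * M)^-1).
have k0 : 0 < (4 * M)^-1 by rewrite invr_gt0 mulr_gt0.
have ls : lamW < s by rewrite /s ltr_pMr// ltrDl.
have s0 : 0 < s by exact: lt_trans ls.
have s2 : s <= 2 * lamW.
  rewrite /s mulrC ler_pM2r//.
  have : (4 * M)^-1 <= 1 by rewrite invf_le1 ?mulr_gt0//; lra.
  by lra.
have sM : s * (1 - (2 * M)^-1) < lamW.
  rewrite /s -mulrA gtr_pMr//.
  have -> : (2 * M)^-1 = 2 * (4 * M)^-1 by field; rewrite lt0r_neq0.
  by move: k0; set k := (4 * M)^-1 => k0; nra.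
pose s' := (lamW + s) / 2.
have [ls' s's] : lamW < s' /\ s' < s by rewrite /s'; split; lra.
have [K K0 KL] := iter_tr_lam x0 c_gt0 Wc ls'.
have [N NK] : exists N, (s' / s) ^+ N < (2 * K)^-1.
  apply: expr_lt_ex; last by rewrite invr_gt0 mulr_gt0.
  rewrite ltr_pdivrMr// mul1r s's andbT divr_ge0 ?ltW//.
  exact: lt_trans ls'.
have small x : s^-1 ^+ N * iter N L (fun=> 1) x <= 2^-1.
  apply: (@le_trans _ _ (s^-1 ^+ N * (K * s' ^+ N))).
    by rewrite ler_wpM2l// exprn_ge0// invr_ge0 ltW.
  rewrite mulrCA -exprMn [s^-1 * _]mulrC.
  apply: (@le_trans _ _ (K * (2 * K)^-1)).
    by rewrite ler_pM2l// ltW.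
  by rewrite invfM mulrCA mulfV ?lt0r_neq0// mulr1.
have it0 n x : 0 <= iter n L (fun=> 1) x.
  by apply: (iter_tr_ge0 c_gt0 Wc) => y; rewrite ler01.
have N0 : (0 < N)%N.
  by case: N small {NK} => // /(_ x0); rewrite expr0 mul1r /=; lra.
have T1 x : 1 <= T s N (fun=> 1) x.
  rewrite /T; case: N N0 {NK small} => // n _.
  rewrite big_ord_recl expr0 mul1r -[leLHS]addr0; apply: lerD => //.
  apply: sumr_ge0 => i _; apply: mulr_ge0; last exact: it0.
  by rewrite exprn_ge0// invr_ge0 ltW.
(* If the series [T] of [1] were at most [M] everywhere, then [L T <= s (T - 1/2) <= s (1 - 1 / (2
   M)) T], so that [lamW] would be at most a number known to be smaller. The [1/2] comes from
   [small]. *)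
have [x Mx] : exists x, M < T s N (fun=> 1) x.
  apply/not_existsP => TM.
  have TM' x : T s N (fun=> 1) x <= M by rewrite leNgt; apply/negP.
  have : lamW <= s * (1 - (2 * M)^-1).
    apply: (@lam_le_eigen _ _ _ x0 _ _ _ c_gt0 Wc (T s N (fun=> 1)) 1 M) => //.
    - rewrite mulr_gt0// subr_gt0 invf_lt1 ?mulr_gt0//; lra.
    - by move=> x; rewrite T1 TM'.
    move=> x; rewrite /T tr_sum T_tele ?lt0r_neq0// -[leRHS]mulrA ler_pM2l//.
    have := small x; have := TM' x; rewrite -/(T s N (fun=> 1) x).
    set t := T _ _ _ _ => tM.
    have : (2 * M)^-1 * t <= 2^-1.
      by rewrite mulrC ler_pdivrMr ?mulr_gt0// mulrA mulVf// mul1r.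
    by rewrite mulrBl mul1r; lra.
  by lra.
exists (fun u => T s N u x / T s N (fun=> 1) x).
have T0 : 0 < T s N (fun=> 1) x by exact: lt_le_trans (T1 x).
split => [a u v|u u0||u B uB].
- rewrite mulrA -mulrDl; congr (_ / _); rewrite /T mulr_sumr -big_split /=.
  apply: eq_bigr => i _; rewrite iter_trD.
  rewrite (_ : iter i L _ x = a * iter i L u x); last by rewrite -iter_trZ.
  by ring.
- rewrite divr_ge0 ?(ltW T0)// sumr_ge0// => i _.
  rewrite mulr_ge0 ?exprn_ge0// ?invr_ge0 ?(ltW s0)//.
  exact: (iter_tr_ge0 c_gt0 Wc).
- by rewrite divff// lt0r_neq0.
have itB n y : `|iter n L u y| <= B * iter n L (fun=> 1) y.
  rewrite ler_norml -mulNr -!iter_trZ; apply/andP; split.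
    apply: (iter_tr_le c_gt0 Wc) => z; rewrite mulr1.
    by have := uB z; rewrite ler_norml => /andP[].
  apply: (iter_tr_le c_gt0 Wc) => z; rewrite mulr1.
  by have := uB z; rewrite ler_norml => /andP[].
have B0 : 0 <= B by exact: le_trans (uB x0).
have TB : `|T s N u x| <= B * T s N (fun=> 1) x.
  rewrite /T mulr_sumr; apply: (le_trans (ler_norm_sum _ _ _)).
  apply: ler_sum => i _; have si : 0 <= s^-1 ^+ i by rewrite exprn_ge0// invr_ge0 ltW.
  by rewrite normrM ger0_norm// mulrCA ler_wpM2l.
have -> : T s N (L u) x = s * (T s N u x + s^-1 ^+ N * iter N L u x - u x).
  rewrite -T_tele ?lt0r_neq0//; apply: eq_bigr => i _.
  by rewrite -iterSr.
set t := T s N (fun=> 1) x in T0 Mx TB *.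
have -> : s * (T s N u x + s^-1 ^+ N * iter N L u x - u x) / t - lamW * (T s N u x / t) =
  ((s - lamW) * T s N u x + s * (s^-1 ^+ N * iter N L u x - u x)) / t by ring.
rewrite normrM normfV (ger0_norm (ltW T0)) ler_pdivrMr//.
rewrite (le_trans (ler_normD _ _))// (normrM (s - lamW)) (normrM s).
have h1 : `|s - lamW| = lamW * (4 * M)^-1.
  by rewrite ger0_norm ?subr_ge0 ?ltW// /s; ring.
have h2 : `|s^-1 ^+ N * iter N L u x - u x| <= 2 * B.
  rewrite (le_trans (ler_normB _ _))// normrM.
  have si : 0 <= s^-1 ^+ N by rewrite exprn_ge0// invr_ge0 ltW.
  rewrite (ger0_norm si).
  have h3 : s^-1 ^+ N * `|iter N L u x| <= B.
    apply: (@le_trans _ _ (s^-1 ^+ N * (B * iter N L (fun=> 1) x))).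
      by rewrite ler_wpM2l.
    by rewrite mulrCA ler_piMr//; have := small x; lra.
  by have := uB x; lra.
rewrite (ger0_norm (ltW s0)) h1.
have h4 : s * `|s^-1 ^+ N * iter N L u x - u x| <= 2 * lamW * (2 * B).
  by apply: ler_pM => //; exact: ltW.
have h5 : lamW / (4 * M) * `|T s N u x| <= lamW / (4 * M) * (B * t).
  by rewrite ler_wpM2l// mulr_ge0 ?ltW.
have h6 : lamW / (4 * M) <= eps / 4.
  rewrite ler_pdivrMr ?mulr_gt0// (_ : eps / 4 * (4 * M) = eps * M); last by field.
  by lra.
have h7 : lamW / (4 * M) * (B * t) <= eps / 4 * (B * t).
  by rewrite ler_wpM2r// mulr_ge0// ltW.
have h8 : 8 * (lamW * B) <= eps * B * t.
  apply: (@le_trans _ _ (eps * M * B)); first by rewrite mulrA ler_wpM2r.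
  by rewrite mulrAC; apply: ler_wpM2l; [rewrite mulr_ge0// ltW|exact: ltW].
have h9 : 0 <= lamW * B by rewrite mulr_ge0// ltW.
apply: le_trans (lerD (le_trans h5 h7) h4) _.
by move: h8 h9; clear; lra.
Qed.

(** The approximate functionals are bounded on each bounded function, so their limit along one
    ultrafilter exists on all of them at once; it is positive, linear and an exact
    eigenfunctional. *)
Lemma eigen_posfun : exists2 m, posfun m &
  forall u, bdd u -> m (L u) = lamW * m u.
Proof.
pose P k nu := [/\ forall a u v, nu (fun x => a * u x + v x) = a * nu u + nu v,
      forall u, (forall x, 0 <= u x) -> 0 <= nu u, nu (fun=> 1) = 1
    & forall u (B : R), (forall x, `|u x| <= B) ->
        `|nu (L u) - lamW * nu u| <= k.+1%:R^-1 * B].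
have /choice[nu nuP] : forall k, exists nu, P k nu.
  by move=> k; apply: approx_posfun; rewrite invr_gt0.
have pnu k : posfun (nu k).
  by have [h1 h2 h3 _] := nuP k; split => // u *; exact: h2.
have [G [uG Goo]] := @ultraFilterLemma _ \oo _.
have cnu u : bdd u -> cvg ((fun k => nu k u) @ G).
  by move=> [B uB]; apply: (@ultra_lim _ _ _ B) => k; exact: posfun_norm.
have pG : ProperFilter G by exact: ultra_proper.
pose m u := lim ((fun k => nu k u) @ G).
have m_lim u l : (fun k => nu k u) @ G --> l -> m u = l.
  by move=> ul; apply: cvg_lim.
exists m; first split.
- move=> a u v bu bv; apply: m_lim.
  rewrite (_ : (fun k => _) = (fun k => a * nu k u + nu k v)); last first.
    by apply/funext => k; rewrite posfun_lin.
  by apply: cvgD; [apply: cvgMr|]; exact: cnu.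
- move=> u bu u0; apply: limr_ge; first exact: cnu.
  by apply: filterE => k; exact: posfun_ge0.
- apply: m_lim; rewrite (_ : (fun k => _) = (fun=> 1)); first exact: cvg_cst.
  by apply/funext => k; case: (pnu k).
move=> u bu; have [B B0 uB] := bdd_ge0 bu.
have bLu : bdd (L u) by exact: (bdd_tr c_gt0 Wc).
apply: m_lim; rewrite (_ : (fun k => nu k (L u)) =
  (fun k => lamW * nu k u + (nu k (L u) - lamW * nu k u))); last first.
  by apply/funext => k; rewrite addrC subrK.
rewrite -[X in _ --> X]addr0; apply: cvgD; first by apply: cvgMr; exact: cnu.
have : (fun k => k.+1%:R^-1 * B) @ G --> (0 : R).
  rewrite -[X in _ --> X](mul0r B); apply: cvgMl.
  by apply: cvg_trans (@cvg_harmonic R) => A; exact: Goo.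
move=> /cvgrPdist_le h; apply/cvgrPdist_le => e e0.
apply: filterS (h _ e0) => k /=; rewrite !sub0r !normrN => hk.
have [_ _ _ /(_ u B uB) h'] := nuP k.
apply: le_trans h' _; apply: le_trans hk; exact: ler_norm.
Qed.
End patterson.

(** * Spectral gap in the presence of a neutral branch *)

Lemma sqrt_cauchy (R : realType) (a b c d : R) :
  0 <= a -> 0 <= b -> 0 <= c -> 0 <= d ->
  Num.sqrt (a * b) + Num.sqrt (c * d) <= Num.sqrt ((a + c) * (b + d)).
Proof.
move=> a0 b0 c0 d0.
rewrite -[leLHS]ger0_norm ?addr_ge0 ?sqrtr_ge0// -sqrtr_sqr ler_wsqrtr//.
rewrite sqrrD !sqr_sqrtr ?mulr_ge0//.
have -> : Num.sqrt (a * b) * Num.sqrt (c * d) = Num.sqrt (a * d) * Num.sqrt (c * b).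
  by rewrite -!sqrtrM ?mulr_ge0//; congr Num.sqrt; ring.
have := sqr_ge0 (Num.sqrt (a * d) - Num.sqrt (c * b)).
rewrite sqrrB !sqr_sqrtr ?mulr_ge0// => h; lra.
Qed.

Lemma le_cvg0 (R : realType) (q : nat -> R) (K x y : R) : 0 <= K ->
  (forall e : R, 0 < e -> exists n, q n <= e) ->
  (forall n, x <= y + K * q n) -> x <= y.
Proof.
move=> K0 q0 h; apply/ler_addgt0Pr => e e0.
have [n qn] := q0 (e / (K + 1)) (divr_gt0 e0 (ltr_wpDl K0 ltr01)).
apply: le_trans (h n) _; rewrite lerD2l.
apply: (@le_trans _ _ (K * (e / (K + 1)))); first exact: ler_wpM2l.
rewrite mulrA ler_pdivrMr ?ltr_wpDl// mulrDr mulr1 mulrC lerDl.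
exact: ltW.
Qed.

Lemma cauchy_lim (R : realType) (a q : nat -> R) :
  (forall e : R, 0 < e -> exists n, q n <= e) ->
  (forall n k, `|a (n + k)%N - a n| <= q n) ->
  exists l, forall n, `|a n - l| <= q n.
Proof.
move=> q0 aq.
have /cvg_ex[l al] : cvg (a @ \oo).
  apply: cauchy_cvg; apply/cauchy_exP => e e0.
  have [n qn] := q0 (e / 2) (divr_gt0 e0 (ltr0Sn _ _)).
  exists (a n); exists n => // k /= nk.
  rewrite /ball /= distrC -(subnKC nk); apply: le_lt_trans (aq _ _) _.
  by apply: le_lt_trans qn _; lra.
exists l => n; rewrite distrC.
have : (fun k => `|a (n + k)%N - a n|) @ \oo --> `|l - a n|.
  apply: cvg_norm; apply: cvgB; last exact: cvg_cst.
  have -> : (fun k => a (n + k)%N) = (fun k => a (k + n)%N).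
    by apply/funext => k; rewrite addnC.
  by rewrite (cvg_shiftn n a).
move=> /cvg_lim <-//; apply: limr_le.
  by apply/cvg_ex; exists `|l - a n|; apply: cvg_norm; apply: cvgB;
  [have -> : (fun k => a (n + k)%N) = (fun k => a (k + n)%N);
  [by apply/funext => k; rewrite addnC|by rewrite (cvg_shiftn n a)]|exact: cvg_cst].
by apply: nearW => k.
Qed.

Lemma eq_refl_le (R : realType) (x y : R) : x = y -> x <= y.
Proof. by move->. Qed.

Section words.
Variables (X : Type) (g : bool -> X -> X).

Definition gs (w : seq bool) (x : X) : X := foldr g x w.

Lemma gs_itinerary (f : X -> X) : (forall x, exists b, x = g b (f x)) ->
  forall n z, exists2 w, size w = n & z = gs w (iter n f z).
Proof.
move=> fg; elim=> [|n IH] z; first by exists [::].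
have [w wn zw] := IH (f z); have [b zb] := fg z.
exists (b :: w); first by rewrite /= wn.
by rewrite iterSr /= -/(gs w _) -zw.
Qed.

End words.

Section spectral.
Variables (R : realType) (X : Type) (g : bool -> X -> X) (f : X -> X).
Variables (D : X -> X -> R) (s : R) (eta : nat -> R).
Hypothesis D_ge0 : forall x y, 0 <= D x y.
Hypothesis D_le1 : forall x y, D x y <= 1.
Hypothesis s01 : 0 < s < 1.
Hypothesis gD : forall b x y, D (g b x) (g b y) <= (if b then s else 1) * D x y.
Hypothesis gs_eta : forall w x y, D (gs g w x) (gs g w y) <= eta (size w).
Hypothesis eta0 : forall e : R, 0 < e -> exists N, forall n, (N <= n)%N -> eta n <= e.
Hypothesis fg : forall x, exists b, x = g b (f x).

Variables (x0 z0 : X) (W : bool -> X -> R) (c C K : R).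
Hypothesis gz0 : g false z0 = z0.
Hypothesis c_gt0 : 0 < c.
Hypothesis Wc : forall b x, c <= W b x <= C.
Hypothesis K_ge0 : 0 <= K.
Hypothesis WK : forall b x y, `|W b x - W b y| <= K * D x y.
Implicit Types (u v U : X -> R).

Notation L := (tr g W).
Notation lamW := (lam g W).

Let W_gt0 b x : 0 < W b x.
Proof. by have /andP[+ _] := Wc b x; exact: lt_le_trans. Qed.
Let W_ge0 b x : 0 <= W b x. Proof. exact: ltW. Qed.
Let C_gt0 : 0 < C.
Proof. by have /andP[_] := Wc false x0; apply: lt_le_trans. Qed.
Let eta_ge0 n : 0 <= eta n.
Proof. by have := gs_eta (nseq n true) x0 x0; rewrite size_nseq; exact: le_trans. Qed.

Section lyapunov.
Hypothesis gap : W false z0 < lamW.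

(** Existence of a weight when the branch [true] is discounted by [t]. For [t = 1] it contradicts
    the definition of [lamW]; for small [t] only the subdominant branch [false] matters. The goal is
    [t = s]. *)
Let P t := exists (U : X -> R) (M Lambda : R), [/\ forall x, 1 <= U x <= M, 0 <= Lambda < lamW &
  forall x, W false x * U (g false x) + t * W true x * U (g true x) <= Lambda * U x].

(** The weight [V] is the product of [W false] over [J] backward steps along the branch [false].
    Composing it with [g false] shifts the product by one, which replaces the factor [W false x] by
    its value at the [J]-th point. That point is close to [z0], where the weight is below [lamW]. *)
Let P_small : exists2 t, 0 < t & P t.
Proof.
pose W0 := W false z0; pose L0 := (2 * W0 + lamW) / 3; pose L1 := (W0 + 2 * lamW) / 3.
have [h1 h2 h3] : [/\ W0 < L0, L0 < L1 & L1 < lamW].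
  by move: gap; rewrite /L0 /L1 /W0 => ?; split; lra.
have W00 : 0 < W0 by exact: W_gt0.
have L00 : 0 < L0 by exact: lt_trans h1.
have [J /(_ J (leqnn J)) hJ] : exists J, forall n, (J <= n)%N -> eta n <= (L0 - W0) / (K + 1).
  by apply: eta0; rewrite divr_gt0// ?subr_gt0// ltr_wpDl.
have WJ x : W false (gs g (nseq J false) x) <= L0.
  have := gs_eta (nseq J false) x z0; rewrite size_nseq.
  have -> : gs g (nseq J false) z0 = z0 by elim: (J) => //= j ->.
  move=> hD; have := WK false (gs g (nseq J false) x) z0.
  rewrite ler_norml => /andP[_ h].
  have h4 : K * D (gs g (nseq J false) x) z0 <= L0 - W0.
    apply: (@le_trans _ _ (K * ((L0 - W0) / (K + 1)))).
      by rewrite ler_wpM2l// (le_trans hD).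
    rewrite mulrA ler_pdivrMr ?ltr_wpDl// mulrC ler_wpM2l ?subr_ge0 ?(ltW h1)//.
    by rewrite lerDl.
  by move: h h4; rewrite -/W0; lra.
pose V x := \prod_(j < J) (W false (gs g (nseq j false) x) / L0).
pose a := (c / L0) ^+ J; pose b := (C / L0) ^+ J.
have a0 : 0 < a by rewrite exprn_gt0// divr_gt0.
have b0 : 0 < b by rewrite exprn_gt0// divr_gt0.
have Va x : a <= V x.
  rewrite /a -[J in _ ^+ J]card_ord -prodr_const; apply: ler_prod => i _.
  rewrite divr_ge0 ?(ltW c_gt0) ?(ltW L00)//= ler_pM2r ?invr_gt0//.
  by have /andP[] := Wc false (gs g (nseq i false) x).
have Vb x : V x <= b.
  rewrite /b -[J in _ ^+ J]card_ord -prodr_const; apply: ler_prod => i _.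
  rewrite divr_ge0 ?(ltW L00)//= ler_pM2r ?invr_gt0//.
  by have /andP[] := Wc false (gs g (nseq i false) x).
have VW x : W false x * V (g false x) <= L0 * V x.
  have -> : W false x * V (g false x) = W false (gs g (nseq J false) x) * V x.
    have -> : V x = \prod_(j < J) (W false (gs g (nseq j false) x) / L0) by [].
    have -> : V (g false x) = \prod_(j < J) (W false (gs g (nseq j.+1 false) x) / L0).
      apply: eq_bigr => j _; congr (W _ _ / _).
      by elim: (nat_of_ord j) => //= n ->.
    pose G j := W false (gs g (nseq j false) x) / L0.
    have E : (\prod_(j < J) G j.+1) * G 0%N = (\prod_(j < J) G j) * G J.
      elim: (J) => [|j IH]; first by rewrite !big_ord0.
      by rewrite !big_ord_recr /= mulrAC IH.
    have Wx : W false x = G 0%N * L0 by rewrite /G /= divfK// lt0r_neq0.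
    have WJx : W false (gs g (nseq J false) x) = G J * L0.
      by rewrite /G divfK// lt0r_neq0.
    rewrite Wx WJx -/(G _).
    rewrite [LHS]mulrAC (mulrC (G 0%N) (\prod_(j < J) G j.+1)) E [RHS]mulrAC.
    by rewrite (mulrC (G J)).
  rewrite ler_wpM2r// ?WJ//; exact: le_trans (ltW a0) (Va x).
(* With this discount the branch [true] contributes at most [(L1 - L0) * a], which fits between the
   rate [L0] of the branch [false] and [L1 < lamW]. *)
exists ((L1 - L0) * a / (C * b)); first by rewrite !divr_gt0 ?mulr_gt0// subr_gt0.
exists (fun x => a^-1 * V x), (a^-1 * b), L1; split=> [x||x].
- by rewrite -(mulVf (lt0r_neq0 a0)) !ler_pM2l ?invr_gt0// Va Vb.
- by rewrite h3 andbT ltW// (lt_trans L00).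
set t := _ / (C * b).
have t0 : 0 < t by rewrite /t divr_gt0 ?mulr_gt0// subr_gt0.
rewrite mulrCA [t * _ * _]mulrCA [L1 * _]mulrCA -mulrDr ler_pM2l ?invr_gt0//.
have h5 : t * W true x * V (g true x) <= (L1 - L0) * V x.
  apply: (@le_trans _ _ ((L1 - L0) * a)); last first.
    by rewrite ler_wpM2l ?subr_ge0 ?(ltW h2).
  have -> : (L1 - L0) * a = t * (C * b).
    by rewrite /t divfK// lt0r_neq0// mulr_gt0.
  rewrite -mulrA ler_pM2l//; apply: ler_pM => //.
    exact: le_trans (ltW a0) (Va _).
  by have /andP[] := Wc true x.
by apply: le_trans (lerD (VW x) h5) _; rewrite -mulrDl addrC subrK.
Qed.

Let P_mono t t' : t' <= t -> P t -> P t'.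
Proof.
move=> tt [U [M [Lam [U1 Lam1 h]]]]; exists U, M, Lam; split => // x.
apply: le_trans (h x); rewrite lerD2l -!mulrA ler_wpM2r// mulr_ge0//.
by have /andP[+ _] := U1 (g true x); exact: le_trans.
Qed.

(** Take the geometric mean of a weight of rate [Lam] for the discount [t ^+ 2] and a superharmonic
    function of rate [l'] just above [lamW]. By the Cauchy-Schwarz inequality it has rate
    [Num.sqrt (l' * Lam)] for the discount [t]. *)
Let P_sqrt t : 0 < t -> P (t ^+ 2) -> P t.
Proof.
move=> t0 [U [M [Lam [U1 /andP[Lam0 Lam1] h]]]].
have l0 : 0 < lamW by exact: (lam_gt0 x0 c_gt0 Wc).
have [l' ll' l'L] : exists2 l', lamW < l' & Num.sqrt (l' * Lam) < lamW.
  exists (lamW + (lamW - Lam) / 2); first by rewrite ltrDl divr_gt0// subr_gt0.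
  rewrite -[ltRHS](ger0_norm (ltW l0)) -sqrtr_sqr ltr_sqrt ?exprn_gt0//.
  by rewrite expr2; nra.
have l'0 : 0 < l' by exact: lt_trans ll'.
have [_ [H [N [HN Hl]]]] := lam_superharm x0 c_gt0 Wc ll'.
have U0 x : 0 <= U x by have /andP[+ _] := U1 x; exact: le_trans.
have H0 x : 0 <= H x by have /andP[+ _] := HN x; exact: le_trans.
exists (fun x => Num.sqrt (H x * U x)), (Num.sqrt (N * M)), (Num.sqrt (l' * Lam)).
split => [x||x]; last 1 first.
- have -> : W false x * Num.sqrt (H (g false x) * U (g false x)) =
     Num.sqrt ((W false x * H (g false x)) * (W false x * U (g false x))).
    rewrite mulrACA -expr2 [RHS]sqrtrM ?sqr_ge0// sqrtr_sqr ger0_norm//.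
  have -> : t * W true x * Num.sqrt (H (g true x) * U (g true x)) =
     Num.sqrt ((W true x * H (g true x)) * (t ^+ 2 * W true x * U (g true x))).
    rewrite (_ : _ * (t ^+ 2 * _ * _) =
      (t * W true x) ^+ 2 * (H (g true x) * U (g true x))); last by ring.
    by rewrite [RHS]sqrtrM ?sqr_ge0// sqrtr_sqr ger0_norm// mulr_ge0// ltW.
  apply: le_trans (sqrt_cauchy (mulr_ge0 (W_ge0 _ _) (H0 _))
    (mulr_ge0 (W_ge0 _ _) (U0 _)) (mulr_ge0 (W_ge0 _ _) (H0 _))
    (mulr_ge0 (mulr_ge0 (sqr_ge0 _) (W_ge0 _ _)) (U0 _))) _.
  have l'L0 : 0 <= l' * Lam by rewrite mulr_ge0// ltW.
  rewrite -sqrtrM//; apply: ler_wsqrtr; rewrite mulrACA; apply: ler_pM.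
  + by apply: addr_ge0; apply: mulr_ge0.
  + by apply: addr_ge0; rewrite !mulr_ge0// ltW.
  + exact: Hl.
  + exact: h.
- have /andP[h1 h2] := HN x; have /andP[h3 h4] := U1 x.
  apply/andP; split; last by apply: ler_wsqrtr; apply: ler_pM.
  rewrite -[leLHS]sqrtr1; apply: ler_wsqrtr.
  by rewrite -[leLHS]mulr1; apply: ler_pM.
- by rewrite sqrtr_ge0.
Qed.

(** Choose [n] with [s ^+ (2 ^ n)] below the discount of [P_small], then take [n] successive square
    roots. *)
Lemma lyapunov : exists (U : X -> R) (M theta : R), [/\ forall x, 1 <= U x <= M, 0 <= theta < 1 &
  forall x, W false x * U (g false x) + s * W true x * U (g true x)
    <= theta * lamW * U x].
Proof.
have /andP[s0 s1] := s01.
have l0 : 0 < lamW by exact: (lam_gt0 x0 c_gt0 Wc).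
suff [U [M [Lam [U1 /andP[Lam0 Lam1] h]]]] : P s.
  exists U, M, (Lam / lamW); split => //.
    by rewrite divr_ge0 ?(ltW l0)//= ltr_pdivrMr// mul1r.
  by move=> x; rewrite divfK ?lt0r_neq0.
have [t t0 Pt] := P_small.
have [n sn] := @expr_lt_ex _ s t (introT andP (conj (ltW s0) s1)) t0.
have : P (s ^+ (2 ^ n)).
  apply: P_mono Pt; apply: le_trans (ltW sn).
  by apply: ler_wiXn2l; rewrite ?(ltW s0) ?(ltW s1)// ltnW// ltn_expl.
elim: n {sn} => // n IH; rewrite expnS mulnC exprM => h; apply: IH.
by apply: P_sqrt h; rewrite exprn_gt0.
Qed.

End lyapunov.

(** One constant bounds both the sup norm and the Lipschitz seminorm for [D]. As a relation it
    spares all suprema; with [D] a power of the distance it is a Hölder norm bound. *)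
Definition nrm (u : X -> R) (A : R) :=
  (forall x, `|u x| <= A) /\ (forall x y, `|u x - u y| <= A * D x y).

Section gap.
Hypothesis lam1 : lamW = 1.
Hypothesis gap : W false z0 < 1.

Section cone.
Variables (U : X -> R) (M theta : R) (m : (X -> R) -> R).
Hypothesis U1 : forall x, 1 <= U x <= M.
Hypothesis theta01 : 0 <= theta < 1.
Hypothesis Utheta : forall x,
  W false x * U (g false x) + s * W true x * U (g true x) <= theta * U x.
Hypothesis pm : posfun m.
Hypothesis mL : forall u, bdd u -> m (L u) = m u.

Let U_ge1 x : 1 <= U x. Proof. by have /andP[] := U1 x. Qed.
Let U_leM x : U x <= M. Proof. by have /andP[] := U1 x. Qed.
Let U_gt0 x : 0 < U x. Proof. exact: lt_le_trans (U_ge1 x). Qed.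
Let U_ge0 x : 0 <= U x. Proof. exact: ltW. Qed.
Let M_ge1 : 1 <= M. Proof. exact: le_trans (U_ge1 x0) (U_leM x0). Qed.
Let M_gt0 : 0 < M. Proof. exact: lt_le_trans M_ge1. Qed.
Let M_ge0 : 0 <= M. Proof. exact: ltW. Qed.
Let mLn n u : bdd u -> m (iter n L u) = m u.
Proof.
move=> bu; elim: n => //= n <-; apply: mL.
exact: (bdd_iter_tr c_gt0 Wc).
Qed.

(** The Lipschitz bound is relaxed by the weight [U]: by [Utheta] it is this seminorm, not the plain
    one, that the operator contracts. *)
Definition hol u A := forall x y, `|u x - u y| <= A * (U x * D x y).

Let UD_ge0 x y : 0 <= U x * D x y. Proof. exact: mulr_ge0. Qed.
Let UD_leM x y : U x * D x y <= M.
Proof. by rewrite -[leRHS]mulr1; apply: ler_pM. Qed.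

Lemma hol_bdd u A : 0 <= A -> hol u A -> bdd u.
Proof.
move=> A0 hu; exists (`|u x0| + A * M) => x.
have h : `|u x - u x0| <= A * M.
  by apply: le_trans (hu x x0) _; rewrite ler_wpM2l.
by rewrite -[u x](subrK (u x0)) addrC (le_trans (ler_normD _ _))// lerD2l.
Qed.

Lemma hol_le u A A' : A <= A' -> hol u A -> hol u A'.
Proof.
by move=> AA hu x y; apply: le_trans (hu x y) _; rewrite ler_wpM2r.
Qed.

Lemma hol_subc u A a : hol u A -> hol (fun x => u x - a) A.
Proof. by move=> hu x y; rewrite opprB addrA subrK. Qed.

(** Lasota-Yorke inequality: the variation of [u] is contracted by [theta] thanks to [Utheta], and
    the variation of the two weights costs [K * B] each. *)
Lemma hol_tr u A B : 0 <= A -> hol u A -> (forall x, `|u x| <= B) ->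
  hol (L u) (theta * A + 2 * K * B).
Proof.
move=> A0 hu uB x y.
have B0 : 0 <= B by exact: le_trans (uB x0).
have h1 b : `|W b x * (u (g b x) - u (g b y))| <=
    A * ((if b then s else 1) * W b x * U (g b x)) * D x y.
  rewrite normrM (ger0_norm (W_ge0 b x)).
  apply: (@le_trans _ _ (W b x * (A * (U (g b x) * ((if b then s else 1) * D x y))))).
    rewrite ler_wpM2l//; apply: le_trans (hu _ _) _.
    by rewrite ler_wpM2l// ler_wpM2l.
  by apply: eq_refl_le; ring.
have h2 b : `|(W b x - W b y) * u (g b y)| <= K * B * (U x * D x y).
  rewrite normrM; apply: (@le_trans _ _ (K * D x y * B)); first exact: ler_pM.
  rewrite mulrAC; apply: ler_wpM2l; first exact: mulr_ge0.
  by rewrite -[leLHS]mul1r ler_wpM2r.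
have -> : L u x - L u y = W false x * (u (g false x) - u (g false y))
    + W true x * (u (g true x) - u (g true y))
    + ((W false x - W false y) * u (g false y)
    + (W true x - W true y) * u (g true y)) by rewrite /tr; ring.
rewrite (le_trans (ler_normD _ _))// [leRHS]mulrDl; apply: lerD; last first.
  rewrite (le_trans (ler_normD _ _))//.
  by apply: le_trans (lerD (h2 false) (h2 true)) _; apply: eq_refl_le; ring.
rewrite (le_trans (ler_normD _ _))//.
apply: le_trans (lerD (h1 false) (h1 true)) _.
rewrite -mulrDl -mulrDr mul1r [theta * A]mulrC -!mulrA; apply: ler_wpM2l => //.
rewrite !mulrA; apply: ler_wpM2r => //; exact: Utheta.
Qed.

Lemma iter_tr_lb n w u x : (forall y, 0 <= u y) -> size w = n ->
  c ^+ n * u (gs g w x) <= iter n L u x.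
Proof.
elim: n w u => [|n IH] [|b w] u u0 //= wn; first by rewrite expr0 mul1r.
rewrite -iterS iterSr.
have Lu0 y : 0 <= L u y by exact: (tr_ge0 c_gt0 Wc).
apply: le_trans (IH w _ Lu0 _); last by case: wn.
rewrite exprSr -mulrA ler_wpM2l ?exprn_ge0 ?(ltW c_gt0)//.
have h b' y : 0 <= W b' y * u (g b' y) by exact: mulr_ge0.
apply: (@le_trans _ _ (W b (gs g w x) * u (g b (gs g w x)))).
  by rewrite ler_wpM2r//; have /andP[] := Wc b (gs g w x).
by rewrite /tr; case: b; rewrite ?lerDl ?lerDr.
Qed.

(** A value of [u] is controlled by its mean: [z] lies in a cylinder of length [n], on which [u]
    oscillates by at most [A * M * eta n], and this single cylinder contributes at least [c ^+ n]
    times the value to [iter n L u], whose mean is [m u]. *)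
Lemma cone_ub u A n z : 0 <= A -> (forall y, 0 <= u y) -> hol u A ->
  u z <= c ^- n * m u + A * M * eta n.
Proof.
move=> A0 u0 hu; have bu := hol_bdd A0 hu.
have [w wn zw] := gs_itinerary fg n z.
have cn : 0 < c ^+ n by rewrite exprn_gt0.
rewrite -lerBlDr [leRHS]mulrC ler_pdivlMr// mulrC -(mLn n bu).
apply: (posfun_lb pm); first exact: (bdd_iter_tr c_gt0 Wc).
move=> x; apply: le_trans (iter_tr_lb x u0 wn); rewrite ler_pM2l//.
rewrite lerBlDr -lerBlDl; apply: le_trans (ler_norm _) _.
apply: le_trans (hu _ _) _; rewrite -mulrA ler_wpM2l//.
by rewrite ler_pM// zw -wn.
Qed.

Definition cone a u := (forall y, 0 <= u y) /\ hol u (a * m u).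

Lemma cone_bdd a u : 0 <= a -> cone a u -> bdd u.
Proof.
move=> a0 [u0 hu]; have [mu0|/ltW mu0] := leP 0 (m u).
  by apply: hol_bdd hu; rewrite mulr_ge0.
exists (u x0) => x; have h := hu x x0.
have : `|u x - u x0| <= 0.
  by apply: le_trans h _; rewrite mulr_le0_ge0// mulr_ge0_le0.
by rewrite normr_le0 subr_eq0 => /eqP ->; rewrite ger0_norm.
Qed.

Lemma cone_m_ge0 a u : 0 <= a -> cone a u -> 0 <= m u.
Proof. by move=> a0 cu; apply: (posfun_ge0 pm (cone_bdd a0 cu)); case: cu. Qed.

Lemma cone_le a u x : 0 <= a -> cone a u -> u x <= (1 + a * M) * m u.
Proof.
move=> a0 cu; have m0 := cone_m_ge0 a0 cu; have [u0 hu] := cu.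
have bu := cone_bdd a0 cu.
have : u x - a * M * m u <= m u.
  apply: (posfun_lb pm bu) => y; rewrite lerBlDr -lerBlDl.
  apply: le_trans (ler_norm _) _; apply: le_trans (hu _ _) _.
  by rewrite (mulrAC a M) ler_wpM2l// mulr_ge0.
by rewrite lerBlDr mulrDl mul1r.
Qed.

(** The Lasota-Yorke inequality sends the cone into itself with the constant [a * th'] in place of
    [a]. The room left allows one to subtract the constant [c1 * m u]: this lowers the mean, hence
    the admissible seminorm, only by the factor [1 - c1]. Positivity survives because a point where
    [u >= m u / 2] has preimage words of length [N] near it from every base point. *)
Lemma cone_contraction : exists (a c1 : R) N, [/\ 0 < a, 0 < c1 < 1, (0 < N)%N,
  forall u, cone a u -> cone a (L u) &
  forall u, cone a u -> cone a (fun x => iter N L u x - c1 * m u)].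
Proof.
have /andP[th0 th1] := theta01.
pose th' := (1 + theta) / 2.
have th'1 : th' < 1 by rewrite /th'; lra.
have KM : 0 < 4 * (2 * K * M + 1) by rewrite mulr_gt0// ltr_wpDl// !mulr_ge0.
have [n /(_ n (leqnn n)) en] :
    exists N, forall n, (N <= n)%N -> eta n <= (1 - theta) / (4 * (2 * K * M + 1)).
  by apply: eta0; rewrite divr_gt0// subr_gt0.
have cn : 0 < c ^+ n by rewrite exprn_gt0.
(* Given [n], the bound [cone_ub] makes the additive Lasota-Yorke term a sum of two pieces. This [a]
   makes the first at most [a * (1 - theta) / 4 * m u], and the choice of [n] does so for the
   second; [theta] plus [(1 - theta) / 2] is [th']. *)
pose a := 8 * (K + 1) / (c ^+ n * (1 - theta)).
have d0 : 0 < c ^+ n * (1 - theta) by rewrite mulr_gt0// subr_gt0.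
have a0 : 0 < a by rewrite /a divr_gt0// mulr_gt0// ltr_wpDl.
have step u : cone a u -> hol (L u) (a * th' * m u).
  move=> cu; have m0 := cone_m_ge0 (ltW a0) cu; have [u0 hu] := cu.
  have am0 : 0 <= a * m u by rewrite mulr_ge0// ltW.
  have uB x : `|u x| <= c ^- n * m u + a * m u * M * eta n.
    by rewrite ger0_norm//; exact: cone_ub.
  apply: hol_le (hol_tr am0 hu uB).
  have e1 : 2 * K * (c ^- n * m u) <= a * (1 - theta) / 4 * m u.
    rewrite mulrA ler_wpM2r//.
    have -> : a * (1 - theta) / 4 = 2 * (K + 1) * c ^- n.
      by rewrite /a; field; rewrite lt0r_neq0//= lt0r_neq0// subr_gt0.
    by rewrite ler_wpM2r ?invr_ge0 ?(ltW cn)//; lra.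
  have e2 : 2 * K * (a * m u * M * eta n) <= a * (1 - theta) / 4 * m u.
    have -> : 2 * K * (a * m u * M * eta n) = a * m u * (2 * K * M * eta n) by ring.
    have -> : a * (1 - theta) / 4 * m u = a * m u * ((1 - theta) / 4) by ring.
    rewrite ler_wpM2l//.
    apply: (@le_trans _ _ ((2 * K * M + 1) * eta n)).
      by rewrite ler_wpM2r// lerDl.
    apply: le_trans (ler_wpM2l _ en) _; first by rewrite addr_ge0// !mulr_ge0.
    have KM' : 2 * K * M + 1 != 0 by rewrite lt0r_neq0// ltr_wpDl// !mulr_ge0.
    by apply: eq_refl_le; field.
  rewrite mulrDr; apply: le_trans (lerD (lexx _) (lerD e1 e2)) _.
  by rewrite le_eqVlt; apply/orP; left; apply/eqP; rewrite /th'; field.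
have stepc u : cone a u -> cone a (L u).
  move=> cu; have m0 := cone_m_ge0 (ltW a0) cu; split.
    by move=> y; apply: (tr_ge0 c_gt0 Wc); case: cu.
  rewrite (mL (cone_bdd (ltW a0) cu)); apply: hol_le (step _ cu).
  by rewrite ler_wpM2r// ler_piMr ?ltW.
have stepn k u : cone a u -> cone a (iter k L u).
  by move=> cu; elim: k => //= k; exact: stepc.
have aM : 0 < 4 * (a * M + 1) by rewrite mulr_gt0// ltr_wpDl// mulr_ge0// ltW.
have [N0 hN0] : exists N, forall n, (N <= n)%N -> eta n <= (4 * (a * M + 1))^-1.
  by apply: eta0; rewrite invr_gt0.
(* A successor, so that the strict improvement of [step] is available for the last application of
   [L]. *)
pose N := N0.+1.
have eN : eta N <= (4 * (a * M + 1))^-1 by apply: hN0.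
have cN : 0 < c ^+ N by rewrite exprn_gt0.
(* The first bound keeps [iter N L u - c1 * m u] nonnegative, the second gives [th' <= 1 - c1]. *)
pose c1 := Num.min (c ^+ N / 4) ((1 - th') / 2).
have c10 : 0 < c1 by rewrite /c1 lt_min !divr_gt0//= subr_gt0.
have c1th : c1 <= (1 - th') / 2 by rewrite /c1 ge_min lexx orbT.
have c1c : c1 <= c ^+ N / 4 by rewrite /c1 ge_min lexx.
have c11 : c1 < 1.
  by apply: le_lt_trans c1th _; rewrite /th'; lra.
exists a, c1, N; split => //; first by rewrite c10.
move=> u cu; have m0 := cone_m_ge0 (ltW a0) cu; have [u0 hu] := cu.
have bu := cone_bdd (ltW a0) cu.
have lb x : c1 * m u <= iter N L u x.
  have [m00|mu0] := eqVneq (m u) 0.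
    by rewrite m00 mulr0; apply: (iter_tr_ge0 c_gt0 Wc).
  have mup : 0 < m u by rewrite lt_def mu0.
  have [z uz] : exists z, m u / 2 <= u z.
    apply/not_existsP => h; have : m u <= m u / 2.
      by apply: (posfun_ub pm bu) => y; rewrite leNgt; apply/negP => /ltW /h.
    by lra.
  have [w wN zw] := gs_itinerary fg N z.
  apply: le_trans (iter_tr_lb x u0 wN).
  apply: (@le_trans _ _ (c ^+ N * (m u / 4))).
    by rewrite mulrCA [m u * _]mulrC ler_wpM2r.
  rewrite ler_wpM2l ?(ltW cN)//.
  have h : u z - u (gs g w x) <= m u / 4.
    apply: le_trans (ler_norm _) _; apply: le_trans (hu _ _) _.
    apply: (@le_trans _ _ (a * m u * (M * eta N))).
      apply: ler_wpM2l; first by rewrite mulr_ge0// ltW.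
      by apply: ler_pM => //; rewrite {1}zw -wN.
    have -> : a * m u * (M * eta N) = m u * (a * M * eta N) by ring.
    rewrite ler_wpM2l//; apply: (@le_trans _ _ ((a * M + 1) * eta N)).
      by rewrite ler_wpM2r// lerDl.
    have aM1 : 0 < a * M + 1 by rewrite ltr_wpDl// mulr_ge0// ltW.
    apply: le_trans (ler_wpM2l (ltW aM1) eN) _.
    by rewrite invfM mulrCA mulfV ?mulr1// lt0r_neq0.
  by lra.
split=> [y|]; first by rewrite subr_ge0.
have mN : m (fun x => iter N L u x - c1 * m u) = (1 - c1) * m u.
  rewrite (posfunB pm) ?(posfun_cst pm) ?mLn ?mulrBl ?mul1r//.
    exact: (bdd_iter_tr c_gt0 Wc).
  exact: bdd_cst.
rewrite mN; apply: hol_subc; apply: hol_le (step _ (stepn N0 _ cu)).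
rewrite (mLn _ bu) [leRHS]mulrA; apply: ler_wpM2r => //.
by apply: ler_wpM2l; [exact: ltW|lra].
Qed.

End cone.

(** Iterating the cone contraction splits [iter n L u] into [m u] times a function that does not
    depend on [u] and a remainder in the cone whose mass decays geometrically. Iterates of functions
    of equal mass therefore merge, uniformly and in seminorm, and [h] is the limit of the iterates
    of [1]. *)
Theorem spectral_gap_normalized : exists m (h : X -> R) (C1 rho : R),
  [/\ posfun m, forall u, bdd u -> m (L u) = m u,
      [/\ exists2 a : R, 0 < a & forall x, a <= h x, exists A, nrm h A,
          forall x, L h x = h x & m h = 1],
      0 <= C1 /\ 0 < rho < 1 &
  forall u A n, nrm u A ->
    nrm (fun x => iter n L u x - m u * h x) (C1 * rho ^+ n * A)].
Proof.
have [U [M [theta [U1 th01 Uth]]]] := lyapunov (eq_ind_r (fun l => _ < l) gap lam1).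
have {}Uth x : W false x * U (g false x) + s * W true x * U (g true x) <= theta * U x.
  by have := Uth x; rewrite lam1 mulr1.
have [m pm mL0] := eigen_posfun g x0 c_gt0 Wc.
have mL u : bdd u -> m (L u) = m u by move=> bu; rewrite mL0// lam1 mul1r.
have U_ge1 x : 1 <= U x by have /andP[] := U1 x.
have U_leM x : U x <= M by have /andP[] := U1 x.
have M1 : 1 <= M by exact: le_trans (U_ge1 x0) (U_leM x0).
have M0 : 0 <= M by exact: le_trans M1.
have U_ge0 x : 0 <= U x by exact: le_trans (U_ge1 x).
have [a [c1 [N [a0 /andP[c10 c11] N0 coneL coneN]]]] :=
  cone_contraction U1 th01 Uth pm mL.
pose cn := cone U m a.
have cbdd u : cn u -> bdd u by exact: (cone_bdd U1 (ltW a0)).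
have cm0 u : cn u -> 0 <= m u by exact: (cone_m_ge0 U1 pm (ltW a0)).
pose B := 1 + a * M.
have B0 : 0 <= B by rewrite addr_ge0// mulr_ge0// ltW.
have cub u x : cn u -> u x <= B * m u by exact: (cone_le U1 pm x (ltW a0)).
have mLn n u : bdd u -> m (iter n L u) = m u.
  by move=> bu; elim: n => //= n <-; apply/mL/(bdd_iter_tr c_gt0 Wc).
(* The quantifiers matter: the same [w] serves all [u] in the cone, so it cancels in differences. *)
pose couple n q := exists w, forall u, cn u ->
  exists v, [/\ cn v, m v = q * m u & forall x, iter n L u x = m u * w x + v x].
have couple0 : couple 0%N 1.
  by exists (fun=> 0) => u cu; exists u; split => // [|x]; rewrite ?mul1r ?mulr0 ?add0r.
have couple1 n q : couple n q -> couple n.+1 q.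
  move=> [w hw]; exists (L w) => u cu; have [v [cv mv vw]] := hw u cu.
  exists (L v); split => [||x]; [exact: coneL|by rewrite mL//; exact: cbdd|].
  by rewrite iterS (funext vw : _ = fun x => m u * w x + v x) trD trZ.
have coupleN n q : couple n q -> couple (N + n)%N (q * (1 - c1)).
  move=> [w hw]; exists (fun x => iter N L w x + c1 * q) => u cu.
  have [v [cv mv vw]] := hw u cu.
  exists (fun x => iter N L v x - c1 * m v); split=> [||x]; first exact: coneN.
    rewrite (posfunB pm) ?(posfun_cst pm) ?mLn ?mv; last exact: bdd_cst.
    - by ring.
    - exact: cbdd.
    - exact/(bdd_iter_tr c_gt0 Wc)/cbdd.
  rewrite iterD (funext vw : _ = fun x => m u * w x + v x) iter_trD iter_trZ mv.
  by ring.
pose q n := (1 - c1) ^+ (n %/ N).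
have coupleq n : couple n (q n).
  rewrite /q {1}(divn_eq n N) addnC.
  elim: (n %% N)%N => [|r IH]; last exact: couple1.
  rewrite add0n; elim: (n %/ N)%N => [|k IH]; first by rewrite mul0n expr0.
  by rewrite mulSn exprSr; exact: coupleN.
have c1' : 0 < 1 - c1 by rewrite subr_gt0.
have q_ge0 n : 0 <= q n by rewrite exprn_ge0// ltW.
have q_anti n k : q (n + k)%N <= q n.
  by apply: ler_wiXn2l; rewrite ?(ltW c1')// ?leq_div2r ?leq_addr// gerBl ltW.
have q0 : forall e : R, 0 < e -> exists n, q n <= e.
  move=> e e0; have c1'' : 0 <= 1 - c1 < 1 by rewrite ltW//= ltrBlDr ltrDl.
  have [n hn] := expr_lt_ex c1'' e0.
  by exists (n * N)%N; rewrite /q mulnK// ltW.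
have cone1 : cn (fun=> 1).
  split=> // x y; rewrite subrr normr0 !mulr_ge0 ?(ltW a0)//.
  by case: pm => _ _ ->.
have m1 : m (fun=> 1) = 1 by case: pm.
have coneLn n u : cn u -> cn (iter n L u).
  by move=> cu; elim: n => //= n; exact: coneL.
pose b n := iter n L (fun=> 1).
have bB n k x : `|b (n + k)%N x - b n x| <= B * q n.
  have [w hw] := coupleq n.
  have [v1 [cv1 mv1 h1]] := hw _ (coneLn k _ cone1).
  have [v2 [cv2 mv2 h2]] := hw _ cone1.
  rewrite /b iterD h1 h2 mLn; last exact: bdd_cst.
  rewrite opprD addrACA subrr add0r ler_norml.
  have mk : m (iter k L (fun=> 1)) = 1 by rewrite mLn//; exact: bdd_cst.
  have := cub v1 x cv1; have := cub v2 x cv2.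
  have : 0 <= v1 x by case: cv1.
  have : 0 <= v2 x by case: cv2.
  by rewrite mv1 mv2 mk m1 mulr1 => *; apply/andP; split; lra.
have Bq0 e : 0 < e -> exists n, B * q n <= e.
  move=> e0; have [n hn] := q0 (e / (B + 1)) (divr_gt0 e0 (ltr_wpDl B0 ltr01)).
  exists n; apply: le_trans (ler_wpM2l B0 hn) _.
  by rewrite mulrA ler_pdivrMr ?ltr_wpDl// mulrC ler_wpM2l ?(ltW e0)// lerDl.
have /choice[h hP] : forall x, exists l, forall n, `|b n x - l| <= B * q n.
  by move=> x; apply: (cauchy_lim Bq0) => n k; exact: bB.
have hb n x : `|h x - b n x| <= B * q n by rewrite distrC.
have bh : bdd h.
  have [b0 _] := cbdd _ (coneLn 0%N _ cone1).
  exists (1 + B * q 0) => x.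
  have := hb 0%N x; rewrite /b /= => h1.
  by rewrite -[h x](subrK 1) (le_trans (ler_normD _ _))// normr1 addrC lerD2l.
have bb n : bdd (b n) by exact/cbdd/coneLn.
have mb n : m (b n) = 1 by rewrite mLn//; exact: bdd_cst.
have mh : m h = 1.
  apply/eqP; rewrite -subr_eq0 -normr_le0.
  apply: (@le_cvg0 _ q B) => // n.
  by rewrite add0r -(mb n) -(posfunB pm)//; exact: (posfun_norm pm).
have Lh x : L h x = h x.
  apply/eqP; rewrite -subr_eq0 -normr_le0.
  apply: (@le_cvg0 _ q ((2 * C + 1) * B)) => //.
    by rewrite mulr_ge0// addr_ge0// mulr_ge0// ltW.
  move=> n; rewrite add0r.
  have -> : L h x - h x = L (fun y => h y - b n y) x - (h x - b n.+1 x).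
    by rewrite trB /b iterS; ring.
  apply: le_trans (ler_normB _ _) _.
  have e1 : `|L (fun y => h y - b n y) x| <= 2 * C * (B * q n).
    exact: (tr_norm c_gt0 Wc).
  have e2 : `|h x - b n.+1 x| <= B * q n.
    by apply: le_trans (hb _ _) _; rewrite ler_wpM2l// -addn1 q_anti.
  by apply: le_trans (lerD e1 e2) _; apply: eq_refl_le; ring.
have hc x : c1 <= h x.
  apply: (@le_cvg0 _ q B) => // n.
  have h1 : c1 <= b (N + n)%N x.
    rewrite /b iterD; have := (coneN _ (coneLn n _ cone1)).1 x.
    by rewrite mLn ?m1 ?mulr1 ?subr_ge0//; exact: bdd_cst.
  have : q (N + n)%N <= q n by rewrite addnC q_anti.
  move=> /(ler_wpM2l B0) qq.
  have := hb (N + n)%N x; rewrite ler_norml => /andP[+ _].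
  by move: h1 qq; lra.
have ch : cn h.
  split=> [y|x y]; first by apply: le_trans (hc y); exact: ltW.
  rewrite mh mulr1; apply: (@le_cvg0 _ q (B + B)) => // [|n]; first exact: addr_ge0.
  have -> : h x - h y = (b n x - b n y) + ((h x - b n x) - (h y - b n y)) by ring.
  apply: le_trans (ler_normD _ _) _; apply: lerD.
    by have := (coneLn n _ cone1).2 x y; rewrite mb mulr1.
  by apply: le_trans (ler_normB _ _) _; rewrite mulrDl; apply: lerD.
have cnrm u : cn u -> nrm u (B * m u).
  move=> cu; split=> [x|x y]; first by rewrite ger0_norm ?cub//; case: cu.
  apply: le_trans (cu.2 x y) _; rewrite mulrA ler_wpM2r//.
  rewrite [a * _]mulrC -mulrA mulrC ler_wpM2r ?cm0// /B.
  apply: (@le_trans _ _ (a * M)); last by rewrite lerDr.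
  by rewrite ler_wpM2l// ltW.
(* By Bernoulli's inequality [rho ^+ N >= 1 - c1 / 2], which turns the stepwise rate
   [(1 - c1) ^+ (n %/ N)] into a true power of [n]. *)
pose rho := 1 - c1 / (2 * N%:R).
have NR : 0 < N%:R :> R by rewrite ltr0n.
have N1 : 1 <= N%:R :> R by rewrite ler1n.
have cN1 : c1 / (2 * N%:R) < 1.
  rewrite ltr_pdivrMr ?mulr_gt0// mul1r; lra.
have rho0 : 0 < rho by rewrite /rho subr_gt0.
have rho1 : rho < 1 by rewrite /rho ltrBlDr ltrDl divr_gt0// mulr_gt0.
have qrho n : q n <= rho ^- N * rho ^+ n.
  have rN : 1 - c1 <= rho ^+ N.
    have bern k : 1 - k%:R * (c1 / (2 * N%:R)) <= rho ^+ k.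
      elim: k => [|k IH]; first by rewrite mul0r subr0 expr0.
      rewrite exprSr; apply: le_trans (ler_wpM2r (ltW rho0) IH).
      rewrite /rho -natr1; set z := c1 / _.
      have zz0 : 0 <= z by rewrite divr_ge0 ?mulr_ge0// ltW.
      have : 0 <= k%:R * z * z by apply: mulr_ge0 => //; apply: mulr_ge0.
      by lra.
    apply: le_trans (bern N); rewrite lerD2l lerN2.
    have -> : N%:R * (c1 / (2 * N%:R)) = c1 / 2 by field; rewrite lt0r_neq0.
    by lra.
  rewrite /q; apply: (@le_trans _ _ (rho ^+ (N * (n %/ N)))).
    by rewrite exprM lerXn2r// nnegrE ?ltW// exprn_gt0.
  rewrite mulrC ler_pdivlMr ?exprn_gt0// -exprD.
  apply: ler_wiXn2l; rewrite ?(ltW rho0) ?(ltW rho1)//.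
  by rewrite {1}(divn_eq n N) mulnC leq_add2l ltnW// ltn_pmod.
exists m, h, (B * (4 + 2 / a) * rho ^- N), rho; split => //.
- split=> //; first by exists c1.
  by exists (B * m h); exact: cnrm.
- split; last by rewrite rho0.
  rewrite !mulr_ge0// ?addr_ge0 ?divr_ge0 ?invr_ge0 ?exprn_ge0// ltW//.
move=> u A n [uA hu].
have A0 : 0 <= A by exact: le_trans (uA x0).
have bu : bdd u by exists A.
(* Adding this constant brings [u] into the cone: the part [A] makes it nonnegative and offsets a
   negative mean, and [A / a] pays for the seminorm. *)
pose t := A + A / a.
have t0 : 0 <= t by rewrite addr_ge0// divr_ge0// ltW.
have mut : m (fun x => u x + t) = m u + t.
  by rewrite (posfunD pm) ?(posfun_cst pm)//; exact: bdd_cst.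
have muA : `|m u| <= A by exact: (posfun_norm pm).
have cut : cn (fun x => u x + t).
  split=> [x|x y].
    have := uA x; rewrite ler_norml => /andP[+ _].
    have : 0 <= A / a by rewrite divr_ge0// ltW.
    by rewrite /t; lra.
  rewrite opprD addrACA subrr addr0; apply: le_trans (hu x y) _.
  rewrite mut mulrA; apply: ler_wpM2r => //.
  rewrite -[leLHS]mulr1; apply: ler_pM => //.
  rewrite mulrC -ler_pdivrMr// /t addrA lerDr.
  by move: muA; rewrite ler_norml => /andP[+ _]; lra.
have [w hw] := coupleq n.
have [v1 [cv1 mv1 h1]] := hw _ cut.
have [v2 [cv2 mv2 h2]] := hw _ cone1.
have [v3 [cv3 mv3 h3]] := hw _ ch.
have Lnh x : iter n L h x = h x.
  by elim: (n) x => //= k IH x; rewrite (funext IH : _ = h).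
(* The common part [w] of the three decompositions, of [u + t], of [1] and of [h], cancels. *)
have E x : iter n L u x - m u * h x = v1 x - t * v2 x - m u * v3 x.
  have -> : iter n L u x = iter n L (fun y => u y + t) x - t * iter n L (fun=> 1) x.
    rewrite -iter_trZ -iter_trB; congr (iter n L _ x); apply/funext => y.
    by rewrite mulr1 addrK.
  rewrite h1 h2 -(Lnh x) h3 mh m1 mut; ring.
have n1 := cnrm _ cv1; have n2 := cnrm _ cv2; have n3 := cnrm _ cv3.
rewrite mv1 mut in n1; rewrite mv2 m1 mulr1 in n2; rewrite mv3 mh mulr1 in n3.
have key (p1 p2 p3 d : R) : 0 <= d -> `|p1| <= B * (q n * (m u + t)) * d ->
    `|p2| <= B * q n * d -> `|p3| <= B * q n * d ->
    `|p1 - t * p2 - m u * p3| <= B * (4 + 2 / a) * rho ^- N * rho ^+ n * A * d.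
  move=> d0 p1B p2B p3B.
  have Bq : 0 <= B * q n * d by rewrite !mulr_ge0.
  apply: (@le_trans _ _ (B * q n * d * (m u + t + t + A))).
    have e1 : `|p1| <= B * q n * d * (m u + t).
      by apply: le_trans p1B _; apply: eq_refl_le; ring.
    have e2 : `|t * p2| <= B * q n * d * t.
      by rewrite normrM (ger0_norm t0) mulrC; apply: ler_wpM2r.
    have e3 : `|m u * p3| <= B * q n * d * A.
      by rewrite normrM mulrC; apply: ler_pM.
    apply: le_trans (ler_normB _ _) _.
    apply: le_trans (lerD (ler_normB _ _) (lexx _)) _.
    apply: le_trans (lerD (lerD e1 e2) e3) _.
    by apply: eq_refl_le; ring.
  apply: (@le_trans _ _ (B * (rho ^- N * rho ^+ n) * d * ((4 + 2 / a) * A))).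
    apply: ler_pM => //.
    - by move: muA; rewrite ler_norml => /andP[? _]; lra.
    - by rewrite ler_wpM2r// ler_wpM2l.
    - have : m u <= A by apply: le_trans (ler_norm _) muA.
      have -> : (4 + 2 / a) * A = 4 * A + 2 * (A / a) by ring.
      by rewrite /t; lra.
  by apply: eq_refl_le; ring.
split=> [x|x y].
  rewrite E -[leRHS]mulr1; apply: key => //; rewrite ?mulr1.
  - exact: n1.1.
  - exact: n2.1.
  - exact: n3.1.
rewrite !E.
have -> : v1 x - t * v2 x - m u * v3 x - (v1 y - t * v2 y - m u * v3 y) =
  (v1 x - v1 y) - t * (v2 x - v2 y) - m u * (v3 x - v3 y) by ring.
by apply: key => //; [exact: n1.2|exact: n2.2|exact: n3.2].
Qed.

End gap.
End spectral.

(** * Perturbation of the leading eigenvalue *)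

Lemma strong_rec (T : Type) (t0 : T) (F : nat -> (nat -> T) -> T) :
  (forall n u v, (forall k, (k < n)%N -> u k = v k) -> F n u = F n v) ->
  exists u : nat -> T, forall n, u n = F n u.
Proof.
move=> Fext.
pose us := fix us n := if n is n'.+1 then
  fun k => if k == n' then F n' (us n') else us n' k else fun=> t0.
pose u n := us n.+1 n.
have uE m k : (k < m)%N -> us m k = u k.
  elim: m => // m IH; rewrite ltnS leq_eqVlt => /predU1P[->//|km].
  by rewrite /= ltn_eqF// IH.
exists u => n; rewrite {1}/u /= eqxx.
by apply: Fext => k kn; exact: uE.
Qed.

Section convolution.
Variable R : realType.
Implicit Types (a b : nat -> R).

Definition conv a b n := \sum_(k < n.+1) a k * b (n - k)%N.

Lemma sum_triangle (F : nat -> nat -> R) N :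
  \sum_(n < N) \sum_(k < n.+1) F k (n - k)%N = \sum_(k < N) \sum_(j < N - k) F k j.
Proof.
elim: N => [|N IH]; first by rewrite !big_ord0.
rewrite big_ord_recr /= IH [RHS]big_ord_recr /= big_ord_recr /= subnn.
rewrite subSn// subnn big_ord1 addrA; congr (_ + _).
rewrite -big_split /=; apply: eq_bigr => k _.
by rewrite subSn ?big_ord_recr//= ltnW.
Qed.

Lemma sum_ord_split a m N : (m <= N)%N ->
  \sum_(i < N) a i = \sum_(i < m) a i + \sum_(m <= i < N) a i.
Proof. by move=> mN; rewrite -!(big_mkord xpredT a) -big_cat_nat. Qed.

Lemma sum_conv_le a b N : (forall n, 0 <= a n) -> (forall n, 0 <= b n) ->
  \sum_(n < N) conv a b n <= (\sum_(k < N) a k) * (\sum_(j < N) b j).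
Proof.
move=> a0 b0; rewrite (sum_triangle (fun k j => a k * b j)) mulr_suml.
apply: ler_sum => k _; rewrite -mulr_sumr ler_wpM2l//.
by rewrite (sum_ord_split b (leq_subr k N)) lerDl sumr_ge0.
Qed.

(** The pairs missing from the truncated Cauchy product have total index at least [N]; the weights
    [2 ^+ k] built into the hypotheses bound them by [2 ^- N]. Convergence at half of the radius of
    summability thus comes with an explicit error. *)
Lemma sum_conv_diff a b (A B : R) N :
  (forall n, \sum_(k < n) `|a k| * 2 ^+ k <= A) ->
  (forall n, \sum_(k < n) `|b k| * 2 ^+ k <= B) ->
  `|(\sum_(k < N) a k) * (\sum_(j < N) b j) - \sum_(n < N) conv a b n|
    <= A * B * 2 ^- N.
Proof.
move=> aA bB; rewrite (sum_triangle (fun k j => a k * b j)) mulr_suml -sumrB.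
apply: (@le_trans _ _ (\sum_(k < N) (`|a k| * 2 ^+ k) * B * 2 ^- N)); last first.
  rewrite -!mulr_suml -[leLHS]mulrA -[leRHS]mulrA; apply: ler_wpM2r; last exact: aA.
  rewrite mulr_ge0// ?invr_ge0 ?exprn_ge0//.
  by have := bB 0%N; rewrite big_ord0.
apply: (le_trans (ler_norm_sum _ _ _)); apply: ler_sum => k _.
rewrite -mulr_sumr -mulrBr normrM -!mulrA ler_wpM2l//.
rewrite (sum_ord_split b (leq_subr k N)) addrAC subrr add0r; apply: (le_trans (ler_norm_sum _ _ _)).
apply: (@le_trans _ _ (2 ^+ k * (\sum_(N - k <= j < N) `|b j| * 2 ^+ j) * 2 ^- N)).
  rewrite mulr_sumr mulr_suml [leLHS]big_nat_cond [leRHS]big_nat_cond.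
  apply: ler_sum => j /andP[/andP[kj jN] _].
  rewrite ler_pdivlMr ?exprn_gt0// mulrCA -exprD ler_wpM2l// ler_weXn2l ?ler1n//.
  by rewrite -leq_subLR.
rewrite -mulrA ler_wpM2l ?exprn_ge0// ler_wpM2r ?invr_ge0 ?exprn_ge0//.
apply: le_trans (bB N).
rewrite (sum_ord_split (fun j => `|b j| * 2 ^+ j) (leq_subr k N)) lerDr.
by apply: sumr_ge0 => j _; rewrite mulr_ge0// exprn_ge0.
Qed.

Lemma cvg_geometric2 (A : R) : (fun n => A * 2 ^- n) @ \oo --> (0 : R).
Proof.
rewrite -(mulr0 A); apply: cvgMr.
have -> : (fun n => 2 ^- n) = (fun n => (2^-1) ^+ n) :> (nat -> R).
  by apply/funext => n; rewrite exprVn.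
by apply: cvg_expr; rewrite ger0_norm ?invr_ge0// invf_lt1// ltr1n.
Qed.

Lemma cvg_conv a b (A B la lb : R) :
  (forall n, \sum_(k < n) `|a k| * 2 ^+ k <= A) ->
  (forall n, \sum_(k < n) `|b k| * 2 ^+ k <= B) ->
  (fun n => \sum_(k < n) a k) @ \oo --> la ->
  (fun n => \sum_(k < n) b k) @ \oo --> lb ->
  (fun N => \sum_(n < N) conv a b n) @ \oo --> la * lb.
Proof.
move=> aA bB ala blb.
pose d N := (\sum_(k < N) a k) * (\sum_(j < N) b j) - \sum_(n < N) conv a b n.
have d0 : d @ \oo --> (0 : R).
  apply/cvgrPdist_le => e e0.
  have /cvgrPdist_le/(_ _ e0) := cvg_geometric2 (A * B).
  apply: filterS => N /=; rewrite !sub0r !normrN => h.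
  apply: le_trans (sum_conv_diff N aA bB) _; apply: le_trans h; exact: ler_norm.
have -> : (fun N => \sum_(n < N) conv a b n) =
    (fun N => (\sum_(k < N) a k) * (\sum_(j < N) b j) - d N).
  by apply/funext => N; rewrite /d opprB addrCA subrr addr0.
by rewrite -[X in _ --> X]subr0; apply: cvgB d0; exact: cvgM.
Qed.

Lemma sum_tail2 a (A : R) : (forall n, \sum_(k < n) `|a k| * 2 ^+ k <= A) ->
  exists l, forall n, `|\sum_(k < n) a k - l| <= A * 2 ^- n.
Proof.
move=> aA; apply: cauchy_lim => [e e0|n k].
  have A0 : 0 <= A by have := aA 0%N; rewrite big_ord0.
  have /cvgrPdist_le/(_ _ e0)[n _ /(_ n (leqnn n))] := cvg_geometric2 A.
  rewrite /= sub0r normrN => h; exists n; apply: le_trans h; exact: ler_norm.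
rewrite (sum_ord_split a (leq_addr k n)) addrAC subrr add0r; apply: (le_trans (ler_norm_sum _ _ _)).
apply: (@le_trans _ _ ((\sum_(n <= j < n + k) `|a j| * 2 ^+ j) * 2 ^- n)).
  rewrite mulr_suml [leLHS]big_nat_cond [leRHS]big_nat_cond.
  apply: ler_sum => j /andP[/andP[nj _] _].
  by rewrite ler_pdivlMr ?exprn_gt0// ler_wpM2l// ler_weXn2l ?ler1n.
rewrite ler_wpM2r ?invr_ge0 ?exprn_ge0//.
apply: le_trans (aA (n + k)%N).
rewrite (sum_ord_split (fun j => `|a j| * 2 ^+ j) (leq_addr k n)) lerDr.
by apply: sumr_ge0 => j _; rewrite mulr_ge0// exprn_ge0.
Qed.

Lemma dist_cvg a (q : nat -> R) (l : R) :
  q @ \oo --> (0 : R) -> (forall n, `|a n - l| <= q n) -> a @ \oo --> l.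
Proof.
move=> q0 aq; apply/cvgrPdist_le => e e0.
have /cvgrPdist_le/(_ _ e0) := q0; apply: filterS => n /=.
rewrite sub0r normrN distrC => h; apply: le_trans (aq n) _.
by apply: le_trans h; exact: ler_norm.
Qed.

Lemma cvg_exp_sum (x : R) :
  (fun n => \sum_(k < n) x ^+ k / k`!%:R) @ \oo --> expR x.
Proof.
have -> : (fun n => \sum_(k < n) x ^+ k / k`!%:R) = series (exp_coeff x).
  by apply/funext => n; rewrite /series /= big_mkord.
exact: is_cvg_series_exp_coeff.
Qed.

Lemma exp_sum_le (x : R) n : 0 <= x -> \sum_(k < n) x ^+ k / k`!%:R <= expR x.
Proof.
move=> x0; rewrite -(cvg_lim (@Rhausdorff R) (cvg_exp_sum (x := x))).
apply: nondecreasing_cvgn_le; last by apply/cvg_ex; exists (expR x); exact: (cvg_exp_sum (x := x)).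
apply/nondecreasing_seqP => k; rewrite big_ord_recr /= lerDl.
by rewrite divr_ge0// exprn_ge0.
Qed.

End convolution.

Section nrm.
Variables (R : realType) (X : Type) (D : X -> X -> R).
Hypothesis D_ge0 : forall x y, 0 <= D x y.
Implicit Types (u v : X -> R) (A B : R).

Lemma nrm_le u A B : A <= B -> nrm D u A -> nrm D u B.
Proof.
move=> AB [h1 h2]; split=> [x|x y]; first exact: le_trans (h1 x) AB.
by apply: le_trans (h2 x y) _; rewrite ler_wpM2r.
Qed.

Lemma nrm_bdd u A : nrm D u A -> bdd u.
Proof. by case=> h _; exists A. Qed.

Lemma nrmD u v A B : nrm D u A -> nrm D v B -> nrm D (fun x => u x + v x) (A + B).
Proof.
move=> [h1 h2] [h3 h4]; split=> [x|x y].
  by rewrite (le_trans (ler_normD _ _))// lerD.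
by rewrite opprD addrACA (le_trans (ler_normD _ _))// mulrDl lerD.
Qed.

Lemma nrmZ a u A : nrm D u A -> nrm D (fun x => a * u x) (`|a| * A).
Proof.
move=> [h1 h2]; split=> [x|x y]; first by rewrite normrM ler_wpM2l.
by rewrite -mulrBr normrM -mulrA ler_wpM2l.
Qed.

Lemma nrmB u v A B : nrm D u A -> nrm D v B -> nrm D (fun x => u x - v x) (A + B).
Proof.
move=> hu /(nrmZ (-1)); rewrite normrN1 mul1r => hv.
have := nrmD hu hv; congr nrm; apply/funext => x.
by rewrite mulN1r.
Qed.

Lemma nrm_cst a : nrm D (fun=> a) `|a|.
Proof. by split=> // x y; rewrite subrr normr0 mulr_ge0. Qed.

Lemma nrm_sum n (F : nat -> X -> R) (A : nat -> R) :
  (forall i, (i < n)%N -> nrm D (F i) (A i)) ->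
  nrm D (fun x => \sum_(i < n) F i x) (\sum_(i < n) A i).
Proof.
elim: n => [|n IH] h.
  have := nrm_cst 0; rewrite big_ord0 normr0; congr nrm.
  by apply/funext => x; rewrite big_ord0.
have := nrmD (IH (fun i lt => h i (ltnW lt))) (h n (leqnn _)).
rewrite big_ord_recr /=; congr nrm.
by apply/funext => x; rewrite big_ord_recr.
Qed.

Lemma nrmM u v A B : 0 <= A -> 0 <= B -> nrm D u A -> nrm D v B ->
  nrm D (fun x => u x * v x) (2 * A * B).
Proof.
move=> A0 B0 [h1 h2] [h3 h4].
have AB : 0 <= A * B by exact: mulr_ge0.
split=> [x|x y].
  rewrite normrM (le_trans (ler_pM _ _ (h1 x) (h3 x)))//.
  by rewrite -mulrA ler_peMl// ler1n.
have -> : u x * v x - u y * v y = u x * (v x - v y) + (u x - u y) * v y by ring.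
rewrite (le_trans (ler_normD _ _))// !normrM.
have -> : 2 * A * B * D x y = A * (B * D x y) + A * D x y * B by ring.
by apply: lerD; apply: ler_pM.
Qed.

Lemma nrmX u A n : 0 <= A -> nrm D u A -> nrm D (fun x => u x ^+ n) ((2 * A) ^+ n).
Proof.
move=> A0 hu; elim: n => [|n IH].
  by have := nrm_cst 1; rewrite normr1 expr0; congr nrm.
have A20 : 0 <= (2 * A) ^+ n by rewrite exprn_ge0// mulr_ge0.
have := nrmM A0 A20 hu IH; rewrite exprS; congr nrm.
by apply/funext => x; rewrite exprS.
Qed.

End nrm.

Section perturbation.
Variables (R : realType) (X : Type) (g : bool -> X -> X).
Variables (D : X -> X -> R).
Hypothesis D_ge0 : forall x y, 0 <= D x y.
Hypothesis D_le1 : forall x y, D x y <= 1.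
Hypothesis gD : forall b x y, D (g b x) (g b y) <= D x y.
Variables (x0 : X) (W : bool -> X -> R) (c C K : R).
Hypothesis c_gt0 : 0 < c.
Hypothesis Wc : forall b x, c <= W b x <= C.
Hypothesis K_ge0 : 0 <= K.
Hypothesis WK : forall b x y, `|W b x - W b y| <= K * D x y.
Variables (m : (X -> R) -> R) (h : X -> R) (C1 rho hmin hmax : R).
Hypothesis pm : posfun m.
Hypothesis mL : forall u, bdd u -> m (tr g W u) = m u.
Hypothesis hmin_gt0 : 0 < hmin.
Hypothesis h_ge : forall x, hmin <= h x.
Hypothesis h_nrm : nrm D h hmax.
Hypothesis Lh : forall x, tr g W h x = h x.
Hypothesis mh : m h = 1.
Hypothesis C1_ge0 : 0 <= C1.
Hypothesis rho01 : 0 < rho < 1.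
Hypothesis gap : forall u A n, nrm D u A ->
    nrm D (fun x => iter n (tr g W) u x - m u * h x) (C1 * rho ^+ n * A).
Variables (psi : X -> R) (B : R).
Hypothesis B_gt0 : 0 < B.
Hypothesis psiB : nrm D psi B.
Implicit Types (u v : X -> R).

Notation L := (tr g W).
Let nrm := nrm D.
Let W_gt0 b x : 0 < W b x.
Proof. by have /andP[+ _] := Wc b x; exact: lt_le_trans. Qed.
Let W_ge0 b x : 0 <= W b x. Proof. exact: ltW. Qed.
Let C_gt0 : 0 < C.
Proof. by have /andP[_] := Wc false x0; apply: lt_le_trans. Qed.
Let rho_gt0 : 0 < rho. Proof. by case/andP: rho01. Qed.
Let rho_lt1 : rho < 1. Proof. by case/andP: rho01. Qed.
Let rho1 : 0 < 1 - rho. Proof. by rewrite subr_gt0. Qed.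
Let nrm_ge0 u A : nrm u A -> 0 <= A.
Proof. by case=> h1 _; exact: le_trans (h1 x0). Qed.

Lemma nrm_tr u A : nrm u A -> nrm (L u) (2 * (C + K) * A).
Proof.
move=> hu; have A0 := nrm_ge0 hu; have [h1 h2] := hu; split=> [x|x y].
  apply: le_trans (tr_norm c_gt0 Wc _ _ x h1) _.
  by rewrite ler_wpM2r// ler_wpM2l// lerDl.
have -> : L u x - L u y = W false x * (u (g false x) - u (g false y))
    + W true x * (u (g true x) - u (g true y))
    + ((W false x - W false y) * u (g false y)
    + (W true x - W true y) * u (g true y)) by rewrite /tr; ring.
have e1 b : `|W b x * (u (g b x) - u (g b y))| <= C * A * D x y.
  rewrite normrM -mulrA ler_pM//.
    by rewrite ger0_norm//; have /andP[] := Wc b x.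
  by apply: le_trans (h2 _ _) _; rewrite ler_wpM2l.
have e2 b : `|(W b x - W b y) * u (g b y)| <= K * A * D x y.
  by rewrite normrM mulrAC ler_pM.
apply: le_trans (ler_normD _ _) _.
apply: le_trans (lerD (ler_normD _ _) (ler_normD _ _)) _.
apply: le_trans (lerD (lerD (e1 _) (e1 _)) (lerD (e2 _) (e2 _))) _.
by apply: eq_refl_le; ring.
Qed.

Let CS := C1 / (1 - rho).
Let CS_ge0 : 0 <= CS. Proof. by rewrite divr_ge0// ltW. Qed.

Let geom_sum n k : \sum_(n <= j < n + k) rho ^+ j <= rho ^+ n / (1 - rho).
Proof.
have -> : \sum_(n <= j < n + k) rho ^+ j = (rho ^+ n - rho ^+ (n + k)) / (1 - rho).
  elim: k => [|k IH]; first by rewrite addn0 big_geq// subrr mul0r.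
  rewrite addnS big_nat_recr ?leq_addr//= IH exprS; field.
  by rewrite lt0r_neq0.
by rewrite ler_pM2r ?invr_gt0// gerBl exprn_ge0// ltW.
Qed.

Let rho_small (A e : R) : 0 <= A -> 0 < e -> exists n, A * rho ^+ n <= e.
Proof.
move=> A0 e0; have [n hn] := @expr_lt_ex _ rho (e / (A + 1))
  (introT andP (conj (ltW rho_gt0) rho_lt1)) (divr_gt0 e0 (ltr_wpDl A0 ltr01)).
exists n; apply: le_trans (ler_wpM2l A0 (ltW hn)) _.
by rewrite mulrA ler_pdivrMr ?ltr_wpDl// mulrC ler_wpM2l ?(ltW e0)// lerDl.
Qed.

(** On the kernel of [m] the iterates decay geometrically, so the Neumann series inverts [1 - L].
    The hypotheses stand under the existential so that choice yields a total operator. *)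
Lemma resolvent u : exists v, (exists A, nrm u A) -> m u = 0 ->
  [/\ forall A, nrm u A -> nrm v (CS * A), m v = 0 & forall x, v x - L v x = u x].
Proof.
have [[[A0 uA] mu]|] := pselect ((exists A, nrm u A) /\ m u = 0); last first.
  by move=> h1; exists u => h2 h3; exfalso; apply: h1.
have A00 := nrm_ge0 uA.
have Ln A n : nrm u A -> nrm (iter n L u) (C1 * rho ^+ n * A).
  move=> /(gap n); congr nrm.
  by apply/funext => x; rewrite mu mul0r subr0.
pose a n x := \sum_(j < n) iter j L u x.
pose q n := CS * A0 * rho ^+ n.
have aq x n k : `|a (n + k)%N x - a n x| <= q n.
  rewrite /a (sum_ord_split (fun j => iter j L u x) (leq_addr k n)).
  rewrite addrAC subrr add0r; apply: (le_trans (ler_norm_sum _ _ _)).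
  apply: (@le_trans _ _ (\sum_(n <= j < n + k) C1 * A0 * rho ^+ j)).
    by apply: ler_sum => j _; have [h1 _] := Ln _ j uA; rewrite mulrAC.
  rewrite -mulr_sumr; apply: (le_trans (ler_wpM2l _ (geom_sum n k))).
    exact: mulr_ge0.
  by apply: eq_refl_le; rewrite /q /CS; ring.
have q0 e : 0 < e -> exists n, q n <= e.
  by apply: rho_small; rewrite mulr_ge0.
have /choice[v vP] : forall x, exists l, forall n, `|a n x - l| <= q n.
  by move=> x; apply: cauchy_lim => // n k; exact: aq.
have an A n : nrm u A -> nrm (a n) (CS * A).
  move=> uA'; have A0' := nrm_ge0 uA'.
  apply: (nrm_le D_ge0 _ (nrm_sum D_ge0 (fun i _ => Ln _ i uA'))).
  rewrite -mulr_suml ler_wpM2r// -mulr_sumr /CS ler_wpM2l//.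
  by have := geom_sum 0 n; rewrite add0n big_mkord expr0 mul1r.
have bLn n : bdd (iter n L u) by exact: (bdd_iter_tr c_gt0 Wc _ _ (nrm_bdd uA)).
have ban n : bdd (a n) by exact: nrm_bdd (an _ n uA).
have nv A : nrm u A -> nrm v (CS * A).
  move=> uA'; split=> [x|x y].
    apply: (@le_cvg0 _ q 1) => // n; rewrite mul1r.
    have -> : v x = a n x - (a n x - v x) by ring.
    apply: le_trans (ler_normB _ _) _; apply: lerD => //.
    by have [h1 _] := an A n uA'.
  apply: (@le_cvg0 _ q 2) => // n.
  have -> : v x - v y = (a n x - a n y) - ((a n x - v x) - (a n y - v y)) by ring.
  apply: le_trans (ler_normB _ _) _; apply: lerD.
    by have [_ h1] := an A n uA'.
  apply: le_trans (ler_normB _ _) _; rewrite mulr_natl mulr2n; exact: lerD.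
have bv : bdd v by exact: nrm_bdd (nv _ uA).
have man n : m (a n) = 0.
  elim: n => [|n IH].
    by rewrite -(posfun0 pm); congr m; apply/funext => x; rewrite /a big_ord0.
  have -> : a n.+1 = fun x => a n x + iter n L u x.
    by apply/funext => x; rewrite /a big_ord_recr.
  rewrite (posfunD pm)// IH add0r -mu.
  by elim: n {IH} => //= n <-; exact: mL.
exists v => _ _; split => //.
  apply/eqP; rewrite -normr_le0; apply: (@le_cvg0 _ q 1) => // n.
  rewrite add0r mul1r -[m v]subr0 -(man n) -(posfunB pm)//.
  by apply: (posfun_norm pm) => x; rewrite distrC.
move=> x; apply/eqP; rewrite -subr_eq0 -normr_le0.
apply: (@le_cvg0 _ q (1 + 2 * C)) => // [|n].
  by rewrite addr_ge0// mulr_ge0// ltW.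
rewrite add0r.
have La : a n.+1 x = u x + L (a n) x.
  rewrite /a big_ord_recl /=; congr (_ + _).
  have -> : (fun y => \sum_(j < n) iter j L u y) =
      (fun y => \sum_(j < n) 1 * iter j L u y).
    by apply/funext => y; apply: eq_bigr => j _; rewrite mul1r.
  by rewrite (tr_sum g W n (fun=> 1)); apply: eq_bigr => j _; rewrite mul1r.
have -> : v x - L v x - u x = L (fun y => a n y - v y) x - (a n.+1 x - v x).
  by rewrite trB La; ring.
apply: le_trans (ler_normB _ _) _; rewrite mulrDl mul1r addrC -[2 * C * _]mulrA.
have qn : q n.+1 <= q n.
  rewrite /q; apply: ler_wpM2l; first exact: mulr_ge0.
  by rewrite exprS ler_piMl ?exprn_ge0 ?ltW.
apply: lerD; first exact: le_trans (vP _ _) qn.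
by rewrite mulrA; apply: (tr_norm c_gt0 Wc).
Qed.

(** The coefficient of [t ^+ k] in the perturbed operator sending [u] to
    [L (expR (t * psi) * u)]. *)
Let M k u := L (fun x => psi x ^+ k / k`!%:R * u x).
Let bk k := 4 * (C + K) * (2 * B) ^+ k.

Let nrmMk k u A : nrm u A -> nrm (M k u) (bk k * A).
Proof.
move=> hu; have A0 := nrm_ge0 hu.
have B20 : 0 <= (2 * B) ^+ k by rewrite exprn_ge0// mulr_ge0// ltW.
have hp : nrm (fun x => psi x ^+ k / k`!%:R) ((2 * B) ^+ k).
  have := nrmZ (k`!%:R^-1) (nrmX D_ge0 k (ltW B_gt0) psiB).
  have -> : (fun x => k`!%:R^-1 * psi x ^+ k) = fun x => psi x ^+ k / k`!%:R.
    by apply/funext => x; rewrite mulrC.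
  apply: nrm_le => //; rewrite ler_piMl// normfV ger0_norm// invf_le1 ?ltr0n ?fact_gt0//.
  by rewrite ler1n fact_gt0.
have h3 := nrm_tr (nrmM B20 A0 hp hu).
rewrite /M; apply: (nrm_le D_ge0 _ h3).
by apply: eq_refl_le; rewrite /bk; ring.
Qed.

(** The [n]-th coefficient of the leading eigenvalue for [n > 0], obtained by applying [m] to the
    eigenvalue equation. *)
Let lf (H : nat -> X -> R) n := \sum_(k < n) m (M k.+1 (H (n.-1 - k)%N)).

(** The equation for the eigenfunction is solved order by order with the normalization [m (H n) = 0]
    for [n > 0]. The coefficient [lf] is exactly what puts the right-hand side into the kernel of
    [m], where [S] inverts [1 - L]. *)
Lemma formal_eigen : exists H : nat -> X -> R, exists S : (X -> R) -> X -> R,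
 [/\ forall u, (exists A, nrm u A) -> m u = 0 ->
   [/\ forall A, nrm u A -> nrm (S u) (CS * A), m (S u) = 0 &
       forall x, S u x - L (S u) x = u x],
   H 0%N = h &
   forall n, H n.+1 = S (fun x => \sum_(k < n.+1)
      (M k.+1 (H (n - k)%N) x - lf H k.+1 * H (n - k)%N x))].
Proof.
have /choice[S SP] := resolvent.
pose F n (H : nat -> X -> R) := if n is n'.+1 then
  S (fun x => \sum_(k < n'.+1)
      (M k.+1 (H (n' - k)%N) x - lf H k.+1 * H (n' - k)%N x)) else h.
have [|H HE] := @strong_rec _ h F; last first.
  by exists H, S; split => // [|n]; rewrite HE.
case=> // n u v uv; rewrite /F; congr S; apply/funext => x.
apply: eq_bigr => k _; rewrite uv ?ltnS ?leq_subr//; congr (_ - _ * _).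
rewrite /lf; apply: eq_bigr => i _ /=.
by rewrite uv// ltnS (leq_trans (leq_subr _ _))// -ltnS ltn_ord.
Qed.

Let posfun_sum n (F : nat -> X -> R) : (forall i, (i < n)%N -> bdd (F i)) ->
  bdd (fun x => \sum_(i < n) F i x) /\
  m (fun x => \sum_(i < n) F i x) = \sum_(i < n) m (F i).
Proof.
elim: n => [|n IH] h1.
  have -> : (fun x => \sum_(i < 0) F i x) = fun=> 0.
    by apply/funext => x; rewrite big_ord0.
  by rewrite big_ord0 (posfun0 pm); split => //; exact: bdd_cst.
have [b1 e1] := IH (fun i lt => h1 i (ltnW lt)).
have -> : (fun x => \sum_(i < n.+1) F i x) = fun x => \sum_(i < n) F i x + F n x.
  by apply/funext => x; rewrite big_ord_recr.
split; first exact/bddD/h1.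
by rewrite big_ord_recr /= -e1 (posfunD pm)//; exact: h1.
Qed.

Let hmax_ge0 : 0 <= hmax. Proof. exact: nrm_ge0 h_nrm. Qed.
Let bk_ge0 k : 0 <= bk k.
Proof. by rewrite !mulr_ge0 ?addr_ge0 ?exprn_ge0 ?mulr_ge0 ?(ltW C_gt0) ?(ltW B_gt0). Qed.

Let ln (H : nat -> X -> R) n := if n is n'.+1 then lf H n'.+1 else 1.

(** Norm bounds [a n] are defined by the recursion of the [H n] with every operator replaced by its
    norm bound. The resulting majorant series converges for small [x], which gives a positive radius
    to the formal eigenfunction and eigenvalue. *)
Lemma majorant : exists (H : nat -> X -> R) (a : nat -> R) (x : R),
  [/\ 0 < x, forall n, nrm (H n) (a n), forall y, H 0%N y = h y,
      (forall n, 0 <= a n) /\ (forall N, \sum_(n < N) a n.+1 * x ^+ n.+1 <= 1) /\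
      (exists S, forall N, \sum_(n < N) `|ln H n| * x ^+ n <= S)
    & forall n y, \sum_(k < n.+1) M k (H (n - k)%N) y =
                  \sum_(k < n.+1) ln H k * H (n - k)%N y].
Proof.
have [H [S [SP H0 HS]]] := formal_eigen.
pose Lb (a : nat -> R) n := \sum_(k < n) bk k.+1 * a (n.-1 - k)%N.
pose F n (a : nat -> R) := if n is n'.+1 then
  CS * \sum_(k < n'.+1) (bk k.+1 + Lb a k.+1) * a (n' - k)%N else hmax.
have [|a aE] := @strong_rec _ 0 F.
  case=> // n u v uv; rewrite /F; congr (_ * _).
  apply: eq_bigr => k _; rewrite uv ?ltnS ?leq_subr//; congr ((_ + _) * _).
  rewrite /Lb; apply: eq_bigr => i _ /=.
  by rewrite uv// ltnS (leq_trans (leq_subr _ _))// -ltnS ltn_ord.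
have a0 n : 0 <= a n.
  elim/ltn_ind: n => -[|n] IH; rewrite aE//= mulr_ge0// sumr_ge0// => k _.
  apply: mulr_ge0; last by rewrite IH// ltnS leq_subr.
  rewrite addr_ge0// sumr_ge0// => i _.
  by rewrite mulr_ge0 ?IH//= ltnS (leq_trans (leq_subr _ _))// -ltnS ltn_ord.
have Lb0 n : 0 <= Lb a n by rewrite sumr_ge0// => k _; exact: mulr_ge0.
have lfB n : (forall k, (k <= n)%N -> nrm (H k) (a k)) -> `|lf H n.+1| <= Lb a n.+1.
  move=> Hk; apply: le_trans (ler_norm_sum _ _ _) _; apply: ler_sum => k _ /=.
  have [h1 _] := nrmMk k.+1 (Hk _ (leq_subr k n)).
  exact: (posfun_norm pm).
have Hind n : (forall k, (k <= n)%N -> nrm (H k) (a k)) /\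
    m (H 0%N) = 1 /\ (forall k, (k < n)%N -> m (H k.+1) = 0 /\
      forall x, H k.+1 x - L (H k.+1) x = \sum_(i < k.+1)
      (M i.+1 (H (k - i)%N) x - lf H i.+1 * H (k - i)%N x)).
  elim: n => [|n [IH1 [IH2 IH3]]].
    split=> [k|]; last by rewrite H0 mh.
    by rewrite leqn0 => /eqP ->; rewrite H0 aE.
  pose G i x := M i.+1 (H (n - i)%N) x - lf H i.+1 * H (n - i)%N x.
  have Gn i : (i < n.+1)%N ->
      nrm (G i) (bk i.+1 * a (n - i)%N + Lb a i.+1 * a (n - i)%N).
    rewrite ltnS => lin; have Hni := IH1 _ (leq_subr i n).
    apply: (nrm_le D_ge0 _ (nrmB (nrmMk i.+1 Hni) (nrmZ (lf H i.+1) Hni))).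
    rewrite lerD2l ler_wpM2r//; apply: lfB => k ki; apply: IH1.
    exact: leq_trans lin.
  have uA := nrm_sum D_ge0 Gn.
  have mu : m (fun x => \sum_(i < n.+1) G i x) = 0.
    have [_ ->] := posfun_sum (fun i lt => nrm_bdd (Gn i lt)).
    have E i : (i < n.+1)%N -> m (G i) =
        m (M i.+1 (H (n - i)%N)) - lf H i.+1 * m (H (n - i)%N).
      rewrite ltnS => lin; have Hni := IH1 _ (leq_subr i n).
      rewrite /G (posfunB pm); first by rewrite (posfunZ pm)//; exact: nrm_bdd Hni.
        exact: nrm_bdd (nrmMk i.+1 Hni).
      by apply: bddZ; exact: nrm_bdd Hni.
    rewrite (eq_bigr (fun i : 'I_n.+1 => m (M i.+1 (H (n - i)%N)) -
      lf H i.+1 * m (H (n - i)%N))) => [|i _]; last exact: E.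
    rewrite sumrB -/(lf H n.+1) big_ord_recr /= subnn IH2 mulr1.
    rewrite big1 ?add0r ?subrr// => i _.
    have [j nj] : exists j, (n - i)%N = j.+1.
      by exists (n - i).-1; rewrite prednK// subn_gt0 ltn_ord.
    rewrite nj; have [|-> _] := IH3 j; last by rewrite mulr0.
    by rewrite -nj leq_subr.
  have [h1 h2 h3] := SP _ (ex_intro _ _ uA) mu.
  rewrite -(HS n) in h1 h2 h3.
  split=> [k|].
    rewrite leq_eqVlt => /predU1P[->|]; last by rewrite ltnS; exact: IH1.
    rewrite aE /=; apply: (nrm_le D_ge0 _ (h1 _ uA)).
    by rewrite ler_wpM2l// ler_sum// => i _; rewrite mulrDl.
  split=> // k; rewrite ltnS leq_eqVlt => /predU1P[->|]; last exact: IH3.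
  by split => // x; exact: h3.
(* The smallness that closes the bootstrap in [asum], recorded as [yb]; the summand [2] ensures
   [y <= 1/2]. *)
pose y := (2 + 8 * (C + K) * CS * (2 + hmax) * (1 + hmax))^-1.
have den0 : 0 <= 8 * (C + K) * CS * (2 + hmax) * (1 + hmax).
  apply: mulr_ge0; last by rewrite addr_ge0.
  apply: mulr_ge0; last by rewrite addr_ge0.
  by apply: mulr_ge0 => //; rewrite mulr_ge0 ?addr_ge0 ?(ltW C_gt0).
have y0 : 0 < y by rewrite invr_gt0 ltr_pwDl.
have y12 : y <= 2^-1 by rewrite lef_pV2 ?posrE// ?ltr_pwDl// lerDl.
have yb : 8 * (C + K) * y * CS * (2 + hmax) * (1 + hmax) <= 1.
  have : y * (2 + 8 * (C + K) * CS * (2 + hmax) * (1 + hmax)) = 1.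
    by rewrite mulVf// lt0r_neq0// ltr_pwDl.
  by move: (ltW y0); set z := y; lra.
(* Then [bk k * x ^+ k] is [4 * (C + K) * y ^+ k], a geometric term. *)
pose x := y / (2 * B).
have x0' : 0 < x by rewrite divr_gt0// mulr_gt0.
pose b := 8 * (C + K) * y.
have b0 : 0 <= b by rewrite /b !mulr_ge0// ?addr_ge0// ltW.
have bsum N : \sum_(k < N) bk k.+1 * x ^+ k.+1 <= b.
  have -> : \sum_(k < N) bk k.+1 * x ^+ k.+1 = 4 * (C + K) * \sum_(k < N) y ^+ k.+1.
    rewrite mulr_sumr; apply: eq_bigr => k _.
    rewrite /bk -mulrA -exprMn; congr (_ * _ ^+ _).
    by rewrite /x mulrCA divff ?mulr1// lt0r_neq0// mulr_gt0.
  rewrite /b (_ : 8 * (C + K) * y = 4 * (C + K) * (2 * y)); last by ring.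
  rewrite ler_wpM2l ?mulr_ge0 ?addr_ge0 ?(ltW C_gt0)//.
  have E k : \sum_(i < k) y ^+ i.+1 <= 2 * y - 2 * (y ^+ k * y).
    elim: k => [|k IH]; first by rewrite big_ord0 expr0; lra.
    rewrite big_ord_recr /= !exprSr; move: IH; set p := y ^+ k.
    have p0 : 0 <= p * y by rewrite mulr_ge0 ?exprn_ge0 ?(ltW y0).
    have : p * y * y <= p * y * 2^-1 by rewrite ler_wpM2l.
    by move: p0; set z := p * y; lra.
  by apply: le_trans (E N) _; rewrite gerBl mulr_ge0// mulr_ge0 ?exprn_ge0 ?(ltW y0).
pose be n := a n * x ^+ n.
have be0 n : 0 <= be n by rewrite mulr_ge0 ?exprn_ge0 ?(ltW x0').
pose bs k := bk k.+1 * x ^+ k.+1.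
have bs0 n : 0 <= bs n by rewrite mulr_ge0 ?exprn_ge0 ?(ltW x0').
pose ls k := Lb a k.+1 * x ^+ k.+1.
have ls0 n : 0 <= ls n by rewrite mulr_ge0 ?exprn_ge0 ?(ltW x0').
have convE (p : nat -> R) n : conv (fun k => p k.+1 * x ^+ k.+1) be n =
    (\sum_(k < n.+1) p k.+1 * a (n - k)%N) * x ^+ n.+1.
  rewrite /conv mulr_suml; apply: eq_bigr => k _; rewrite /be.
  by rewrite mulrACA -exprD addSn subnKC// -ltnS ltn_ord.
have lsE n : ls n = conv bs be n by rewrite convE.
have lsum N : \sum_(k < N) ls k <= b * \sum_(n < N) be n.
  rewrite (eq_bigr (fun n : 'I_N => conv bs be n)) => [|n _]; last exact: lsE.
  apply: le_trans (sum_conv_le N bs0 be0) _.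
  by apply: ler_wpM2r; [exact: sumr_ge0|exact: bsum].
(* Bootstrap: a bound [hmax + 1] on the first [N] terms, inserted in the recursion through the
   convolution inequality, bounds the terms of positive index by [1], and this restores the bound
   for [N.+1] terms. *)
have asum N : \sum_(n < N) be n <= hmax + 1 /\ \sum_(n < N) be n.+1 <= 1.
  elim: N => [|N [IH _]]; first by rewrite !big_ord0 ler01 addr_ge0.
  have bN : \sum_(n < N) be n.+1 <= 1.
    have -> : \sum_(n < N) be n.+1 =
        CS * \sum_(n < N) conv (fun k => bs k + ls k) be n.
      rewrite mulr_sumr; apply: eq_bigr => n _.
      have -> : (fun k => bs k + ls k) = fun k => (bk k.+1 + Lb a k.+1) * x ^+ k.+1.
        by apply/funext => k; rewrite mulrDl.
      by rewrite (convE (fun k => bk k + Lb a k)) /be aE /= mulrA.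
    have bl0 n : 0 <= bs n + ls n by exact: addr_ge0.
    apply: le_trans (ler_wpM2l CS_ge0 (sum_conv_le N bl0 be0)) _.
    have s1 : \sum_(k < N) (bs k + ls k) <= b * (2 + hmax).
      rewrite big_split /=; apply: le_trans (lerD (bsum N) (lsum N)) _.
      have := ler_wpM2l b0 IH; lra.
    apply: le_trans (ler_wpM2l CS_ge0 (ler_pM _ _ s1 IH)) _.
    - by apply: sumr_ge0.
    - by apply: sumr_ge0.
    by apply: le_trans yb; apply: eq_refl_le; rewrite /b; ring.
  have bS : \sum_(n < N.+1) be n <= hmax + 1.
    rewrite big_ord_recl /= {1}/be expr0 mulr1 aE /=; apply: lerD => //.
  split => //.
  have -> : \sum_(n < N.+1) be n.+1 =
      CS * \sum_(n < N.+1) conv (fun k => bs k + ls k) be n.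
    rewrite mulr_sumr; apply: eq_bigr => n _.
    have -> : (fun k => bs k + ls k) = fun k => (bk k.+1 + Lb a k.+1) * x ^+ k.+1.
      by apply/funext => k; rewrite mulrDl.
    by rewrite (convE (fun k => bk k + Lb a k)) /be aE /= mulrA.
  have bl0 n : 0 <= bs n + ls n by exact: addr_ge0.
  apply: le_trans (ler_wpM2l CS_ge0 (sum_conv_le N.+1 bl0 be0)) _.
  have s1 : \sum_(k < N.+1) (bs k + ls k) <= b * (2 + hmax).
    rewrite big_split /=; apply: le_trans (lerD (bsum N.+1) (lsum N.+1)) _.
    have := ler_wpM2l b0 bS; lra.
  apply: le_trans (ler_wpM2l CS_ge0 (ler_pM _ _ s1 bS)) _.
  - by apply: sumr_ge0.
  - by apply: sumr_ge0.
  by apply: le_trans yb; apply: eq_refl_le; rewrite /b; ring.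
exists H, a, x; split => //.
- by move=> n; have [h1 _] := Hind n; exact: h1.
- by move=> z; rewrite H0.
- split => //; split => [N|]; first by have [] := asum N.
  exists (1 + b * (hmax + 1)) => N.
  apply: (@le_trans _ _ (\sum_(n < N.+1) `|ln H n| * x ^+ n)).
    by rewrite big_ord_recr /= lerDl mulr_ge0 ?exprn_ge0 ?(ltW x0').
  rewrite big_ord_recl /= expr0 mulr1 normr1 lerD2l.
  apply: (@le_trans _ _ (\sum_(k < N) ls k)).
    apply: ler_sum => k _; rewrite ler_wpM2r ?exprn_ge0 ?(ltW x0')//.
    by apply: lfB => i ik; have [h1 _] := Hind k; exact: h1.
  by apply: le_trans (lsum N) _; rewrite ler_wpM2l//; have [] := asum N.
move=> n z.
have M0 u w : M 0%N u w = L u w.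
  by rewrite /M; congr (L _ w); apply/funext => v; rewrite expr0 fact0 divr1 mul1r.
case: n => [|n]; first by rewrite !big_ord1 /= M0 mul1r H0 Lh.
have [_ [_ h1]] := Hind n.+1.
have [_ /(_ z)] := h1 n (leqnn _).
rewrite sumrB => h2.
rewrite big_ord_recl [RHS]big_ord_recl /= !subn0 M0 mul1r.
rewrite (eq_bigr (fun i : 'I_n.+1 => M i.+1 (H (n - i)%N) z)) => [|i _]; last first.
  by rewrite /bump /= add1n subSS.
rewrite [X in _ = _ + X](eq_bigr (fun i : 'I_n.+1 => lf H i.+1 * H (n - i)%N z)) => [|i _]; last first.
  by rewrite /bump /= add1n subSS.
lra.
Qed.

(** For small [t] the series of the [H n] sums to an eigenfunction of the perturbed operator that is
    bounded and bounded away from [0]. Such an eigenfunction forces its eigenvalue to be [lam], so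
    no uniqueness of eigenvalues has to be discussed. *)
Theorem lam_analytic : exists (r : R) (l : nat -> R) (S : R), [/\ 0 < r, l 0%N = 1,
  forall N, \sum_(n < N) `|l n| * r ^+ n <= S &
  forall t, `|t| <= r / 2 ->
    (fun N => \sum_(n < N) l n * t ^+ n) @ \oo -->
      lam g (fun b y => expR (t * psi (g b y)) * W b y)].
Proof.
have [H [a [x [x_gt0 Ha H0 [a0 [asum [S Ssum]]] EH]]]] := majorant.
have k01 : 0 < Num.min 1 hmin by rewrite lt_min ltr01.
(* The factor [hmin] makes the terms of positive index at most [hmin / 2] in total when
   [|t| <= r / 2], so the eigenfunction stays positive. *)
pose r := x * Num.min 1 hmin.
have r0 : 0 < r by rewrite mulr_gt0.
have rx : r <= x by rewrite ger_pMr// ge_min lexx.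
exists r, (ln H), S; split => //.
  move=> N; apply: le_trans (Ssum N); apply: ler_sum => n _.
  by rewrite ler_wpM2l// lerXn2r// nnegrE ltW.
move=> t tr2.
have tx : `|t| <= x / 2 by apply: le_trans tr2 _; rewrite ler_pM2r.
have tn n : `|t| ^+ n * 2 ^+ n <= x ^+ n.
  rewrite -exprMn lerXn2r// ?nnegrE ?mulr_ge0 ?(ltW x_gt0)//.
  by rewrite -ler_pdivlMr.
have asum1 N : \sum_(n < N) a n * x ^+ n <= a 0%N + 1.
  apply: (@le_trans _ _ (\sum_(n < N.+1) a n * x ^+ n)).
    by rewrite big_ord_recr /= lerDl mulr_ge0 ?exprn_ge0 ?(ltW x_gt0).
  rewrite big_ord_recl /= expr0 mulr1 lerD2l; exact: asum.
have Hsum y N : \sum_(n < N) `|H n y * t ^+ n| * 2 ^+ n <= a 0%N + 1.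
  apply: le_trans (asum1 N); apply: ler_sum => n _.
  rewrite normrM normrX -mulrA; have [h1 _] := Ha n; apply: ler_pM => //.
have lsum N : \sum_(n < N) `|ln H n * t ^+ n| * 2 ^+ n <= S.
  apply: le_trans (Ssum N); apply: ler_sum => n _.
  by rewrite normrM normrX -mulrA ler_wpM2l.
have esum y N : \sum_(k < N) `|(t * psi y) ^+ k / k`!%:R| * 2 ^+ k
    <= expR (`|t * psi y| * 2).
  apply: le_trans (exp_sum_le N _); last by rewrite mulr_ge0.
  apply: ler_sum => k _; rewrite normrM normrX exprMn mulrAC normfV.
  by rewrite (@ger0_norm _ (k`!%:R)).
have /choice[ht htP] y := @sum_tail2 _ (fun n => H n y * t ^+ n) _ (Hsum y).
have htc y : (fun n => \sum_(k < n) H k y * t ^+ k) @ \oo --> ht y.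
  by apply: dist_cvg (htP y); exact: cvg_geometric2.
have [lt ltP] := @sum_tail2 _ (fun n => ln H n * t ^+ n) _ lsum.
have ltc : (fun n => \sum_(k < n) ln H k * t ^+ k) @ \oo --> lt.
  by apply: dist_cvg ltP; exact: cvg_geometric2.
pose Wt b y := expR (t * psi (g b y)) * W b y.
have eig y : tr g Wt ht y = lt * ht y.
  have c1 := @cvg_conv _ (fun n => ln H n * t ^+ n) (fun n => H n y * t ^+ n) _ _ _ _ lsum (Hsum y) ltc (htc y).
  pose e z k := (t * psi z) ^+ k / k`!%:R.
  have c2 z := @cvg_conv _ (e z) (fun n => H n z * t ^+ n) _ _ _ _ (esum z) (Hsum z) (cvg_exp_sum (x := t * psi z)) (htc z).
  have c3 : (fun N => W false y * \sum_(n < N) conv (e (g false y)) (fun k => H k (g false y) * t ^+ k) n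
      + W true y * \sum_(n < N) conv (e (g true y)) (fun k => H k (g true y) * t ^+ k) n) @ \oo
      --> W false y * (expR (t * psi (g false y)) * ht (g false y)) +
          W true y * (expR (t * psi (g true y)) * ht (g true y)).
    by apply: cvgD; apply: cvgMr; exact: c2.
  have -> : tr g Wt ht y = W false y * (expR (t * psi (g false y)) * ht (g false y)) +
          W true y * (expR (t * psi (g true y)) * ht (g true y)).
    by rewrite /tr /Wt; ring.
  apply: (cvg_unique (@Rhausdorff R) c3); apply: cvg_trans c1.
  apply: near_eq_cvg; apply: nearW => N; rewrite !mulr_sumr -big_split /=.
  apply: eq_bigr => n _; rewrite /conv; symmetry.
  transitivity (t ^+ n * \sum_(k < n.+1) M k (H (n - k)%N) y).
    rewrite !mulr_sumr -big_split /=; apply: eq_bigr => k _.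
    have -> : t ^+ n = t ^+ k * t ^+ (n - k) by rewrite -exprD subnKC// -ltnS ltn_ord.
    by rewrite /M /tr /e !exprMn; ring.
  rewrite EH mulr_sumr; apply: eq_bigr => k _.
  have -> : t ^+ n = t ^+ k * t ^+ (n - k) by rewrite -exprD subnKC// -ltnS ltn_ord.
  by ring.
have htlb y : hmin / 2 <= ht y.
  apply: (ler_cvg_to (cvg_cst (hmin / 2)) (htc y)); exists 1%N => // -[//|n] _ /=.
  rewrite big_ord_recl /= expr0 mulr1 H0.
  have : `|\sum_(i < n) H (bump 0 i) y * t ^+ bump 0 i| <= hmin / 2.
    apply: le_trans (ler_norm_sum _ _ _) _.
    apply: (@le_trans _ _ (\sum_(i < n) (hmin / 2) * (a i.+1 * x ^+ i.+1))).
      apply: ler_sum => i _; rewrite /bump /= add1n normrM normrX.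
      have [h1 _] := Ha i.+1.
      rewrite mulrCA; apply: ler_pM; rewrite ?exprn_ge0//.
      rewrite !exprS mulrA; apply: ler_pM; rewrite ?exprn_ge0//.
        apply: le_trans tr2 _; have -> : hmin / 2 * x = x * hmin / 2 by ring.
        by rewrite /r ler_pM2r ?invr_gt0// ler_pM2l// ge_min lexx orbT.
      rewrite lerXn2r// ?nnegrE ?(ltW x_gt0)//; apply: le_trans tx _.
      by rewrite ler_pdivrMr// ler_peMr ?ler1n// ltW.
    by rewrite -mulr_sumr ler_piMr// divr_ge0// ltW.
  rewrite ler_norml => /andP[h1 _]; have := h_ge y; lra.
have htub y : ht y <= a 0%N + 1.
  apply: (ler_cvg_to (htc y) (cvg_cst (a 0%N + 1))); apply: nearW => N.
  apply: le_trans (Hsum y N); apply: ler_sum => n _.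
  by apply: le_trans (ler_norm _) _; rewrite ler_peMr// exprn_ege1// ler1n.
have h20 : 0 < hmin / 2 by rewrite divr_gt0.
have Wtc b y : c * expR (- (`|t| * B)) <= Wt b y <= C * expR (`|t| * B).
  have /andP[W1 W2] := Wc b y; have [h1 _] := psiB.
  have : `|t * psi (g b y)| <= `|t| * B by rewrite normrM ler_wpM2l.
  rewrite ler_norml => /andP[h2 h3]; rewrite /Wt [expR _ * W b y]mulrC.
  by rewrite !ler_pM ?ler_expR ?expR_ge0 ?(ltW c_gt0)//.
have c'0 : 0 < c * expR (- (`|t| * B)) by rewrite mulr_gt0 ?expR_gt0.
have lt0 : 0 < lt.
  have y := x0; have ht0 z : 0 < ht z by exact: lt_le_trans (htlb z).
  rewrite -(pmulr_lgt0 _ (ht0 x0)) -eig /tr addr_gt0// mulr_gt0// mulr_gt0 ?expR_gt0//.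
suff -> : lam g Wt = lt by [].
apply/eqP; rewrite eq_le; apply/andP; split.
  apply: (@lam_le_eigen _ _ _ x0 _ _ _ c'0 Wtc ht (hmin / 2) (a 0%N + 1)) => // y.
    by rewrite htlb htub.
  by rewrite eig.
apply: (@lam_ge_eigen _ _ _ x0 _ _ _ c'0 Wtc ht (hmin / 2) (a 0%N + 1)) => // y.
  by rewrite htlb htub.
by rewrite eig.
Qed.

End perturbation.

(** * Logarithm of a convergent power series *)

Section log_series.
Variable R : realType.
Implicit Types (c l : nat -> R) (x t S : R).

Definition abs_summable c x S := forall N, \sum_(n < N) `|c n| * x ^+ n <= S.

Let ps c t : R := limn (pseries c t).

Lemma pseriesE c t : pseries c t = fun N => \sum_(n < N) c n * t ^+ n.
Proof. by apply/funext => N; rewrite /pseries /series /= big_mkord. Qed.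

Lemma abs_summable2 c x S t : abs_summable c x S -> `|t| <= x / 2 ->
  forall N, \sum_(n < N) `|c n * t ^+ n| * 2 ^+ n <= S.
Proof.
move=> cS tx N; apply: le_trans (cS N); apply: ler_sum => n _.
rewrite normrM normrX -mulrA -exprMn ler_wpM2l// lerXn2r// ?nnegrE ?mulr_ge0//.
  by apply: le_trans (_ : `|t| * 2 <= _); rewrite ?mulr_ge0// -ler_pdivlMr.
by rewrite -ler_pdivlMr.
Qed.

Lemma ps_cvg c x S t : abs_summable c x S -> `|t| <= x / 2 ->
  pseries c t @ \oo --> ps c t.
Proof.
move=> cS tx.
have [v vP] := @sum_tail2 _ (fun n => c n * t ^+ n) _ (abs_summable2 cS tx).
have cv : pseries c t @ \oo --> v.
  by rewrite pseriesE; apply: dist_cvg vP; exact: cvg_geometric2.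
by rewrite /ps (cvg_lim (@Rhausdorff R) cv).
Qed.

Lemma abs_summable_diffs c x S : 0 < x -> abs_summable c x S ->
  abs_summable (pseries_diffs c) (x / 2) (2 / x * S).
Proof.
move=> x0 cS N.
apply: (@le_trans _ _ (2 / x * \sum_(n < N) `|c n.+1| * x ^+ n.+1)).
  rewrite mulr_sumr; apply: ler_sum => n _; rewrite /pseries_diffs normrM.
  have -> : 2 / x * (`|c n.+1| * x ^+ n.+1) = 2 ^+ n.+1 * `|c n.+1| * (x / 2) ^+ n.
    rewrite expr_div_n !exprS; field.
    by rewrite expf_neq0//= lt0r_neq0.
  rewrite ler_wpM2r ?exprn_ge0 ?divr_ge0 ?(ltW x0)// ler_wpM2r//.
  rewrite ger0_norm// -natrX ler_nat; exact/ltnW/ltn_expl.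
rewrite ler_wpM2l ?divr_ge0 ?(ltW x0)//; apply: le_trans (cS N.+1).
by rewrite [leRHS]big_ord_recl /= lerDr mulr_ge0 ?exprn_ge0 ?(ltW x0).
Qed.

Lemma abs_summable_le c x y S : 0 <= y <= x -> abs_summable c x S -> abs_summable c y S.
Proof.
move=> /andP[y0 yx] cS N; apply: le_trans (cS N); apply: ler_sum => n _.
by rewrite ler_wpM2l// lerXn2r// nnegrE// (le_trans y0).
Qed.

(** Each formal derivative halves the radius of summability, and convergence is used at half of that
    radius; two derivatives lead to [x / 8]. *)
Lemma ps_derive c x S t : 0 < x -> abs_summable c x S -> `|t| < x / 8 ->
  is_derive t (1 : R) (ps c) (ps (pseries_diffs c) t).
Proof.
move=> x0 cS tx.
have x20 : 0 < x / 2 by rewrite divr_gt0.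
have dS := abs_summable_diffs x0 cS.
have ddS := abs_summable_diffs x20 dS.
have x8 : `|x / 8| = x / 8 by rewrite ger0_norm// divr_ge0// ltW.
apply: (@pseries_snd_diffs _ c (x / 8)); last by rewrite x8.
- by apply/cvg_ex; eexists; apply: (ps_cvg cS); rewrite x8; lra.
- by apply/cvg_ex; eexists; apply: (ps_cvg dS); rewrite x8; lra.
- by apply/cvg_ex; eexists; apply: (ps_cvg ddS); rewrite x8; lra.
Qed.

Lemma ps0 c : ps c 0 = c 0%N.
Proof.
apply: (cvg_lim (@Rhausdorff R)); rewrite pseriesE; apply/cvgrPdist_le => e e0.
exists 1%N => // -[//|n] _ /=; rewrite big_ord_recl /= expr0 mulr1 big1.
  by rewrite addr0 subrr normr0 ltW.
by move=> i _; rewrite expr0n /= mulr0.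
Qed.

(** The formal quotient [c] of the derivative of [l] by [l] converges, and its primitive [b] has the
    same derivative as the logarithm of the sum of [l] and the same value at [0]. *)
Lemma ln_pseries l r S : 0 < r -> l 0%N = 1 -> abs_summable l r S ->
  exists b r', 0 < r' /\ forall t v, `|t| < r' -> pseries l t @ \oo --> v ->
    pseries b t @ \oo --> ln v.
Proof.
move=> r0 l0 lS.
have S1 : 1 <= S by have := lS 1%N; rewrite big_ord1 l0 normr1 expr0 mulr1.
(* On the radius [k * r] the coefficients of positive index sum to at most [1/2]. This keeps the sum
   of [l] above [1/2] and makes the recursion for [c] contracting. *)
pose k := (2 * (S + 1))^-1.
have S10 : 0 < 2 * (S + 1) by lra.
have k0 : 0 < k by rewrite invr_gt0.
have kS : k * S <= 2^-1.
  rewrite mulrC ler_pdivrMr// mulrA mulVf// mul1r; lra.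
have k1 : k <= 2^-1 by rewrite lef_pV2 ?posrE//; lra.
pose x := k * r.
have x0 : 0 < x by rewrite mulr_gt0.
have xr : x <= r / 2 by rewrite /x [r / 2]mulrC ler_pM2r.
have xS N : \sum_(n < N) `|l n.+1| * x ^+ n.+1 <= 2^-1.
  apply: le_trans kS; apply: (@le_trans _ _ (k * \sum_(n < N) `|l n.+1| * r ^+ n.+1)).
    rewrite mulr_sumr; apply: ler_sum => n _; rewrite mulrCA ler_wpM2l//.
    rewrite exprMn ler_wpM2r ?exprn_ge0 ?(ltW r0)// exprS ler_piMr ?(ltW k0)//.
    by rewrite exprn_ile1 ?(ltW k0)//; lra.
  rewrite ler_wpM2l ?(ltW k0)//; apply: le_trans (lS N.+1).
  by rewrite [leRHS]big_ord_recl /= lerDr mulr_ge0 ?exprn_ge0 ?(ltW r0).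
pose d := pseries_diffs l.
pose S' := 2 / r * S.
have dS : abs_summable d x S'.
  by apply: abs_summable_le (abs_summable_diffs r0 lS); rewrite (ltW x0) xr.
have lSx : abs_summable l x S.
  by apply: abs_summable_le lS; rewrite (ltW x0)/=; lra.
have [|c cE] := @strong_rec _ 0 (fun n c => d n - \sum_(i < n) c i * l (n - i)%N).
  move=> n u v uv; congr (_ - _); apply: eq_bigr => i _.
  by rewrite uv.
have cl n : conv c l n = d n.
  by rewrite /conv big_ord_recr /= subnn l0 mulr1 [X in _ + X]cE addrC subrK.
pose l' j := if j is j'.+1 then `|l j'.+1| * x ^+ j'.+1 else 0.
pose c' j := `|c j| * x ^+ j.
have l'0 j : 0 <= l' j by case: j => //= j; rewrite mulr_ge0 ?exprn_ge0 ?(ltW x0).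
have c'0 j : 0 <= c' j by rewrite mulr_ge0 ?exprn_ge0 ?(ltW x0).
have c'le n : c' n <= `|d n| * x ^+ n + conv c' l' n.
  rewrite {1}/c' cE /conv big_ord_recr /= subnn /= mulr0 addr0.
  apply: le_trans (ler_wpM2r _ (ler_normB _ _)) _; first by rewrite exprn_ge0 ?ltW.
  rewrite mulrDl lerD2l; apply: le_trans (ler_wpM2r _ (ler_norm_sum _ _ _)) _.
    by rewrite exprn_ge0 ?ltW.
  rewrite mulr_suml; apply: ler_sum => i _; rewrite normrM /c'.
  have ni : (0 < n - i)%N by rewrite subn_gt0.
  have -> : l' (n - i)%N = `|l (n - i)%N| * x ^+ (n - i) by rewrite -(prednK ni).
  by rewrite mulrACA -exprD subnKC// ltnW.
(* The partial sums satisfy [s <= S' + s / 2], hence are at most [2 * S']. *)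
have cS : abs_summable c x (2 * S').
  move=> N; have : \sum_(n < N) c' n <= S' + (\sum_(n < N) c' n) * 2^-1.
    apply: (@le_trans _ _ (\sum_(n < N) (`|d n| * x ^+ n + conv c' l' n))).
      by apply: ler_sum => n _; exact: c'le.
    rewrite big_split /=; apply: lerD; first exact: dS.
    apply: le_trans (sum_conv_le N c'0 l'0) _.
    rewrite ler_wpM2l ?sumr_ge0//; case: N => [|N]; first by rewrite big_ord0 invr_ge0.
    by rewrite big_ord_recl /= add0r; exact: xS.
  by rewrite /c'; set s := \sum_(n < N) _; lra.
pose b n := if n is n'.+1 then c n' / n'.+1%:R else 0.
have bc : pseries_diffs b = c.
  by apply/funext => n; rewrite /pseries_diffs /b mulrC divfK// pnatr_eq0.
have bS : abs_summable b x (x * (2 * S')).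
  move=> N; apply: (@le_trans _ _ (\sum_(n < N.+1) `|b n| * x ^+ n)).
    by rewrite big_ord_recr /= lerDl mulr_ge0 ?exprn_ge0 ?(ltW x0).
  rewrite big_ord_recl /= normr0 mul0r add0r.
  apply: le_trans (ler_wpM2l (ltW x0) (cS N)); rewrite mulr_sumr.
  apply: ler_sum => n _; rewrite exprS mulrCA ler_wpM2l ?(ltW x0)//.
  rewrite ler_wpM2r ?exprn_ge0 ?(ltW x0)// normrM ler_piMr//.
  by rewrite ger0_norm ?invr_ge0// invf_le1 ?ltr0n// ler1n.
exists b, (x / 8); split; first by rewrite divr_gt0.
have x2 t : `|t| < x / 8 -> `|t| <= x / 2 by move=> ?; lra.
have cl_ps t : `|t| < x / 8 -> ps c t * ps l t = ps d t.
  move=> tx; have tx2 := x2 t tx.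
  have h1 := ps_cvg cS tx2; have h2 := ps_cvg lSx tx2.
  rewrite !pseriesE in h1 h2.
  have := @cvg_conv _ (fun n => c n * t ^+ n) (fun n => l n * t ^+ n) _ _ _ _
    (abs_summable2 cS tx2) (abs_summable2 lSx tx2) h1 h2.
  have -> : (fun N => \sum_(n < N) conv (fun n => c n * t ^+ n) (fun n => l n * t ^+ n) n)
      = pseries d t.
    rewrite pseriesE; apply/funext => N; apply: eq_bigr => n _.
    rewrite -cl /conv mulr_suml; apply: eq_bigr => i _.
    by rewrite mulrACA -exprD subnKC// -ltnS ltn_ord.
  by move=> h3; exact: (cvg_unique (@Rhausdorff R) h3 (ps_cvg dS tx2)).
have l_gt0 t : `|t| < x / 8 -> 0 < ps l t.
  move=> tx; apply: (@lt_le_trans _ _ 2^-1); first by rewrite invr_gt0.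
  have h2 := ps_cvg lSx (x2 t tx); rewrite pseriesE in h2.
  apply: (ler_cvg_to (cvg_cst (2^-1 : R)) h2); exists 1%N => // -[//|n] _ /=.
  rewrite big_ord_recl /= expr0 mulr1 l0.
  have : `|\sum_(i < n) l (bump 0 i) * t ^+ bump 0 i| <= 2^-1.
    apply: le_trans (ler_norm_sum _ _ _) _; apply: le_trans (xS n).
    apply: ler_sum => i _; rewrite /bump /= add1n normrM normrX ler_wpM2l//.
    by rewrite lerXn2r// ?nnegrE ?(ltW x0)//; lra.
  by rewrite ler_norml => /andP[h1 _]; lra.
pose phi t := ln (ps l t) - ps b t.
have dphi t : `|t| < x / 8 -> is_derive t (1 : R) phi 0.
  move=> tx; have dl := ps_derive x0 lSx tx; have db := ps_derive x0 bS tx.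
  have dln := is_derive1_ln (l_gt0 t tx).
  have d1 := is_derive1_comp dln dl.
  have := is_deriveB d1 db.
  rewrite bc -/d -(cl_ps t tx) mulrCA mulVf ?lt0r_neq0 ?l_gt0// mulr1 subrr.
  by [].
have phi0 t : `|t| < x / 8 -> phi t = 0.
  move=> tx.
  have p0 : phi 0 = 0 by rewrite /phi !ps0 l0 ln1 /= subrr.
  have cont a b' : `|a| < x / 8 -> `|b'| < x / 8 -> {within `[a, b'], continuous phi}.
    move=> ha hb; apply: derivable_within_continuous => z.
    rewrite in_itv /= => /andP[az zb].
    have [] // := dphi z _; move: ha hb; rewrite !ltr_norml => /andP[? ?] /andP[? ?].
    by apply/andP; split; lra.
  have mvt a b' : a <= b' -> `|a| < x / 8 -> `|b'| < x / 8 -> phi b' = phi a.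
    move=> ab ha hb.
    have [|z _] := @MVT_segment _ phi (fun=> 0) a b' ab _ (cont a b' ha hb).
      move=> z; rewrite in_itv /= => /andP[az zb].
      apply: dphi; move: ha hb; rewrite !ltr_norml => /andP[? ?] /andP[? ?].
      by apply/andP; split; lra.
    by rewrite mul0r => /eqP; rewrite subr_eq0 => /eqP.
  have n0 : `|0 : R| < x / 8 by rewrite normr0 divr_gt0.
  have [t0|t0] := leP 0 t; first by rewrite (mvt 0 t).
  by rewrite -(mvt t 0)// ltW.
move=> t v tx lv.
have -> : v = ps l t by exact: (cvg_unique (@Rhausdorff R) lv (ps_cvg lSx (x2 t tx))).
have -> : ln (ps l t) = ps b t by apply/eqP; rewrite -subr_eq0; apply/eqP/phi0.
exact: (ps_cvg bS (x2 t tx)).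
Qed.

End log_series.

(** * Inverse branches of the intermittent map *)

Section clamp.
Variable R : realType.

Fact clamp_subproof (x : R) :
  Num.min (Num.max x 0) 1 \in (`[0, 1]%classic : set R).
Proof.
by rewrite inE /= in_itv /= le_min le_max lexx orbT ler01 ge_min lexx orbT.
Qed.

(** A retraction of the line onto the interval, left inverse to [set_val]; composing with it
    transfers continuity and measurability questions from the subtype to the line. *)
Definition clamp (x : R) : uitv R := exist _ (Num.min (Num.max x 0) 1) (clamp_subproof x).

Lemma clampE (x : R) : 0 <= x <= 1 -> set_val (clamp x) = x.
Proof.
move=> /andP[x0 x1]; transitivity (Num.min (Num.max x 0) 1) => //.
by rewrite (max_idPl x0) (min_idPl x1).
Qed.

Lemma uitv_inj (x y : uitv R) : set_val x = set_val y -> x = y.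
Proof. exact: val_inj. Qed.

Lemma set_valK (x : uitv R) : clamp (set_val x) = x.
Proof. by apply: uitv_inj; rewrite clampE// uitv_ge0 uitv_le1. Qed.

End clamp.

Section branches.
Variables (R : realType) (alpha : {posnum R}).

Definition expand (x : R) : R := x * (1 + x `^ alpha%:num).

Let F := expand.
Let a0 : 0 < alpha%:num. Proof. by []. Qed.

Lemma powR_le (p x y : R) : 0 <= p -> 0 <= x -> x <= y -> x `^ p <= y `^ p.
Proof.
move=> p0 x0 xy; apply: ge0_ler_powR => //; rewrite nnegrE//.
exact: le_trans xy.
Qed.

Lemma expand_ge (x : R) : 0 <= x -> x <= expand x.
Proof. by move=> x0; rewrite /expand mulrDr mulr1 lerDl mulr_ge0// powR_ge0. Qed.

Lemma expand0 : expand 0 = 0. Proof. by rewrite /expand mul0r. Qed.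

Lemma expand1 : expand 1 = 2. Proof. by rewrite /expand powR1 mul1r. Qed.

Lemma expand_slope (x y : R) : 0 <= x -> x <= y ->
  (1 + x `^ alpha%:num) * (y - x) <= expand y - expand x.
Proof.
move=> x0 xy; have h : x `^ alpha%:num <= y `^ alpha%:num by apply: powR_le.
have y0 : 0 <= y by exact: le_trans xy.
have := ler_wpM2l y0 h; rewrite /expand; lra.
Qed.

(** Superadditivity replaces uniform expansion: a branch shrinks distances at least as much as the
    inverse of [expand] does, even next to the neutral fixed point. *)
Lemma expand_super (x y : R) : 0 <= x -> x <= y ->
  expand (y - x) <= expand y - expand x.
Proof.
move=> x0 xy; have h : x `^ alpha%:num <= y `^ alpha%:num by apply: powR_le.
have h' : (y - x) `^ alpha%:num <= y `^ alpha%:num.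
  by apply: powR_le => //; [rewrite subr_ge0|rewrite gerBl].
have yx : 0 <= y - x by rewrite subr_ge0.
have := ler_wpM2l yx h'; have := ler_wpM2l x0 h; rewrite /expand; lra.
Qed.

Lemma expand_lt (x y : R) : 0 <= x -> x < y -> expand x < expand y.
Proof.
move=> x0 xy; have := expand_slope x0 (ltW xy).
have : 0 < y - x by rewrite subr_gt0.
have := powR_ge0 x alpha%:num => h1 h2.
have h3 : 0 <= x `^ alpha%:num * (y - x) by rewrite mulr_ge0// ltW.
by lra.
Qed.

Lemma expand_le (x y : R) : 0 <= x -> x <= y -> expand x <= expand y.
Proof.
by move=> x0; rewrite le_eqVlt => /predU1P[->//|xy]; apply/ltW/expand_lt.
Qed.

Lemma expand_leE (x y : R) : 0 <= x -> 0 <= y -> (expand x <= expand y) = (x <= y).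
Proof.
move=> x0 y0; have [xy|yx] := leP x y; first exact: expand_le.
by apply/negbTE; rewrite -ltNge; exact: expand_lt.
Qed.

Lemma expand_inj (x y : R) : 0 <= x -> 0 <= y -> expand x = expand y -> x = y.
Proof.
by move=> x0 y0 xy; apply/eqP; rewrite eq_le -(expand_leE x0 y0) -(expand_leE y0 x0) xy lexx.
Qed.

Lemma expand_continuous_pos (x : R) : 0 < x -> {for x, continuous expand}.
Proof.
move=> x0; apply: differentiable_continuous; apply/derivable1_diffP.
apply: derivableM; first exact: derivable_id.
apply: derivableD; first exact: derivable_cst.
by apply: derivable_powR; rewrite in_itv /= x0.
Qed.

Lemma expand_surj (y : R) : 0 <= y <= 2 -> exists2 x, 0 <= x <= 1 & expand x = y.
Proof.
move=> y02; have [||x] := @IVT R expand 0 1 y ler01; last first.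
- by rewrite in_itv /= => x01 <-; exists x.
- by rewrite expand0 expand1 (min_idPl _) ?(max_idPr _).
apply/continuous_within_itvP => //; split.
- by move=> x; rewrite in_itv /= => /andP[x0 _]; exact: expand_continuous_pos.
(* Differentiability covers only positive points; at [0] continuity follows from
   [expand x <= 2 * x]. *)
- rewrite expand0; apply/cvgrPdist_le => e e0.
  exists (Num.min 1 (e / 2)) => /=; first by rewrite lt_min ltr01 divr_gt0.
  move=> x /=; rewrite !sub0r !normrN => xe x0.
  rewrite gtr0_norm// in xe; rewrite ger0_norm; last first.
    by rewrite (le_trans (ltW x0))// expand_ge// ltW.
  move: xe; rewrite lt_min => /andP[x1 xe].
  apply: (@le_trans _ _ (x * 2)); last by lra.
  rewrite ler_wpM2l ?(ltW x0)// -[X in _ <= X](_ : 1 + 1 = 2)// lerD2l.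
  by rewrite powR_le1// !ltW.
- apply: cvg_at_left_filter; exact: expand_continuous_pos.
Qed.

(* [br true 0] is the endpoint [cut] of the first branch, not a preimage of [0]
   under the map. *)
Definition br (b : bool) (y : uitv R) : uitv R :=
  clamp (xget 0 [set x : R | 0 <= x <= 1 /\ expand x = set_val y + b%:R]).

Lemma brP (b : bool) (y : uitv R) : expand (set_val (br b y)) = set_val y + b%:R.
Proof.
rewrite /br; case: xgetP => [x _ [x01 Fx]|]; first by rewrite clampE.
have [|x x01 Fx] := @expand_surj (set_val y + b%:R); last first.
  by move=> /(_ x) h; exfalso; apply: h.
rewrite addr_ge0 ?uitv_ge0//= (_ : 2 = 1 + 1)// lerD ?uitv_le1//.
by case: b.
Qed.

Definition cut : R := set_val (br true (uitv0 R)).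

Lemma expand_cut : expand cut = 1.
Proof. by rewrite /cut brP /= add0r. Qed.

Lemma cut_gt0 : 0 < cut.
Proof.
rewrite lt_def uitv_ge0 andbT; apply/eqP => c0.
by have := expand_cut; rewrite c0 expand0 => /eqP; rewrite eq_sym oner_eq0.
Qed.

Definition im (x : uitv R) : uitv R := intermittent alpha x.

Lemma imE (x : uitv R) : set_val (im x) = if expand (set_val x) <= 1
  then expand (set_val x) else expand (set_val x) - 1.
Proof. by []. Qed.

(** The inequality is strict because the map sends the endpoint [cut] to [1] by its first branch. *)
Definition side (x : uitv R) : bool := cut < set_val x.

Lemma sideE (x : uitv R) : (expand (set_val x) <= 1) = ~~ side x.
Proof.
by rewrite /side -leNgt -(expand_leE (uitv_ge0 x) (ltW cut_gt0)) expand_cut.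
Qed.

Lemma expand_im (x : uitv R) : expand (set_val x) = set_val (im x) + (side x)%:R.
Proof.
by rewrite imE sideE; case: (side x) => /=; rewrite ?addr0 ?subrK.
Qed.

Lemma br_im (x : uitv R) : br (side x) (im x) = x.
Proof.
by apply/uitv_inj/expand_inj; rewrite ?uitv_ge0// brP -expand_im.
Qed.

Lemma br_side (b : bool) (y : uitv R) : (b -> 0 < set_val y) -> side (br b y) = b.
Proof.
move=> by0; apply: negb_inj; rewrite -sideE brP.
case: b by0 => /= [/(_ isT) y0|_]; last by rewrite addr0 uitv_le1.
by apply/negbTE; rewrite -ltNge ltrDr.
Qed.

Lemma im_br (b : bool) (y : uitv R) : (b -> 0 < set_val y) -> im (br b y) = y.
Proof.
move=> by0; apply: uitv_inj; have := expand_im (br b y).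
by rewrite brP br_side// => /addIr.
Qed.

Lemma br_le (b : bool) (x y : uitv R) : set_val x <= set_val y -> set_val (br b x) <= set_val (br b y).
Proof. by move=> xy; rewrite -expand_leE ?uitv_ge0// !brP lerD2r. Qed.

Lemma br_lt (b : bool) (x y : uitv R) : set_val x < set_val y -> set_val (br b x) < set_val (br b y).
Proof.
by move=> xy; rewrite ltNge -expand_leE ?uitv_ge0// !brP lerD2r -ltNge.
Qed.

Lemma br_false_fix : br false (uitv0 R) = uitv0 R.
Proof.
by apply/uitv_inj/expand_inj; rewrite ?uitv_ge0// brP /= addr0 expand0.
Qed.

Lemma br_dist (b : bool) (x y : uitv R) :
  expand `|set_val (br b x) - set_val (br b y)| <= `|set_val x - set_val y|.
Proof.
wlog xy : x y / set_val x <= set_val y.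
  have /orP[] := le_total (set_val x) (set_val y); first by move=> + h; exact: h.
  by move=> yx h; rewrite distrC [leRHS]distrC; exact: h.
have bxy := br_le b xy.
rewrite distrC ger0_norm ?subr_ge0// distrC ger0_norm ?subr_ge0//.
apply: le_trans (expand_super (uitv_ge0 _) bxy) _.
by rewrite !brP opprD addrACA subrr addr0.
Qed.

(** The inverse of a lower bound for the slopes of [expand] on [[cut, 1]], the range of the second
    inverse branch. *)
Definition kappa : R := (1 + cut `^ alpha%:num)^-1.

Lemma kappa_gt0 : 0 < kappa.
Proof. by rewrite invr_gt0 ltr_pwDl// powR_ge0. Qed.

Lemma kappa_lt1 : kappa < 1.
Proof.
rewrite invf_lt1; first by rewrite ltrDl powR_gt0// cut_gt0.
by rewrite ltr_pwDl// powR_ge0.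
Qed.

Lemma br_dist_le (b : bool) (x y : uitv R) : `|set_val (br b x) - set_val (br b y)| <=
  (if b then kappa else 1) * `|set_val x - set_val y|.
Proof.
case: b; last by rewrite mul1r; apply: le_trans (br_dist false x y); exact: expand_ge.
wlog xy : x y / set_val x <= set_val y.
  have /orP[] := le_total (set_val x) (set_val y); first by move=> + h; exact: h.
  by move=> yx h; rewrite distrC [`|set_val x - _|]distrC; exact: h.
have bxy := br_le true xy.
rewrite distrC ger0_norm ?subr_ge0// distrC ger0_norm ?subr_ge0//.
rewrite mulrC ler_pdivlMr ?invr_gt0 ?kappa_gt0//; last by rewrite ltr_pwDl// powR_ge0.
have := expand_slope (uitv_ge0 _) bxy; rewrite !brP opprD addrACA subrr addr0.
apply: le_trans; rewrite mulrC ler_wpM2r ?subr_ge0// lerD2l.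
apply: powR_le => //; first exact: ltW cut_gt0.
by apply: br_le; exact: uitv_ge0.
Qed.

(** The right endpoint of the cylinder coded by [n] zeros, which is also a bound for the diameters
    of all cylinders of length [n]. *)
Definition cyl (n : nat) : R := set_val (iter n (br false) (clamp 1)).

Lemma cyl0 : cyl 0 = 1. Proof. by rewrite /cyl clampE// ler01 lexx. Qed.

Lemma expand_cyl n : expand (cyl n.+1) = cyl n.
Proof. by rewrite /cyl iterS brP addr0. Qed.

Lemma cyl_ge0 n : 0 <= cyl n. Proof. exact: uitv_ge0. Qed.

Lemma cyl_gt0 n : 0 < cyl n.
Proof.
elim: n => [|n IH]; first by rewrite cyl0.
rewrite lt_def cyl_ge0 andbT; apply/eqP => c0.
by have := expand_cyl n; rewrite c0 expand0 => h; rewrite -h ltxx in IH.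
Qed.

Lemma cyl_anti m n : (m <= n)%N -> cyl n <= cyl m.
Proof.
move=> mn; rewrite -(subnK mn); elim: (n - m)%N => // k IH.
apply: le_trans IH; rewrite addSn -[leRHS]expand_cyl.
by apply: expand_ge; exact: cyl_ge0.
Qed.

(** As long as [cyl] stays above [e], each step lowers it by at least [e * e ^ alpha], and this can
    happen only finitely often. *)
Lemma cyl_small (e : R) : 0 < e -> exists N, forall n, (N <= n)%N -> cyl n <= e.
Proof.
move=> e0; pose c := e * e `^ alpha%:num.
have c0 : 0 < c by rewrite mulr_gt0// powR_gt0.
have H n : cyl n <= e \/ cyl n <= 1 - n%:R * c.
  elim: n => [|n [IH|IH]]; first by right; rewrite cyl0 mul0r subr0.
    by left; apply: le_trans IH; exact: cyl_anti.
  have [|en] := leP (cyl n.+1) e; first by left.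
  right; apply: (@le_trans _ _ (cyl n - c)); last by rewrite -natr1; lra.
  rewrite -[cyl n]expand_cyl /expand mulrDr mulr1 -addrA lerDl subr_ge0 /c.
  by apply: ler_pM; rewrite ?powR_ge0 ?powR_le ?(ltW e0) ?(ltW en).
have [N hN] : exists N, c^-1 < N%:R.
  by exists (Num.bound c^-1); apply: archi_boundP; rewrite invr_ge0 ltW.
exists N => n Nn; apply: le_trans (cyl_anti Nn) _.
have [//|h] := H N; apply: le_trans h _.
move: hN; rewrite -[c^-1]mul1r ltr_pdivrMr// => hN.
by apply: le_trans (ltW e0); lra.
Qed.

(** By superadditivity, [expand] of the new distance is at most the old distance; the sequence [cyl]
    satisfies the same relation with equality. *)
Lemma gs_dist (w : seq bool) (x y : uitv R) : `|set_val (gs br w x) - set_val (gs br w y)| <= cyl (size w).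
Proof.
elim: w => [|b w IH]; first by rewrite cyl0 uitv_dist_le1.
rewrite -expand_leE ?cyl_ge0// expand_cyl /=; exact: le_trans (br_dist _ _ _) IH.
Qed.

End branches.

Section holder_distance.
Variables (R : realType) (alpha gamma : {posnum R}).
Notation br := (br alpha).

(** With respect to this power of the distance, Hölder functions are the Lipschitz functions of the
    abstract part. *)
Definition hdist (x y : uitv R) : R := `|set_val x - set_val y| `^ gamma%:num.

Let g0 : 0 <= gamma%:num. Proof. by []. Qed.

Lemma hdist_ge0 x y : 0 <= hdist x y. Proof. exact: powR_ge0. Qed.

Lemma hdist_le1 x y : hdist x y <= 1.
Proof. by rewrite powR_le1// normr_ge0 uitv_dist_le1. Qed.

Definition rate : R := kappa alpha `^ gamma%:num.

Lemma rate01 : 0 < rate < 1.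
Proof.
rewrite powR_gt0 ?kappa_gt0//=.
have := kappa_lt1 alpha; have := kappa_gt0 alpha => k0 k1.
apply: (@lt_le_trans _ _ (1 `^ gamma%:num)); last by rewrite powR1.
by apply: gt0_ltr_powR => //; rewrite nnegrE ltW.
Qed.

Lemma hdist_br (b : bool) (x y : uitv R) : hdist (br b x) (br b y) <= (if b then rate else 1) * hdist x y.
Proof.
have -> : (if b then rate else 1) = (if b then kappa alpha else 1) `^ gamma%:num.
  by case: b; rewrite ?powR1.
rewrite -powRM//; last by case: b; rewrite ?(ltW (kappa_gt0 _)).
by apply: powR_le => //; exact: br_dist_le.
Qed.

Definition cylh n : R := cyl alpha n `^ gamma%:num.

Lemma cylh_ge0 n : 0 <= cylh n. Proof. exact: powR_ge0. Qed.

Lemma hdist_gs (w : seq bool) (x y : uitv R) : hdist (gs br w x) (gs br w y) <= cylh (size w).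
Proof. by apply: powR_le => //; exact: gs_dist. Qed.

Lemma cylh_small (e : R) : 0 < e -> exists N, forall n, (N <= n)%N -> cylh n <= e.
Proof.
move=> e0; have [N hN] := cyl_small alpha (powR_gt0 (gamma%:num)^-1 e0).
exists N => n /hN h; rewrite /cylh.
have := powR_le g0 (cyl_ge0 alpha n) h.
by rewrite -powRrM mulVf// powRr1// ltW.
Qed.

End holder_distance.

(** * Entropy and generators *)

Section bounded_measurable.
Context d (T : measurableType d) (R : realType).
Implicit Types (u v : T -> R) (A : set T) (J : (T -> R) -> R).

Definition bm u := measurable_fun [set: T] u /\ bdd u.

Lemma bm_cst a : bm (fun=> a).
Proof. by split; [exact: measurable_cst|exact: bdd_cst]. Qed.

Lemma bm_lin a u v : bm u -> bm v -> bm (fun x => a * u x + v x).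
Proof.
move=> [mu bu] [mv bv]; split; last exact: bdd_lin.
by apply: measurable_funD => //; apply: measurable_funM => //; exact: measurable_cst.
Qed.

Lemma bmZ a u : bm u -> bm (fun x => a * u x).
Proof.
move=> [mu bu]; split; last exact: bddZ.
by apply: measurable_funM => //; exact: measurable_cst.
Qed.

Lemma bmD u v : bm u -> bm v -> bm (fun x => u x + v x).
Proof. by move=> [mu bu] [mv bv]; split; [exact: measurable_funD|exact: bddD]. Qed.

Lemma bmB u v : bm u -> bm v -> bm (fun x => u x - v x).
Proof. by move=> [mu bu] [mv bv]; split; [exact: measurable_funB|exact: bddB]. Qed.

Lemma bmM u v : bm u -> bm v -> bm (fun x => u x * v x).
Proof. by move=> [mu bu] [mv bv]; split; [exact: measurable_funM|exact: bddM]. Qed.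

Lemma bm_indic A : measurable A -> bm (\1_A).
Proof.
move=> mA; split; first exact: measurable_indic.
by apply: (@bddP _ _ _ 0 1) => x; rewrite indicE; case: (_ \in _); rewrite /= ?lexx ?ler01.
Qed.

Lemma bm_sum n (F : nat -> T -> R) : (forall i, (i < n)%N -> bm (F i)) ->
  bm (fun x => \sum_(i < n) F i x).
Proof.
elim: n => [|n IH] h.
  have -> : (fun x => \sum_(i < 0) F i x) = fun=> 0 by apply/funext => x; rewrite big_ord0.
  exact: bm_cst.
have -> : (fun x => \sum_(i < n.+1) F i x) = fun x => \sum_(i < n) F i x + F n x.
  by apply/funext => x; rewrite big_ord_recr.
by apply: bmD; [apply: IH => i /ltnW; exact: h|exact: h].
Qed.

Lemma bm_comp (f : T -> T) u : measurable_fun [set: T] f -> bm u -> bm (u \o f).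
Proof.
move=> mf [mu [B uB]]; split; first exact: measurableT_comp.
by exists B => x; exact: uB.
Qed.

(** The analogue of [posfun] on bounded measurable functions only, so as to cover expectations and
    finitely additive functionals alike. *)
Definition mposfun J :=
  [/\ forall a u v, bm u -> bm v -> J (fun x => a * u x + v x) = a * J u + J v,
      forall u, bm u -> (forall x, 0 <= u x) -> 0 <= J u
    & J (fun=> 1) = 1].

Section mposfun.
Variables (J : (T -> R) -> R) (pJ : mposfun J).

Lemma mposfunD u v : bm u -> bm v -> J (fun x => u x + v x) = J u + J v.
Proof.
case: pJ => lin _ _ bu bv; rewrite -[J u]mul1r -lin//.
by congr J; apply/funext => x; rewrite mul1r.
Qed.

Lemma mposfun0 : J (fun=> 0) = 0.
Proof.
have := mposfunD (bm_cst 0) (bm_cst 0).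
have -> : (fun x : T => 0 + 0 : R) = fun=> 0 by apply/funext => x; rewrite addr0.
by move=> h; lra.
Qed.

Lemma mposfunZ a u : bm u -> J (fun x => a * u x) = a * J u.
Proof.
case: pJ => lin _ _ bu; rewrite -[RHS]addr0 -mposfun0 -lin//; last exact: bm_cst.
by congr J; apply/funext => x; rewrite addr0.
Qed.

Lemma mposfun_cst a : J (fun=> a) = a.
Proof.
have [_ _ J1] := pJ; have := mposfunZ a (bm_cst 1); rewrite J1 mulr1 => {2}<-.
by congr J; apply/funext => x; rewrite mulr1.
Qed.

Lemma mposfunB u v : bm u -> bm v -> J (fun x => u x - v x) = J u - J v.
Proof.
case: pJ => lin _ _ bu bv; rewrite [RHS]addrC -mulN1r -lin//.
by congr J; apply/funext => x; rewrite mulN1r addrC.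
Qed.

Lemma mposfun_le u v : bm u -> bm v -> (forall x, u x <= v x) -> J u <= J v.
Proof.
case: pJ => _ pos _ bu bv uv; rewrite -subr_ge0 -mposfunB//.
by apply: pos; [exact: bmB|move=> x; rewrite subr_ge0].
Qed.

Lemma mposfun_sum n (F : nat -> T -> R) : (forall i, (i < n)%N -> bm (F i)) ->
  J (fun x => \sum_(i < n) F i x) = \sum_(i < n) J (F i).
Proof.
elim: n => [|n IH] h.
  rewrite big_ord0 -[RHS]mposfun0; congr J; apply/funext => x; by rewrite big_ord0.
have -> : (fun x => \sum_(i < n.+1) F i x) = fun x => \sum_(i < n) F i x + F n x.
  by apply/funext => x; rewrite big_ord_recr.
rewrite mposfunD ?IH ?big_ord_recr//.
- by move=> i /ltnW; exact: h.
- by apply: bm_sum => i /ltnW; exact: h.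
- exact: h.
Qed.

Lemma mposfun_norm u B : bm u -> (forall x, `|u x| <= B) -> `|J u| <= B.
Proof.
move=> bu uB; rewrite ler_norml -(mposfun_cst (- B)) -{2}(mposfun_cst B).
apply/andP; split; apply: mposfun_le => //; try exact: bm_cst.
- by move=> x; have := uB x; rewrite ler_norml => /andP[].
- by move=> x; have := uB x; rewrite ler_norml => /andP[].
Qed.

End mposfun.

(* Bounded measurable functions are uniform limits of step functions. *)
Lemma mposfun_eq J1 J2 : mposfun J1 -> mposfun J2 ->
  (forall A, measurable A -> J1 \1_A = J2 \1_A) ->
  forall u, bm u -> J1 u = J2 u.
Proof.
move=> p1 p2 J12 u [mu bu].
have [B B0 uB] := bdd_ge0 bu.
apply/eqP; rewrite -subr_eq0 -normr_le0; apply/ler_addgt0Pr => e e0.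
rewrite add0r; pose dd := e / 2.
have d0 : 0 < dd by rewrite divr_gt0.
have [N hN] : exists N, 2 * B / dd < N%:R.
  by exists (Num.bound (2 * B / dd)); apply: archi_boundP; rewrite divr_ge0 ?mulr_ge0// ltW.
pose lev k := - B + k%:R * dd.
pose A k := [set x | lev k <= u x < lev k.+1].
have mA k : measurable (A k).
  rewrite (_ : A k = u @^-1` `[lev k, lev k.+1[%classic); last first.
    by apply/seteqP; split => x /=; rewrite in_itv.
  by rewrite -[X in measurable X]setTI; apply: mu => //; exact: measurable_itv.
pose s x := \sum_(k < N) lev k * \1_(A k) x.
have bs k : bm (fun x => lev k * \1_(A k) x) by apply/bmZ/bm_indic.
have us x : `|u x - s x| <= dd.
  have uBx := uB x; have u1 : - B <= u x by move: uBx; rewrite ler_norml => /andP[].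
  have [k kN ku] : exists2 k, (k < N)%N & A k x.
    have hex : exists k, u x < lev k.
      exists N; rewrite /lev; move: hN uBx; rewrite ltr_pdivrMr// ler_norml => h /andP[_ ?].
      by lra.
    pose k := ex_minn hex; have : u x < lev k /\ forall j, u x < lev j -> (k <= j)%N.
      by rewrite /k; case: ex_minnP => j.
    clearbody k; case: k => [|j] [h1 h2].
      by move: h1; rewrite /lev mul0r addr0 ltNge u1.
    have jle : lev j <= u x.
      by rewrite leNgt; apply/negP => /h2; rewrite ltnn.
    exists j; last by rewrite /A /= jle.
    have : u x < lev N.
      rewrite /lev; move: hN uBx; rewrite ltr_pdivrMr// ler_norml => h /andP[_ ?].
      by lra.
    by move=> /h2.
  have -> : s x = lev k.
    rewrite /s (bigD1 (Ordinal kN)) //= big1 => [|i ik].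
      by rewrite addr0 indicE mem_set// mulr1.
    rewrite indicE memNset ?mulr0// => Ai.
    move: ik; rewrite -val_eqE /= neq_ltn => /orP[ij|ij].
      have : lev i.+1 <= lev k by rewrite lerD2l ler_wpM2r ?(ltW d0)// ler_nat.
      by move: Ai ku => /andP[_ a1] /andP[a2 _]; lra.
    have : lev k.+1 <= lev i by rewrite lerD2l ler_wpM2r ?(ltW d0)// ler_nat.
    by move: Ai ku => /andP[a1 _] /andP[_ a2]; lra.
  move: ku => /andP[k1 k2]; rewrite ger0_norm ?subr_ge0//.
  by move: k2; rewrite /lev -natr1; lra.
have bms : bm s by exact: (bm_sum (F := fun k x => lev k * \1_(A k) x) (fun k _ => bs k)).
have bmu : bm u by [].
have Js : J1 s = J2 s.
  rewrite /s (mposfun_sum p1 (fun k _ => bs k)) (mposfun_sum p2 (fun k _ => bs k)).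
  by apply: eq_bigr => k _; rewrite (mposfunZ p1) ?(mposfunZ p2) ?J12//; exact: bm_indic.
have -> : J1 u - J2 u = J1 (fun x => u x - s x) - J2 (fun x => u x - s x).
  by rewrite (mposfunB p1)// (mposfunB p2)// Js; ring.
apply: le_trans (ler_normB _ _) _; rewrite (_ : e = dd + dd); last by rewrite /dd; field.
by apply: lerD; [apply: (mposfun_norm p1)|apply: (mposfun_norm p2)] => //; exact: bmB.
Qed.

Variable nu : probability T R.

Let nuT : nu [set: T] = 1%E. Proof. exact: probability_setT. Qed.

Definition expect u : R := \int[nu]_x u x.

Lemma bm_integrable u : bm u -> nu.-integrable [set: T] (EFin \o u).
Proof.
move=> [mu bu]; have [B B0 uB] := bdd_ge0 bu.
apply: measurable_bounded_integrable => //.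
  by have := ltry (1 : R); rewrite -nuT.
exists B; split; first by rewrite num_real.
by move=> y By x _; apply: le_trans (uB x) _; exact: ltW.
Qed.

Lemma expect_pos : mposfun expect.
Proof.
split=> [a u v bu bv|u bu u0|].
- rewrite /expect RintegralD// ?RintegralZl//.
  + exact: bm_integrable.
  + exact: (bm_integrable (bmZ a bu)).
  + exact: bm_integrable.
- by apply: Rintegral_ge0.
- by rewrite /expect Rintegral_cst// mul1r; exact: (congr1 fine nuT).
Qed.

Lemma expect_indic A : measurable A -> expect \1_A = fine (nu A).
Proof.
by move=> mA; rewrite /expect /Rintegral integral_indic// setIT.
Qed.

Lemma expectE u : bm u -> (\int[nu]_x (u x)%:E = (expect u)%:E)%E.
Proof.
move=> bu; rewrite /expect /Rintegral fineK//.
exact: integrable_fin_num (bm_integrable bu).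
Qed.

Lemma expect_invariant (f : T -> T) : measurable_fun [set: T] f ->
  invariant_measure f nu -> forall u, bm u -> expect (u \o f) = expect u.
Proof.
move=> mf inv u bu; apply: (@mposfun_eq (fun u => expect (u \o f)) expect) => //.
- have [lin pos J1] := expect_pos; split=> [a v w bv bw|v bv v0|//].
    by apply: (lin a (v \o f) (w \o f)); exact: bm_comp.
  by apply: pos => [|x]; [exact: bm_comp|exact: v0].
- exact: expect_pos.
- move=> A mA; have -> : \1_A \o f = \1_(f @^-1` A) :> (T -> R).
    by [].
  rewrite !expect_indic//.
    by congr fine; exact: inv.
  by rewrite -[X in measurable X]setTI; exact: mf.
Qed.

Lemma expect_ae0 u v A : bm u -> bm v -> measurable A -> nu A = 0%E ->
  (forall x, ~ A x -> u x = v x) -> expect u = expect v.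
Proof.
move=> bu bv mA A0 uv.
have p := expect_pos.
have [B B0 uB] := bdd_ge0 (bmB bu bv).2.
apply/eqP; rewrite -subr_eq0 -(mposfunB p)// -normr_le0.
have -> : (0 : R) = B * fine (nu A) by rewrite A0 mulr0.
rewrite -expect_indic// -(mposfunZ p); last exact: bm_indic.
have bA : bm (fun x => B * \1_A x) by apply/bmZ/bm_indic.
have key x : `|u x - v x| <= B * \1_A x.
  rewrite indicE; have [/set_mem Ax|/negP nAx] := boolP (x \in A); first by rewrite mulr1.
  rewrite mulr0 uv ?subrr ?normr0// => Ax; apply: nAx; exact: mem_set.
rewrite ler_norml; apply/andP; split; last first.
  apply: (mposfun_le p) => //; first exact: bmB.
  by move=> x; apply: le_trans (key x); exact: ler_norm.
rewrite lerNl -mulN1r -(mposfunZ p); last exact: bmB.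
apply: (mposfun_le p) => //; first by apply/bmZ/bmB.
by move=> x; apply: le_trans (key x); rewrite mulN1r -normrN; exact: ler_norm.
Qed.

Section labels.
Variables (L : finType) (z : T -> L).
Hypothesis pz : is_partition z.

Definition pr (l : L) : R := fine (nu (z @^-1` [set l])).

Lemma pr_ge0 l : 0 <= pr l. Proof. by rewrite /pr fine_ge0. Qed.

Lemma bm_label (a : L -> R) : bm (fun x => a (z x)).
Proof.
split; last first.
  exists (\sum_l `|a l|) => x; rewrite (bigD1 (z x)) //= lerDl.
  exact: sumr_ge0.
move=> _ Y mY; rewrite setTI.
have -> : (fun x => a (z x)) @^-1` Y = \big[setU/set0]_(l <- enum L | a l \in Y) (z @^-1` [set l]).
  apply/seteqP; split => x /=.
    move=> Yx; rewrite -bigcup_seq_cond /=.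
    by exists (z x) => //=; rewrite mem_enum inE.
  rewrite -bigcup_seq_cond => -[l /= /andP[_ /set_mem al] zl]; by rewrite zl.
apply: bigsetU_measurable => l _; exact: pz.
Qed.

Lemma expect_label (a : L -> R) : expect (fun x => a (z x)) = \sum_l a l * pr l.
Proof.
pose F l x := a l * \1_(z @^-1` [set l]) x.
have bF l : bm (F l) by apply/bmZ/bm_indic/pz.
have E x : a (z x) = \sum_(l <- enum L) F l x.
  rewrite big_enum /= (bigD1 (z x)) //= big1 => [|l lz].
    by rewrite addr0 /F indicE mem_set// mulr1.
  rewrite /F indicE memNset ?mulr0// => /= zl.
  by move: lz; rewrite zl eqxx.
rewrite (funext E) -[RHS]big_enum /=.
have p := expect_pos.
suff [_ ->] : bm (fun x => \sum_(l <- enum L) F l x) /\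
    expect (fun x => \sum_(l <- enum L) F l x) = \sum_(l <- enum L) a l * pr l by [].
elim: (enum L) => [|l s [b IH]].
  have -> : (fun x : T => \sum_(l <- [::]) F l x) = fun=> 0.
    by apply/funext => x; rewrite big_nil.
  by rewrite big_nil (mposfun0 p); split => //; exact: bm_cst.
have -> : (fun x : T => \sum_(l0 <- l :: s) F l0 x) =
    fun x => F l x + \sum_(l0 <- s) F l0 x.
  by apply/funext => x; rewrite big_cons.
split; first exact: bmD.
rewrite (mposfunD p)// IH big_cons; congr (_ + _).
rewrite /F (mposfunZ p) ?expect_indic//.
exact/bm_indic/pz.
Qed.

Lemma sum_pr : \sum_l pr l = 1.
Proof.
have [_ _ <-] := expect_pos; rewrite (expect_label (fun=> 1)).
by apply: eq_bigr => l _; rewrite mul1r.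
Qed.

Lemma partition_comp (L' : finType) (h : L -> L') : is_partition (h \o z).
Proof.
move=> l'; have := (bm_label (fun l => (h l == l')%:R)).1 measurableT _ (measurable_set1 1).
rewrite setTI; congr measurable; apply/seteqP; split => x /=.
  by case: eqP => // _ /eqP; rewrite eq_sym oner_eq0.
by move=> ->; rewrite eqxx.
Qed.

Lemma expect_pr (l : L) : expect (fun x => (z x == l)%:R) = pr l.
Proof.
rewrite (expect_label (fun k => (k == l)%:R)) (bigD1 l) //= eqxx mul1r.
rewrite big1 ?addr0// => k /negbTE ->; exact: mul0r.
Qed.

End labels.
End bounded_measurable.

(** Nonnegativity of relative entropy, from [ln z <= z - 1]. Labels with [p l = 0] contribute
    nothing to either side, whatever the value of [ln] there. *)
Lemma gibbs_inequality (R : realType) (L : finType) (p q : L -> R) :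
  (forall l, 0 <= p l) -> (forall l, 0 <= q l) ->
  (forall l, 0 < p l -> 0 < q l) -> \sum_l q l <= \sum_l p l ->
  \sum_l p l * ln (q l) <= \sum_l p l * ln (p l).
Proof.
move=> p0 q0 pq qp; rewrite -subr_le0 -sumrB.
apply: le_trans (_ : \sum_l (q l - p l) <= 0); last by rewrite sumrB subr_le0.
apply: ler_sum => l _; have := p0 l; rewrite le_eqVlt => /predU1P[<-|pl].
  by rewrite !mul0r !subr0.
have ql := pq _ pl.
rewrite -mulrBr -ln_div ?posrE//.
have : ln (q l / p l) <= q l / p l - 1.
  have := @le_ln1Dx R (q l / p l - 1).
  have -> : 1 + (q l / p l - 1) = q l / p l by ring.
  by apply; rewrite ltrBrDl subrr divr_gt0.
move=> h; rewrite -(ler_pM2l pl) in h; apply: le_trans h _.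
by apply: eq_refl_le; field; rewrite gt_eqF.
Qed.

Section fekete.
Variables (R : realType) (a : nat -> R).
Hypothesis a_ge0 : forall n, 0 <= a n.
Hypothesis a_sub : forall n m, a (n + m)%N <= a n + a m.

Lemma fekete : exists l : R,
  a n / n%:R @[n --> \oo] --> l /\ forall n, l * n%:R <= a n.
Proof.
pose E := [set a n.+1 / n.+1%:R | n in [set: nat]].
have E0 : has_inf E.
  split; first by exists (a 1%N / 1%:R), 0%N.
  by exists 0 => _ [n _ <-]; rewrite divr_ge0.
have lE n : inf E <= a n.+1 / n.+1%:R by apply: ge_inf; [exact: E0.2|exists n].
exists (inf E); split; last first.
  case=> [|n]; first by rewrite mulr0.
  by rewrite -ler_pdivlMr ?ltr0n.
have mult N q r : a (q * N + r)%N <= q%:R * a N + a r.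
  elim: q => [|q IH]; first by rewrite mul0n add0n mul0r add0r.
  rewrite mulSn -addnA (le_trans (a_sub _ _))// -natr1 mulrDl mul1r.
  by move: IH; lra.
apply/cvgrPdist_le => e e0.
have e20 : 0 < e / 2 by rewrite divr_gt0.
have [_ [N _ <-] aN] := inf_adherent e20 E0.
pose C := \sum_(r < N.+1) a r.
have C0 : 0 <= C by apply: sumr_ge0.
have [M hM] : exists M, C / (e / 2) < M%:R.
  by exists (Num.bound (C / (e / 2))); apply: archi_boundP; rewrite divr_ge0// ltW.
exists M.+1 => // n /= Mn.
have n0 : (0 < n)%N by apply: leq_trans Mn.
have nR : 0 < n%:R :> R by rewrite ltr0n.
have l1 : inf E <= a n / n%:R by case: n n0 {Mn nR} => // n _.
rewrite distrC ger0_norm ?subr_ge0//.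
have h1 := mult N.+1 (n %/ N.+1)%N (n %% N.+1)%N.
rewrite -divn_eq in h1.
have h2 : a (n %% N.+1)%N <= C.
  rewrite /C (bigD1 (Ordinal (ltn_pmod n (ltn0Sn N)))) //= lerDl.
  exact: sumr_ge0.
have N0 : 0 < N.+1%:R :> R by rewrite ltr0n.
have h3 : (n %/ N.+1)%:R * a N.+1 <= n%:R * (a N.+1 / N.+1%:R).
  rewrite [leRHS]mulrCA [leLHS]mulrC ler_wpM2l// ler_pdivlMr// -natrM ler_nat.
  by apply: leq_divM.
have h4 : C <= (e / 2) * n%:R.
  move: hM; rewrite ltr_pdivrMr// => /ltW/le_trans; apply.
  by rewrite mulrC ler_wpM2l// ?(ltW e20)// ler_nat ltnW.
have h5 : n%:R * (a N.+1 / N.+1%:R) <= n%:R * (inf E + e / 2).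
  by rewrite ler_wpM2l// ltW.
have fin (e' i A X Y C' n' Z : R) : A <= X + Y -> Y <= C' -> X <= n' * Z ->
  C' <= e' / 2 * n' -> n' * Z <= n' * (i + e' / 2) -> A <= (e' + i) * n' by nra.
by rewrite lerBlDr ler_pdivrMr//; exact: fin h1 h2 h3 h4 h5.
Qed.

End fekete.

Section entropy_theory.
Context d (T : measurableType d) (R : realType).
Variable nu : probability T R.

Local Notation pr := (pr nu).
Local Notation H := (partition_entropy nu).

Lemma entropyE (L : finType) (z : T -> L) : H z = - \sum_l pr z l * ln (pr z l).
Proof. by []. Qed.

Lemma pr_le1 (L : finType) (z : T -> L) (pz : is_partition z) l : pr z l <= 1.
Proof.
rewrite -(sum_pr nu pz) (bigD1 l) //= lerDl; apply: sumr_ge0 => k _.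
exact: pr_ge0.
Qed.

Lemma pr_le (L L' : finType) (z : T -> L) (z' : T -> L') l l' :
  is_partition z -> is_partition z' ->
  (forall x, z x = l -> z' x = l') -> pr z l <= pr z' l'.
Proof.
move=> pz pz' h; rewrite -(expect_pr nu pz) -(expect_pr nu pz').
apply: (mposfun_le (expect_pos nu)).
- exact: (bm_label pz (fun k => (k == l)%:R)).
- exact: (bm_label pz' (fun k => (k == l')%:R)).
- by move=> x; case: eqP => [/h ->|_]; rewrite ?eqxx ?ler0n.
Qed.

Lemma entropy_ge0 (L : finType) (z : T -> L) : is_partition z -> 0 <= H z.
Proof.
move=> pz; rewrite entropyE oppr_ge0; apply: sumr_le0 => l _.
by rewrite mulr_ge0_le0 ?pr_ge0// ln_le0// pr_le1.
Qed.

(** Entropy is bounded by cross entropy. The upper bounds below come from a choice of the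
    subprobability [q] on labels. *)
Lemma entropy_le (L : finType) (z : T -> L) (q : L -> R) : is_partition z ->
  (forall l, 0 <= q l) -> (forall l, 0 < pr z l -> 0 < q l) ->
  \sum_l q l <= 1 -> H z <= - expect nu (fun x => ln (q (z x))).
Proof.
move=> pz q0 q1 q2; rewrite (expect_label nu pz (fun l => ln (q l))) entropyE lerN2.
under eq_bigr do rewrite mulrC.
apply: gibbs_inequality => //; first by move=> l; exact: pr_ge0.
by rewrite sum_pr.
Qed.

Lemma entropy_comp (L L' : finType) (z : T -> L) (h : L -> L') :
  is_partition z -> H (h \o z) <= H z.
Proof.
move=> pz; have phz := partition_comp R pz h.
have e1 : H (h \o z) = - expect nu (fun x => ln (pr (h \o z) (h (z x)))).
  rewrite (expect_label nu phz (fun l => ln (pr (h \o z) l))) entropyE; congr (- _).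
  by apply: eq_bigr => l _; rewrite mulrC.
rewrite e1 (expect_label nu pz (fun l => ln (pr (h \o z) (h l)))) entropyE lerN2.
apply: ler_sum => l _; rewrite mulrC.
have := pr_ge0 nu z l; rewrite le_eqVlt => /predU1P[<-|pl]; first by rewrite !mulr0.
rewrite ler_pM2r//.
have ple : pr z l <= pr (h \o z) (h l) by apply: pr_le => // x /= ->.
by rewrite ler_ln ?posrE//; exact: lt_le_trans ple.
Qed.

Lemma partition_pair (L L' : finType) (z : T -> L) (z' : T -> L') :
  is_partition z -> is_partition z' -> is_partition (fun x => (z x, z' x)).
Proof.
move=> pz pz' [l l'].
rewrite (_ : _ @^-1` _ = z @^-1` [set l] `&` z' @^-1` [set l']).
  exact: measurableI.
apply/seteqP; split => x /=; first by move=> [-> ->].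
by move=> [-> ->].
Qed.

(** Here [q] is the product of the two marginals. *)
Lemma entropy_pair (L L' : finType) (z : T -> L) (z' : T -> L') :
  is_partition z -> is_partition z' ->
  H (fun x => (z x, z' x)) <= H z + H z'.
Proof.
move=> pz pz'; have pp := partition_pair pz pz'.
pose q (a : L * L') := pr z a.1 * pr z' a.2.
have pos l l' : 0 < pr (fun x => (z x, z' x)) (l, l') -> 0 < pr z l /\ 0 < pr z' l'.
  move=> h; split; apply: lt_le_trans h _; apply: pr_le => // x.
    by move=> [-> _].
  by move=> [_ ->].
have q0 a : 0 <= q a by rewrite mulr_ge0// pr_ge0.
have := @entropy_le _ _ q pp q0.
have h1 l : 0 < pr (fun x => (z x, z' x)) l -> 0 < q l.
  by case: l => l l' /pos[a b]; exact: mulr_gt0.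
have h2 : \sum_l q l <= 1.
  rewrite -(pair_bigA _ (fun a b => pr z a * pr z' b)) /=.
  under eq_bigr do rewrite -mulr_sumr (sum_pr nu pz') mulr1.
  by rewrite (sum_pr nu pz).
move=> /(_ h1 h2) /le_trans; apply.
rewrite (expect_label nu pp (fun a => ln (q a))).
have -> : \sum_l ln (q l) * pr (fun x => (z x, z' x)) l =
    \sum_l (ln (pr z l.1) + ln (pr z' l.2)) * pr (fun x => (z x, z' x)) l.
  apply: eq_bigr => -[l l'] _.
  have := pr_ge0 nu (fun x => (z x, z' x)) (l, l').
  rewrite le_eqVlt => /predU1P[<-|/pos[a b]]; first by rewrite !mulr0.
  by rewrite /q lnM.
rewrite -(expect_label nu pp (fun l => ln (pr z l.1) + ln (pr z' l.2))) /=.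
have := mposfunD (expect_pos nu) (bm_label pz (fun l => ln (pr z l)))
  (bm_label pz' (fun l => ln (pr z' l))).
rewrite /= => ->.
rewrite (expect_label nu pz (fun l => ln (pr z l))).
rewrite (expect_label nu pz' (fun l => ln (pr z' l))) !entropyE opprD.
by apply: eq_refl_le; congr (- _ - _); apply: eq_bigr => l _; rewrite mulrC.
Qed.

Section invariant.
Variable f : T -> T.
Hypotheses (mf : measurable_fun [set: T] f) (inv : invariant_measure f nu).

Lemma measurable_iter n : measurable_fun [set: T] (iter n f).
Proof.
elim: n => [|n IH]; first exact: measurable_id.
exact: (measurableT_comp mf IH).
Qed.

Lemma expect_iter u n : bm u -> expect nu (fun x => u (iter n f x)) = expect nu u.
Proof.
elim: n => [//|n IH] bu; rewrite -[RHS]IH//.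
have bn : bm (fun x => u (iter n f x)) by apply: (bm_comp (measurable_iter n)).
rewrite -[RHS](expect_invariant mf inv bn); congr expect; apply/funext => x /=.
by rewrite -iterSr.
Qed.

Lemma partition_iter (L : finType) (z : T -> L) n :
  is_partition z -> is_partition (fun x => z (iter n f x)).
Proof.
move=> pz l; rewrite -[X in measurable X]setTI.
exact: (measurable_iter n measurableT (pz l)).
Qed.

Lemma pr_iter (L : finType) (z : T -> L) n l : is_partition z ->
  pr (fun x => z (iter n f x)) l = pr z l.
Proof.
move=> pz; rewrite -(expect_pr nu (partition_iter n pz)) -(expect_pr nu pz).
exact: (expect_iter n (bm_label pz (fun k => (k == l)%:R))).
Qed.

Lemma entropy_iter (L : finType) (z : T -> L) n : is_partition z ->
  H (fun x => z (iter n f x)) = H z.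
Proof.
by move=> pz; rewrite !entropyE; congr (- _); apply: eq_bigr => l _; rewrite pr_iter.
Qed.

Variables (L : finType) (xi : T -> L).
Hypothesis pxi : is_partition xi.
Local Notation join := (iterated_join f xi).

Lemma partition_join (n : nat) : is_partition (join n).
Proof.
move=> w; rewrite (_ : _ @^-1` _ =
    \big[setI/setT]_(i <- enum 'I_n) ((fun x => xi (iter i f x)) @^-1` [set w i])).
  by apply: bigsetI_measurable => i _; exact: partition_iter.
rewrite -bigcap_seq; apply/seteqP; split => x /=.
  by move=> <- i _ /=; rewrite ffunE.
by move=> h; apply/ffunP => i; rewrite ffunE; apply: h; rewrite /= mem_enum.
Qed.

Lemma entropy_join_sub n m : H (join (n + m)) <= H (join n) + H (join m).
Proof.
have pn := @partition_join n.
have pm := partition_iter n (@partition_join m).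
rewrite -(entropy_iter n (@partition_join m)).
apply: le_trans (entropy_pair pn pm).
pose h (a : {ffun 'I_n -> L} * {ffun 'I_m -> L}) : {ffun 'I_(n + m) -> L} :=
  [ffun i => match fintype.split i with inl j => a.1 j | inr j => a.2 j end].
have -> : join (n + m) = h \o (fun x => (join n x, join m (iter n f x))).
  apply/funext => x; apply/ffunP => i; rewrite !ffunE /=.
  case: fintype.splitP => j ij; rewrite ffunE ij//.
  by rewrite addnC iterD.
exact/entropy_comp/partition_pair.
Qed.

Lemma entropy_wrt_lim :
  H (join n) / n%:R @[n --> \oo] --> entropy_wrt nu f xi /\
  forall n, entropy_wrt nu f xi * n%:R <= H (join n).
Proof.
have [l [hl1 hl2]] := fekete (fun n => entropy_ge0 (@partition_join n)) entropy_join_sub.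
have -> : entropy_wrt nu f xi = l by apply/cvg_lim.
by [].
Qed.

Lemma entropy_wrt_le c : (forall e, 0 < e -> exists C, forall n,
    H (join n) <= C + (c + e) * n%:R) -> entropy_wrt nu f xi <= c.
Proof.
move=> hc; have [hl1 hl2] := entropy_wrt_lim.
apply/ler_addgt0Pr => e e0.
have e20 : 0 < e / 2 by rewrite divr_gt0.
have [C hC] := hc _ e20.
have [N hN] : exists N, `|C| / (e / 2) < N%:R.
  by exists (Num.bound (`|C| / (e / 2))); apply: archi_boundP; rewrite divr_ge0// ltW.
have N0 : 0 < N%:R :> R by apply: le_lt_trans hN; rewrite divr_ge0// ltW.
rewrite -(ler_pM2r N0); apply: le_trans (hl2 N) _; apply: le_trans (hC N) _.
move: hN; rewrite ltr_pdivrMr// => hN; have := ler_norm C; lra.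
Qed.

End invariant.
End entropy_theory.

(** * Generating partitions *)

Fact window_subproof n m (i : 'I_n) (j : 'I_m) : (i + j < n + m)%N.
Proof. by case: i j => i hi [j hj] /=; lia. Qed.

Definition window (L : finType) n m (w : {ffun 'I_(n + m) -> L}) (i : 'I_n) :
  {ffun 'I_m -> L} := [ffun j => w (Ordinal (window_subproof i j))].

Section generators.
Context d (T : measurableType d) (R : realType).
Variables (nu : probability T R) (f : T -> T).
Hypotheses (mf : measurable_fun [set: T] f) (inv : invariant_measure f nu).

Local Notation H := (partition_entropy nu).

Lemma join_window (L : finType) (xi : T -> L) n m i x :
  window (iterated_join f xi (n + m) x) i = iterated_join f xi m (iter (i : 'I_n) f x).
Proof. by apply/ffunP => j; rewrite !ffunE /= addnC iterD. Qed.

Lemma entropy_wrt_ub (L : finType) (xi : T -> L) (pxi : is_partition xi) e :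
  0 < e -> exists C, forall n,
    H (iterated_join f xi n) <= C + (entropy_wrt nu f xi + e) * n%:R.
Proof.
move=> e0; have [hl _] := entropy_wrt_lim mf inv pxi.
have pj n := @partition_join _ _ f mf _ _ pxi n.
have c0 : 0 <= entropy_wrt nu f xi.
  apply: (ler_cvg_to (cvg_cst 0) hl).
  by apply: nearW => n; rewrite divr_ge0// entropy_ge0.
have /cvgrPdist_le /(_ e e0) [N _ hN] := hl.
exists (\sum_(i < N.+1) H (iterated_join f xi i)) => n.
have [Nn|nN] := ltnP N n.
  have n0 : 0 < n%:R :> R by rewrite ltr0n; lia.
  have := hN n (ltnW Nn); rewrite ler_norml => /andP[h _].
  apply: le_trans (_ : (entropy_wrt nu f xi + e) * n%:R <= _).
    by rewrite -ler_pdivrMr//; lra.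
  by rewrite lerDr; apply: sumr_ge0 => i _; exact: entropy_ge0.
apply: ler_wpDr; first by rewrite mulr_ge0// addr_ge0// ltW.
have nN' : (n < N.+1)%N by [].
rewrite (bigD1 (Ordinal nN')) //= lerDl; apply: sumr_ge0 => i _.
exact: entropy_ge0.
Qed.

(* Coding [eta] by the windows of [xi] costs at most [ln (1 - dd)] per correct
   guess and [ln (dd / k)] per wrong one. *)
Lemma entropy_wrt_approx (K L : finType) (eta : T -> K) (xi : T -> L) :
  is_partition eta -> is_partition xi ->
  (forall e : R, 0 < e -> exists m (phi : {ffun 'I_m -> L} -> K),
     expect nu (fun x => (eta x != phi (iterated_join f xi m x))%:R) <= e) ->
  entropy_wrt nu f eta <= entropy_wrt nu f xi.
Proof.
move=> peta pxi appr.
apply: (entropy_wrt_le mf inv peta) => e e0.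
pose e4 := e / 4.
have e40 : 0 < e4 by rewrite divr_gt0.
(* The log-weights [- e4] of a correct guess and [- B] of each wrong one are such that the weights
   of all guesses sum to at most [1], see [scs]. The guess error is then chosen so small that wrong
   guesses cost at most [e4] on average. *)
pose B := - ln ((1 - expR (- e4)) / (#|K|%:R + 1)).
have K0 : 0 < #|K|%:R + 1 :> R by rewrite ltr_wpDl.
have dd0 : 0 < 1 - expR (- e4) by rewrite subr_gt0 expR_lt1 oppr_lt0.
have [m [phi hphi]] : exists m (phi : {ffun 'I_m -> L} -> K),
   expect nu (fun x => (eta x != phi (iterated_join f xi m x))%:R) <= e4 / (`|B| + 1).
  by apply: appr; rewrite divr_gt0// ltr_wpDl.
have [C hC] := entropy_wrt_ub pxi (divr_gt0 e0 (ltr0n R 2 : 0 < 2%:R)).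
have pj n := @partition_join _ _ f mf _ _ pxi n.
have pe n := @partition_join _ _ f mf _ _ peta n.
exists (C + H (iterated_join f xi m)) => n.
pose sc (a b : K) : R := if a == b then - e4 else - B.
have scs b : \sum_a expR (sc a b) <= 1.
  rewrite (bigD1 b) //= /sc eqxx.
  apply: le_trans (_ : expR (- e4) +
     \sum_(a | a != b) (1 - expR (- e4)) / (#|K|%:R + 1) <= _).
    rewrite lerD2l; apply: ler_sum => a /negbTE ->.
    by rewrite opprK lnK// posrE divr_gt0.
  apply: le_trans (_ : expR (- e4) +
     \sum_(a : K) (1 - expR (- e4)) / (#|K|%:R + 1) <= _).
    rewrite lerD2l [leRHS](bigD1 b) //= lerDr.
    by rewrite divr_ge0// ltW.
  rewrite sumr_const -[X in _ + X <= _]mulr_natr -[X in _ + X <= _]mulrA -lerBrDl.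
  rewrite ger_pMr// mulrC ler_pdivrMr// mul1r; lra.
pose z x := (iterated_join f eta n x, iterated_join f xi (n + m) x).
have pz : is_partition z by apply: partition_pair.
pose S (l : {ffun 'I_n -> K} * {ffun 'I_(n + m) -> L}) :=
  \sum_(i < n) sc (l.1 i) (phi (window l.2 i)).
(* Draw the long [xi]-word with its true mass, then guess each [eta]-label independently from the
   window starting at the same time. *)
pose q (l : {ffun 'I_n -> K} * {ffun 'I_(n + m) -> L}) :=
  pr nu (iterated_join f xi (n + m)) l.2 * expR (S l).
have q0 l : 0 <= q l by rewrite mulr_ge0 ?pr_ge0 ?expR_ge0.
have pos l : 0 < pr nu z l -> 0 < pr nu (iterated_join f xi (n + m)) l.2.
  move=> h; apply: lt_le_trans h _; apply: pr_le => // x; by case: l => a b [_ ->].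
have q1 l : 0 < pr nu z l -> 0 < q l.
  by move=> /pos h; rewrite mulr_gt0 ?expR_gt0.
have q2 : \sum_l q l <= 1.
  rewrite -(sum_pr nu (pj (n + m)%N)).
  rewrite -(pair_bigA _ (fun a b => q (a, b))) /= exchange_big /=.
  apply: ler_sum => w _; rewrite /q /= -mulr_sumr ler_piMr ?pr_ge0//.
  rewrite /S /=; under eq_bigr do rewrite expR_sum.
  rewrite -(bigA_distr_bigA (fun i a => expR (sc a (phi (window w i))))) /=.
  apply: le_trans (_ : \prod_(i < n) (1 : R) <= 1); last by rewrite big1.
  apply: ler_prod => i _; rewrite scs andbT.
  by apply: sumr_ge0 => a _; exact: expR_ge0.
have h1 : H (iterated_join f eta n) <= H z by exact: (entropy_comp nu fst pz).
have h2 := entropy_le pz q0 q1 q2.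
have h3 : expect nu (fun x => ln (q (z x))) =
   - H (iterated_join f xi (n + m)) + expect nu (fun x => S (z x)).
  rewrite (expect_label nu pz (fun l => ln (q l))).
  transitivity (\sum_l (ln (pr nu (iterated_join f xi (n + m)) l.2) + S l) * pr nu z l).
    apply: eq_bigr => l _; have := pr_ge0 nu z l.
    rewrite le_eqVlt => /predU1P[<-|/pos pl]; first by rewrite !mulr0.
    by rewrite /q lnM ?posrE ?expR_gt0// expRK.
  rewrite -(expect_label nu pz
     (fun l => ln (pr nu (iterated_join f xi (n + m)) l.2) + S l)) /=.
  rewrite (mposfunD (expect_pos nu)
     (bm_label (pj (n + m)%N) (fun l => ln (pr nu (iterated_join f xi (n + m)) l)))
     (bm_label pz S)).
  congr (_ + _).
  rewrite (expect_label nu (pj (n + m)%N)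
     (fun l => ln (pr nu (iterated_join f xi (n + m)) l))) entropyE opprK.
  by apply: eq_bigr => l _; rewrite mulrC.
pose y x := (eta x, iterated_join f xi m x).
have py : is_partition y by apply: partition_pair.
pose s0 (l : K * {ffun 'I_m -> L}) := sc l.1 (phi l.2).
have bs0 := bm_label py s0.
have h4 : expect nu (fun x => S (z x)) = n%:R * expect nu (fun x => s0 (y x)).
  have -> : (fun x => S (z x)) = fun x => \sum_(i < n) s0 (y (iter i f x)).
    apply/funext => x; apply: eq_bigr => i _ /=.
    by rewrite join_window ffunE.
  rewrite (mposfun_sum (expect_pos nu)
     (F := fun i x => s0 (y (iter i f x)))); last first.
    by move=> i _; apply: (bm_comp (u := fun x => s0 (y x))) => //; exact: measurable_iter.
  under eq_bigr do rewrite (expect_iter mf inv _ bs0).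
  by rewrite sumr_const card_ord -[LHS]mulr_natl.
have h5 : - (e4 + e4) <= expect nu (fun x => s0 (y x)).
  pose t0 (l : K * {ffun 'I_m -> L}) : R := (l.1 != phi l.2)%:R.
  have bt0 := bm_label py t0.
  have bt : bm (fun x => (- `|B|) * t0 (y x) + - e4) by apply: bm_lin => //; exact: bm_cst.
  apply: le_trans (_ : expect nu (fun x => (- `|B|) * t0 (y x) + - e4) <= _).
    rewrite (mposfunD (expect_pos nu) (bmZ _ bt0) (bm_cst _ _)) (mposfun_cst (expect_pos nu)).
    rewrite (mposfunZ (expect_pos nu) _ bt0) opprD lerD2r mulNr lerN2.
    move: hphi; rewrite ler_pdivlMr ?ltr_wpDl//; apply: le_trans.
    rewrite mulrC ler_wpM2l//; last by rewrite lerDl.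
    by case: (expect_pos nu) => _ + _; apply.
  apply: (mposfun_le (expect_pos nu)) => // x.
  rewrite /t0 /s0 /sc /=; case: eqP => _ /=; first by rewrite mulr0 add0r.
  by rewrite mulr1; have := ler_norm B; lra.
have h6 : n%:R * - (e4 + e4) <= n%:R * expect nu (fun x => s0 (y x)) by rewrite ler_wpM2l.
have h7 := entropy_join_sub mf inv pxi n m.
have h8 := hC n.
have h9 : n%:R * (e4 + e4) = n%:R * (e / 2) by rewrite /e4; field.
move: h1 h2; rewrite h3 h4; move: h6 h7 h8; rewrite mulrN h9; lra.
Qed.

Section sets.
Variables (L : finType) (xi : T -> L).
Hypothesis pxi : is_partition xi.
Local Notation join := (iterated_join f xi).

(** Approximation in mean by finite unions of cylinders of the partition [xi]. *)
Definition codable A := measurable A /\ forall e : R, 0 < e ->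
  exists m (S : {ffun 'I_m -> L} -> bool),
    expect nu (fun x => `|\1_A x - (S (join m x))%:R|) <= e.

Let pj (n : nat) : is_partition (join n) := @partition_join _ _ f mf _ _ pxi n.

Lemma bm_abs (u : T -> R) : bm u -> bm (fun x => `|u x|).
Proof.
move=> [mu [B uB]]; split; first exact: (measurableT_comp (@normr_measurable _ _)).
by exists B => x; rewrite normr_id.
Qed.

Lemma bm_code A m (S : {ffun 'I_m -> L} -> bool) : measurable A ->
  bm (fun x => `|\1_A x - (S (join m x))%:R| : R).
Proof.
move=> mA; apply: bm_abs; apply: bmB; first exact: bm_indic.
exact: (bm_label (@pj m) (fun w => (S w)%:R)).
Qed.

Lemma code_lift m m' (X : Type) (S : {ffun 'I_m -> L} -> X) : (m <= m')%N ->
  exists S' : {ffun 'I_m' -> L} -> X, forall x, S' (join m' x) = S (join m x).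
Proof.
move=> mm'; exists (fun w => S [ffun i => w (widen_ord mm' i)]) => x.
by congr S; apply/ffunP => i; rewrite !ffunE.
Qed.

Lemma codableC A : codable A -> codable (~` A).
Proof.
move=> [mA hA]; split; first exact: measurableC.
move=> e /hA[m [S hS]]; exists m, (fun w => ~~ S w).
apply: le_trans hS; apply: eq_refl_le; congr expect; apply/funext => x.
rewrite !indicE in_setC; case: (_ \in _); case: (S _) => /=;
  by rewrite ?subrr ?subr0 ?sub0r ?normrN.
Qed.

Lemma codableU A B : codable A -> codable B -> codable (A `|` B).
Proof.
move=> [mA hA] [mB hB]; split; first exact: measurableU.
move=> e e0; have e20 : 0 < e / 2 by rewrite divr_gt0.
have [m [S hS]] := hA _ e20; have [m' [S' hS']] := hB _ e20.
have [Q hQ] := code_lift S (leq_maxl m m').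
have [Q' hQ'] := code_lift S' (leq_maxr m m').
exists (maxn m m'), (fun w => Q w || Q' w).
apply: le_trans (_ : e / 2 + e / 2 <= e); last by apply: eq_refl_le; field.
apply: le_trans (lerD hS hS').
rewrite -(mposfunD (expect_pos nu)); [|exact: bm_code|exact: bm_code].
apply: (mposfun_le (expect_pos nu)).
- exact: (@bm_code _ _ (fun w => Q w || Q' w) (measurableU _ _ mA mB)).
- by apply: bmD; exact: bm_code.
- move=> x; rewrite !indicE in_setU hQ hQ'.
  case: (_ \in _); case: (_ \in _); case: (S _); case: (S' _) => /=;
  by rewrite ?subrr ?subr0 ?sub0r ?normrN ?normr0 ?normr1 ?addr0 ?add0r ?lexx ?ler01 ?lerDl ?ler01.
Qed.

(** A finite subunion is already close in measure, by continuity from below, and finite unions are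
    codable. *)
Lemma codable_bigcup (A : nat -> set T) : (forall i, codable (A i)) ->
  codable (\bigcup_i A i).
Proof.
move=> cA; have mA : measurable (\bigcup_i A i).
  by apply: bigcupT_measurable => i; exact: (cA i).1.
split=> // e e0; have e20 : 0 < e / 2 by rewrite divr_gt0.
pose F n := \big[setU/set0]_(i < n.+1) A i.
have cF n : codable (F n).
  rewrite /F; elim: n => [|n IH]; first by rewrite big_ord_recl big_ord0 setU0.
  by rewrite big_ord_recr; apply: codableU.
have FA : \bigcup_n F n = \bigcup_i A i by exact: bigcup_bigsetU_bigcup.
have Fsub n : F n `<=` \bigcup_i A i by rewrite -FA => x; exists n.
have hcv : nu (F n) @[n --> \oo] --> nu (\bigcup_i A i).
  rewrite -FA; apply: nondecreasing_cvg_mu.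
  - by move=> n; exact: (cF n).1.
  - by rewrite FA.
  - move=> n m nm; apply/subsetPset; rewrite /F; exact: subset_bigsetU.
have hfin : fine (nu (F n)) @[n --> \oo] --> fine (nu (\bigcup_i A i)).
  by apply: fine_cvg; rewrite fineK// fin_num_measure.
have /cvgrPdist_le /(_ _ e20)[N _ hN] := hfin.
have [m [S hS]] := (cF N).2 _ e20.
exists m, S.
apply: le_trans (_ : e / 2 + e / 2 <= e); last by apply: eq_refl_le; field.
have := hN N (leqnn N); rewrite /= -!expect_indic//; last exact: (cF N).1.
rewrite -(mposfunB (expect_pos nu)); [|exact: bm_indic|exact/bm_indic/(cF N).1].
move=> h; have {h} := le_trans (ler_norm _) h => h.
apply: le_trans (lerD h hS).
rewrite -(mposfunD (expect_pos nu)); last first.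
- exact/bm_code/(cF N).1.
- by apply: bmB; apply: bm_indic => //; exact: (cF N).1.
apply: (mposfun_le (expect_pos nu)).
- exact: bm_code.
- by apply: bmD; [apply: bmB; apply: bm_indic => //; exact: (cF N).1|exact/bm_code/(cF N).1].
move=> x; have le1 : \1_(F N) x <= \1_(\bigcup_i A i) x :> R.
  rewrite !indicE ler_nat; case: (boolP (x \in F N)) => //.
  by move=> /set_mem/Fsub xA; rewrite mem_set.
set a := \1_(\bigcup_i A i) x; set b := \1_(F N) x; set c := (S _)%:R.
have -> : a - c = (a - b) + (b - c) by ring.
by rewrite (le_trans (ler_normD _ _))// lerD2r ger0_norm// subr_ge0.
Qed.

Hypothesis gen : forall A : set T, measurable A ->
  <<s [set B | exists m (S : {ffun 'I_m -> L} -> bool), B = [set x | S (join m x)]] >> A.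

(** The codable sets form a sigma-algebra containing the cylinders, which generate. *)
Lemma codable_measurable A : measurable A -> codable A.
Proof.
move=> /gen; apply: smallest_sub.
  split=> [|B cB|B cB].
  - split=> // e e0; exists 0%N, (fun=> false); apply: le_trans (ltW e0).
    apply: eq_refl_le; rewrite -[RHS](mposfun_cst (expect_pos nu)); congr expect.
    by apply/funext => x; rewrite indic0 subrr normr0.
  - by rewrite setTD; exact: codableC.
  - exact: codable_bigcup.
move=> _ [m [S ->]].
have mS : measurable [set x | S (join m x)].
  rewrite (_ : [set _ | _] = (S \o join m) @^-1` [set true]).
    by have := partition_comp R (@pj m) S; apply.
  by apply/seteqP; split.
split=> // e e0; exists m, S; apply: le_trans (ltW e0).
apply: eq_refl_le; rewrite -[RHS](mposfun_cst (expect_pos nu)); congr expect.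
apply/funext => x; rewrite indicE; case: (boolP (S (join m x))) => h.
  by rewrite mem_set// subrr normr0.
by rewrite memNset ?subrr ?normr0//=; exact/negP.
Qed.

(** Each atom of [eta] is coded separately with error [e / #|K|], at a common word length, and the
    guess is any label whose code accepts. A wrong guess at a point means that some atom is miscoded
    there, so the errors add up to [e]. *)
Lemma entropy_wrt_generator (K : finType) (eta : T -> K) (x0 : T) :
  is_partition eta -> entropy_wrt nu f eta <= entropy_wrt nu f xi.
Proof.
move=> peta; apply: entropy_wrt_approx => // e e0.
have K0 : 0 < #|K|%:R :> R by rewrite ltr0n; apply/card_gt0P; exists (eta x0).
have /choice[m hm] : forall l : K, exists m : nat,
    exists S : {ffun 'I_m -> L} -> bool,
    expect nu (fun x => `|\1_(eta @^-1` [set l]) x - (S (join m x))%:R|) <= e / #|K|%:R.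
  move=> l; have [_ h] := codable_measurable (peta l).
  by have [m hm] := h _ (divr_gt0 e0 K0); exists m.
pose M := (\max_l m l)%N.
have /choice[S hS] : forall l : K, exists S : {ffun 'I_M -> L} -> bool,
    expect nu (fun x => `|\1_(eta @^-1` [set l]) x - (S (join M x))%:R|) <= e / #|K|%:R.
  move=> l; have [S hS] := hm l.
  have [S' hS'] := code_lift S (leq_bigmax l : m l <= M)%N.
  by exists S'; under eq_fun do rewrite hS'.
exists M, (fun w => odflt (eta x0) [pick l | S l w]).
pose F l x : R := `|\1_(eta @^-1` [set l]) x - (S l (join M x))%:R|.
have bF l : bm (F l) by apply: bm_code.
apply: le_trans (_ : \sum_l expect nu (F l) <= _); last first.
  apply: le_trans (ler_sum _ (fun l _ => hS l)) _.
  by apply: eq_refl_le; rewrite sumr_const -[LHS]mulr_natr divfK// gt_eqF.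
have [bs <-] : bm (fun x => \sum_l F l x) /\
    expect nu (fun x => \sum_l F l x) = \sum_l expect nu (F l).
  have e1 x : \sum_l F l x = \sum_(i < #|K|) F (enum_val i) x.
    by rewrite (reindex_onto enum_val enum_rank) //=; [apply: eq_bigl => i; rewrite enum_valK eqxx|move=> i _; rewrite enum_rankK].
  have e2 : \sum_l expect nu (F l) = \sum_(i < #|K|) expect nu (F (enum_val i)).
    by rewrite (reindex_onto enum_val enum_rank) //=; [apply: eq_bigl => i; rewrite enum_valK eqxx|move=> i _; rewrite enum_rankK].
  pose G (i : nat) := if insub i is Some j then F (enum_val (j : 'I_#|K|)) else fun=> 0.
  have bG i : bm (G i) by rewrite /G; case: insub => [j|]; [exact: bF|exact: bm_cst].
  have GE (i : 'I_#|K|) : G i = F (enum_val i) by rewrite /G valK.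
  have e3 : (fun x => \sum_l F l x) = fun x => \sum_(i < #|K|) G i x.
    by apply/funext => x; rewrite e1; apply: eq_bigr => i _; rewrite GE.
  rewrite e2 e3; split; first by apply: bm_sum.
  rewrite (mposfun_sum (expect_pos nu) (fun i _ => bG i)).
  by apply: eq_bigr => i _; rewrite GE.
have pz : is_partition (fun x => (eta x, join M x)) by apply: partition_pair.
apply: (mposfun_le (expect_pos nu)) => //.
  exact: (bm_label pz (fun l => (l.1 != odflt (eta x0) [pick k | S k l.2])%:R)).
move=> x; case: eqP => [_|ne]; first by apply: sumr_ge0 => l _; exact: normr_ge0.
(* If all codes were right at [x], the accepted label would exist and be [eta x]. *)
have [l hl] : exists l, (eta x == l) != S l (join M x).
  apply/existsP; apply: contra_notT ne => /existsPn h.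
  case: pickP => [l Sl|none] /=.
    by have := h l; rewrite negbK Sl => /eqP/eqP.
  by have := h (eta x); rewrite negbK none eqxx.
rewrite (bigD1 l) //=; apply: ler_wpDr; first by apply: sumr_ge0 => k _; exact: normr_ge0.
rewrite /F indicE; move: hl; have [e1|ne1] := eqVneq (eta x) l.
  rewrite mem_set//; case: (S l _) => //= _; by rewrite subr0 normr1.
rewrite memNset; last by move=> /= e1; rewrite e1 eqxx in ne1.
by case: (S l _) => //= _; rewrite sub0r normrN normr1.
Qed.

(** The Kolmogorov-Sinai theorem. Since [entropy] ranges over partitions labelled by some ['I_k],
    the reverse inequality relabels [xi] through [enum_rank]. *)
Lemma entropy_generator (x0 : T) : entropy nu f = (entropy_wrt nu f xi)%:E.
Proof.
apply/eqP; rewrite eq_le; apply/andP; split.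
  apply: ge_ereal_sup => _ [k [eta [peta ->]]].
  by rewrite lee_fin entropy_wrt_generator.
pose eta x := enum_rank (xi x).
have peta : is_partition eta by exact: (partition_comp R pxi enum_rank).
apply: (@le_trans _ _ (entropy_wrt nu f eta)%:E); last first.
  by apply: ereal_sup_ubound; exists #|L|, eta.
rewrite lee_fin; apply: entropy_wrt_approx => // e e0.
exists 1%N, (fun w => enum_val (w ord0)); apply: le_trans (ltW e0).
apply: eq_refl_le; rewrite -[RHS](mposfun_cst (expect_pos nu)); congr expect.
by apply/funext => x; rewrite ffunE /= enum_rankK eqxx.
Qed.

End sets.
End generators.

(** * From functionals to invariant measures *)

Section uitv_measurable.
Variable R : realType.
Local Notation I := (uitv R).

Lemma open_uitvP (U : set I) : open U <->
  exists2 V : set R, open V & set_val @^-1` V = U.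
Proof. by split=> [[V oV <-]|[V oV <-]]; exists V. Qed.

Lemma measurable_set_val : measurable_fun [set: I] (set_val : I -> R).
Proof.
apply: (measurability (@open R)).
  rewrite /measurable /=; apply/seteqP; split.
    have -> : @measurableR R = @measurable _ (measurableTypeR R) by [].
    rewrite measurable_realfun.RGenOpens.measurableE.
    apply: smallest_sub; first exact: smallest_sigma_algebra.
    by move=> _ [x [y ->]]; apply: sub_sigma_algebra; exact: itv_open.
  apply: smallest_sub; first exact: sigma_algebra_measurable.
  by move=> A; exact: open_measurable.
move=> _ [V oV <-]; rewrite setTI; apply: sub_sigma_algebra.
by apply/open_uitvP; exists V.
Qed.

Lemma clamp_dist (x y : R) : `|set_val (clamp x) - set_val (clamp y)| <= `|x - y|.
Proof.
wlog xy : x y / x <= y.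
  by move=> h; have [/h//|/ltW/h] := leP x y; rewrite distrC (distrC y).
change (`|Num.min (Num.max x 0) 1 - Num.min (Num.max y 0) 1| <= `|x - y|).
have mono : Num.min (Num.max x 0) 1 <= Num.min (Num.max y 0) 1.
  case: (leP x 0) => x0; case: (leP y 0) => y0; rewrite ?(min_idPl (@ler01 R))//.
  - by case: (leP y 1) => y1; rewrite ?ler01 ?ltW.
  - by lra.
  - by case: (leP x 1) => x1; case: (leP y 1) => y1; lra.
have lip : Num.min (Num.max y 0) 1 - Num.min (Num.max x 0) 1 <= y - x.
  case: (leP x 0) => x0; case: (leP y 0) => y0; rewrite ?(min_idPl (@ler01 R)); try lra.
  - by case: (leP y 1) => y1; lra.
  - by case: (leP x 1) => x1; case: (leP y 1) => y1; lra.
by rewrite distrC (distrC x) !ger0_norm ?subr_ge0.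
Qed.

Lemma clamp_continuous : continuous (fun x : R => set_val (clamp x)).
Proof.
move=> x; apply/cvgrPdist_le => e e0; near=> y.
apply: le_trans (clamp_dist x y) _.
by near: y; apply: cvgr_dist_le => //; exact: cvg_id.
Unshelve. all: by end_near. Qed.

Lemma measurable_clamp : measurable_fun [set: R] (@clamp R).
Proof.
apply: (measurability (@open I)); first by [].
move=> _ [U /open_uitvP[V oV <-] <-]; rewrite setTI.
rewrite -[X in measurable X]/((fun x : R => set_val (clamp x)) @^-1` V).
apply: open_measurable; apply: open_comp => // x _; exact: clamp_continuous.
Qed.

Lemma measurable_to_uitv d (T : measurableType d) (f : T -> I) :
  measurable_fun [set: T] (fun x => set_val (f x)) -> measurable_fun [set: T] f.
Proof.
move=> mf; have -> : f = (@clamp R) \o (fun x => set_val (f x)).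
  by apply/funext => x /=; rewrite set_valK.
exact: (measurableT_comp measurable_clamp mf).
Qed.

Lemma measurable_from_uitv d (T : measurableType d) (u : I -> T) :
  measurable_fun [set: R] (fun x => u (clamp x)) -> measurable_fun [set: I] u.
Proof.
move=> mu; have -> : u = (fun x => u (clamp x)) \o set_val.
  by apply/funext => x /=; rewrite set_valK.
exact: (measurableT_comp mu measurable_set_val).
Qed.

Lemma measurable_holder (g : {posnum R}) (A : R) (u : I -> R) :
  (forall x y, `|u x - u y| <= A * hdist g x y) -> measurable_fun [set: I] u.
Proof.
move=> uA; apply: measurable_from_uitv; apply: continuous_measurable_fun => x.
apply/cvgrPdist_le => e e0.
have A0 : 0 < `|A| + 1 by rewrite ltr_wpDl.
have eA : 0 < e / (`|A| + 1) by rewrite divr_gt0.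
pose dd := (e / (`|A| + 1)) `^ (g%:num)^-1.
have dd0 : 0 < dd by rewrite powR_gt0.
near=> y; apply: le_trans (uA _ _) _.
have h : hdist g (clamp x) (clamp y) <= e / (`|A| + 1).
  have -> : e / (`|A| + 1) = dd `^ g%:num.
    by rewrite /dd -powRrM mulVf// powRr1// ltW.
  apply: powR_le => //; apply: le_trans (clamp_dist x y) _.
  by near: y; apply: cvgr_dist_le => //; exact: cvg_id.
move: h; rewrite ler_pdivlMr// => h.
apply: le_trans (_ : (`|A| + 1) * hdist g (clamp x) (clamp y) <= _).
  by rewrite ler_wpM2r ?hdist_ge0//; have := ler_norm A; lra.
by rewrite mulrC.
Unshelve. all: by end_near. Qed.

Lemma bm_nrm (g : {posnum R}) (A : R) (u : I -> R) : nrm (hdist g) u A -> bm u.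
Proof. by move=> [u1 u2]; split; [exact: measurable_holder u2|exists A]. Qed.

Lemma measurable_le (c : R) : measurable [set y : I | set_val y <= c].
Proof.
rewrite -[X in measurable X]setTI.
have := measurable_set_val measurableT (measurable_itv `]-oo, c]).
by congr measurable; apply/seteqP; split => x /=; rewrite in_itv.
Qed.

(** Continuity at the empty set, the form in which sigma-additivity is asked of a functional. *)
Definition cont_fun (J : (I -> R) -> R) := forall A : nat -> set I,
  (forall n, measurable (A n)) -> (forall n, A n.+1 `<=` A n) ->
  \bigcap_n A n = set0 -> J \1_(A n) @[n --> \oo] --> (0 : R).

Lemma uitv_generated (A : set I) : measurable A ->
  <<s [set B | exists c : R, B = [set y : I | set_val y <= c]] >> A.
Proof.
set G := [set B | _].
have mG : measurable_fun (T := g_sigma_algebraType G) [set: g_sigma_algebraType G]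
   (set_val : I -> R).
  apply: (measurability (@measurable_realfun.RGenOInfty.G R)).
    exact: measurable_realfun.RGenOInfty.measurableE.
  move=> _ [_ [x ->] <-]; rewrite setTI.
  have -> : set_val @^-1` `]x, +oo[%classic = ~` [set y : I | set_val y <= x].
    by apply/seteqP; split => y /=; rewrite in_itv /= andbT ltNge => /negP.
  apply: measurableC; apply: sub_sigma_algebra; by exists x.
apply: smallest_sub; first exact: smallest_sigma_algebra.
move=> U /open_uitvP[V oV <-].
by have := mG measurableT _ (open_measurable oV); rewrite setTI.
Qed.

(** Dynkin's argument: the half-lines are stable under intersection and generate, and [cont_fun]
    handles countable disjoint unions, which positivity and linearity alone do not. *)
Lemma mposfun_eq_le (J1 J2 : (I -> R) -> R) : mposfun J1 -> mposfun J2 ->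
  cont_fun J1 -> cont_fun J2 ->
  (forall c : R, J1 \1_[set y : I | set_val y <= c] = J2 \1_[set y : I | set_val y <= c]) ->
  forall u, bm u -> J1 u = J2 u.
Proof.
move=> p1 p2 c1 c2 h12; apply: mposfun_eq => // A mA.
have iC (J : (I -> R) -> R) S : mposfun J -> measurable S -> J \1_(~` S) = 1 - J \1_S.
  move=> p mS; rewrite -{1}(mposfun_cst p 1) -(mposfunB p); last 2 first.
  - exact: bm_cst.
  - exact: bm_indic.
  congr J; apply/funext => x; rewrite !indicE in_setC.
  by case: (_ \in _); rewrite /= ?subrr ?subr0.
have G : measurable = <<s [set B | exists c : R, B = [set y : I | set_val y <= c]] >>.
  apply/seteqP; split => S; first exact: uitv_generated.
  apply: smallest_sub; first exact: sigma_algebra_measurable.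
  by move=> _ [c ->]; exact: measurable_le.
move: (uitv_generated mA).
apply: (@dynkin_induction _ I _ (fun S => J1 \1_S = J2 \1_S) G).
- move=> _ _ [c ->] [c' ->]; exists (Num.min c c').
  by apply/seteqP; split => y /=; rewrite le_min; [move=> [-> ->]|move/andP].
- by rewrite indicT; case: p1 => _ _ ->; case: p2 => _ _ ->.
- by move=> _ [c ->].
- by move=> S mS; rewrite !iC// => ->.
- move=> F mF tF hF.
  (* The tails of a disjoint family decrease to the empty set, so the difference of the two
     functionals, which is constant along the tails, vanishes. *)
  pose tail n := \bigcup_(i in [set i | (n <= i)%N]) F i.
  have mt n : measurable (tail n) by apply: bigcup_measurable.
  have key (J : (I -> R) -> R) : mposfun J -> forall n,
      J \1_(\bigcup_k F k) = \sum_(i < n) J \1_(F i) + J \1_(tail n).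
    move=> p; elim=> [|n ->].
      rewrite big_ord0 add0r; congr (J \1__).
      by apply/seteqP; split => x [i _ Fx]; exists i.
    rewrite big_ord_recr -addrA; congr (_ + _).
    rewrite -(mposfunD p); [|exact: bm_indic..].
    congr J; apply/funext => x; rewrite !indicE.
    have -> : tail n = F n `|` tail n.+1.
      apply/seteqP; split => y.
        move=> [i /= ni Fy]; have [e|ne] := eqVneq n i; first by left; rewrite e.
        by right; exists i => //=; rewrite ltn_neqAle ne.
      by move=> [Fy|[i /= ni Fy]]; [exists n => /=|exists i => //=; exact: ltnW].
    rewrite in_setU; case: (boolP (x \in F n)) => xn; case: (boolP (x \in tail n.+1)) => xt //=; rewrite ?addr0 ?add0r//.
    exfalso; move: xn xt => /set_mem xn /set_mem [i /= ni xi].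
    have := tF n i Logic.I Logic.I (ex_intro _ x (conj xn xi)).
    by move=> e; rewrite e ltnn in ni.
  have t0 (J : (I -> R) -> R) : cont_fun J -> J \1_(tail n) @[n --> \oo] --> (0 : R).
    apply => //.
      by move=> n x [i /= ni Fx]; exists i => //=; exact: ltnW.
    apply/seteqP; split => // x h; have [i /= _ Fi] := h 0%N Logic.I.
    have [j /= ij Fj] := h i.+1 Logic.I.
    have := tF i j Logic.I Logic.I (ex_intro _ x (conj Fi Fj)).
    by move=> e; rewrite e ltnn in ij.
  have : J1 \1_(tail n) - J2 \1_(tail n) @[n --> \oo] --> 0 - (0 : R).
    by apply: cvgB; exact: t0.
  have -> : (fun n => J1 \1_(tail n) - J2 \1_(tail n)) =
     fun=> J1 \1_(\bigcup_k F k) - J2 \1_(\bigcup_k F k).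
    apply/funext => n; rewrite (key J1 p1 n) (key J2 p2 n).
    by under eq_bigr do rewrite hF; ring.
  rewrite subr0 => /cvg_lim; rewrite lim_cst// => h.
  by apply/eqP; rewrite -subr_eq0 h.
Qed.

Lemma expect_cont (nu : probability I R) : cont_fun (expect nu).
Proof.
move=> A mA dA A0.
have h : nu (A n) @[n --> \oo] --> nu (\bigcap_n A n).
  apply: nonincreasing_cvg_mu => //.
  - by rewrite -ge0_fin_numE//; exact: fin_num_measure.
  - by rewrite A0.
  - apply/nonincreasing_seqP => n; apply/subsetPset; exact: dA.
have : fine (nu (A n)) @[n --> \oo] --> fine (nu (\bigcap_n A n)).
  by apply: fine_cvg; rewrite fineK// fin_num_measure// A0.
rewrite A0 measure0; under eq_fun do rewrite -expect_indic//.
by [].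
Qed.

End uitv_measurable.

Section map_measurable.
Variables (R : realType) (alpha : {posnum R}).
Local Notation I := (uitv R).
Local Notation br := (br alpha).
Local Notation im := (im alpha).
Local Notation side := (side alpha).

Lemma measurable_br b : measurable_fun [set: I] (br b).
Proof.
apply: measurable_to_uitv; apply: (@measurable_holder _ 1%:pos 1) => x y.
rewrite mul1r /hdist /= powRr1//; apply: le_trans (br_dist alpha b x y).
exact: expand_ge.
Qed.

Lemma measurable_side : is_partition side.
Proof.
have h : measurable [set x : I | side x].
  rewrite (_ : [set _ | _] = ~` [set y : I | set_val y <= cut alpha]).
    by apply: measurableC; exact: measurable_le.
  by apply/seteqP; split => x /=; rewrite -[side x]/(cut alpha < set_val x) ltNge => /negP.
case; first exact: h.
rewrite (_ : _ @^-1` _ = ~` [set x : I | side x]); first exact: measurableC.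
by apply/seteqP; split => x /=; [move=> ->|move/negP/negbTE].
Qed.

Lemma measurable_im : measurable_fun [set: I] im.
Proof.
apply: measurable_to_uitv.
have -> : (fun x : I => set_val (im x)) =
    fun x => expand alpha (set_val x) - (side x)%:R.
  by apply/funext => x; rewrite expand_im addrK.
apply: measurable_funB; last exact: (bm_label measurable_side (fun b : bool => b%:R)).1.
apply: (measurableT_comp (f := expand alpha)); last exact: measurable_set_val.
apply: measurable_funM; first exact: measurable_id.
apply: measurable_funD; first exact: measurable_cst.
exact: measurable_powR.
Qed.

Fixpoint word (n : nat) (x : I) : seq bool :=
  if n is n'.+1 then side x :: word n' (im x) else [::].

Lemma size_word n x : size (word n x) = n.
Proof. by elim: n x => //= n IH x; rewrite IH. Qed.

Lemma gs_word n x : gs br (word n x) (iter n im x) = x.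
Proof.
by elim: n x => [//|n IH] x; rewrite iterSr /= /gs /= -/(gs _ _ _) IH br_im.
Qed.

Lemma word_eq n x y : (forall i, (i < n)%N -> side (iter i im x) = side (iter i im y)) ->
  word n x = word n y.
Proof.
elim: n x y => [//|n IH] x y h /=; rewrite (h 0%N)//; congr cons; apply: IH => i ni.
by rewrite -!iterSr; exact: h.
Qed.

Lemma word_join n x y : iterated_join im side n x = iterated_join im side n y ->
  word n x = word n y.
Proof.
move=> e; apply: word_eq => i ni.
by have := congr1 (fun w : {ffun 'I_n -> bool} => w (Ordinal ni)) e; rewrite !ffunE.
Qed.

Lemma join_dist n x y : iterated_join im side n x = iterated_join im side n y ->
  `|set_val x - set_val y| <= cyl alpha n.
Proof.
move=> /word_join e; rewrite -(gs_word n x) -(gs_word n y) e.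
by have := gs_dist alpha (word n y) (iter n im x) (iter n im y); rewrite size_word.
Qed.

(** Diameters of cylinders tend to [0], so an open set is the countable union of the cylinders that
    it contains. *)
Lemma side_generates (A : set I) : measurable A ->
  <<s [set B | exists m (S : {ffun 'I_m -> bool} -> bool),
         B = [set x | S (iterated_join im side m x)]] >> A.
Proof.
set G := [set B | _].
apply: smallest_sub; first exact: smallest_sigma_algebra.
move=> U oU.
pose S m (w : {ffun 'I_m -> bool}) := `[< forall y, iterated_join im side m y = w -> U y >].
have -> : U = \bigcup_m [set x | S m (iterated_join im side m x)].
  apply/seteqP; split => x; last by move=> [m _ /asboolP]; exact.
  move=> Ux; have /open_uitvP[V oV VU] := oU.
  have Vx : V (set_val x) by move: Ux; rewrite -VU.
  have /nbhs_ballP[e e0 eV] : nbhs (set_val x) V by exact: open_nbhs_nbhs.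
  have [N hN] := cyl_small alpha (divr_gt0 e0 (ltr0n R 2 : 0 < 2%:R)).
  exists N => //; apply/asboolP => y /esym/join_dist h.
  rewrite -VU /=; apply: eV; rewrite /ball /=; apply: le_lt_trans h _.
  by apply: le_lt_trans (hN N (leqnn N)) _; move: e0 => /=; lra.
have [S0 SC SU] := smallest_sigma_algebra [set: I] G.
apply: SU => m; apply: sub_sigma_algebra; by exists m, (S m).
Qed.

End map_measurable.

(** * Recovering a measure from a functional *)

Section lower_sets.
Variable R : realType.
Local Notation I := (uitv R).

Definition low (c : R) (y : I) : R := (set_val y <= c)%R%:R.

Lemma low_indic c : low c = \1_[set y : I | set_val y <= c].
Proof.
apply/funext => y; rewrite indicE /low; congr (_%:R); apply: congr1.
by apply/idP/idP => [h|/set_mem//]; exact: mem_set.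
Qed.

Lemma bm_low c : bm (low c).
Proof. by rewrite low_indic; apply: bm_indic; exact: measurable_le. Qed.

Lemma lowM a c y : low a y * low c y = low (Num.min a c) y.
Proof. by rewrite /low le_min -natrM mulnb. Qed.

Definition iv (a b : R) (y : I) : R := ((a < set_val y) && (set_val y <= b))%R%:R.

Lemma iv_low a b y : a <= b -> iv a b y = low b y - low a y.
Proof.
move=> ab; rewrite /iv /low; case: (leP (set_val y) a) => h /=.
  by rewrite (le_trans h ab) subrr.
by rewrite subr0.
Qed.

Lemma iv01 a b y : 0 <= iv a b y <= 1.
Proof. by rewrite /iv ler0n lern1 leq_b1. Qed.

(* Step functions approximate a Hölder function uniformly. *)
Lemma mposfun_low_holder (g : {posnum R}) (J1 J2 : (I -> R) -> R) :
  mposfun J1 -> mposfun J2 -> (forall c, J1 (low c) = J2 (low c)) ->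
  forall v A c, nrm (hdist g) v A ->
    J1 (fun y => v y * low c y) = J2 (fun y => v y * low c y).
Proof.
move=> p1 p2 J12 v A c nv; have bv := bm_nrm nv; have [_ vA] := nv.
have A0 : 0 <= A by apply: le_trans (nv.1 (uitv0 R)).
have bvc : bm (fun y => v y * low c y) by exact: bmM (bm_low c).
apply/eqP; rewrite -subr_eq0 -normr_le0; apply/ler_addgt0Pr => e e0; rewrite add0r.
pose dd := (e / (2 * (A + 1))) `^ (g%:num)^-1.
have A1 : 0 < A + 1 by rewrite ltr_wpDl.
have dd0 : 0 < dd by rewrite powR_gt0// divr_gt0// mulr_gt0.
have [N hN] : exists N, dd^-1 < N%:R.
  by exists (Num.bound dd^-1); apply: archi_boundP; rewrite invr_ge0 ltW.
have N0 : 0 < N%:R :> R by apply: lt_trans hN; rewrite invr_gt0.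
have Nd : N%:R^-1 <= dd.
  by rewrite -[dd]invrK lef_pV2 ?posrE ?invr_gt0// ltW.
pose t (k : nat) : R := k%:R / N%:R.
have tS k : t k <= t k.+1 by rewrite ler_pM2r ?invr_gt0// ler_nat.
pose F k y : R := v (clamp (t k)) * (low (Num.min (t k.+1) c) y - low (Num.min (t k) c) y).
have bF k : bm (F k) by apply: bmZ; apply: bmB; exact: bm_low.
pose s0 y : R := v (uitv0 R) * low (Num.min 0 c) y.
have bs0 : bm s0 by apply: bmZ; exact: bm_low.
pose s y : R := \sum_(k < N) F k y + s0 y.
have bsum : bm (fun y => \sum_(k < N) F k y) by apply: bm_sum => k _; exact: bF.
have bs : bm s by exact: bmD.
have Js : J1 s = J2 s.
  rewrite /s (mposfunD p1 bsum bs0) (mposfunD p2 bsum bs0).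
  rewrite (mposfun_sum p1 (fun k _ => bF k)) (mposfun_sum p2 (fun k _ => bF k)).
  rewrite /s0 (mposfunZ p1 _ (bm_low _)) (mposfunZ p2 _ (bm_low _)) J12.
  congr (_ + _); apply: eq_bigr => k _.
  rewrite /F (mposfunZ p1 _ (bmB (bm_low _) (bm_low _))) (mposfunZ p2 _ (bmB (bm_low _) (bm_low _))).
  by rewrite (mposfunB p1 (bm_low _) (bm_low _)) (mposfunB p2 (bm_low _) (bm_low _)) !J12.
have us y : `|v y * low c y - s y| <= e / 2.
  have -> : v y * low c y - s y =
      (v y - (\sum_(k < N) v (clamp (t k)) * iv (t k) (t k.+1) y + v (uitv0 R) * low 0 y)) * low c y.
    rewrite mulrBl mulrDl mulr_suml /s /s0 -lowM; congr (_ - (_ + _)); last by rewrite mulrA.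
    by apply: eq_bigr => k _; rewrite /F -!lowM -mulrBl mulrA iv_low.
  rewrite normrM; apply: le_trans (_ : `|v y - (\sum_(k < N) v (clamp (t k)) * iv (t k) (t k.+1) y + v (uitv0 R) * low 0 y)| <= _).
    by rewrite ler_piMr// ger0_norm /low ?ler0n// lern1 leq_b1.
  have [y0|y0] := leP (set_val y) 0.
    have ye : y = uitv0 R by apply/uitv_inj/eqP; rewrite eq_le y0 uitv_ge0.
    rewrite big1 => [|k _].
      by rewrite add0r /low y0 mulr1 ye subrr normr0 divr_ge0// ltW.
    rewrite /iv ltNge (le_trans y0) ?mulr0//; by rewrite divr_ge0.
  have hex : exists k, set_val y <= t k.
    by exists N; rewrite /t divff ?gt_eqF// uitv_le1.
  pose k := ex_minn hex; have : set_val y <= t k /\ forall j, set_val y <= t j -> (k <= j)%N.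
    by rewrite /k; case: ex_minnP.
  clearbody k; case: k => [|k] [k1 k2].
    by move: k1; rewrite /t mul0r leNgt y0.
  have k3 : t k < set_val y by rewrite ltNge; apply/negP => /k2; rewrite ltnn.
  have kN : (k < N)%N by apply: k2; rewrite /t divff ?gt_eqF// uitv_le1.
  rewrite (bigD1 (Ordinal kN)) //= big1 => [|i ik].
    have -> : iv (t k) (t k.+1) y = 1 by rewrite /iv k3 k1.
    have -> : low 0 y = 0 by rewrite /low leNgt y0.
    rewrite mulr1 mulr0 !addr0.
    apply: le_trans (vA _ _) _.
    have t01 : 0 <= t k <= 1.
      rewrite divr_ge0//= ler_pdivrMr// mul1r ler_nat; exact: ltnW.
    have h : hdist g y (clamp (t k)) <= e / (2 * (A + 1)).
      have -> : e / (2 * (A + 1)) = dd `^ g%:num.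
        by rewrite /dd -powRrM mulVf// powRr1// ltW// divr_gt0// mulr_gt0.
      apply: powR_le => //; rewrite clampE//; apply: le_trans Nd.
      rewrite ger0_norm ?subr_ge0 ?(ltW k3)//.
      rewrite lerBlDl; apply: le_trans k1 _; apply: eq_refl_le.
      by rewrite /t -natr1 mulrDl mul1r.
    apply: le_trans (_ : (A + 1) * (e / (2 * (A + 1))) <= _).
      by apply: ler_pM => //; [exact: hdist_ge0|rewrite lerDl].
    by apply: eq_refl_le; field; rewrite gt_eqF.
  move: ik; rewrite -val_eqE /= neq_ltn => /orP[ik|ki].
    rewrite /iv [X in _ && X]leNgt.
    have -> : t i.+1 < set_val y by apply: le_lt_trans k3; rewrite ler_pM2r ?invr_gt0// ler_nat.
    by rewrite andbF mulr0.
  have h : set_val y <= t i.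
    by apply: le_trans k1 _; rewrite ler_pM2r ?invr_gt0// ler_nat.
  by rewrite /iv ltNge h /= mulr0.
have -> : J1 (fun y => v y * low c y) - J2 (fun y => v y * low c y) =
   J1 (fun y => v y * low c y - s y) - J2 (fun y => v y * low c y - s y).
  by rewrite (mposfunB p1)// (mposfunB p2)// Js; ring.
apply: le_trans (ler_normB _ _) _.
apply: le_trans (_ : e / 2 + e / 2 <= e); last by apply: eq_refl_le; field.
by apply: lerD; [apply: (mposfun_norm p1)|apply: (mposfun_norm p2)] => //; exact: bmB.
Qed.

End lower_sets.

Section gmeasure.
Variables (R : realType) (alpha g : {posnum R}).
Local Notation I := (uitv R).
Local Notation br := (br alpha).
Variables (p : bool -> I -> R) (mu : (I -> R) -> R) (e0 K : R).
Hypotheses (pmu : posfun mu) (mu_inv : forall u, bdd u -> mu (tr br p u) = mu u).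
Hypotheses (p_sum : forall x, p false x + p true x = 1).
Hypotheses (e0_gt0 : 0 < e0) (p_ge : forall b x, e0 <= p b x).
Hypothesis pK : forall b, nrm (hdist g) (p b) K.

Let p_le b x : p b x <= 1 - e0.
Proof.
by have := p_sum x; have := p_ge (~~ b) x; case: b => /=; lra.
Qed.

Let e01 : 0 <= 1 - e0 < 1.
Proof.
have := p_le false (uitv0 R); have := p_ge false (uitv0 R); move: e0_gt0.
by move=> a b c; apply/andP; split; lra.
Qed.

Let bdd_iv a b : bdd (@iv R a b).
Proof. by apply: (@bddP _ _ _ 0 1) => x; exact: iv01. Qed.

(** An interval inside the range of one branch is invisible to the other one. The strict bounds on
    [y] and [t] exclude the endpoints at which the two ranges meet. *)
Lemma branch_iv (c b : bool) (x y t z : R) w : 0 <= x -> 0 <= y < 1 -> t < 1 -> expand alpha x = y + b%:R ->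
  0 <= z -> expand alpha z = t + b%:R ->
  iv x z (br c w) = (c == b)%:R * iv y t w.
Proof.
move=> x0 /andP[y0 y1] t1 Fx z0 Fz; rewrite /iv.
have E1 : (x < set_val (br c w)) = (y + b%:R < set_val w + c%:R).
  by rewrite ltNge -(expand_leE alpha (uitv_ge0 _) x0) brP Fx -ltNge.
have E2 : (set_val (br c w) <= z) = (set_val w + c%:R <= t + b%:R).
  by rewrite -(expand_leE alpha (uitv_ge0 _) z0) brP Fz.
rewrite {}E1 {}E2; have w0 := uitv_ge0 w; have w1 := uitv_le1 w.
case: eqP => [->|]; first by rewrite ltrD2r lerD2r mul1r.
case: c; case: b {Fx Fz} => //= _; rewrite mul0r ?addr0.
  by rewrite [X in _ && X]leNgt (_ : t < set_val w + 1) ?andbF//; lra.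
by rewrite ltNge (_ : set_val w <= y + 1) //; lra.
Qed.

(** By invariance, a short interval has at most [1 - e0] times the mass of its image, because only
    one branch reaches it. Iterating [n] times excludes jumps of the distribution function from the
    right. *)
Lemma iv_small n (x : R) : 0 <= x < 1 ->
  exists2 e : R, 0 < e & mu (iv x (x + e)) <= (1 - e0) ^+ n.
Proof.
elim: n x => [|n IH] x /andP[x0 x1].
  exists 1 => //; apply: (posfun_ub pmu) => // y; by case/andP: (iv01 x (x + 1) y).
pose b := cut alpha <= x.
pose y := expand alpha x - b%:R.
have y01 : 0 <= y < 1.
  rewrite /y /b; have c0 := ltW (cut_gt0 alpha).
  case: (leP (cut alpha) x) => xc /=.
    rewrite subr_ge0 -{1}(expand_cut alpha) expand_le//=.
    by have := expand_lt alpha x0 x1; rewrite expand1; lra.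
  rewrite subr0 (le_trans x0 (expand_ge alpha x0))/=.
  by rewrite -(expand_cut alpha) expand_lt.
have [e' e'0 he'] := IH _ y01.
have /andP[y0 y1] := y01.
(* Capping below [1] keeps the preimage interval inside the range of the branch [b]. *)
pose t := Num.min (y + e') ((y + 1) / 2).
have yt : y < t by rewrite lt_min; apply/andP; split; lra.
have t1 : t < 1.
  by apply: le_lt_trans (_ : (y + 1) / 2 < 1); [rewrite ge_min lexx orbT|lra].
have tb : 0 <= t + b%:R <= 2 by case: (b) => /=; apply/andP; split; lra.
have [z /andP[z0 z1] Fz] := expand_surj alpha tb.
have Fx : expand alpha x = y + b%:R by rewrite /y subrK.
have xz : x < z.
  by rewrite ltNge -(expand_leE alpha z0 x0) Fx Fz lerD2r -ltNge.
exists (z - x); first by rewrite subr_gt0.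
rewrite [x + _]addrC subrK -mu_inv//.
apply: le_trans (_ : mu (fun w => (1 - e0) * iv y (y + e') w) <= _).
  apply: (posfun_le pmu).
  - apply: bddD; apply: bddM; try by exists K => ?; exact: (pK _).1.
    + by apply: (@bddP _ _ _ 0 1) => ?; exact: iv01.
    + by apply: (@bddP _ _ _ 0 1) => ?; exact: iv01.
  - exact: bddZ.
  - move=> w; rewrite /tr !(branch_iv _ w x0 y01 t1 Fx z0 Fz).
    have h : iv y t w <= iv y (y + e') w.
      rewrite /iv ler_nat; case: (y < _) => //=.
      case: (leP _ t) => // h; rewrite (le_trans h)// ge_min lexx//.
    have i0 : 0 <= iv y t w by case/andP: (iv01 y t w).
    have [pf pt] := (p_le false w, p_le true w).
    have [qf qt] := (le_trans (ltW e0_gt0) (p_ge false w), le_trans (ltW e0_gt0) (p_ge true w)).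
    by case: (b) => /=; rewrite ?mul0r ?mulr0 ?mul1r ?addr0 ?add0r; apply: ler_pM.
rewrite (posfunZ pmu)// exprS ler_wpM2l//.
by case/andP: e01.
Qed.

(** The function [mu (low r)] of [r] is right-continuous by [iv_small], hence a distribution
    function. The measure it defines agrees with [mu] on Hölder functions, which are uniform limits
    of step functions; a finitely additive [mu] need not agree with it further. Invariance under the
    operator is therefore proved for the measure anew, on half-lines. *)
Lemma gmeasure : exists nu : probability I R,
  (forall u, bm u -> expect nu u = expect nu (tr br p u)) /\
  (forall u A, nrm (hdist g) u A -> expect nu u = mu u).
Proof.
have bl (c : R) : bdd (@low R c) by exact: (bm_low c).2.
pose F (r : R) : R := mu (low r).
have Fnd : {homo F : x y / x <= y}.
  move=> x y xy; apply: (posfun_le pmu) => // w.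
  by rewrite /low ler_nat; case: leP => // h; rewrite (le_trans h xy).
have F0 r : r < 0 -> F r = 0.
  move=> r0; rewrite /F -(posfun0 pmu); congr mu; apply/funext => w.
  by rewrite /low leNgt (lt_le_trans r0)// uitv_ge0.
have F1 r : 1 <= r -> F r = 1.
  move=> r1; rewrite /F -(posfun_cst pmu 1); congr mu; apply/funext => w.
  by rewrite /low (le_trans (uitv_le1 w)).
have Frc : right_continuous F.
  move=> x; apply/cvgrPdist_le => e e_gt0.
  have [x0|x0] := ltP x 0.
    near=> y; have y0 : y < 0 by near: y; exact: nbhs_right_lt.
    by rewrite (F0 x)// (F0 y)// subrr normr0 ltW.
  have [x1|x1] := leP 1 x.
    near=> y; have xy : x <= y by near: y; exact: nbhs_right_ge.
    by rewrite (F1 x)// (F1 y) ?(le_trans x1)// subrr normr0 ltW.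
  have [n hn] := expr_lt_ex e01 e_gt0.
  have x01 : 0 <= x < 1 by apply/andP.
  have [e' e'0 he'] := iv_small n x01.
  near=> y.
  have xy : x <= y by near: y; exact: nbhs_right_ge.
  have yx : y <= x + e' by near: y; apply: nbhs_right_le; rewrite ltrDl.
  rewrite distrC ger0_norm ?subr_ge0 ?Fnd//.
  rewrite /F -(posfunB pmu)//; apply: le_trans (_ : mu (iv x (x + e')) <= _); last first.
    exact: le_trans he' (ltW hn).
  apply: (posfun_le pmu) => //; first exact: bddB.
  move=> w; rewrite -iv_low// /iv ler_nat; case: (x < _) => //=.
  by case: leP => // h; rewrite (le_trans h).
have FNy : F x @[x --> -oo] --> (0 : R).
  apply/cvgrPdist_le => e e_gt0; near=> y.
  have y0 : y < 0 by near: y; exact: nbhs_ninfty_lt.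
  by rewrite (F0 y)// subrr normr0 ltW.
have Fy : F x @[x --> +oo] --> (1 : R).
  apply/cvgrPdist_le => e e_gt0; near=> y.
  have y1 : 1 <= y by near: y; exact: nbhs_pinfty_ge.
  by rewrite (F1 y)// subrr normr0 ltW.
pose M1 := isCumulative.Build R _ R F Fnd Frc.
pose M2 := isCumulativeBounded.Build R 0 1 F FNy Fy.
pose FC : cumulativeBounded (0 : R) (1 : R) := HB.pack F M1 M2.
pose P : probability _ R := lebesgue_stieltjes_measure FC.
pose X : {mfun measurableTypeR R >-> I} :=
  HB.pack (@clamp R) (@isMeasurableFun.Build _ _ (measurableTypeR R) I (@clamp R) (@measurable_clamp R)).
pose nu : probability I R := distribution P X.
have nu_low c : expect nu (low c) = mu (low c).
  rewrite low_indic expect_indic; last exact: measurable_le.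
  rewrite -low_indic -/(F c).
  have [c0|c0] := ltP c 0.
    rewrite F0// (_ : [set y : I | _] = set0) ?measure0//.
    by apply/seteqP; split => // y /=; rewrite leNgt (lt_le_trans c0)// uitv_ge0.
  have [c1|c1] := leP 1 c.
    rewrite F1// (_ : [set y : I | _] = setT) ?probability_setT//.
    by apply/seteqP; split => // y _ /=; rewrite (le_trans (uitv_le1 y)).
  have := cdf_lebesgue_stieltjes_id FC c; rewrite /cdf /distribution /pushforward /=.
  move=> h; rewrite -[RHS]/(fine (F c)%:E) -h; congr (fine (lebesgue_stieltjes_measure _ _)).
  apply/seteqP; split => y /=; rewrite in_itv /= -[set_val _]/(Num.min (Num.max y 0) 1).
    by rewrite ge_min ge_max (leNgt 1) c1 orbF => /andP[].
  by move=> yc; rewrite ge_min ge_max yc c0.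
exists nu.
have pE := expect_pos nu.
have pm : mposfun mu.
  case: pmu => lin pos m1; split => // [a u v bu bv|u bu u0].
    by apply: lin; [exact: bu.2|exact: bv.2].
  by apply: pos => //; exact: bu.2.
have agree := mposfun_low_holder (g := g) pE pm nu_low.
split; last first.
  move=> u A nu_; have := agree u A 1 nu_.
  have -> // : (fun y => u y * low 1 y) = u.
  by apply/funext => y; rewrite /low uitv_le1 mulr1.
have bp b : bm (p b) by exact: bm_nrm (pK b).
have bt u : bm u -> bm (tr br p u).
  by move=> bu; apply: bmD; apply: bmM => //; apply: bm_comp => //; exact: measurable_br.
(* The functionals compared are the expectation and its composition with the operator. *)
apply: mposfun_eq_le => //.
- split=> [a u v bu bv|u bu u0|].
  + rewrite -(mposfunZ pE); last exact: bt.
    rewrite -(mposfunD pE); last exact: bt.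
      by congr expect; apply/funext => x; rewrite /tr; ring.
    by apply: bmZ; exact: bt.
  + case: pE => _ pos _; apply: pos; first exact: bt.
    move=> x; rewrite /tr addr_ge0// mulr_ge0//; exact: le_trans (ltW e0_gt0) (p_ge _ _).
  + rewrite -[RHS](mposfun_cst pE 1); congr expect; apply/funext => x.
    by rewrite /tr !mulr1 p_sum.
- exact: expect_cont.
- move=> A mA dA A0.
  have mb b n : measurable (br b @^-1` A n).
    by rewrite -[X in measurable X]setTI; exact: measurable_br.
  have hb b : expect nu \1_(br b @^-1` A n) @[n --> \oo] --> (0 : R).
    apply: expect_cont => //; first by move=> n x; exact: dA.
    by rewrite -preimage_bigcap A0 preimage_set0.
  have hs : expect nu \1_(br false @^-1` A n) + expect nu \1_(br true @^-1` A n) @[n --> \oo] --> (0 : R).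
    by rewrite -[X in _ --> X](addr0 0); apply: cvgD; exact: hb.
  apply: (squeeze_cvgr _ (cvg_cst 0) hs); near=> n.
  have bi : bm (\1_(A n) : I -> R) by exact: bm_indic.
  apply/andP; split.
    case: pE => _ pos _; apply: pos; first exact: bt.
    move=> x; rewrite /tr addr_ge0// mulr_ge0//; exact: le_trans (ltW e0_gt0) (p_ge _ _).
  rewrite -(mposfunD pE); [|exact: bm_indic..].
  apply: (mposfun_le pE); first exact: bt.
    by apply: bmD; exact: bm_indic.
  move=> x; rewrite /tr; apply: lerD; rewrite -[leRHS]mul1r;
    (apply: ler_wpM2r; first by rewrite indicE);
    by have := p_le _ x : p false x <= _; have := p_le true x; case/andP: e01; lra.
- move=> c; rewrite -low_indic nu_low -mu_inv//.
  have [c0|c0] := ltP c 0.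
    have -> : tr br p (low c) = fun=> 0.
      apply/funext => x; rewrite /tr /low !leNgt !(lt_le_trans c0 (uitv_ge0 _)).
      by rewrite !mulr0 addr0.
    by rewrite (mposfun0 pE) (mposfun0 pm).
  (* The preimages of a half-line under the two branches are half-lines, so the operator yields
     products of a Hölder weight and a [low], on which [mu] and the measure agree. *)
  have -> : tr br p (low c) = fun x =>
      p false x * low (expand alpha c) x + p true x * low (expand alpha c - 1) x.
    apply/funext => x; rewrite /tr /low.
    by rewrite -!(expand_leE alpha (uitv_ge0 _) c0) !brP addr0 lerBrDr.
  rewrite (mposfunD pE); [|exact: bmM (bm_low _)..].
  rewrite (mposfunD pm); [|exact: bmM (bm_low _)..].
  by rewrite !(agree _ K).
Unshelve. all: by end_near. Qed.

End gmeasure.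

(** * The variational principle *)

Section words.
Variables (R : realType) (alpha g : {posnum R}).
Local Notation I := (uitv R).
Local Notation br := (br alpha).
Local Notation im := (im alpha).
Local Notation side := (side alpha).
Local Notation word := (word alpha).
Local Notation join n x := (iterated_join im side n x).

Fixpoint words (n : nat) : seq (seq bool) :=
  if n is n'.+1 then [seq false :: w | w <- words n'] ++ [seq true :: w | w <- words n']
  else [:: [::]].

Lemma mem_words n w : (w \in words n) = (size w == n).
Proof.
elim: n w => [|n IH] w /=; first by rewrite inE; case: w.
rewrite mem_cat; case: w => [|b w] /=.
  by apply/negbTE; rewrite negb_or; apply/andP; split; apply/mapP => -[].
rewrite eqSS -IH; apply/orP/idP; first by case=> /mapP[v hv [_ ->]].
by move=> h; case: b; [right|left]; apply/mapP; exists w.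
Qed.

Lemma uniq_words n : uniq (words n).
Proof.
elim: n => //= n IH; rewrite cat_uniq !map_inj_uniq ?IH ?andbT //=; try by move=> ? ? [].
by apply/hasPn => _ /mapP[w _ ->]; apply/mapP => -[].
Qed.

Lemma sum_words n (F : seq bool -> R) :
  \sum_(l : {ffun 'I_n -> bool}) F (codom l) = \sum_(w <- words n) F w.
Proof.
rewrite -big_enum /= -(big_map (fun l : {ffun 'I_n -> bool} => codom l) xpredT F).
apply: perm_big; apply: uniq_perm; last 1 first.
- move=> w; rewrite mem_words; apply/mapP/eqP => [[l _ ->]|sw].
    by rewrite size_codom card_ord.
  exists [ffun i => nth false w (i : 'I_n)]; first by rewrite mem_enum.
  apply: (@eq_from_nth _ false); first by rewrite size_codom card_ord.
  move=> i; rewrite sw => ni; rewrite codomE (nth_map (Ordinal ni)) ?size_enum_ord//.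
  by rewrite ffunE nth_enum_ord.
- rewrite map_inj_in_uniq ?enum_uniq// => l l' _ _ e; apply/ffunP => i.
  by move: e; rewrite !codomE => /eq_in_map; apply; rewrite mem_enum.
- exact: uniq_words.
Qed.

Lemma wordE n x : word n x = [seq side (iter i im x) | i <- iota 0 n].
Proof.
elim: n x => [//|n IH] x /=; congr cons; rewrite IH (iotaDl 1 0) -map_comp.
by apply: eq_map => i /=; rewrite -iterSr.
Qed.

Lemma codom_join n x : codom (join n x) = word n x.
Proof.
rewrite wordE -val_enum_ord -map_comp codomE.
by apply: eq_map => i; rewrite ffunE.
Qed.

Section potential.
Variable phi : I -> R.

Definition birk n (x : I) : R := \sum_(i < n) phi (iter i im x).

(** The Birkhoff sum of [phi] over the [size w] points of the orbit leading from [gs br w y] to [y],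
    without [y] itself. *)
Fixpoint wS (w : seq bool) (y : I) : R :=
  if w is b :: w' then phi (gs br w y) + wS w' y else 0.

Definition wt (b : bool) (x : I) : R := expR (phi (br b x)).

Lemma birkS n x : birk n.+1 x = phi x + birk n (im x).
Proof.
by rewrite /birk big_ord_recl; congr (_ + _); apply: eq_bigr => i _; rewrite /= -iterSr.
Qed.

Lemma wS_birk n x : wS (word n x) (iter n im x) = birk n x.
Proof.
elim: n x => [|n IH] x; first by rewrite /birk big_ord0.
have e := gs_word alpha n.+1 x; rewrite iterSr in e.
transitivity (phi (gs br (word n.+1 x) (iter n im (im x))) + wS (word n (im x)) (iter n im (im x))).
  by rewrite iterSr.
by rewrite e IH -birkS.
Qed.

Lemma iter_tr_words n u y : iter n (tr br wt) u y =
  \sum_(w <- words n) expR (wS w y) * u (gs br w y).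
Proof.
elim: n u => [|n IH] u; first by rewrite /= big_seq1 /= expR0 mul1r.
rewrite iterSr IH /= big_cat !big_map /= -big_split /=.
by apply: eq_bigr => w _; rewrite /tr /wt !expRD; ring.
Qed.

Variable A : R.
Hypothesis phiA : nrm (hdist g) phi A.

(** Bounds, up to the factor [A], the distortion of [wS] on words of length [n]. Near a neutral
    fixed point it may be unbounded in [n]. *)
Definition dsum n : R := \sum_(i < n) cylh alpha g i.+1.

Lemma wS_dist w x y : `|wS w x - wS w y| <= A * dsum (size w).
Proof.
have A0 : 0 <= A by apply: le_trans (phiA.1 (uitv0 R)).
elim: w => [|b w IH]; first by rewrite /= subrr normr0 /dsum big_ord0 mulr0.
have -> : wS (b :: w) x - wS (b :: w) y =
   (wS w x - wS w y) + (phi (gs br (b :: w) x) - phi (gs br (b :: w) y)) by rewrite /=; ring.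
rewrite /dsum big_ord_recr mulrDr; apply: le_trans (ler_normD _ _) _; apply: lerD => //.
apply: le_trans (phiA.2 _ _) _; rewrite ler_wpM2l//.
exact: (hdist_gs alpha g (b :: w)).
Qed.

(** Sublinear growth suffices wherever only exponential rates matter: the terms tend to [0]. *)
Lemma dsum_small (e : R) : 0 < e -> exists2 C : R, 0 <= C & forall n, dsum n <= C + e * n%:R.
Proof.
move=> e0; have [N hN] := cylh_small alpha g e0.
exists N%:R => // n; rewrite /dsum; elim: n => [|n IH].
  by rewrite big_ord0 mulr0 addr0.
rewrite big_ord_recr /= -natr1 mulrDr mulr1.
have [Nn|nN] := leqP N n.
  by have := hN n.+1 (leqW Nn); move: IH; lra.
apply: le_trans (_ : n.+1%:R <= _); last first.
  apply: le_trans (_ : N%:R <= _); first by rewrite ler_nat.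
  by rewrite lerDl addr_ge0// ?mulr_ge0// ltW.
rewrite -(big_ord_recr n (fun i : 'I_n.+1 => cylh alpha g i.+1)).
apply: le_trans (ler_sum _ (fun i _ => _ : _ <= 1)) _.
  move=> i _; rewrite /cylh powR_le1// cyl_ge0 /=.
  by rewrite -(cyl0 alpha) cyl_anti.
by rewrite sumr_const card_ord.
Qed.

Lemma wS_word n x y : `|wS (word n x) y - birk n x| <= A * dsum n.
Proof. by have := wS_dist (word n x) y (iter n im x); rewrite size_word wS_birk. Qed.

Lemma bm_phi : bm phi. Proof. exact: bm_nrm phiA. Qed.

Lemma wt_bound : exists2 c : R, 0 < c & exists C : R, forall b x, c <= wt b x <= C.
Proof.
exists (expR (- A)); first exact: expR_gt0.
exists (expR A) => b x; rewrite /wt !ler_expR.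
by rewrite -ler_norml; exact: phiA.1.
Qed.

Section invariant.
Variable nu : probability I R.
Hypothesis inv : invariant_measure im nu.

Let mim := measurable_im alpha.

Lemma bm_birk n : bm (birk n).
Proof.
apply: (bm_sum (F := fun i x => phi (iter i im x))) => i _; apply: (bm_comp (f := iter i im)); last exact: bm_phi.
exact: measurable_iter.
Qed.

Lemma expect_birk n : expect nu (birk n) = n%:R * expect nu phi.
Proof.
rewrite (mposfun_sum (expect_pos nu) (F := fun i x => phi (iter i im x))); last first.
  move=> i _; apply: (bm_comp (f := iter i im)); last exact: bm_phi.
  exact: measurable_iter.
under eq_bigr do rewrite (expect_iter mim inv _ bm_phi).
by rewrite sumr_const card_ord -[LHS]mulr_natl.
Qed.

Lemma entropyE_side : entropy nu im = (entropy_wrt nu im side)%:E.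
Proof.
apply: entropy_generator => //; [exact: measurable_side|exact: side_generates|exact: uitv0].
Qed.

Lemma free_energyE : free_energy im phi nu = (entropy_wrt nu im side + expect nu phi)%:E.
Proof. by rewrite /free_energy entropyE_side expectE//; exact: bm_phi. Qed.

Lemma entropy_wrt_side_ge0 : 0 <= entropy_wrt nu im side.
Proof.
have [h _] := entropy_wrt_lim mim inv (measurable_side alpha).
apply: (ler_cvg_to (cvg_cst 0) h); apply: nearW => n.
by rewrite divr_ge0// entropy_ge0//; apply: partition_join => //; exact: measurable_side.
Qed.

Lemma entropy_word_le n (F : seq bool -> R) :
  \sum_(w <- words n) expR (F w) <= 1 ->
  partition_entropy nu (iterated_join im side n) <= - expect nu (fun x => F (word n x)).
Proof.
move=> F1; have pj := partition_join mim (measurable_side alpha) (n := n).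
have := @entropy_le _ _ _ nu _ _ (fun l : {ffun 'I_n -> bool} => expR (F (codom l))) pj.
move=> /(_ (fun l => expR_ge0 _) (fun l _ => expR_gt0 _)).
rewrite (sum_words n (fun w => expR (F w))) => /(_ F1).
have -> // : (fun x => ln (expR (F (codom (iterated_join im side n x))))) = fun x => F (word n x).
by apply/funext => x; rewrite expRK codom_join.
Qed.

Lemma bm_word n (F : seq bool -> R) : bm (fun x => F (word n x)).
Proof.
have pj := partition_join mim (measurable_side alpha) (n := n).
have := bm_label (R := R) pj (fun l : {ffun 'I_n -> bool} => F (codom l)).
by have -> : (fun x => F (codom (iterated_join im side n x))) = fun x => F (word n x)
  by apply/funext => x; rewrite codom_join.
Qed.

(** The competitor in Gibbs' inequality gives a word the weight [expR (wS w 0) / Z], with [Z] the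
    iterate of [1] at [0]. The growth rate of [Z] is at most [lam], and replacing [wS] by Birkhoff
    sums costs only [dsum]. *)
Lemma variational_ub : entropy_wrt nu im side + expect nu phi <= ln (lam br wt).
Proof.
have [c c_gt0 [C Wc]] := wt_bound.
have A0 : 0 <= A by apply: le_trans (phiA.1 (uitv0 R)).
have l0 := lam_gt0 (uitv0 R) c_gt0 Wc.
rewrite -lerBrDr; apply: (entropy_wrt_le mim inv (measurable_side alpha)) => e e0.
have s0 : lam br wt < lam br wt * expR (e / 2).
  by rewrite ltr_pMr// -expR0 ltr_expR divr_gt0.
have [M M0 hM] := iter_tr_lam (uitv0 R) c_gt0 Wc s0.
have [D D0 hD] := dsum_small (divr_gt0 e0 (mulr_gt0 (ltr0n R 2 : 0 < 2%:R) (ltr_wpDl A0 ltr01))).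
exists (ln M + A * D) => n.
pose Z := iter n (tr br wt) (fun=> 1) (uitv0 R).
have ZE : Z = \sum_(w <- words n) expR (wS w (uitv0 R)).
  by rewrite /Z iter_tr_words; apply: eq_bigr => w _; rewrite mulr1.
have ZM : Z <= M * (lam br wt * expR (e / 2)) ^+ n by exact: hM.
have Z0 : 0 < Z.
  rewrite ZE; have : nseq n false \in words n by rewrite mem_words size_nseq.
  move=> /(big_rem _) ->; apply: ltr_pwDl; first exact: expR_gt0.
  by apply: sumr_ge0 => w _; exact: expR_ge0.
have lnZ : ln Z <= ln M + n%:R * (ln (lam br wt) + e / 2).
  apply: le_trans (_ : ln (M * (lam br wt * expR (e / 2)) ^+ n) <= _).
    by rewrite ler_ln ?posrE// mulr_gt0// exprn_gt0// mulr_gt0// expR_gt0.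
  rewrite lnM ?posrE ?exprn_gt0 ?mulr_gt0 ?expR_gt0//.
  rewrite lnXn ?mulr_gt0 ?expR_gt0// lnM ?posrE ?expR_gt0// expRK.
  by rewrite mulr_natl.
have h := @entropy_word_le n (fun w => wS w (uitv0 R) - ln Z).
have h1 : \sum_(w <- words n) expR (wS w (uitv0 R) - ln Z) <= 1.
  under eq_bigr do rewrite expRD expRN lnK ?posrE//.
  by rewrite -mulr_suml -ZE divff// gt_eqF.
have h2 : n%:R * expect nu phi - (A * dsum n + ln Z) <=
    expect nu (fun x => wS (word n x) (uitv0 R) - ln Z).
  rewrite -expect_birk -(mposfun_cst (expect_pos nu) (A * dsum n + ln Z)).
  rewrite -(mposfunB (expect_pos nu) (bm_birk n) (bm_cst _ _)).
  apply: (mposfun_le (expect_pos nu)).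
  - by apply: bmB; [exact: bm_birk|exact: bm_cst].
  - exact: (bm_word n (fun w => wS w (uitv0 R) - ln Z)).
  - by move=> x; have := wS_word n x (uitv0 R); rewrite ler_norml => /andP[+ _]; lra.
have h3 : A * dsum n <= A * D + e / 2 * n%:R.
  apply: le_trans (_ : A * (D + e / (2 * (A + 1)) * n%:R) <= _).
    by rewrite ler_wpM2l.
  rewrite mulrDr lerD2l mulrA ler_wpM2r// mulrA ler_pdivrMr ?mulr_gt0 ?ltr_wpDl//.
  by move: e0 A0; nra.
move: (h h1) h2 h3 lnZ; rewrite mulrDl mulrBl [n%:R * (_ + _)]mulrDr.
rewrite [n%:R * expect _ _]mulrC [n%:R * ln _]mulrC [n%:R * (e / 2)]mulrC.
have -> : e * n%:R = e / 2 * n%:R + e / 2 * n%:R by rewrite -mulrDl; congr (_ * _); field.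
lra.
Qed.

End invariant.
End potential.
End words.

(** * Gibbs states when the pressure exceeds the value at the fixed point *)

Lemma lin_le (R : realType) (a b C : R) : (forall n : nat, a * n%:R <= C + b * n%:R) -> a <= b.
Proof.
move=> h; rewrite leNgt; apply/negP => ba.
have ab : 0 < a - b by rewrite subr_gt0.
have := h (Num.bound (`|C| / (a - b))).
have : `|C| / (a - b) < (Num.bound (`|C| / (a - b)))%:R.
  by apply: archi_boundP; rewrite divr_ge0// ltW.
by rewrite ltr_pdivrMr//; set N := (X in X%:R); have := ler_norm C; nra.
Qed.

Lemma lam_scale (R : realType) (X : Type) (g : bool -> X -> X) (x0 : X)
    (W : bool -> X -> R) (c C a : R) : 0 < c -> (forall b x, c <= W b x <= C) -> 0 < a ->
  lam g (fun b x => a * W b x) = a * lam g W.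
Proof.
move=> c0 Wc a0.
have sc (V : bool -> X -> R) (r t : R) : 0 < r -> superharm g V t ->
    superharm g (fun b x => r * V b x) (r * t).
  move=> r0 [t0 [h [M [hM ht]]]]; split; first exact: mulr_gt0.
  exists h, M; split=> // x; rewrite -mulrA; apply: le_trans (_ : r * tr g V h x <= _).
    by apply: eq_refl_le; rewrite /tr; ring.
  by rewrite ler_pM2l.
have ac0 : 0 < a * c by rewrite mulr_gt0.
have aWc b x : a * c <= a * W b x <= a * C by rewrite !ler_pM2l.
apply/eqP; rewrite eq_le; apply/andP; split.
  rewrite mulrC -ler_pdivrMr//; apply/ler_addgt0Pr => e e0.
  rewrite ler_pdivrMr// mulrC; apply: (superharm_lam x0 ac0 aWc); apply: sc => //.
  by apply: (lam_superharm x0 c0 Wc); rewrite ltrDl.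
apply/ler_addgt0Pr => e e0.
have h : superharm g (fun b x => a * W b x) (lam g (fun b x => a * W b x) + e).
  by apply: (lam_superharm x0 ac0 aWc); rewrite ltrDl.
have ai0 : 0 < a^-1 by rewrite invr_gt0.
have EW : (fun b x => a^-1 * (a * W b x)) = W.
  by apply/funext => b; apply/funext => x; rewrite mulKf ?gt_eqF.
have := sc _ _ _ ai0 h; rewrite EW => /(superharm_lam x0 c0 Wc).
by rewrite ler_pdivlMl.
Qed.

Lemma nrmV (R : realType) (X : Type) (D : X -> X -> R) (h : X -> R) (a A : R) :
  (forall x y, 0 <= D x y) -> 0 < a -> (forall x, a <= h x) -> nrm D h A ->
  nrm D (fun x => (h x)^-1) (a^-1 + A / a ^+ 2).
Proof.
move=> D0 a0 ha [h1 h2].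
have hp x : 0 < h x by exact: lt_le_trans (ha x).
have Aa (x : X) : 0 <= A / a ^+ 2.
  by rewrite divr_ge0 ?exprn_ge0 ?(ltW a0)//; exact: le_trans (h1 x).
split=> [x|x y].
  rewrite ger0_norm ?invr_ge0 ?(ltW (hp x))//; apply: ler_wpDr; first exact: Aa x.
  by rewrite lef_pV2 ?posrE.
have -> : (h x)^-1 - (h y)^-1 = (h y - h x) / (h x * h y).
  by field; rewrite !gt_eqF.
rewrite normrM mulrDl distrC normfV [X in _ / X]ger0_norm ?mulr_ge0 ?(ltW (hp _))//.
apply: ler_wpDl; first by rewrite mulr_ge0// invr_ge0 ltW.
rewrite mulrAC; apply: ler_pM => //; first by rewrite invr_ge0 mulr_ge0 ?(ltW (hp _)).
by rewrite lef_pV2 ?posrE ?exprn_gt0 ?mulr_gt0// expr2 ler_pM// ltW.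
Qed.

Section transfer_words.
Variables (R : realType) (alpha : {posnum R}).
Local Notation I := (uitv R).
Local Notation br := (br alpha).
Variable W : bool -> I -> R.

Fixpoint wP (w : seq bool) (y : I) : R :=
  if w is b :: w' then W b (gs br w' y) * wP w' y else 1.

Lemma iter_tr_wP n u y : iter n (tr br W) u y =
  \sum_(w <- words n) wP w y * u (gs br w y).
Proof.
elim: n u => [|n IH] u; first by rewrite /= big_seq1 /= mul1r.
rewrite iterSr IH /= big_cat !big_map /= -big_split /=.
by apply: eq_bigr => w _; rewrite /tr; ring.
Qed.

Lemma wP_ge0 w y : (forall b x, 0 <= W b x) -> 0 <= wP w y.
Proof. by move=> W0; elim: w => //= b w IH; rewrite mulr_ge0. Qed.

Lemma wP_le c w y : (forall b x, 0 <= W b x <= c) -> wP w y <= c ^+ size w.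
Proof.
move=> Wc; have W0 b x : 0 <= W b x by case/andP: (Wc b x).
elim: w => //= b w IH; rewrite exprS ler_pM//; first exact: wP_ge0.
by case/andP: (Wc b (gs br w y)).
Qed.

End transfer_words.

Section gstate.
Variables (R : realType) (alpha : {posnum R}).
Local Notation I := (uitv R).
Local Notation br := (br alpha).
Local Notation im := (im alpha).
Local Notation side := (side alpha).
Local Notation word := (word alpha).
Variables (p : bool -> I -> R) (e0 : R) (nu : probability I R).
Hypotheses (p_sum : forall x, p false x + p true x = 1).
Hypotheses (e0_gt0 : 0 < e0) (p_ge : forall b x, e0 <= p b x).
Hypotheses (bp : forall b, bm (p b)).
Hypothesis nuE : forall u, bm u -> expect nu u = expect nu (tr br p u).

Let mim := measurable_im alpha.
Let pE := expect_pos nu.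

Lemma gp_ge0 b x : 0 <= p b x. Proof. exact: le_trans (ltW e0_gt0) (p_ge b x). Qed.

Lemma gp_le b x : 0 <= p b x <= 1 - e0.
Proof.
rewrite gp_ge0 /=; have := p_sum x; have := p_ge (~~ b) x; case: b => /=; lra.
Qed.

Lemma bm_gtr u : bm u -> bm (tr br p u).
Proof.
by move=> bu; apply: bmD; apply: bmM => //; apply: bm_comp => //; exact: measurable_br.
Qed.

Lemma bm_giter n u : bm u -> bm (iter n (tr br p) u).
Proof. by move=> bu; elim: n => //= n IH; exact: bm_gtr. Qed.

Lemma gexpect_iter n u : bm u -> expect nu u = expect nu (iter n (tr br p) u).
Proof. by move=> bu; elim: n => //= n IH; rewrite -nuE//; exact: bm_giter. Qed.

(** Only the branch [false] maps a point to [0], and only [0] itself, so this mass is at most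
    [1 - e0] times itself. It follows that the point [br true 0], which is not a preimage of [0]
    under the map, never matters. *)
Lemma gzero : nu [set y : I | set_val y <= 0] = 0%E.
Proof.
have m0 := measurable_le (0 : R).
have h : expect nu (low 0) = 0.
  apply/eqP; rewrite eq_le; apply/andP; split; last first.
    by case: pE => _ pos _; apply: pos; [exact: bm_low|move=> x; rewrite /low ler0n].
  have : expect nu (low 0) <= (1 - e0) * expect nu (low 0).
    rewrite {1}nuE; last exact: bm_low.
    rewrite -(mposfunZ pE _ (bm_low _)); apply: (mposfun_le pE).
    - exact/bm_gtr/bm_low.
    - exact/bmZ/bm_low.
    - move=> x; rewrite /tr.
      have -> : low 0 (br true x) = 0.
        rewrite /low -(expand_leE alpha (uitv_ge0 _) (lexx 0)) brP expand0 leNgt.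
        by rewrite ltr_wpDl// uitv_ge0.
      have -> : low 0 (br false x) = low 0 x.
        by rewrite /low -(expand_leE alpha (uitv_ge0 _) (lexx 0)) brP expand0 addr0.
      have l0 : 0 <= low 0 x by rewrite /low ler0n.
      rewrite mulr0 addr0 ler_wpM2r//.
      by case/andP: (gp_le false x).
  move=> le_e; rewrite -(pmulr_rle0 _ e0_gt0).
  by move: le_e; rewrite mulrBl mul1r; lra.
rewrite low_indic expect_indic// in h.
by rewrite -[LHS]fineK ?h// fin_num_measure.
Qed.

Lemma gae u v : bm u -> bm v -> (forall y : I, 0 < set_val y -> u y = v y) ->
  expect nu u = expect nu v.
Proof.
move=> bu bv uv; apply: (expect_ae0 bu bv (measurable_le 0) gzero) => x /= /negP.
by rewrite -ltNge; exact: uv.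
Qed.

Lemma gdual1 u v : bm u -> bm v ->
  expect nu (fun x => v (im x) * u x) = expect nu (fun x => v x * tr br p u x).
Proof.
move=> bu bv; have bvf : bm (fun x => v (im x)) by exact: (bm_comp mim).
rewrite nuE; last exact: bmM.
apply: gae; [exact/bm_gtr/bmM|by apply: bmM => //; exact: bm_gtr|].
by move=> y y0; rewrite /tr !im_br//; ring.
Qed.

Lemma ginvariant : invariant_measure im nu.
Proof.
move=> A mA; have bA := bm_indic R mA.
have b1 : bm (fun _ : I => 1 : R) by exact: bm_cst.
have := gdual1 b1 bA.
have -> : (fun x : I => \1_A (im x) * 1) = \1_(im @^-1` A) :> (I -> R).
  by apply/funext => x; rewrite mulr1.
have -> : (fun x : I => \1_A x * tr br p (fun=> 1) x) = \1_A.
  by apply/funext => x; rewrite /tr !mulr1 p_sum mulr1.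
have mfA : measurable (im @^-1` A) by rewrite -[X in measurable X]setTI; exact: mim.
rewrite !expect_indic// => h.
by rewrite /pushforward -[LHS]fineK ?h ?fineK// fin_num_measure.
Qed.

Lemma gdual n u v : bm u -> bm v ->
  expect nu (fun x => v (iter n im x) * u x) = expect nu (fun x => v x * iter n (tr br p) u x).
Proof.
elim: n u => [//|n IH] u bu bv.
have -> : (fun x => v (iter n.+1 im x) * u x) = fun x => (fun z => v (iter n im z)) (im x) * u x.
  by apply/funext => x; rewrite iterSr.
rewrite (gdual1 (v := fun z => v (iter n im z)))//; last exact: (bm_comp (measurable_iter mim n)).
by rewrite IH ?iterSr//; exact: bm_gtr.
Qed.

Lemma word_gs_pos w (y : I) : 0 < set_val y ->
  word (size w) (gs br w y) = w /\ 0 < set_val (gs br w y).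
Proof.
move=> y0; elim: w => [//|b w [IH1 IH2]] /=.
rewrite br_side// im_br// IH1; split=> //.
by apply: le_lt_trans (_ : set_val (br b (uitv0 R)) < _); [exact: uitv_ge0|exact: br_lt].
Qed.

(** Off the null point [0], the [n]-th iterate of the indicator of a cylinder is the product [wP] of
    the weights along its word, so the mass of the cylinder is at most [expR (G w)]. *)
Lemma gentropy_ge (n : nat) (G : seq bool -> R) :
  (forall w y, size w = n -> wP alpha p w y <= expR (G w)) ->
  - expect nu (fun x => G (word n x)) <= partition_entropy nu (iterated_join im side n).
Proof.
move=> hG; have pj := partition_join mim (measurable_side alpha) (n := n).
have -> : (fun x => G (word n x)) = fun x => G (codom (iterated_join im side n x)).
  by apply/funext => x; rewrite codom_join.
rewrite (expect_label nu pj (fun l : {ffun 'I_n -> bool} => G (codom l))) entropyE lerN2.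
apply: ler_sum => l _; rewrite mulrC.
have := pr_ge0 nu (iterated_join im side n) l.
rewrite le_eqVlt => /predU1P[<-|pl]; first by rewrite !mulr0.
rewrite ler_pM2r// -[leRHS]expRK ler_ln ?posrE ?expR_gt0//.
have bl := bm_label (R := R) pj (fun k : {ffun 'I_n -> bool} => (k == l)%:R).
rewrite -(expect_pr nu pj) (gexpect_iter n bl).
have sl : size (codom l) = n by rewrite size_codom card_ord.
have wle y : wP alpha p (codom l) y <= expR (G (codom l)) by exact: hG.
(* The pointwise bound is known only for [y > 0]; truncation makes it valid everywhere and changes
   the function on a null set only. *)
pose v := fun y : I => Num.min (iter n (tr br p)
    (fun x => (iterated_join im side n x == l)%:R) y) (expR (G (codom l))).
have bi := bm_giter n bl.
have bv : bm v.
  case: bi => mi [B hB]; split; first by apply: measurable_minr => //; exact: measurable_cst.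
  exists (Num.max B (expR (G (codom l)))) => x; rewrite /v /Num.min; case: ifP => _.
    by rewrite le_max hB.
  by rewrite ger0_norm ?expR_ge0// le_max lexx orbT.
rewrite (gae bi bv).
  rewrite -[leRHS](mposfun_cst pE); apply: (mposfun_le pE) => //; first exact: bm_cst.
  by move=> x; rewrite /v ge_min lexx orbT.
move=> y y0; rewrite /v; apply/esym/min_idPl.
rewrite iter_tr_wP (big_rem (codom l)) /=; last by rewrite mem_words sl.
rewrite big_seq big1 ?addr0 => [|w].
  apply: le_trans (wle y); rewrite ler_piMr ?lern1 ?leq_b1// wP_ge0// => b x.
  exact: gp_ge0.
rewrite mem_rem_uniq ?uniq_words// inE mem_words => /andP[wl /eqP sw].
case: eqP => [e|_]; last by rewrite mulr0.
move: wl; rewrite -e codom_join; have [+ _] := word_gs_pos w y0.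
by rewrite sw => ->; rewrite eqxx.
Qed.

(** Every cylinder of length [n] has mass at most [(1 - e0) ^+ n], so the entropy is at least
    [- ln (1 - e0)]. *)
Lemma gentropy_pos : 0 < entropy_wrt nu im side.
Proof.
have e01 : 0 < 1 - e0.
  have := gp_le true (uitv0 R); have := p_ge true (uitv0 R); move: e0_gt0.
  by move=> a b /andP[_ c]; lra.
have l0 : 0 < - ln (1 - e0) by rewrite oppr_gt0 ln_lt0// e01 /=; move: e0_gt0; lra.
apply: lt_le_trans l0 _; apply/ler_addgt0Pr => e e_gt0.
have [C hC] := entropy_wrt_ub mim ginvariant (measurable_side alpha) e_gt0.
apply: (@lin_le _ _ _ C) => n; apply: le_trans (hC n).
apply: le_trans (gentropy_ge (G := fun w => n%:R * ln (1 - e0)) _); last first.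
  move=> w y sw; apply: le_trans (wP_le alpha w y gp_le) _.
  by rewrite expRM_natl lnK ?posrE// sw.
by rewrite (mposfun_cst pE) mulNr mulrC.
Qed.

End gstate.

Section gibbs.
Variables (R : realType) (alpha g : {posnum R}).
Local Notation I := (uitv R).
Local Notation br := (br alpha).
Local Notation im := (im alpha).
Local Notation side := (side alpha).
Local Notation word := (word alpha).
Variables (phi : I -> R) (A : R).
Hypothesis phiA : nrm (hdist g) phi A.
Local Notation wt := (wt alpha phi).
Local Notation l0 := (lam br wt).

Let mim := measurable_im alpha.

Let hd0 (x y : I) : 0 <= hdist g x y := hdist_ge0 g x y.

Lemma phiA_ge0 : 0 <= A.
Proof. by apply: le_trans (phiA.1 (uitv0 R)). Qed.

Lemma wt_lip b (x y : I) : `|wt b x - wt b y| <= (expR A * A) * hdist g x y.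
Proof.
have key u v : u <= A -> `|u| <= A -> `|v| <= A -> v <= u -> `|expR u - expR v| <= expR A * `|u - v|.
  move=> uA _ _ vu; rewrite !ger0_norm ?subr_ge0 ?ler_expR//.
  have -> : expR u - expR v = expR u * (1 - expR (v - u)).
    by rewrite mulrBr mulr1 -expRD; congr (_ - expR _); ring.
  apply: ler_pM; rewrite ?expR_ge0 ?ler_expR//.
    by rewrite subr_ge0 expR_le1 subr_le0.
  by have := expR_ge1Dx (v - u); lra.
have [hx hy] := (phiA.1 (br b x), phiA.1 (br b y)).
have [ux uy] := (le_trans (ler_norm _) hx, le_trans (ler_norm _) hy).
rewrite /wt; apply: le_trans (_ : expR A * `|phi (br b x) - phi (br b y)| <= _).
  by have [h|/ltW h] := leP (phi (br b y)) (phi (br b x)); [|rewrite distrC (distrC (phi _))]; exact: key.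
rewrite -mulrA ler_wpM2l ?expR_ge0//; apply: le_trans (phiA.2 _ _) _.
rewrite ler_wpM2l ?phiA_ge0//; apply: powR_le => //.
by apply: le_trans (br_dist alpha b x y); exact: expand_ge.
Qed.

Lemma wt_lam_ge : expR (phi (uitv0 R)) <= l0.
Proof.
have [c c0 [C Wc]] := wt_bound alpha phiA.
have := lam_ge_fix (uitv0 R) c0 Wc (br_false_fix alpha).
by rewrite /wt br_false_fix.
Qed.

Lemma lam_wt_gt0 : 0 < l0.
Proof. by apply: lt_le_trans wt_lam_ge; exact: expR_gt0. Qed.

Definition nwt b x : R := l0^-1 * wt b x.

Lemma nwt_spectral : expR (phi (uitv0 R)) < l0 ->
  (exists c C K : R, [/\ 0 < c, forall b x, c <= nwt b x <= C, 0 <= K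
     & forall b x y, `|nwt b x - nwt b y| <= K * hdist g x y]) /\
  exists (m : (I -> R) -> R) (h : I -> R) (C1 rho : R),
   [/\ posfun m, forall u, bdd u -> m (tr br nwt u) = m u,
       [/\ exists2 a, 0 < a & forall x, a <= h x, exists B, nrm (hdist g) h B,
           forall x, tr br nwt h x = h x & m h = 1],
       0 <= C1 /\ 0 < rho < 1
     & forall u B n, nrm (hdist g) u B ->
       nrm (hdist g) (fun x => iter n (tr br nwt) u x - m u * h x) (C1 * rho ^+ n * B)].
Proof.
move=> gap; have l0_gt0 := lam_wt_gt0; have li0 : 0 < l0^-1 by rewrite invr_gt0.
have [c c0 [C Wc]] := wt_bound alpha phiA.
have lam1 : lam br nwt = 1.
  by rewrite [LHS](lam_scale br (uitv0 R) c0 Wc)// mulVf// gt_eqF.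
have cW0 : 0 < l0^-1 * c by rewrite mulr_gt0.
have WcC b x : l0^-1 * c <= nwt b x <= l0^-1 * C by rewrite !ler_pM2l.
have KW0 : 0 <= l0^-1 * (expR A * A).
  by rewrite mulr_ge0 ?(ltW li0)// mulr_ge0 ?expR_ge0 ?phiA_ge0.
have WK b x y : `|nwt b x - nwt b y| <= l0^-1 * (expR A * A) * hdist g x y.
  by rewrite -mulrBr normrM (ger0_norm (ltW li0)) -mulrA ler_pM2l// wt_lip.
have gapW : nwt false (uitv0 R) < 1.
  by rewrite /nwt ltr_pdivrMl// mulr1 /wt br_false_fix.
have fgx x : exists b, x = br b (im x) by exists (side x); rewrite br_im.
split; first by exists (l0^-1 * c), (l0^-1 * C), (l0^-1 * (expR A * A)).
have [m [h [C1 [rho [pm mW [[a a0 ha] nh Lh mh] r01 sg]]]]] :=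
  spectral_gap_normalized hd0 (hdist_le1 g) (rate01 alpha g) (hdist_br alpha g)
    (hdist_gs alpha g) (cylh_small alpha g) fgx (uitv0 R) (br_false_fix alpha)
    cW0 WcC KW0 WK lam1 gapW.
by exists m, h, C1, rho; split=> //; split=> //; exists a.
Qed.

(** Conjugating the normalized operator by its eigenfunction [h] makes it preserve constants, so its
    weights [p] are transition probabilities and [mu = m (h * _)] is stationary for them. The bound
    on [wP] is the upper half of the Gibbs property: the quotients of [h] telescope along a word. *)
Lemma gibbs_exists : expR (phi (uitv0 R)) < l0 ->
  exists (nu : probability I R) (p : bool -> I -> R) (e0 K C rho : R),
  [/\ forall x, p false x + p true x = 1,
      0 < e0 /\ (forall b x, e0 <= p b x) /\ (forall b, bm (p b)),
      forall u, bm u -> expect nu u = expect nu (tr br p u),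
      forall w y, wP alpha p w y <= expR (wS alpha phi w y - (size w)%:R * ln l0 + K)
    & [/\ 0 <= C, 0 < rho < 1 & forall u B n x, nrm (hdist g) u B ->
        `|iter n (tr br p) u x - expect nu u| <= C * rho ^+ n * B]].
Proof.
move=> gap; have l0_gt0 := lam_wt_gt0; have li0 : 0 < l0^-1 by rewrite invr_gt0.
have [[c [C [K [c0 WcC K0 WK]]]] [m [h [C1 [rho [pm mW
  [[a a0 ha] [H0 nh] Lh] mh] [C10 rho01] sg]]]]] := nwt_spectral gap.
have h0 x : 0 < h x by exact: lt_le_trans (ha x).
have hH x : h x <= H0 by apply: le_trans (nh.1 x); exact: ler_norm.
have bh : bdd h by exists H0; exact: nh.1.
have H00 : 0 < H0 by exact: lt_le_trans (h0 (uitv0 R)) (hH _).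
have nhV := nrmV hd0 a0 ha nh.
pose W := nwt.
pose p b x := W b x * h (br b x) / h x.
pose mu u := m (fun x => h x * u x).
have W0 b x : 0 < W b x by case/andP: (WcC b x) => w _; exact: lt_le_trans w.
have p_sum x : p false x + p true x = 1.
  by rewrite /p -mulrDl -[X in X / _]/(tr br W h x) Lh divff// gt_eqF.
pose e0 := c * a / H0.
have e0_gt0 : 0 < e0 by rewrite divr_gt0// mulr_gt0.
have p_ge b x : e0 <= p b x.
  have e1 : 0 <= c * a by rewrite mulr_ge0// ltW.
  have e2 : 0 <= H0^-1 by rewrite invr_ge0 ltW.
  have e3 : H0^-1 <= (h x)^-1 by rewrite lef_pV2 ?posrE.
  have e4 : c <= W b x by case/andP: (WcC b x).
  have e5 : c * a <= W b x * h (br b x) by apply: ler_pM => //; exact: ltW.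
  exact: ler_pM.
have [Kp nKp] : exists Kp, forall b, nrm (hdist g) (p b) Kp.
  have nW b : nrm (hdist g) (W b) (C + K).
    have lC0 : 0 <= C by apply: ltW; case/andP: (WcC b (uitv0 R)) => _; exact: lt_le_trans.
    split=> [x|x y].
      rewrite ger0_norm ?(ltW (W0 _ _))//; apply: ler_wpDr => //.
      by case/andP: (WcC b x).
    by rewrite mulrDl; apply: ler_wpDl; [rewrite mulr_ge0|exact: WK].
  have nhb b : nrm (hdist g) (fun x => h (br b x)) H0.
    split=> [x|x y]; first exact: nh.1.
    apply: le_trans (nh.2 _ _) _; rewrite ler_wpM2l ?(ltW H00)//; apply: powR_le => //.
    by apply: le_trans (br_dist alpha b x y); exact: expand_ge.
  have n0 (u : I -> R) B : nrm (hdist g) u B -> 0 <= B.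
    by move=> [+ _]; move=> /(_ (uitv0 R)); exact: le_trans.
  eexists => b; apply: nrmM; [| |apply: nrmM; [| |exact: nW|exact: nhb]|exact: nhV].
  - by rewrite !mulr_ge0 ?(n0 _ _ (nW b)) ?(ltW H00).
  - exact: n0 nhV.
  - exact: n0 (nW b).
  - exact: ltW.
have bmp b : bm (p b) by exact: bm_nrm (nKp b).
have trp u x : tr br p u x = tr br W (fun y => h y * u y) x / h x.
  by rewrite /tr /p; field; rewrite gt_eqF.
have bdp u : bdd u -> bdd (tr br p u).
  move=> bu; have bc b : bdd (fun x => u (br b x)).
    by case: bu => B hB; exists B => x; exact: hB.
  by apply: bddD; apply: bddM => //; exact: (bmp _).2.
have pmu : posfun mu.
  split=> [x u v bu bv|u bu u0|].
  - rewrite /mu -(posfun_lin pm); [|exact: bddM..].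
    by congr m; apply/funext => y; ring.
  - by apply: (posfun_ge0 pm); [exact: bddM|move=> x; rewrite mulr_ge0// ltW].
  - by rewrite /mu -[RHS]mh; congr m; apply/funext => x; rewrite mulr1.
have mu_inv u : bdd u -> mu (tr br p u) = mu u.
  move=> bu; rewrite /mu -[RHS]mW; last exact: bddM.
  by congr m; apply/funext => x; rewrite trp mulrCA divff ?mulr1// gt_eqF.
have [nu [nuE num]] := gmeasure pmu mu_inv p_sum e0_gt0 p_ge nKp.
have itp n u x : iter n (tr br p) u x = iter n (tr br W) (fun y => h y * u y) x / h x.
  elim: n x => [|n IH] x; first by rewrite /= mulrAC divff ?mul1r// gt_eqF.
  rewrite !iterS trp; congr (_ / _); congr (tr br W _ x); apply/funext => y.
  by rewrite IH mulrCA divff ?mulr1// gt_eqF.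
exists nu, p, e0, (ln (H0 / a)), (C1 * (2 * H0) / a), rho; split=> //.
- move=> w y.
  have -> : wP alpha p w y = expR (wS alpha phi w y - (size w)%:R * ln l0) * (h (gs br w y) / h y).
    elim: w => [|b w IH]; first by rewrite /= mul0r subr0 expR0 mul1r divff// gt_eqF.
    rewrite [LHS]/= IH /p /W /nwt /wt [wS _ _ (b :: w) y]/= [size (b :: w)]/= -natr1.
    rewrite mulrDl mul1r.
    have -> : phi (br b (gs br w y)) + wS alpha phi w y - ((size w)%:R * ln l0 + ln l0) =
      (wS alpha phi w y - (size w)%:R * ln l0) + phi (br b (gs br w y)) - ln l0 by ring.
    rewrite (expRD _ (- ln l0)) expRN lnK ?posrE// (expRD _ (phi _)) /=.
    by field; rewrite !gt_eqF.
  rewrite [leRHS]expRD lnK ?posrE ?divr_gt0// ler_wpM2l ?expR_ge0//.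
  by apply: ler_pM; rewrite ?invr_ge0 ?(ltW (h0 _))// lef_pV2 ?posrE.
- split=> //; first by rewrite divr_ge0 ?(ltW a0)// !mulr_ge0// ltW.
  move=> u B n x nu_; rewrite (num u B nu_) itp.
  have B0 : 0 <= B by apply: le_trans (nu_.1 x).
  have nhu : nrm (hdist g) (fun y => h y * u y) (2 * H0 * B).
    by apply: nrmM => //; exact: ltW.
  have := (sg _ _ n nhu).1 x; rewrite -/(mu u) => hs.
  have -> : iter n (tr br W) (fun y => h y * u y) x / h x - mu u =
      (iter n (tr br W) (fun y => h y * u y) x - mu u * h x) / h x.
    by field; rewrite gt_eqF.
  rewrite normrM normfV (ger0_norm (ltW (h0 x))) ler_pdivrMr//.
  apply: le_trans hs _; rewrite -(ler_pM2r a0) .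
  have E : C1 * (2 * H0) / a * rho ^+ n * B * h x * a = C1 * rho ^+ n * (2 * H0 * B) * h x.
    by field; rewrite gt_eqF.
  rewrite E ler_wpM2l//.
  by rewrite mulr_ge0 ?mulr_ge0 ?(ltW H00)// exprn_ge0//; case/andP: rho01 => /ltW.
Qed.

(** The Gibbs bound on cylinder masses, inserted in [gentropy_ge], gives the lower bound of the free
    energy; mixing is the spectral gap read through the duality between the operator and the map. *)
Lemma gibbs_positive : expR (phi (uitv0 R)) < l0 ->
  exists nu : probability I R, [/\ invariant_measure im nu,
    0 < entropy_wrt nu im side, ln l0 <= entropy_wrt nu im side + expect nu phi
    & exists C rho : R, [/\ 0 <= C, 0 < rho < 1 &
      forall n u v B, bm v -> nrm (hdist g) u B -> forall V : R, (forall x, `|v x| <= V) ->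
      `|expect nu (fun x => v (iter n im x) * u x) - expect nu v * expect nu u|
        <= C * rho ^+ n * B * V]].
Proof.
move=> /gibbs_exists[nu [p [e0 [K [C [rho [p_sum [e0_gt0 [p_ge bp]] nuE wPle [C0 rho01 mix]]]]]]]].
have inv := ginvariant p_sum e0_gt0 p_ge bp nuE.
have pE := expect_pos nu.
exists nu; split=> //.
- exact: gentropy_pos p_sum e0_gt0 p_ge bp nuE.
- rewrite -lerBlDr; apply/ler_addgt0Pr => e e_gt0.
  have A0 := phiA_ge0.
  have e2 : 0 < e / 2 by rewrite divr_gt0.
  have [C' hC'] := entropy_wrt_ub mim inv (measurable_side alpha) e2.
  have [D D0 hD] := dsum_small alpha g (divr_gt0 e_gt0 (mulr_gt0 (ltr0n R 4 : 0 < 4%:R) (ltr_wpDl A0 ltr01))).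
  apply: (@lin_le _ _ _ (C' + K + 2 * A * D)) => n.
  pose G w := wS alpha phi w (uitv0 R) + (A * dsum alpha g n - n%:R * ln l0 + K).
  have hG w y : size w = n -> wP alpha p w y <= expR (G w).
    move=> sw; apply: le_trans (wPle w y) _; rewrite ler_expR sw /G.
    have := wS_dist alpha phiA w y (uitv0 R); rewrite sw => /(le_trans (ler_norm _)); lra.
  have := gentropy_ge p_sum e0_gt0 p_ge bp nuE hG.
  have bG : bm (fun x => G (word n x)) by exact: (bm_word alpha n G).
  have h2 : expect nu (fun x => G (word n x)) <=
      n%:R * expect nu phi + (2 * A * dsum alpha g n - n%:R * ln l0 + K).
    rewrite -(expect_birk phiA inv) -(mposfun_cst pE (2 * A * dsum alpha g n - n%:R * ln l0 + K)).
    rewrite -(mposfunD pE (bm_birk alpha phiA n) (bm_cst _ _)).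
    apply: (mposfun_le pE) => //.
      by apply: bmD; [exact: (bm_birk alpha phiA)|exact: bm_cst].
    move=> x; rewrite /G; have := wS_word alpha phiA n x (uitv0 R).
    by move/(le_trans (ler_norm _)); lra.
  have h3 : 2 * A * dsum alpha g n <= 2 * A * D + e / 2 * n%:R.
    apply: le_trans (_ : 2 * A * (D + e / (4 * (A + 1)) * n%:R) <= _).
      by rewrite ler_wpM2l// mulr_ge0.
    rewrite mulrDr lerD2l mulrA ler_wpM2r// mulrA ler_pdivrMr ?mulr_gt0 ?ltr_wpDl//.
    by move: e_gt0 A0; nra.
  have := hC' n; move: h2 h3.
  rewrite !mulrDl mulNr [n%:R * ln _]mulrC [n%:R * expect _ _]mulrC.
  have -> : e * n%:R = e / 2 * n%:R + e / 2 * n%:R by rewrite -mulrDl; congr (_ * _); field.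
  lra.
- exists C, rho; split=> // n u v B bv nu_ V hV.
  have bu := bm_nrm nu_.
  rewrite (gdual p_sum e0_gt0 p_ge bp nuE)//.
  have bi := bm_giter alpha bp n bu.
  rewrite [X in _ - X]mulrC -(mposfunZ pE)// -(mposfunB pE); [|exact: bmM|exact: bmZ].
  apply: (mposfun_norm pE); first by apply: bmB; [exact: bmM|exact: bmZ].
  move=> x; rewrite [X in _ - X]mulrC -mulrBr normrM mulrC.
  by apply: ler_pM => //; exact: mix.
Qed.

Let bphi : bm phi := bm_phi phiA.

Lemma dirac0_invariant : invariant_measure im (\d_ (uitv0 R) : probability I R).
Proof.
move=> B mB; have e : im (uitv0 R) = uitv0 R by rewrite -{1}(br_false_fix alpha) im_br.
rewrite /pushforward /= !diracE; congr (_%:R%:E).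
congr nat_of_bool; by apply/idP/idP => /set_mem h; apply/mem_set; move: h; rewrite /= e.
Qed.

Lemma expect_dirac (a : I) (u : I -> R) : bm u -> expect (\d_ a : probability I R) u = u a.
Proof.
move=> bu; rewrite /expect /Rintegral integral_dirac//; last first.
  by apply/measurable_EFinP; exact: bu.1.
by rewrite diracT mul1e.
Qed.

(** The upper bound is the variational inequality. Equality is reached by the constructed Gibbs
    state if [lam] exceeds [expR (phi 0)], and by the Dirac mass at [0] otherwise. *)
Lemma pressureE : pressure im phi = (ln l0)%:E.
Proof.
apply/eqP; rewrite eq_le; apply/andP; split.
  apply: ge_ereal_sup => _ [nu inv <-]; rewrite (free_energyE phiA inv) lee_fin.
  exact: variational_ub phiA _ inv.
have lb (nu : probability I R) : invariant_measure im nu ->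
    ln l0 <= entropy_wrt nu im side + expect nu phi -> ((ln l0)%:E <= pressure im phi)%E.
  move=> inv h; apply: (@le_trans _ _ (free_energy im phi nu)).
    by rewrite (free_energyE phiA inv) lee_fin.
  by apply: ereal_sup_ubound; exists nu.
have [e|gap] := eqVneq (expR (phi (uitv0 R))) l0.
  apply: (lb (\d_ (uitv0 R) : probability I R)); first exact: dirac0_invariant.
  rewrite expect_dirac// -e expRK lerDr.
  exact: (entropy_wrt_side_ge0 dirac0_invariant).
have : expR (phi (uitv0 R)) < l0 by rewrite lt_neqAle gap wt_lam_ge.
by move=> /gibbs_positive[nu [inv _ + _]]; exact: lb.
Qed.

End gibbs.

(** * Surgery on words *)

Section real_lemmas.
Variable R : realType.

Lemma bernoulli (d : R) n : 0 <= d <= 1 -> 1 - n%:R * d <= (1 - d) ^+ n.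
Proof.
move=> /andP[d0 d1]; elim: n => [|n IH]; first by rewrite mul0r subr0 expr0.
rewrite exprS; apply: le_trans (_ : (1 - d) * (1 - n%:R * d) <= _).
  have h : 0 <= n%:R * d * d by rewrite !mulr_ge0.
  by rewrite -natr1; move: h; lra.
by rewrite ler_wpM2l// subr_ge0.
Qed.

Lemma geometric_sum (r : R) n : (\sum_(i < n) r ^+ i) * (1 - r) = 1 - r ^+ n.
Proof.
elim: n => [|n IH]; first by rewrite big_ord0 mul0r expr0 subrr.
by rewrite big_ord_recr /= mulrDl IH exprS; ring.
Qed.

Lemma geometric_sum_le (r : R) n : 0 <= r < 1 -> \sum_(i < n) r ^+ i <= (1 - r)^-1.
Proof.
move=> /andP[r0 r1]; rewrite -[leRHS]div1r ler_pdivlMr ?subr_gt0// geometric_sum.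
by rewrite gerBl exprn_ge0.
Qed.

Lemma natr_geometric (r : R) n : 0 <= r < 1 -> n.+1%:R * r ^+ n <= (1 - r)^-1.
Proof.
move=> r01; apply: le_trans (geometric_sum_le n.+1 r01); case/andP: r01 => r0 r1.
rewrite mulr_natl -[X in _ *+ X](card_ord n.+1) -sumr_const.
apply: ler_sum => i _; apply: ler_wiXn2l => //; first exact: ltW.
by rewrite -ltnS.
Qed.

Lemma sqrt_lt1 (r : R) : 0 < r < 1 -> 0 < Num.sqrt r < 1.
Proof.
by move=> /andP[r0 r1]; rewrite sqrtr_gt0 r0 /= -[ltRHS]sqrtr1 ltr_sqrt.
Qed.

Lemma power_near1 (M : R) k : 0 < M < 1 ->
  exists th : R, [/\ 0 < th, th < 1 & forall j, (j <= k)%N -> M <= th ^+ j].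
Proof.
move=> /andP[M0 M1].
have k0 : 0 < k.+1%:R :> R by rewrite ltr0n.
pose dd := (1 - M) / k.+1%:R.
have dd0 : 0 < dd by rewrite divr_gt0// subr_gt0.
have dd1 : dd < 1.
  by rewrite ltr_pdivrMr// mul1r; apply: lt_le_trans (_ : 1 <= _); [lra|rewrite ler1n].
exists (1 - dd); split; [by rewrite subr_gt0|by rewrite gtrBl|move=> j jk].
have dd01 : 0 <= dd <= 1 by rewrite !ltW.
apply: le_trans (bernoulli j dd01); rewrite lerBrDl -lerBrDr.
apply: le_trans (_ : k.+1%:R * dd <= _); last by rewrite /dd mulrCA divff ?gt_eqF// mulr1.
by rewrite ler_wpM2r ?(ltW dd0)// ler_nat ltnW.
Qed.

Lemma half_split m m0 : (0 < m0)%N -> (2 * m0 < m)%N ->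
  exists j, [/\ (j + j.+1 <= m)%N, (m <= j + j + 2)%N, (m0 <= j)%N & (j < m)%N].
Proof.
move=> m0p mm; exists (m.-1)./2.
have := odd_double_half m.-1; rewrite -addnn; set j := _./2.
by case: (odd m.-1) => /= h; split; lia.
Qed.

(** Squaring preserves a bound of the form [th ^+ m / 4] with room to spare under doubling of [m],
    and the room absorbs the error term. The seed [1/8] starts the induction on the range between
    [m0] and [2 * m0]. *)
Lemma doubling_decay (q : nat -> R) (C tau : R) :
  (forall n, 0 <= q n <= 1) -> (forall m n, (m <= n)%N -> q n <= q m) ->
  0 <= C -> 0 < tau < 1 ->
  (forall m, q (m + m.+1)%N <= q m ^+ 2 + C * tau ^+ m) ->
  (exists m, q m <= 8^-1) ->
  exists2 K : R, 0 <= K & exists2 th : R, 0 < th < 1 & forall m, q m <= K * th ^+ m.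
Proof.
move=> q01 qd C0 tau01 qq [m1 hm1].
pose t := Num.sqrt tau.
have /andP[t0 t1] : 0 < t < 1 by exact: sqrt_lt1.
have [m2 hm2] : exists m2, t ^+ m2 < (16 * (C + 1))^-1.
  by apply: expr_lt_ex; rewrite ?t1 ?(ltW t0)// invr_gt0 mulr_gt0// ltr_wpDl.
have [m0 [m0p hm01 hm02]] : exists m0, [/\ (0 < m0)%N, (m1 <= m0)%N & (m2 <= m0)%N].
  by exists (maxn m1 m2).+1; split=> //; rewrite ltnW// ltnS ?leq_maxl ?leq_maxr.
have Ct m : (m0 <= m)%N -> C * t ^+ m <= 16^-1.
  move=> mm; apply: le_trans (_ : (C + 1) * (16 * (C + 1))^-1 <= _); last first.
    by apply: eq_refl_le; field; rewrite gt_eqF// ltr_wpDl.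
  apply: ler_pM => //; rewrite ?exprn_ge0 ?(ltW t0) ?lerDl//.
  apply: le_trans (ltW hm2); apply: ler_wiXn2l; rewrite ?(ltW t0) ?(ltW t1)//.
  exact: leq_trans mm.
have q0 m : (m0 <= m)%N -> q m <= 8^-1.
  by move=> mm; apply: le_trans (qd m1 m _) hm1; exact: leq_trans mm.
(* A rate [th] whose first powers all exceed [M] satisfies [th ^+ m >= 1/2] on the initial range,
   [th ^+ 2 >= 1/2] for the shift from [2 j] to [2 j + 2], and [th ^+ 2 >= t] for the error term. *)
have [M [Mt M2 M01]] : exists M : R, [/\ t <= M, 2^-1 <= M & 0 < M < 1].
  exists (Num.max t 2^-1); rewrite !le_max !lexx orbT; split=> //.
  by rewrite lt_max t0 gt_max t1 invf_lt1// ltr1n.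
have [th [th0 th1 thj]] := power_near1 (2 * m0 + 2) M01.
have th2 : t <= th ^+ 2 by apply: le_trans Mt _; exact: thj (leq_addl _ _).
have th2' : 2^-1 <= th ^+ 2 by apply: le_trans M2 _; exact: thj (leq_addl _ _).
have key m : (m0 <= m)%N -> q m <= 4^-1 * th ^+ m.
  elim/ltn_ind: m => m IH mm.
  have [m2m|m2m] := leqP m (2 * m0).
    apply: le_trans (q0 _ mm) _; apply: le_trans (_ : 4^-1 * 2^-1 <= _).
      by apply: eq_refl_le; field.
    rewrite ler_pM2l ?invr_gt0//; by apply: le_trans M2 _; exact: thj (leq_trans m2m (leq_addr _ _)).
  have [j [mj1 mj2 jm0 jm]] := half_split m0p m2m.
  apply: le_trans (qd _ _ mj1) _; apply: le_trans (qq j) _.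
  have q2 : q j ^+ 2 <= 16^-1 * th ^+ (j + j).
    have qj := IH j jm jm0.
    have qj0 : 0 <= q j by case/andP: (q01 j).
    rewrite exprD expr2; apply: le_trans (ler_pM qj0 qj0 qj qj) _.
    by apply: eq_refl_le; field.
  have e2 : C * tau ^+ j <= 16^-1 * th ^+ (j + j).
    have -> : tau ^+ j = t ^+ j * t ^+ j.
      by rewrite -exprMn -expr2 sqr_sqrtr// ltW; case/andP: tau01.
    rewrite mulrA; apply: ler_pM; rewrite ?mulr_ge0 ?exprn_ge0 ?(ltW t0)//; first exact: Ct.
    by rewrite addnn -mul2n exprM lerXn2r ?nnegrE ?exprn_ge0 ?(ltW t0) ?(ltW th0).
  apply: le_trans (_ : 4^-1 * th ^+ (j + j + 2) <= _); last first.
    rewrite ler_pM2l ?invr_gt0//; apply: ler_wiXn2l => //; exact: ltW.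
  rewrite [in leRHS]exprD; have := exprn_ge0 (j + j) (ltW th0).
  by move: q2 e2 th2'; set x := _ ^+ (j + j); nra.
exists ((th ^+ m0)^-1); first by rewrite invr_ge0 exprn_ge0// ltW.
exists th; first by rewrite th0.
move=> m; have [mm|mm] := leqP m0 m.
  apply: le_trans (key m mm) _; rewrite ler_wpM2r ?exprn_ge0 ?(ltW th0)//.
  apply: le_trans (_ : 1 <= _); first by rewrite invf_le1// ler1n.
  by rewrite invf_ge1 ?exprn_gt0// exprn_ile1 ?(ltW th0) ?(ltW th1).
case/andP: (q01 m) => _ /le_trans; apply.
rewrite mulrC ler_pdivlMr ?exprn_gt0// mul1r; apply: ler_wiXn2l; rewrite ?(ltW th0) ?(ltW th1)//.
exact: ltnW.
Qed.

End real_lemmas.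

(** * Mass of the cylinders at the fixed point *)

Section zero_cylinders.
Variables (R : realType) (alpha : {posnum R}).
Local Notation I := (uitv R).
Local Notation im := (im alpha).
Local Notation side := (side alpha).
Local Notation word := (word alpha).

Lemma word_cat n m x : word (n + m) x = word n x ++ word m (iter n im x).
Proof. by elim: n x => [//|n IH] x; rewrite addSn iterSr /= IH. Qed.

Lemma word0P m x : (word m x == nseq m false) = (set_val x <= cyl alpha m).
Proof.
elim: m x => [|m IH] x; first by rewrite cyl0 uitv_le1.
have E : (word m.+1 x == nseq m.+1 false) = ~~ side x && (word m (im x) == nseq m false).
  by rewrite /= eqseq_cons; case: (side x).
rewrite E IH.
rewrite -(expand_leE alpha (uitv_ge0 x) (cyl_ge0 alpha m.+1)) expand_cyl expand_im.
case: (boolP (side x)) => sx /=; last by rewrite addr0.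
apply/esym/negbTE; rewrite -ltNge; apply: le_lt_trans (_ : 1 < _).
  by rewrite -(cyl0 alpha) cyl_anti.
have : ~~ (expand alpha (set_val x) <= 1) by rewrite sideE sx.
by rewrite -ltNge expand_im sx.
Qed.

(** The fixed point is neutral, so the ratio of consecutive [cyl] tends to [1] and eventually
    exceeds any [eta < 1]. *)
Lemma cyl_subexp (eta : R) : 0 < eta < 1 ->
  exists2 c : R, 0 < c & forall m, c * eta ^+ m <= cyl alpha m.
Proof.
move=> /andP[eta0 eta1].
pose e := (eta^-1 - 1) `^ (alpha%:num)^-1.
have e1 : 0 < eta^-1 - 1 by rewrite subr_gt0 invf_gt1.
have [N hN] := cyl_small alpha (powR_gt0 (alpha%:num)^-1 e1 : 0 < e).
exists (cyl alpha N); first exact: cyl_gt0.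
have step m : (N <= m)%N -> eta * cyl alpha m <= cyl alpha m.+1.
  move=> Nm; rewrite -[cyl alpha m]expand_cyl /expand mulrCA ger_pMr ?cyl_gt0//.
  rewrite -ler_pdivlMl// mulr1 -lerBrDl.
  have -> : eta^-1 - 1 = e `^ alpha%:num by rewrite /e -powRrM mulVf// powRr1// ltW.
  by apply: powR_le; rewrite ?cyl_ge0// hN// leqW.
have big m : cyl alpha N * eta ^+ m <= cyl alpha (N + m).
  elim: m => [|m IH]; first by rewrite expr0 mulr1 addn0.
  rewrite exprS mulrCA addnS; apply: le_trans (step _ (leq_addr _ _)).
  by rewrite ler_wpM2l// ltW.
move=> m; apply: le_trans (big m) _; exact/cyl_anti/leq_addl.
Qed.

End zero_cylinders.

Section mixing_decay.
Variables (R : realType) (alpha : {posnum R}) (nu : probability (uitv R) R).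
Local Notation I := (uitv R).
Local Notation im := (im alpha).
Local Notation side := (side alpha).
Local Notation word := (word alpha).
Hypothesis inv : invariant_measure im nu.

Let mim := measurable_im alpha.
Let pE := expect_pos nu.

Definition zer m (x : I) : R := (word m x == nseq m false)%:R.
Definition qz m : R := expect nu (zer m).

Lemma bm_zer m : bm (zer m).
Proof. exact: (bm_word alpha m (fun w => (w == nseq m false)%:R)). Qed.

Lemma zer01 m x : 0 <= zer m x <= 1. Proof. by rewrite /zer ler0n lern1 leq_b1. Qed.

Lemma zer_le m n x : (m <= n)%N -> zer n x <= zer m x.
Proof.
move=> mn; rewrite /zer ler_nat !word0P.
by case: (leP (set_val x) (cyl alpha n)) => // h; rewrite (le_trans h)// cyl_anti.
Qed.

Lemma qz01 m : 0 <= qz m <= 1.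
Proof.
apply/andP; split.
  by case: pE => _ pos _; apply: pos; [exact: bm_zer|move=> x; case/andP: (zer01 m x)].
rewrite -[leRHS](mposfun_cst pE); apply: (mposfun_le pE).
- exact: bm_zer.
- exact: bm_cst.
- by move=> x; case/andP: (zer01 m x).
Qed.

Lemma qz_anti m n : (m <= n)%N -> qz n <= qz m.
Proof. by move=> mn; apply: (mposfun_le pE) => [||x]; [exact: bm_zer..|exact: zer_le]. Qed.

(* A Lipschitz function between the indicators of two nested cylinders turns
   mixing into an approximate product rule for the masses [qz]. *)
Lemma qz_mixing (C rho : R) m :
  (forall psi tpsi : I -> R,
      measurable_fun [set: I] psi -> bounded_fun psi -> Defs.lipschitz tpsi ->
      forall n : nat,
      `| \int[nu]_x (psi (iter n im x) * tpsi x)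
         - (\int[nu]_x psi x) * (\int[nu]_x tpsi x) |
      <= C * sup_norm psi * holder_seminorm 1 tpsi * rho ^+ n) ->
  0 < C -> 0 < rho ->
  qz (m + m.+1) <= qz m ^+ 2 + C * (cyl alpha m - cyl alpha m.+1)^-1 * rho ^+ m.+1.
Proof.
move=> mix C0 rho0; set La := (_ - _)^-1.
have dpos : 0 < cyl alpha m - cyl alpha m.+1.
  rewrite -[cyl alpha m]expand_cyl /expand mulrDr mulr1 addrAC subrr add0r.
  by rewrite mulr_gt0 ?powR_gt0 ?cyl_gt0.
have La0 : 0 < La by rewrite invr_gt0.
(* A ramp of slope [La], equal to [1] up to [cyl m.+1] and to [0] beyond [cyl m]. *)
pose t (x : I) : R := set_val (clamp ((cyl alpha m - set_val x) * La)).
have tlip x y : `|t x - t y| <= La * `|set_val x - set_val y|.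
  apply: le_trans (clamp_dist _ _) _.
  have -> : (cyl alpha m - set_val x) * La - (cyl alpha m - set_val y) * La =
     La * (set_val y - set_val x) by ring.
  by rewrite normrM (ger0_norm (ltW La0)) distrC.
have tq r : holder_quotients 1 t r -> r <= La.
  move=> [[x y] /= xy <-]; rewrite powRr1// ler_pdivrMr ?tlip//.
  by rewrite normr_gt0 uitv_dist_neq0.
have lt_ : Defs.lipschitz t by exists La => r; exact: tq.
have one_neq0 : (clamp 1 : I) != uitv0 R.
  apply/eqP => h; have := congr1 set_val h; rewrite clampE ?ler01 ?lexx//= => /eqP.
  by rewrite oner_eq0.
have q0 : holder_quotients 1 t !=set0 by eexists; exists (clamp 1, uitv0 R).
have sLa : holder_seminorm 1 t <= La by apply: ge_sup => // r; exact: tq.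
have s0 : 0 <= holder_seminorm 1 t.
  have [r hr] := q0; apply: le_trans (_ : r <= _).
    by case: hr => p _ <-; rewrite divr_ge0// powR_ge0.
  by apply: ub_le_sup => //; exists La => z; exact: tq.
have bz := bm_zer m.
have bdz : bounded_fun (zer m).
  exists 1; split; first exact: num_real.
  move=> y y1 x _; apply: le_trans (ltW y1); case/andP: (zer01 m x) => z0 z1.
  by rewrite ger0_norm.
have r0 : range (fun x => `|zer m x|) !=set0 by eexists; exists (uitv0 R).
have rub r : range (fun x => `|zer m x|) r -> r <= 1.
  by move=> [x _ <-]; case/andP: (zer01 m x) => z0 z1; rewrite ger0_norm.
have n1 : sup_norm (zer m) <= 1 by apply: ge_sup => // r; exact: rub.
have n0 : 0 <= sup_norm (zer m).
  apply: le_trans (normr_ge0 (zer m (uitv0 R))) _; apply: ub_le_sup.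
    by exists 1 => r; exact: rub.
  by exists (uitv0 R).
have bt : bm t.
  split; last by exists 1 => x; rewrite ger0_norm ?uitv_ge0// uitv_le1.
  by apply: (@measurable_holder _ 1%:pos La) => x y; rewrite /hdist /= powRr1.
have tle x : t x <= zer m x.
  rewrite /t /zer word0P; case: (leP (set_val x) (cyl alpha m)) => h; first exact: uitv_le1.
  have -> : clamp ((cyl alpha m - set_val x) * La) = uitv0 R.
    apply: uitv_inj; rewrite -[LHS]/(Num.min (Num.max _ 0) 1) (max_idPr _).
      by rewrite (min_idPl ler01).
    by rewrite nmulr_rle0 ?subr_lt0// ltW.
  by [].
have tge x : zer m.+1 x <= t x.
  rewrite /t /zer word0P; case: (leP (set_val x) (cyl alpha m.+1)) => h; last exact: uitv_ge0.
  have h1 : 1 <= (cyl alpha m - set_val x) * La by rewrite ler_pdivlMr// mul1r lerD2l lerN2.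
  rewrite -[leRHS]/(Num.min (Num.max _ 0) 1) (max_idPl _) ?(min_idPr h1)//.
  exact: le_trans h1.
have := mix _ _ bz.1 bdz lt_ m.+1.
rewrite -/(expect nu (fun x => zer m (iter m.+1 im x) * t x)) -/(expect nu (zer m)) -/(expect nu t).
move=> /(le_trans (ler_norm _)) hmix.
have bzi : bm (fun x => zer m (iter m.+1 im x)).
  by apply: (bm_comp (f := iter m.+1 im)) => //; exact: measurable_iter.
(* A run of [m + m.+1] zeros is a run of [m.+1] zeros followed, after [m.+1] iterations, by one of
   [m]; the ramp is at least the indicator of the former. *)
have h1 : qz (m + m.+1) <= expect nu (fun x => zer m (iter m.+1 im x) * t x).
  apply: (mposfun_le pE); [exact: bm_zer|exact: bmM|move=> x].
  apply: le_trans (_ : zer m (iter m.+1 im x) * zer m.+1 x <= _); last first.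
    by rewrite ler_wpM2l//; case/andP: (zer01 m (iter m.+1 im x)).
  rewrite /zer addnC word_cat nseqD eqseq_cat ?size_word ?size_nseq// andbC.
  by rewrite -natrM mulnb.
have h2 : expect nu t <= qz m.
  by apply: (mposfun_le pE) => //; exact: tle.
have h3 : C * sup_norm (zer m) * holder_seminorm 1 t * rho ^+ m.+1 <= C * La * rho ^+ m.+1.
  rewrite ler_wpM2r ?exprn_ge0 ?(ltW rho0)//; apply: ler_pM => //.
    by rewrite mulr_ge0// ltW.
  by rewrite ler_piMr// ltW.
have h4 : qz m * expect nu t <= qz m ^+ 2.
  by rewrite expr2 ler_wpM2l//; case/andP: (qz01 m).
by move: hmix h1 h3 h4; rewrite -/(qz m); lra.
Qed.

Lemma entropy_full_zero : (forall m, 1 <= qz m) -> entropy_wrt nu im side <= 0.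
Proof.
move=> q1; have [_ H] := entropy_wrt_lim mim inv (measurable_side alpha).
apply: (@lin_le _ _ _ 0) => n; rewrite mul0r addr0; apply: le_trans (H n) _.
have pj := partition_join mim (measurable_side alpha) (n := n).
rewrite entropyE oppr_le0; apply: sumr_ge0 => l _.
pose l1 : {ffun 'I_n -> bool} := [ffun=> false].
have cl1 (l' : {ffun 'I_n -> bool}) : (l' == l1) = (codom l' == nseq n false).
  apply/eqP/eqP => [->|e].
    apply: (@eq_from_nth _ false); first by rewrite size_codom card_ord size_nseq.
    move=> i; rewrite size_codom card_ord => ni.
    by rewrite codomE (nth_map (Ordinal ni)) ?size_enum_ord// ffunE nth_nseq ni.
  apply/ffunP => i; rewrite ffunE; move: e; rewrite codomE.
  have -> : nseq n false = [seq false | _ <- enum 'I_n].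
    have gen (T' : Type) (s : seq T') : [seq false | _ <- s] = nseq (size s) false.
      by elim: s => //= a s ->.
    by rewrite gen size_enum_ord.
  by move=> /eq_in_map; apply; rewrite mem_enum.
have p1 : pr nu (iterated_join im side n) l1 = qz n.
  rewrite -(expect_pr nu pj); congr expect; apply/funext => x.
  by rewrite cl1 codom_join.
have [->|ne] := eqVneq l l1.
  have e : pr nu (iterated_join im side n) l1 = 1.
    by apply/eqP; rewrite eq_le (pr_le1 nu pj) /= p1.
  by rewrite e ln1 mulr0.
have : pr nu (iterated_join im side n) l = 0.
  apply/eqP; rewrite eq_le pr_ge0 andbT.
  have := sum_pr nu pj; rewrite (bigD1 l1) //= (bigD1 l) //= p1.
  have : 0 <= \sum_(i | (i != l1) && (i != l)) pr nu (iterated_join im side n) i.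
    by apply: sumr_ge0 => i _; exact: pr_ge0.
  by have := q1 n; lra.
by move=> ->; rewrite mul0r.
Qed.

(** The slope of the ramp is the inverse of [cyl m.+1 ^ (1 + alpha)], which grows subexponentially
    and costs only a square root of the mixing rate. This leaves a doubling recursion for [qz]; its
    seed exists because otherwise all the mass sits at [0] and the entropy vanishes. *)
Lemma qz_exp_decay : exponentially_mixing im nu -> 0 < entropy_wrt nu im side ->
  exists2 K : R, 0 <= K & exists2 th : R, 0 < th < 1 & forall m, qz m <= K * th ^+ m.
Proof.
move=> [C [rho [C0 /andP[rho0 rho1] mix]]] hpos.
have a1 : 0 < 2 * (1 + alpha%:num) by rewrite mulr_gt0// addr_gt0.
(* Chosen so that [eta ^ (1 + alpha)] is the square root of [rho]. *)
pose eta := rho `^ (2 * (1 + alpha%:num))^-1.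
have eta0 : 0 < eta by rewrite powR_gt0.
have eta2 : eta `^ (1 + alpha%:num) = Num.sqrt rho.
  rewrite /eta -powRrM invfM -mulrA mulVf ?gt_eqF ?addr_gt0// mulr1.
  by rewrite -powR12_sqrt// ltW.
have sq01 : 0 < Num.sqrt rho < 1 by apply: sqrt_lt1; rewrite rho0.
have eta1 : eta < 1.
  rewrite ltNge; apply/negP => h; case/andP: sq01 => _; rewrite ltNge -eta2 => /negP; apply.
  apply: (@le_trans _ _ (1 `^ (1 + alpha%:num))); first by rewrite powR1.
  by apply: powR_le; rewrite ?addr_ge0.
clearbody eta.
have [c c0 hc] := cyl_subexp alpha (introT andP (conj eta0 eta1)).
have La m : (cyl alpha m - cyl alpha m.+1)^-1 <= (c `^ (1 + alpha%:num))^-1 * (Num.sqrt rho ^+ m.+1)^-1.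
  rewrite -invfM lef_pV2 ?posrE; last 2 first.
  - rewrite -[cyl alpha m]expand_cyl /expand mulrDr mulr1 addrAC subrr add0r.
    by rewrite mulr_gt0 ?powR_gt0 ?cyl_gt0.
  - by rewrite mulr_gt0 ?powR_gt0// exprn_gt0//; case/andP: sq01.
  have -> : cyl alpha m - cyl alpha m.+1 = cyl alpha m.+1 `^ (1 + alpha%:num).
    rewrite -[cyl alpha m]expand_cyl /expand mulrDr mulr1 addrAC subrr add0r.
    by rewrite powRD ?powRr1 ?cyl_ge0// (gt_eqF (cyl_gt0 _ _)) implybT.
  have -> : c `^ (1 + alpha%:num) * Num.sqrt rho ^+ m.+1 = (c * eta ^+ m.+1) `^ (1 + alpha%:num).
    rewrite powRM ?exprn_ge0 ?(ltW c0) ?(ltW eta0)//; congr (_ * _).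
    have h1 : Num.sqrt rho ^+ m.+1 = (eta `^ (1 + alpha%:num)) `^ m.+1%:R.
      by rewrite -eta2 powR_mulrn// powR_ge0.
    have h2 : eta ^+ m.+1 = eta `^ m.+1%:R by rewrite powR_mulrn// ltW.
    by rewrite h1 h2 -!powRrM [in RHS]mulrC.
  apply: powR_le; [exact: addr_ge0| |exact: hc].
  by rewrite mulr_ge0 ?exprn_ge0 ?(ltW c0) ?(ltW eta0).
pose D := C * (c `^ (1 + alpha%:num))^-1 * Num.sqrt rho.
have D0 : 0 <= D by rewrite !mulr_ge0 ?invr_ge0 ?powR_ge0 ?sqrtr_ge0 ?(ltW C0).
have rec m : qz (m + m.+1) <= qz m ^+ 2 + D * Num.sqrt rho ^+ m.
  apply: le_trans (qz_mixing m mix C0 rho0) _; rewrite lerD2l.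
  apply: le_trans (_ : C * ((c `^ (1 + alpha%:num))^-1 * (Num.sqrt rho ^+ m.+1)^-1) * rho ^+ m.+1 <= _).
    by rewrite ler_wpM2r ?exprn_ge0 ?(ltW rho0)// ler_wpM2l ?(ltW C0).
  apply: eq_refl_le; have -> : rho ^+ m.+1 = Num.sqrt rho ^+ m.+1 * Num.sqrt rho ^+ m.+1.
    by rewrite -exprMn -expr2 sqr_sqrtr// ltW.
  have s0 : Num.sqrt rho ^+ m.+1 != 0 by rewrite gt_eqF// exprn_gt0//; case/andP: sq01.
  rewrite /D [in RHS]mulrAC -mulrA -mulrA -[RHS]mulrA -exprSr; congr (_ * _).
  by rewrite mulrA divfK// mulrC.
apply: (doubling_decay qz01 qz_anti D0 sq01 rec).
(* Without a seed the infimum [a] of [qz] is at least [1/8], while the recursion gives [a <= a ^+ 2]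
   in the limit; hence [a >= 1]. *)
have [//|no] := pselect (exists m, qz m <= 8^-1); exfalso.
have q8 m : 8^-1 < qz m by rewrite ltNge; apply/negP => h; apply: no; exists m.
pose a := inf (range qz).
have hinf : has_inf (range qz).
  by split; [exists (qz 0%N), 0%N|exists 0 => _ [m _ <-]; case/andP: (qz01 m)].
have aq m : a <= qz m by apply: ge_inf; [exact: hinf.2|exists m].
have a8 : 8^-1 <= a.
  by apply: lb_le_inf; [exact: hinf.1|move=> _ [m _ <-]; exact: ltW].
have aa : a <= a ^+ 2.
  apply/ler_addgt0Pr => e e0.
  have e2 : 0 < Num.min 1 (e / 4) by rewrite lt_min ltr01 divr_gt0.
  have [_ [m1 _ <-] hm1] := inf_adherent e2 hinf.
  have e3 : 0 < e / (4 * (D + 1)) by rewrite divr_gt0// mulr_gt0// ltr_wpDl.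
  have [m2 hm2] := expr_lt_ex (introT andP (conj (ltW (andP sq01).1) (andP sq01).2)) e3.
  pose m := maxn m1 m2.
  have qm : qz m < a + Num.min 1 (e / 4) by apply: le_lt_trans hm1; apply: qz_anti; rewrite leq_maxl.
  have sm : D * Num.sqrt rho ^+ m <= e / 4.
    apply: le_trans (_ : (D + 1) * (e / (4 * (D + 1))) <= _); last first.
      by apply: eq_refl_le; field; rewrite gt_eqF// ltr_wpDl.
    apply: ler_pM; rewrite ?exprn_ge0 ?sqrtr_ge0 ?lerDl//; apply: le_trans (ltW hm2).
    by apply: ler_wiXn2l; rewrite ?sqrtr_ge0 ?leq_maxr// ltW; case/andP: sq01.
  have := rec m; have := aq (m + m.+1)%N; have /andP[qm0 qm1] := qz01 m.
  have a1' : a <= 1 by apply: le_trans (aq m) qm1.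
  have : qz m <= a + e / 4.
    by apply: le_trans (ltW qm) _; rewrite lerD2l ge_min lexx orbT.
  have := aq m; move: e0 a8 sm; nra.
have a1' : 1 <= a by move: aa a8; nra.
have := entropy_full_zero (fun m => le_trans a1' (aq m)).
by rewrite leNgt hpos.
Qed.

End mixing_decay.

(** * Random replacement of blocks by zeros *)

Fact square_succ M : (M.+1 * M.+1 = M * M + (2 * M + 1))%N. Proof. lia. Qed.

Fact square_split n : (n * n = n + n * n.-1)%N. Proof. by case: n => // n; lia. Qed.

Fact odd_le m : (2 * m + 1 <= 2 * m.+1)%N. Proof. lia. Qed.

Section replacement.
Variables (R : realType) (alpha g : {posnum R}).
Local Notation I := (uitv R).
Local Notation br := (br alpha).
Local Notation im := (im alpha).
Local Notation side := (side alpha).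
Local Notation word := (word alpha).
Local Notation s := (rate alpha g).
Local Notation y0 := (uitv0 R).
Variables (phi : I -> R) (A : R).
Hypothesis phiA : nrm (hdist g) phi A.
Hypothesis phi0 : phi (uitv0 R) = 0.
Local Notation wS := (wS alpha phi).
Local Notation dsum := (dsum alpha g).

Let A0 : 0 <= A := phiA_ge0 phiA.
Let s0 : 0 <= s. Proof. by case/andP: (rate01 alpha g) => /ltW. Qed.
Let s1 : s <= 1. Proof. by case/andP: (rate01 alpha g) => _ /ltW. Qed.

Definition ones (v : seq bool) : nat := count id v.

(** Sum of [s ^+ ones] over the nonempty suffixes, a Hölder constant of [wS v] up to the factor [A].
    Unlike [dsum] it is not bounded by the length alone in a useful way, but its mean along typical
    orbits is bounded. *)
Fixpoint sig (v : seq bool) : R :=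
  if v is b :: v' then s ^+ ones v + sig v' else 0.

Lemma sig_ge0 v : 0 <= sig v.
Proof. by elim: v => //= b v IH; rewrite addr_ge0// exprn_ge0. Qed.

Lemma ones_cat u v : ones (u ++ v) = (ones u + ones v)%N.
Proof. exact: count_cat. Qed.

Lemma sig_cat u v : sig (u ++ v) = s ^+ ones v * sig u + sig v.
Proof.
elim: u => [|b u IH]; first by rewrite mulr0 add0r.
rewrite cat_cons [LHS]/= IH [sig (b :: u)]/= mulrDr addrA; congr (_ + _ + _).
by rewrite -exprD -[(b + ones (u ++ v))%N]/(ones ((b :: u) ++ v)) ones_cat addnC.
Qed.

Lemma hdist_ones v x y : hdist g (gs br v x) (gs br v y) <= s ^+ ones v * hdist g x y.
Proof.
elim: v => [|b v IH]; first by rewrite mul1r.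
apply: le_trans (hdist_br alpha g b _ _) _.
case: b => /=; last by rewrite mul1r add0n.
by rewrite exprS -mulrA ler_wpM2l.
Qed.

Lemma wS_dist_sig v x y : `|wS v x - wS v y| <= A * sig v * hdist g x y.
Proof.
elim: v => [|b v IH]; first by rewrite /= subrr normr0 mulr0 mul0r.
have -> : wS (b :: v) x - wS (b :: v) y =
  (phi (gs br (b :: v) x) - phi (gs br (b :: v) y)) + (wS v x - wS v y) by rewrite /=; ring.
rewrite [sig _]/= mulrDr mulrDl; apply: le_trans (ler_normD _ _) _; apply: lerD => //.
apply: le_trans (phiA.2 _ _) _; rewrite -mulrA ler_wpM2l//.
exact: (hdist_ones (b :: v)).
Qed.

Lemma wS_cat v w y : wS (v ++ w) y = wS v (gs br w y) + wS w y.
Proof.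
elim: v => [|b v IH]; first by rewrite add0r.
by rewrite cat_cons /= IH addrA /gs foldr_cat.
Qed.

Lemma gs_cat v w (y : I) : gs br (v ++ w) y = gs br v (gs br w y).
Proof. by rewrite /gs foldr_cat. Qed.

Lemma gs_zero N : gs br (nseq N false) y0 = y0.
Proof. by elim: N => //= N ->; exact: br_false_fix. Qed.

Lemma wS_zero N : wS (nseq N false) y0 = 0.
Proof.
elim: N => [//|N IH]; rewrite [LHS]/= IH addr0.
by rewrite -[phi _]/(phi (gs br (nseq N.+1 false) y0)) gs_zero.
Qed.

Lemma dsum_ge0 n : 0 <= dsum n.
Proof. by apply: sumr_ge0 => i _; exact: cylh_ge0. Qed.

Lemma wS_zero_ge N x : - (A * dsum N) <= wS (nseq N false) x.
Proof.
have := wS_dist alpha phiA (nseq N false) x y0.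
by rewrite wS_zero subr0 size_nseq ler_norml => /andP[].
Qed.

Lemma sum_words_cat n m (F : seq bool -> R) :
  \sum_(w <- words (n + m)) F w = \sum_(v <- words n) \sum_(w <- words m) F (v ++ w).
Proof.
elim: n F => [|n IH] F; first by rewrite big_seq1.
by rewrite addSn /= !big_cat !big_map /= !IH.
Qed.

Lemma hdistxx x : hdist g x x = 0.
Proof. by rewrite /hdist subrr normr0 powR0// gt_eqF. Qed.

Definition part n : R := \sum_(w <- words n) expR (wS w y0).

Lemma part_ge1 n : 1 <= part n.
Proof.
rewrite /part (big_rem (nseq n false)) ?mem_words ?size_nseq//= wS_zero expR0 lerDl.
by apply: sumr_ge0 => w _; exact: expR_ge0.
Qed.

Section blocks.
Variable N : nat.
Local Notation z := (nseq N false).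

(* Probabilistic surgery: every block is independently kept (weight [keep]) or
   replaced by the zero block (weight [erase]). The weights are such that the
   total mass landing on each word is at most one copy of that word. *)
Definition keep (v : seq bool) : R := 1 - (v == z)%:R / 2.
Definition erase (v : seq bool) : R := expR (wS v y0) / (2 * part N).

Let Z0 : 0 < part N. Proof. exact: lt_le_trans (part_ge1 N). Qed.

Lemma keep_ge v : 2^-1 <= keep v.
Proof. by rewrite /keep; case: (v == z) => /=; lra. Qed.

Lemma erase_gt0 v : 0 < erase v.
Proof. by rewrite /erase divr_gt0 ?expR_gt0// mulr_gt0. Qed.

Lemma keep_ge0 v : 0 <= keep v.
Proof. by apply: le_trans (keep_ge v); rewrite invr_ge0. Qed.

(** The weighted sum of [X] over the [2 ^ K] outcomes of the surgery on [w]; the head of [X]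
    accumulates the blocks already treated. *)
Fixpoint surgery K (X : seq bool -> R) (w : seq bool) : R :=
  if K is K'.+1 then
    keep (take N w) * surgery K' (fun u => X (take N w ++ u)) (drop N w) +
    erase (take N w) * surgery K' (fun u => X (z ++ u)) (drop N w)
  else X [::].

Lemma surgery_le K X Y w : (forall u, X u <= Y u) -> surgery K X w <= surgery K Y w.
Proof.
elim: K X Y w => [|K IH] X Y w XY /=; first exact: XY.
by apply: lerD; (rewrite ler_wpM2l ?keep_ge0 ?(ltW (erase_gt0 _))//; apply: IH => u; exact: XY).
Qed.

Lemma surgery_scale K c X w : surgery K (fun u => c * X u) w = c * surgery K X w.
Proof. by elim: K X w => [//|K IH] X w /=; rewrite !IH; ring. Qed.

Lemma surgery_cat K X v w : size v = N -> surgery K.+1 X (v ++ w) =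
  keep v * surgery K (fun u => X (v ++ u)) w + erase v * surgery K (fun u => X (z ++ u)) w.
Proof. by move=> sv; rewrite /= take_size_cat// drop_size_cat. Qed.

(** Mass is conserved: the weights [erase v] sum to [1/2] over all blocks, exactly what the zero
    block loses when it is kept with weight [1/2]. *)
Lemma surgery_sum K X :
  \sum_(w <- words (K * N)) surgery K X w = \sum_(w <- words (K * N)) X w.
Proof.
elim: K X => [|K IH] X; first by rewrite !big_seq1.
rewrite mulSn !sum_words_cat; pose S v := \sum_(w <- words (K * N)) X (v ++ w).
transitivity (\sum_(v <- words N) (keep v * S v + erase v * S z)).
  apply: eq_big_seq => v; rewrite mem_words => /eqP sv.
  under eq_bigr do rewrite surgery_cat//.
  by rewrite big_split /= -!mulr_sumr !IH.
rewrite big_split /= -mulr_suml.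
have -> : \sum_(v <- words N) erase v = 2^-1.
  rewrite /erase -mulr_suml -/(part N); field; by rewrite gt_eqF.
have zw : z \in words N by rewrite mem_words size_nseq.
rewrite (big_rem z zw) [RHS](big_rem z zw) /= -/(S z).
have -> : \sum_(v <- rem z (words N)) keep v * S v = \sum_(v <- rem z (words N)) S v.
  apply: eq_big_seq => v; rewrite mem_rem_uniq ?uniq_words// inE => /andP[/negbTE vz _].
  by rewrite /keep vz mul0r subr0 mul1r.
have -> : keep z = 2^-1 by rewrite /keep eqxx /=; field.
rewrite -[\sum_(y <- _) \sum_(w <- _) _]/(\sum_(v <- rem z (words N)) S v).
by set Sg := \sum_(v <- _) S v; field.
Qed.

(** Lower bound for the ratio between the surgery of [expR wS] at [w] and its value there. The
    parameter [P] is the Hölder constant inherited from the blocks on the left: an erasure moves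
    their base point and costs at most [P], after which the accumulated constant of the surviving
    blocks can only be smaller. *)
Fixpoint gains K (P : R) (w : seq bool) : R :=
  if K is K'.+1 then
    (keep (take N w) + erase (take N w) *
       expR (- P - A * dsum N - wS (take N w) (gs br (drop N w) y0))) *
    gains K' (s ^+ ones (take N w) * P + A * sig (take N w)) (drop N w)
  else 1.

Let factor_gt0 v e : 0 < keep v + erase v * expR e.
Proof. by rewrite ltr_wpDl ?keep_ge0// mulr_gt0 ?erase_gt0 ?expR_gt0. Qed.

Lemma gains_gt0 K P w : 0 < gains K P w.
Proof. by elim: K P w => [//|K IH] P w /=; rewrite mulr_gt0. Qed.

Lemma gains_anti K P P' w : P <= P' -> gains K P' w <= gains K P w.
Proof.
elim: K P P' w => [//|K IH] P P' w PP /=.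
apply: ler_pM; rewrite ?(ltW (factor_gt0 _ _)) ?(ltW (gains_gt0 _ _ _))//.
  by rewrite lerD2l ler_wpM2l ?(ltW (erase_gt0 _))// ler_expR; lra.
by apply: IH; rewrite lerD2r ler_wpM2l// exprn_ge0.
Qed.

Lemma split_block K (w : seq bool) : size w = (K.+1 * N)%N ->
  exists v w', [/\ w = v ++ w', size v = N & size w' = (K * N)%N].
Proof.
move=> sw; exists (take N w), (drop N w); rewrite cat_take_drop.
rewrite size_takel; last by rewrite sw mulSn leq_addr.
by rewrite size_drop sw mulSn addKn.
Qed.

Lemma gains_cat K P v w : size v = N -> gains K.+1 P (v ++ w) =
  (keep v + erase v * expR (- P - A * dsum N - wS v (gs br w y0))) *
  gains K (s ^+ ones v * P + A * sig v) w.
Proof. by move=> sv; rewrite /= take_size_cat// drop_size_cat. Qed.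

(** The penalty [P * hdist] lets the induction carry the effect of later changes on earlier blocks.
    Keeping a block contracts the displacement by [s ^+ ones v]; erasing it resets the inherited
    constant to [0], and [gains_anti] returns to the common one. *)
Lemma surgery_ge K P w : 0 <= P -> size w = (K * N)%N ->
  expR (wS w y0) * gains K P w <=
  surgery K (fun u => expR (wS u y0 - P * hdist g (gs br u y0) (gs br w y0))) w.
Proof.
elim: K P w => [|K IH] P w P0 sw.
  by rewrite (size0nil sw) /= hdistxx mulr0 subrr mulr1.
have [v [w' [-> sv sw']]] := split_block sw.
rewrite surgery_cat// gains_cat//.
set P' := s ^+ ones v * P + A * sig v.
have P'0 : 0 <= P' by rewrite addr_ge0 ?mulr_ge0 ?exprn_ge0// sig_ge0.
rewrite wS_cat expRD gs_cat mulrDl mulrDr; apply: lerD.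
- apply: le_trans (_ : keep v * (expR (wS v (gs br w' y0)) *
     surgery K (fun u => expR (wS u y0 - P' * hdist g (gs br u y0) (gs br w' y0))) w') <= _).
    rewrite mulrCA ler_wpM2l ?keep_ge0// -mulrA ler_wpM2l ?expR_ge0//; exact: IH.
  rewrite ler_wpM2l ?keep_ge0// -surgery_scale; apply: surgery_le => u.
  rewrite -expRD ler_expR wS_cat gs_cat.
  have h1 := hdist_ones v (gs br u y0) (gs br w' y0).
  have h2 := wS_dist_sig v (gs br u y0) (gs br w' y0).
  rewrite ler_norml in h2; case/andP: h2 => h2 _.
  have h3 := ler_wpM2l P0 h1.
  by rewrite /P' mulrDl; move: h2 h3; lra.
- apply: le_trans (_ : erase v * (expR (- P - A * dsum N) *
     surgery K (fun u => expR (wS u y0 - 0 * hdist g (gs br u y0) (gs br w' y0))) w') <= _).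
    have -> : expR (wS v (gs br w' y0)) * expR (wS w' y0) *
      (erase v * expR (- P - A * dsum N - wS v (gs br w' y0)) * gains K P' w') =
      erase v * (expR (- P - A * dsum N) * (expR (wS w' y0) * gains K P' w')).
      rewrite expRD [expR (- wS v _)]expRN; field; by rewrite gt_eqF// expR_gt0.
    rewrite ler_wpM2l ?(ltW (erase_gt0 _))// ler_wpM2l ?expR_ge0//.
    apply: le_trans (IH 0 w' (lexx 0) sw').
    by rewrite ler_wpM2l ?expR_ge0// gains_anti.
  rewrite ler_wpM2l ?(ltW (erase_gt0 _))// -surgery_scale; apply: surgery_le => u.
  rewrite -expRD ler_expR wS_cat gs_cat mul0r subr0.
  have h1 := wS_zero_ge N (gs br u y0).
  have h2 : P * hdist g (gs br z (gs br u y0)) (gs br v (gs br w' y0)) <= P.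
    by rewrite ler_piMr// hdist_le1.
  by move: h1 h2; lra.
Qed.

(** The logarithmic price of an erasure: the normalization of [erase], plus one distortion for
    comparing the block at two base points and one for the zero block put in its place. *)
Definition cost : R := ln (2 * part N) + 2 * A * dsum N.

Lemma cost_ge0 : 0 <= cost.
Proof.
rewrite addr_ge0// ?mulr_ge0 ?dsum_ge0//; apply: ln_ge0.
by have := part_ge1 N; lra.
Qed.

(** An additive minorant of [ln gains]. Every block earns half of the erasure weight, since
    [ln (1 + a) >= a / 2], and a zero block loses [ln 2] because it is kept with weight [1/2]. *)
Fixpoint lgain K (P : R) (w : seq bool) : R :=
  if K is K'.+1 then
    (expR (- cost - P) / 2 - ln 2 * (take N w == z)%:R) +
    lgain K' (s ^+ ones (take N w) * P + A * sig (take N w)) (drop N w)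
  else 0.

Lemma lgain_cat K P v w : size v = N -> lgain K.+1 P (v ++ w) =
  (expR (- cost - P) / 2 - ln 2 * (v == z)%:R) + lgain K (s ^+ ones v * P + A * sig v) w.
Proof. by move=> sv; rewrite /= take_size_cat// drop_size_cat. Qed.

Lemma ln1p_ge (a : R) : 0 <= a <= 1 -> a / 2 <= ln (1 + a).
Proof.
move=> /andP[a0 a1]; have a10 : 0 < 1 + a by rewrite ltr_pwDl.
have h : ln (1 + a)^-1 <= (1 + a)^-1 - 1.
  have -> : (1 + a)^-1 = 1 + ((1 + a)^-1 - 1) by ring.
  rewrite [leRHS](_ : _ = (1 + a)^-1 - 1); last by ring.
  by apply: le_ln1Dx; rewrite ltrBrDl subrr invr_gt0.
rewrite lnV ?posrE// in h.
have : a / 2 <= 1 - (1 + a)^-1.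
  have -> : 1 - (1 + a)^-1 = a / (1 + a) by field; rewrite gt_eqF.
  by rewrite ler_wpM2l// lef_pV2 ?posrE//; lra.
by move: h; lra.
Qed.

Lemma lgain_le K P w : 0 <= P -> size w = (K * N)%N -> lgain K P w <= ln (gains K P w).
Proof.
elim: K P w => [|K IH] P w P0 sw; first by rewrite /= ln1.
have [v [w' [-> sv sw']]] := split_block sw.
rewrite gains_cat// lgain_cat//.
set P' := s ^+ ones v * P + A * sig v.
have P'0 : 0 <= P' by rewrite addr_ge0 ?mulr_ge0 ?exprn_ge0// sig_ge0.
rewrite lnM ?posrE ?factor_gt0 ?gains_gt0//; apply: lerD; last exact: IH.
pose a := expR (- cost - P).
have a01 : 0 <= a <= 1.
  by rewrite expR_ge0 -expR0 ler_expR; have := cost_ge0; lra.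
have ae : a <= erase v * expR (- P - A * dsum N - wS v (gs br w' y0)).
  rewrite /a /erase -[(2 * _)^-1](@lnK _) ?posrE ?invr_gt0 ?mulr_gt0//.
  rewrite lnV ?posrE ?mulr_gt0// -!expRD ler_expR /cost.
  have := wS_dist alpha phiA v y0 (gs br w' y0); rewrite sv ler_norml => /andP[h _].
  by move: h; lra.
apply: le_trans (_ : ln (1 + a) - ln 2 * (v == z)%:R <= _).
  by rewrite lerD2r; exact: ln1p_ge.
have a10 : 0 < 1 + a by case/andP: a01 => a0 _; rewrite ltr_pwDl.
case: eqP => vz; last first.
  rewrite mulr0 subr0 ler_ln ?posrE ?factor_gt0//.
  by rewrite /keep; move/eqP/negbTE: vz => ->; rewrite mul0r subr0 lerD2l.
rewrite mulr1 -ln_div ?posrE// ler_ln ?posrE ?factor_gt0 ?divr_gt0//.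
have -> : keep v = 2^-1 by rewrite /keep vz eqxx /=; field.
by case/andP: a01 => ? ?; move: ae; lra.
Qed.

Variable nu : probability I R.
Hypothesis inv : invariant_measure im nu.
Let mim := measurable_im alpha.
Let pE := expect_pos nu.

(** Since surgery conserves mass, the weights [expR (wS w + lgain w) / part] form a subprobability
    on words. Gibbs' inequality with them improves the usual bound by the mean of [lgain]. *)
Lemma surgery_entropy K : partition_entropy nu (iterated_join im side (K * N)) <=
  ln (part (K * N)) -
  (expect nu (fun x => wS (word (K * N) x) y0) + expect nu (fun x => lgain K 0 (word (K * N) x))).
Proof.
pose F w := wS w y0 + lgain K 0 w - ln (part (K * N)).
have Zn0 : 0 < part (K * N) by exact: lt_le_trans (part_ge1 _).
have F1 : \sum_(w <- words (K * N)) expR (F w) <= 1.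
  apply: le_trans (_ : (\sum_(w <- words (K * N)) surgery K (fun u => expR (wS u y0)) w) / part (K * N) <= _); last first.
    by rewrite surgery_sum divff// gt_eqF.
  rewrite mulr_suml big_seq [leRHS]big_seq; apply: ler_sum => w; rewrite mem_words => /eqP sw.
  rewrite /F expRD expRN lnK ?posrE// ler_pM2r ?invr_gt0//.
  have := surgery_ge (lexx 0) sw.
  have -> : (fun u => expR (wS u y0 - 0 * hdist g (gs br u y0) (gs br w y0))) = fun u => expR (wS u y0).
    by apply/funext => u; rewrite mul0r subr0.
  apply: le_trans; rewrite expRD ler_wpM2l ?expR_ge0//.
  rewrite -[leRHS]lnK ?posrE ?gains_gt0// ler_expR; exact: lgain_le.
have hF := entropy_word_le alpha nu F1; apply: le_trans hF _.
have b1 := bm_word alpha (K * N) (fun w => wS w y0).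
have b2 := bm_word alpha (K * N) (fun w => lgain K 0 w).
have -> : (fun x => F (word (K * N) x)) = fun x => (fun x => wS (word (K * N) x) y0 + lgain K 0 (word (K * N) x)) x - (fun=> ln (part (K * N))) x.
  by [].
rewrite (mposfunB pE) ?(mposfunD pE)// ?(mposfun_cst pE) ?opprB//.
- exact: bmD.
- exact: bm_cst.
Qed.

(** By [sig_cat] the constant inherited by a block is [A] times [sig] of the whole orbit segment
    before it. *)
Lemma lgain_orbit K b x : lgain K (A * sig (word (b * N) x)) (word (K * N) (iter (b * N) im x)) =
  \sum_(i < K) (expR (- cost - A * sig (word ((b + i) * N) x)) / 2
                - ln 2 * zer alpha N (iter ((b + i) * N) im x)).
Proof.
elim: K b => [|K IH] b; first by rewrite big_ord0.
rewrite big_ord_recl addn0 mulSn word_cat lgain_cat ?size_word//.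
congr (_ + _); rewrite -iterD.
have -> : s ^+ ones (word N (iter (b * N) im x)) * (A * sig (word (b * N) x)) +
    A * sig (word N (iter (b * N) im x)) = A * sig (word (b.+1 * N) x).
  by rewrite mulSn addnC word_cat sig_cat mulrDr [A * (s ^+ _ * _)]mulrCA.
rewrite -mulSn IH; apply: eq_bigr => i _.
by rewrite lift0 addnS.
Qed.

Variable Ds : R.
Hypothesis sigD : forall n, expect nu (fun x => sig (word n x)) <= Ds.

Definition gain : R := expR (- cost - A * Ds) / 2 - ln 2 * qz alpha nu N.

(** By invariance each block has the same chance of being zero, and by convexity of the exponential
    the mean earning is at least the earning at the mean bound [Ds]. *)
Lemma expect_lgain K : K%:R * gain <= expect nu (fun x => lgain K 0 (word (K * N) x)).
Proof.
pose F i x := expR (- cost - A * sig (word (i * N) x)) / 2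
                - ln 2 * zer alpha N (iter (i * N) im x).
have bzi i : bm (fun x => zer alpha N (iter (i * N) im x)).
  apply: (bm_comp (f := iter (i * N) im)); [exact: measurable_iter|exact: bm_zer].
have be n : bm (fun x => expR (- cost - A * sig (word n x)) / 2).
  exact: (bm_word alpha n (fun w => expR (- cost - A * sig w) / 2)).
have bF i : bm (F i) by apply: bmB => //; exact: bmZ.
have -> : (fun x => lgain K 0 (word (K * N) x)) = fun x => \sum_(i < K) F i x.
  by apply/funext => x; have := lgain_orbit K 0 x; rewrite mul0n /= mulr0 => ->.
rewrite (mposfun_sum pE (fun i _ => bF i)) mulr_natl -[X in _ *+ X](card_ord K) -sumr_const.
apply: ler_sum => i _; rewrite /F (mposfunB pE)//; last exact: bmZ.
rewrite (mposfunZ pE)// (expect_iter mim inv (i * N) (bm_zer alpha N)) -/(qz alpha nu N).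
rewrite lerD2r.
have bs := bm_word (R := R) alpha (i * N) sig.
pose c := expR (- cost - A * Ds) / 2.
have c0 : 0 <= c by rewrite divr_ge0// expR_ge0.
apply: le_trans (_ : expect nu (fun x => (- (c * A)) * sig (word (i * N) x) + (c * (1 + A * Ds))) <= _).
  rewrite (mposfunD pE (bmZ _ bs) (bm_cst _ _)) (mposfunZ pE _ bs) (mposfun_cst pE).
  have h := ler_wpM2l (mulr_ge0 c0 A0) (sigD (i * N)).
  by rewrite -/c; move: h; lra.
apply: (mposfun_le pE) => //; first by apply: bmD; [exact: bmZ|exact: bm_cst].
move=> x; have -> : - cost - A * sig (word (i * N) x) =
  (- cost - A * Ds) + (A * Ds - A * sig (word (i * N) x)) by ring.
rewrite expRD; have := expR_ge1Dx (A * Ds - A * sig (word (i * N) x)) => h.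
have := ler_wpM2l c0 h; rewrite /c; set e := expR (- cost - _); set e' := expR (_ - _).
by move=> h'; apply: le_trans (le_trans h' _); apply: eq_refl_le; field.
Qed.

End blocks.

Section ones_decay.
Variable nu : probability I R.
Hypothesis inv : invariant_measure im nu.
Let mim := measurable_im alpha.
Let pE := expect_pos nu.

Definition em n : R := expect nu (fun x => s ^+ ones (word n x)).

Let b1 n : bm (fun x => s ^+ ones (word n x)).
Proof. exact: (bm_word alpha n (fun w => s ^+ ones w)). Qed.

Lemma em_anti m n : (m <= n)%N -> em n <= em m.
Proof.
move=> mn; apply: (mposfun_le pE) => // x; apply: ler_wiXn2l => //.
by rewrite -(subnKC mn) word_cat ones_cat leq_addr.
Qed.

Lemma em_ge0 n : 0 <= em n.
Proof. by case: pE => _ pos _; apply: pos => // x; exact: exprn_ge0. Qed.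

(** Either each of the [i] windows contains a one, or some window consists of zeros. *)
Lemma ones_windows k i x : s ^+ ones (word (i * k) x) <=
  s ^+ i + \sum_(l < i) zer alpha k (iter (l * k) im x).
Proof.
elim: i x => [|i IH] x; first by rewrite big_ord0 addr0.
rewrite mulSn word_cat ones_cat exprD big_ord_recl /=.
have z0 l : 0 <= zer alpha k (iter (l * k) im x) by case/andP: (zer01 alpha k (iter (l * k) im x)).
have S0 : 0 <= \sum_(l < i) zer alpha k (iter (bump 0 l * k) im x) by apply: sumr_ge0.
rewrite {1}/zer; case: eqP => [_|ne].
  apply: le_trans (_ : 1 <= _); last by rewrite addrA [_ + 1]addrC -addrA lerDl addr_ge0// exprn_ge0.
  by apply: mulr_ile1; rewrite ?exprn_ge0// exprn_ile1.
rewrite add0r; have o1 : (1 <= ones (word k x))%N.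
  rewrite lt0n; apply: contra_notN ne => /eqP o0.
  have := size_word alpha k x; rewrite /ones in o0 *; move: (word k x) o0 => w o0 <-.
  by elim: w o0 => //= -[] // w IHw; rewrite add0n => /IHw {1}->.
apply: le_trans (_ : s * (s ^+ i + \sum_(l < i) zer alpha k (iter (l * k) im (iter k im x))) <= _).
  apply: ler_pM; rewrite ?exprn_ge0//.
  by rewrite -[leRHS]expr1; exact: ler_wiXn2l.
rewrite mulrDr -exprS lerD2l.
have -> : \sum_(l < i) zer alpha k (iter (l * k) im (iter k im x)) = \sum_(l < i) zer alpha k (iter (bump 0 l * k) im x).
  by apply: eq_bigr => l _; rewrite -iterD -[bump 0 l]/(l.+1) mulSn addnC.
by rewrite ler_piMl.
Qed.

Lemma em_windows m : em (m * m) <= s ^+ m + m%:R * qz alpha nu m.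
Proof.
have bz l : bm (fun x => zer alpha m (iter (l * m) im x)).
  apply: (bm_comp (f := iter (l * m) im)); [exact: measurable_iter|exact: bm_zer].
have bS : bm (fun x => \sum_(l < m) zer alpha m (iter (l * m) im x)).
  by apply: (bm_sum (F := fun l x => zer alpha m (iter (l * m) im x))).
have -> : s ^+ m + m%:R * qz alpha nu m =
    expect nu (fun x => s ^+ m + \sum_(l < m) zer alpha m (iter (l * m) im x)).
  rewrite (mposfunD pE (bm_cst _ _) bS) (mposfun_cst pE); congr (_ + _).
  rewrite (mposfun_sum pE (fun l _ => bz l)).
  under eq_bigr do rewrite (expect_iter mim inv _ (bm_zer alpha m)).
  by rewrite sumr_const card_ord -[RHS]mulr_natl.
apply: (mposfun_le pE) => //; first by apply: bmD => //; exact: bm_cst.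
by move=> x; exact: ones_windows.
Qed.

(** Each suffix of a word is again a word of the orbit, so invariance turns the mean of [sig] into a
    sum of the means [em]. *)
Lemma expect_sig n : expect nu (fun x => sig (word n x)) = \sum_(j < n) em j.+1.
Proof.
elim: n => [|n IH]; first by rewrite big_ord0 /= (mposfun_cst pE).
rewrite big_ord_recr /= -IH.
have bs := bm_word (R := R) alpha n sig.
rewrite -[expect nu (fun x => sig (word n x))](expect_invariant mim inv bs) addrC.
by rewrite -(mposfunD pE)//; exact: (bm_comp mim bs).
Qed.

Lemma sum_em_squares M : \sum_(j < M * M) em j <= \sum_(m < M) (2 * m + 1)%:R * em (m * m).
Proof.
elim: M => [|M IH]; first by rewrite mul0n !big_ord0.
rewrite square_succ.
rewrite big_split_ord big_ord_recr /=; apply: lerD => //.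
rewrite mulr_natl -[X in _ *+ X](card_ord (2 * M + 1)) -sumr_const.
by apply: ler_sum => j _; apply: em_anti; rewrite leq_addr.
Qed.

(** With [m] windows of length [m], [em (m * m)] decays geometrically in [m]; by monotonicity it
    bounds the [2 m + 1] terms up to the next square, and the sum converges. *)
Lemma sig_bound (K th : R) : 0 <= K -> 0 < th < 1 ->
  (forall m, qz alpha nu m <= K * th ^+ m) ->
  exists Ds : R, forall n, expect nu (fun x => sig (word n x)) <= Ds.
Proof.
move=> K0 th01 qK.
have [r [r0 r1 sr tr]] : exists r : R, [/\ 0 < r, r < 1, s <= r & th <= r].
  exists (Num.max s th); rewrite lt_max gt_max !le_max !lexx orbT.
  by case/andP: th01 => -> ->; case/andP: (rate01 alpha g) => _ ->; rewrite orbT.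
(* A fourth root: of the four factors [t ^+ m] in [r ^+ m], two absorb the two linear factors in [m]
   and the other two form the summable series. *)
pose t := Num.sqrt (Num.sqrt r).
have /andP[t0 t1] : 0 < t < 1 by apply/sqrt_lt1/sqrt_lt1; rewrite r0.
have t4 : r = t ^+ 2 * t ^+ 2 by rewrite /t !sqr_sqrtr ?sqrtr_ge0// -expr2 sqr_sqrtr// ltW.
pose C := (1 - t)^-1.
have C0 : 0 < C by rewrite invr_gt0 subr_gt0.
have t2 : 0 <= t ^+ 2 < 1 by rewrite exprn_ge0 ?(ltW t0)//= exprn_ilt1// ltW.
pose B := 2 * (1 + K) * C ^+ 2.
have B0 : 0 <= B by rewrite !mulr_ge0 ?addr_ge0 ?exprn_ge0// ltW.
have tm m : (2 * m + 1)%:R * em (m * m) <= B * (t ^+ 2) ^+ m.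
  have e1 : em (m * m) <= (1 + K) * m.+1%:R * r ^+ m.
    apply: le_trans (em_windows m) _; apply: le_trans (_ : r ^+ m + m%:R * (K * r ^+ m) <= _).
      apply: lerD; first by rewrite lerXn2r ?nnegrE// ltW.
      rewrite ler_wpM2l//; apply: le_trans (qK m) _; rewrite ler_wpM2l// lerXn2r ?nnegrE ?(ltW r0)//.
      by case/andP: th01 => /ltW.
    have rm : 0 <= r ^+ m by rewrite exprn_ge0// ltW.
    have -> : r ^+ m + m%:R * (K * r ^+ m) = (1 + m%:R * K) * r ^+ m by ring.
    rewrite ler_wpM2r// -natr1.
    by have := mulr_ge0 (ler0n R m) K0; have := ler0n R m; move: K0; nra.
  have e2 : (2 * m + 1)%:R <= 2 * m.+1%:R :> R.
    by rewrite -natrM ler_nat; exact: odd_le.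
  apply: le_trans (ler_pM (ler0n _ _) (em_ge0 _) e2 e1) _.
  have h := natr_geometric m (introT andP (conj (ltW t0) t1)).
  have h0 : 0 <= m.+1%:R * t ^+ m by rewrite mulr_ge0// exprn_ge0// ltW.
  have hh := ler_pM h0 h0 h h; rewrite -/C in hh.
  have -> : 2 * m.+1%:R * ((1 + K) * m.+1%:R * r ^+ m) =
     2 * (1 + K) * (m.+1%:R * t ^+ m * (m.+1%:R * t ^+ m)) * (t ^+ 2) ^+ m.
    have -> : r ^+ m = (t ^+ m * t ^+ m) * (t ^+ 2) ^+ m.
      by rewrite t4 exprMn; congr (_ * _); rewrite -exprM mul2n -addnn exprD.
    by ring.
  rewrite ler_wpM2r ?exprn_ge0 ?(ltW t0)// /B expr2 ler_wpM2l//.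
  by rewrite mulr_ge0// addr_ge0.
exists (B * (1 - t ^+ 2)^-1) => n; rewrite expect_sig.
apply: le_trans (_ : \sum_(j < n * n) em j <= _).
  apply: le_trans (_ : \sum_(j < n) em j <= _).
    by apply: ler_sum => j _; exact: em_anti.
  rewrite square_split.
  by rewrite big_split_ord /= lerDl; apply: sumr_ge0 => j _; exact: em_ge0.
apply: le_trans (sum_em_squares n) _.
apply: le_trans (_ : \sum_(m < n) B * (t ^+ 2) ^+ m <= _); first by apply: ler_sum.
by rewrite -mulr_sumr ler_wpM2l// geometric_sum_le.
Qed.

End ones_decay.

(** For [lam <= 1] the partition functions grow subexponentially, like the distortion; the cost of
    an erasure is thus subexponential in the block length. *)
Lemma part_small (e : R) : lam br (wt alpha phi) <= 1 -> 0 < e ->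
  exists2 C : R, 0 <= C & forall n, ln (part n) + 2 * A * dsum n <= C + e * n%:R.
Proof.
move=> lam1 e0; have [c c0 [C Wc]] := wt_bound alpha phiA.
have e2 : 0 < e / 2 by rewrite divr_gt0.
have l1 : lam br (wt alpha phi) < expR (e / 2).
  by apply: le_lt_trans lam1 _; rewrite -[X in X < _]expR0 ltr_expR.
have [M M0 hM] := iter_tr_lam y0 c0 Wc l1.
have [D D0 hD] := dsum_small alpha g (divr_gt0 e0 (mulr_gt0 (ltr0n R 4 : 0 < 4%:R) (ltr_wpDl A0 ltr01))).
exists (`|ln M| + 2 * A * D) => [|n]; first by rewrite addr_ge0 ?mulr_ge0.
have Z1 : part n <= M * expR (e / 2) ^+ n.
  apply: le_trans (hM n y0); apply: eq_refl_le; rewrite iter_tr_words.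
  by apply: eq_bigr => w _; rewrite mulr1.
have Z0 : 0 < part n by exact: lt_le_trans (part_ge1 n).
have h1 : ln (part n) <= `|ln M| + e / 2 * n%:R.
  apply: le_trans (_ : ln (M * expR (e / 2) ^+ n) <= _).
    by rewrite ler_ln ?posrE// mulr_gt0// exprn_gt0// expR_gt0.
  rewrite lnM ?posrE ?exprn_gt0 ?expR_gt0// -expRM_natr expRK.
  by rewrite lerD2r ler_norm.
have h3 : 2 * A * dsum n <= 2 * A * D + e / 2 * n%:R.
  apply: le_trans (_ : 2 * A * (D + e / (4 * (A + 1)) * n%:R) <= _).
    by rewrite ler_wpM2l// mulr_ge0.
  rewrite mulrDr lerD2l mulrA ler_wpM2r// mulrA ler_pdivrMr ?mulr_gt0 ?ltr_wpDl//.
  by move: e0 A0; nra.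
have -> : e * n%:R = e / 2 * n%:R + e / 2 * n%:R by rewrite -mulrDl; congr (_ * _); field.
by move: h1 h3; lra.
Qed.

(** For a suitable block length [N] the mean gain per block is positive. It is then fixed while the
    number [k] of blocks grows, so that the total gain [k * gain] exceeds all errors, which are
    sublinear in [k * N]. *)
Lemma no_mixing (nu : probability I R) : invariant_measure im nu ->
  lam br (wt alpha phi) <= 1 -> 0 <= entropy_wrt nu im side + expect nu phi ->
  0 < entropy_wrt nu im side -> exponentially_mixing im nu -> False.
Proof.
move=> inv lam1 hvar hpos mix.
have [K K0 [th th01 qK]] := qz_exp_decay inv mix hpos.
have [Ds sigD] := sig_bound inv K0 th01 qK.
have /andP[th0 th1] := th01.
(* The rate between: zero blocks have mass of order [th ^+ N], and erasures are allowed to cost a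
   factor [t ^+ N], which is much larger. *)
pose t := Num.sqrt th.
have /andP[t0 t1] : 0 < t < 1 by exact: sqrt_lt1.
have tt : th = t * t by rewrite -expr2 sqr_sqrtr// ltW.
have e0 : 0 < - ln t by rewrite oppr_gt0 ln_lt0// t0.
have [C C0 hC] := part_small lam1 e0.
pose c := expR (- (ln 2 + C + A * Ds)) / 2.
have c0 : 0 < c by rewrite divr_gt0// expR_gt0.
have ln2 : 0 < ln 2 :> R by rewrite ln_gt0// ltr1n.
have d0 : 0 < ln 2 * K + 1 by rewrite ltr_wpDl// mulr_ge0// ltW.
have [N hN] := expr_lt_ex (introT andP (conj (ltW t0) t1)) (divr_gt0 c0 d0).
have gain0 : 0 < gain N nu Ds.
  rewrite /gain subr_gt0.
  apply: le_lt_trans (_ : (ln 2 * K + 1) * t ^+ N * t ^+ N < _).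
    rewrite -mulrA -exprMn -tt mulrDl mul1r; apply: ler_wpDr; first by rewrite exprn_ge0// ltW.
    by rewrite -mulrA ler_wpM2l// ltW.
  apply: lt_le_trans (_ : c * t ^+ N <= _).
    rewrite ltr_pM2r ?exprn_gt0//; move: hN; rewrite ltr_pdivlMr//.
    by rewrite mulrC.
  rewrite /c mulrAC ler_pM2r ?invr_gt0// -[t]lnK ?posrE// -expRM_natr -expRD ler_expR.
  rewrite /cost lnM ?posrE ?(lt_le_trans _ (part_ge1 N))//.
  by have := hC N; rewrite [in _ * N%:R]mulNr; lra.
have e1 : 0 < gain N nu Ds / (2 * (N%:R + 1)) by rewrite divr_gt0// mulr_gt0// ltr_wpDl.
(* This error rate makes the total error per block of length [N] less than half of [gain]. *)
have [C' C'0 hC'] := part_small lam1 e1.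
have : gain N nu Ds <= gain N nu Ds / (2 * (N%:R + 1)) * N%:R.
  apply: (@lin_le _ _ _ C') => k.
  have h1 := surgery_entropy N nu k.
  have [_ h2] := entropy_wrt_lim (measurable_im alpha) inv (measurable_side alpha).
  have h3 := h2 (k * N)%N.
  have h4 := expect_lgain N inv sigD k.
  have h5 : (k * N)%:R * expect nu phi - A * dsum (k * N) <= expect nu (fun x => wS (word (k * N) x) y0).
    rewrite -(expect_birk phiA inv) -(mposfun_cst (expect_pos nu) (A * dsum (k * N))).
    rewrite -(mposfunB (expect_pos nu) (bm_birk alpha phiA (k * N)) (bm_cst _ _)).
    apply: (mposfun_le (expect_pos nu)).
    - by apply: bmB; [exact: bm_birk phiA _|exact: bm_cst].
    - exact: (bm_word alpha (k * N) (fun w => wS w y0)).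
    - by move=> x; have := wS_word alpha phiA (k * N) x y0; rewrite ler_norml => /andP[+ _]; lra.
  have h6 := hC' (k * N)%N.
  have h7 : 0 <= A * dsum (k * N) by rewrite mulr_ge0 ?dsum_ge0.
  have h8 := mulr_ge0 (ler0n R (k * N)) hvar.
  have h9 : gain N nu Ds / (2 * (N%:R + 1)) * (k * N)%:R = gain N nu Ds / (2 * (N%:R + 1)) * N%:R * k%:R.
    by rewrite natrM; ring.
  have fin (H lz ws lg e n k' G p d D X : R) : H <= lz - (ws + lg) -> e * n <= H ->
      k' * G <= lg -> n * p - A * d <= ws -> lz + 2 * A * d <= D + X -> 0 <= A * d ->
      0 <= n * (e + p) -> G * k' <= D + X.
    by rewrite mulrDr -mulrA [n * e]mulrC [k' * G]mulrC; lra.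
  rewrite -h9; exact: fin h1 h3 h4 h5 h6 h7 h8.
apply/negP; rewrite -ltNge mulrAC ltr_pdivrMr ?mulr_gt0 ?ltr_wpDl//.
by rewrite ltr_pM2l//; have := ler0n R N; lra.
Qed.

End replacement.

Section not_intermittent.
Variables (R : realType) (alpha g : {posnum R}).
Local Notation I := (uitv R).

Lemma lam_shift (phi : I -> R) (A c : R) : nrm (hdist g) phi A ->
  lam (br alpha) (wt alpha (fun x => phi x - c)) = expR (- c) * lam (br alpha) (wt alpha phi).
Proof.
move=> phiA; have [a a0 [C Wc]] := wt_bound alpha phiA.
rewrite -(lam_scale (br alpha) (uitv0 R) a0 Wc (expR_gt0 _)); congr lam.
by apply/funext => b; apply/funext => x; rewrite /wt expRD mulrC.
Qed.

Lemma lam_not_intermittent (phi : I -> R) (A : R) (nu : probability I R) :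
  nrm (hdist g) phi A -> lam (br alpha) (wt alpha phi) = expR (phi (uitv0 R)) ->
  gibbs_state (im alpha) phi nu -> exponentially_mixing (im alpha) nu ->
  (0 < entropy nu (im alpha))%E -> False.
Proof.
move=> phiA lamE [inv fe] mix; rewrite (entropyE_side inv) lte_fin => hpos.
move: fe; rewrite (free_energyE phiA inv) (pressureE alpha phiA) lamE expRK => -[] fe.
pose psi x := phi x - phi (uitv0 R).
have psiA : nrm (hdist g) psi A.
  split=> [x|x y]; last by rewrite /psi opprB addrA subrK; exact: phiA.2.
  apply: le_trans (phiA.2 _ _) _; rewrite ler_piMr ?hdist_le1//; exact: phiA_ge0 phiA.
apply: (no_mixing psiA _ inv) => //; first by rewrite /psi subrr.
- by rewrite (lam_shift _ phiA) lamE -expRD addNr expR0.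
- have bphi := bm_phi phiA.
  rewrite (mposfunB (expect_pos nu) bphi (bm_cst _ _)) (mposfun_cst (expect_pos nu)).
  by rewrite addrA fe subrr.
Qed.

End not_intermittent.

(** * The pressure along a ray *)

Section identity.
Variable R : realType.

(** By strong induction, once the earlier coefficients vanish, [b k * t ^+ k] is of order
    [t ^+ k.+1] and small [t > 0] forces [b k = 0]. One side of [0] is enough, which is where the
    pressure will be known. *)
Lemma pseries_vanish (b : nat -> R) (r : R) : 0 < r ->
  (forall t, 0 <= t < r -> pseries b t @ \oo --> (0 : R)) -> forall n, b n = 0.
Proof.
move=> r0 hb; pose r1 := r / 2.
have r10 : 0 < r1 by rewrite divr_gt0.
have r1r : 0 <= r1 < r by rewrite (ltW r10)/= /r1; lra.
have [B [B0 hB]] : exists B : R, 0 <= B /\ forall n, `|b n| * r1 ^+ n <= B.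
  have cv := hb _ r1r; have cv1 : cvgn (pseries b r1) by apply: cvgP cv.
  have : (fun n => b n * r1 ^+ n) @ \oo --> (0 : R) by exact: cvg_series_cvg_0 cv1.
  move=> c0; have : bounded_fun (fun n => b n * r1 ^+ n).
    by apply: cvg_seq_bounded; apply: cvgP c0.
  case=> M [_ hM]; exists (`|M| + 1); split; first by rewrite addr_ge0.
  move=> n; have h : `|b n * r1 ^+ n| <= `|M| + 1.
    by apply: (hM (`|M| + 1) _ n) => //; rewrite ltr_pwDr// ler_norm.
  by move: h; rewrite normrM normrX (ger0_norm (ltW r10)).
elim/ltn_ind => k IH; apply/eqP; rewrite -normr_le0; apply/ler_addgt0Pr => e e0.
rewrite add0r.
(* The first bound makes the tail geometric of ratio at most [1/2], the second makes it at most
   [e * t ^+ k]. *)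
pose t := Num.min (r1 / 2) (e * r1 ^+ k.+1 / (2 * (B + 1))).
have B1 : 0 < 2 * (B + 1) by rewrite mulr_gt0// ltr_wpDl.
have t0 : 0 < t.
  by rewrite lt_min divr_gt0//= divr_gt0// mulr_gt0// exprn_gt0.
have t1 : t <= r1 / 2 by rewrite ge_min lexx.
have t2 : t <= e * r1 ^+ k.+1 / (2 * (B + 1)) by rewrite ge_min lexx orbT.
have tr : 0 <= t < r by rewrite (ltW t0)/=; move: t1; rewrite /r1; lra.
have S n : `|pseries b t (k.+1 + n)%N - b k * t ^+ k| <= 2 * B * (t / r1) ^+ k.+1.
  rewrite pseriesE big_split_ord /= big_ord_recr /= big1 => [|i _].
    rewrite add0r addrAC subrr add0r; apply: le_trans (ler_norm_sum _ _ _) _.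
    have q01 : 0 <= t / r1 < 1.
      by rewrite divr_ge0 ?(ltW t0) ?(ltW r10)//= ltr_pdivrMr// mul1r; move: t1; lra.
    apply: le_trans (_ : \sum_(i < n) B * (t / r1) ^+ k.+1 * (t / r1) ^+ i <= _).
      apply: ler_sum => i _; rewrite normrM normrX (ger0_norm (ltW t0)).
      rewrite -mulrA -exprD expr_div_n mulrA ler_pdivlMr ?exprn_gt0//.
      by rewrite mulrAC ler_wpM2r ?hB// exprn_ge0// ltW.
    rewrite -mulr_sumr; have := geometric_sum_le n q01.
    have hq : (1 - t / r1)^-1 <= 2.
      rewrite -[leRHS]invrK lef_pV2 ?posrE ?invr_gt0 ?subr_gt0//; last by case/andP: q01.
      by rewrite lerBrDr -lerBrDl ler_pdivrMr//; move: t1; lra.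
    move=> /le_trans /(_ hq) h.
    have hc : 0 <= B * (t / r1) ^+ k.+1.
      by rewrite mulr_ge0// exprn_ge0//; case/andP: q01.
    by have -> : 2 * B * (t / r1) ^+ k.+1 = B * (t / r1) ^+ k.+1 * 2; [ring|exact: ler_wpM2l].
  by rewrite IH ?mul0r.
have h : `|b k * t ^+ k| <= 2 * B * (t / r1) ^+ k.+1.
  have cv := hb t tr.
  have cv2 : (fun n => `|pseries b t (n + k.+1)%N - b k * t ^+ k|) @ \oo --> `|0 - b k * t ^+ k|.
    apply: cvg_norm; apply: cvgB; last exact: cvg_cst.
    by rewrite (cvg_shiftn k.+1 (pseries b t) _).
  rewrite sub0r normrN in cv2; apply: (ler_cvg_to cv2 (cvg_cst _)).
  by apply: nearW => n; rewrite addnC; exact: S.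
rewrite normrM normrX (ger0_norm (ltW t0)) in h.
have tk : 0 < t ^+ k by rewrite exprn_gt0.
rewrite -(ler_pM2r tk); apply: le_trans h _.
rewrite expr_div_n mulrA ler_pdivrMr ?exprn_gt0//.
have h2 : t * (2 * (B + 1)) <= e * r1 ^+ k.+1 by rewrite -ler_pdivlMr.
have h3 : t * (2 * B) <= e * r1 ^+ k.+1 by apply: le_trans h2; rewrite ler_wpM2l ?(ltW t0)//; lra.
have := ler_wpM2r (ltW tk) h3; rewrite (exprSr t); lra.
Qed.

Definition affc (c0 c1 : R) (n : nat) : R :=
  if n is n'.+1 then (if n' is 0 then c1 else 0) else c0.

Lemma pseries_affc (c0 c1 t : R) : pseries (affc c0 c1) t @ \oo --> c0 + c1 * t.
Proof.
rewrite -(cvg_shiftn 2); apply: cvg_near_cst; apply: nearW => n /=.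
rewrite pseriesE addn2 !big_ord_recl big1 => [|i _]; last by rewrite mul0r.
by rewrite /= expr0 expr1 mulr1 addr0.
Qed.

Lemma pseries_affine (a : nat -> R) (r c0 c1 : R) : 0 < r ->
  (forall t, 0 <= t < r -> pseries a t @ \oo --> c0 + c1 * t) ->
  forall t, pseries a t @ \oo --> c0 + c1 * t.
Proof.
move=> r0 ha; pose b n := a n - affc c0 c1 n.
have b0 : forall n, b n = 0.
  apply: (pseries_vanish r0) => t tr.
  have -> : pseries b t = pseries a t \- pseries (affc c0 c1) t.
    apply/funext => n; rewrite /= !pseriesE -sumrB; apply: eq_bigr => i _.
    by rewrite mulrBl.
  by rewrite -[X in _ --> X](subrr (c0 + c1 * t)); apply: cvgB; [exact: ha|exact: pseries_affc].
have -> : a = affc c0 c1 by apply/funext => n; apply/eqP; rewrite -subr_eq0; apply/eqP/b0.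
exact: pseries_affc.
Qed.

End identity.

Section holder_potential.
Variables (R : realType) (alpha g : {posnum R}).
Local Notation I := (uitv R).
Local Notation br := (br alpha).
Local Notation im := (im alpha).

Lemma holder_nrm (phi : holder_space g) : exists2 A : R, 0 < A & nrm (hdist g) phi A.
Proof.
have hp : holder g%:num phi by have := holder_funP phi; rewrite inE.
have [B hB] := holder_bounded hp; have /holderP[M M0 hM] := hp.
exists (`|B| + M + 1); first by rewrite ltr_wpDl ?addr_ge0.
split=> [x|x y].
  apply: le_trans (_ : B <= _); first by apply: hB; exists x.
  by apply: le_trans (ler_norm _) _; rewrite -addrA lerDl addr_ge0.
have [->|xy] := eqVneq x y; first by rewrite subrr normr0 mulr_ge0 ?hdist_ge0 ?addr_ge0.
apply: le_trans (hM x y xy) _; rewrite ler_wpM2r ?hdist_ge0//.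
by rewrite -addrA addrCA lerDl addr_ge0.
Qed.

Lemma ge_powR (z : R) : g%:num <= 1 -> 0 <= z <= 1 -> z <= z `^ g%:num.
Proof.
move=> g1 /andP[z0 z1]; have [->|zn] := eqVneq z 0; first exact: powR_ge0.
rewrite -{1}[z]powRr1// -{1}(subrK g%:num 1) powRD; last by rewrite zn implybT.
rewrite ler_piMl ?powR_ge0//.
apply: (@le_trans _ _ (1 `^ (1 - g%:num))); last by rewrite powR1.
by apply: powR_le => //; rewrite subr_ge0.
Qed.

(** The mixing estimate for Hölder functions is applied to Lipschitz observables, which are Hölder
    since the exponent is at most [1]. *)
Lemma lam_intermittent (phi : holder_space g) : g%:num <= 1 ->
  expR (phi (uitv0 R)) < lam br (wt alpha phi) -> intermittent_phase alpha g phi.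
Proof.
move=> g1 gap; have [A A0 phiA] := holder_nrm phi.
have [nu [inv hpos hge [C [rho [C0 rho01 mix]]]]] := gibbs_positive phiA gap.
exists nu; split; last by rewrite (entropyE_side inv) lte_fin.
- split=> //; rewrite -[intermittent alpha]/im (free_energyE phiA inv) (pressureE alpha phiA).
  by congr EFin; apply/eqP; rewrite eq_le hge (variational_ub phiA inv).
- have /andP[rho0 rho1] := rho01.
  exists (C + 1), rho; split; [by rewrite ltr_wpDl|exact: rho01|].
  move=> psi tpsi mpsi bpsi lpsi n.
  have [M hM] : exists M, forall x, `|psi x| <= M.
    case: bpsi => M [_ hM]; exists (M + 1) => x; apply: hM => //.
    by rewrite ltrDl.
  have bm1 : bm psi by split => //; exists M.
  have hV x : `|psi x| <= sup_norm psi.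
    by apply: ub_le_sup; [exists M => _ [y _ <-]|exists x].
  pose L := holder_seminorm 1 tpsi.
  have hL x y : x != y -> `|tpsi x - tpsi y| <= L * `|set_val x - set_val y|.
    move=> xy; rewrite -ler_pdivrMr ?normr_gt0 ?uitv_dist_neq0//.
    have : `|tpsi x - tpsi y| / `|set_val x - set_val y| `^ 1 <= L.
      by apply: ub_le_sup => //; exists (x, y).
    by rewrite powRr1.
  have one_neq0 : (clamp 1 : I) != uitv0 R.
    apply/eqP => h; have := congr1 set_val h; rewrite clampE ?ler01 ?lexx//= => /eqP.
    by rewrite oner_eq0.
  have L0 : 0 <= L.
    have := hL _ _ one_neq0; rewrite clampE ?ler01 ?lexx//= subr0 normr1 mulr1.
    exact: le_trans.
  (* Subtracting a constant does not affect correlations, by invariance, and makes the full norm of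
     the observable bounded by its Lipschitz seminorm. *)
  pose u x := tpsi x - tpsi (uitv0 R).
  have uL : nrm (hdist g) u L.
    have k x y : `|u x - u y| <= L * hdist g x y.
      have -> : u x - u y = tpsi x - tpsi y by rewrite /u; ring.
      have [->|xy] := eqVneq x y; first by rewrite subrr normr0 mulr_ge0 ?hdist_ge0.
      apply: le_trans (hL x y xy) _; rewrite ler_wpM2l// ge_powR//.
      by rewrite normr_ge0 uitv_dist_le1.
    split=> // x; have := k x (uitv0 R); rewrite {2}/u subrr subr0 => /le_trans; apply.
    by rewrite ler_piMr// hdist_le1.
  have pE := expect_pos nu.
  have bu := bm_nrm uL.
  have bpn : bm (fun x => psi (iter n im x)).
    by apply: (bm_comp (f := iter n im)) => //; apply: measurable_iter; exact: measurable_im.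
  have e1 : expect nu (fun x => psi (iter n im x) * tpsi x) =
     expect nu (fun x => psi (iter n im x) * u x) + tpsi (uitv0 R) * expect nu psi.
    rewrite -(expect_iter (measurable_im alpha) inv n bm1) -(mposfunZ pE _ bpn).
    rewrite -(mposfunD pE); [|exact: bmM|exact: bmZ].
    by congr expect; apply/funext => x; rewrite /u; ring.
  have e2 : expect nu tpsi = expect nu u + tpsi (uitv0 R).
    rewrite -(mposfun_cst pE (tpsi (uitv0 R))) -(mposfunD pE bu (bm_cst _ _)).
    by congr expect; apply/funext => x; rewrite /u subrK.
  rewrite -[intermittent alpha]/im -/(expect nu (fun x => psi (iter n im x) * tpsi x)).
  rewrite -/(expect nu psi) -/(expect nu tpsi) e1 e2.
  have -> : expect nu (fun x => psi (iter n im x) * u x) + tpsi (uitv0 R) * expect nu psi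
     - expect nu psi * (expect nu u + tpsi (uitv0 R)) =
     expect nu (fun x => psi (iter n im x) * u x) - expect nu psi * expect nu u by ring.
  apply: le_trans (mix n u psi L bm1 uL _ hV) _; rewrite -/L.
  have V0 : 0 <= sup_norm psi by apply: le_trans (hV (uitv0 R)).
  have h : 0 <= sup_norm psi * L * rho ^+ n by rewrite !mulr_ge0// exprn_ge0// ltW.
  by have -> : C * rho ^+ n * L * sup_norm psi = C * (sup_norm psi * L * rho ^+ n); [ring|move: h; lra].
Qed.

Lemma intermittent_lam (phi : holder_space g) : intermittent_phase alpha g phi ->
  expR (phi (uitv0 R)) < lam br (wt alpha phi).
Proof.
move=> [nu [gs mix hpos]]; have [A A0 phiA] := holder_nrm phi.
rewrite lt_neqAle (wt_lam_ge alpha phiA) andbT; apply/eqP => e.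
exact: lam_not_intermittent phiA (esym e) gs mix hpos.
Qed.

Lemma pressure_holder (phi : holder_space g) :
  pressure (intermittent alpha) phi = (ln (lam br (wt alpha phi)))%:E.
Proof. by have [A A0 phiA] := holder_nrm phi; exact: pressureE phiA. Qed.

(** Up to the factor [lam] at [b], the operator of [y *: phi] is the perturbation of the normalized
    operator at [b] with parameter [y - b]; take the logarithm of the eigenvalue series. *)
Lemma pressure_analytic (phi : holder_space g) (b : R) :
  expR ((b *: phi) (uitv0 R)) < lam br (wt alpha (b *: phi)) ->
  analytic_at (fun beta : R => pressure (intermittent alpha) (beta *: phi)) b.
Proof.
move=> gap; have [A A0 phiA] := holder_nrm (b *: phi).
have [B B0 psiB] := holder_nrm phi.
have [[c [C [K [c0 Wc K0 WK]]]] [m [h [C1 [rho [pm mW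
  [[a a0 ha] [H0 nh] Lh mh] [C10 rho01] sg]]]]]] := nwt_spectral phiA gap.
have D1 b' (x y : I) : hdist g (br b' x) (br b' y) <= hdist g x y.
  by apply: powR_le => //; apply: le_trans (br_dist alpha b' x y); exact: expand_ge.
have [r [l [S [r0 l0 lS lE]]]] := lam_analytic (hdist_ge0 g) D1 (uitv0 R) c0 Wc K0 WK
  pm mW a0 ha nh Lh mh C10 rho01 sg B0 psiB.
have [d [r' [r'0 hd]]] := ln_pseries r0 l0 lS.
have [cw cw0 [Cw Wcw]] := wt_bound alpha phiA.
have L0 := lam_wt_gt0 alpha phiA.
pose a' n := if n is n'.+1 then d n else ln (lam br (wt alpha (b *: phi))) + d 0%N.
exists a', (Num.min (r / 2) r'); split; first by rewrite lt_min divr_gt0.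
move=> y; rewrite lt_min => /andP[y1 y2]; set t := y - b in y1 y2 *.
have LE : lam br (wt alpha (y *: phi)) = lam br (wt alpha (b *: phi)) *
   lam br (fun b' x => expR (t * phi (br b' x)) * nwt alpha (b *: phi) b' x).
  have [Ay Ay0 phiAy] := holder_nrm (y *: phi).
  have [cy cy0 [Cy Wcy]] := wt_bound alpha phiAy.
  have -> : (fun b' x => expR (t * phi (br b' x)) * nwt alpha (b *: phi) b' x) =
     (fun b' x => (lam br (wt alpha (b *: phi)))^-1 * wt alpha (y *: phi) b' x).
    apply/funext => b'; apply/funext => x; rewrite /nwt mulrCA; congr (_ * _).
    rewrite /wt -expRD; congr expR.
    rewrite -[(b *: phi : holder_space g) _]/(b * phi _) -[(y *: phi : holder_space g) _]/(y * phi _).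
    by rewrite /t; ring.
  by rewrite (lam_scale br (uitv0 R) cy0 Wcy) ?invr_gt0// mulrA divff ?mul1r// gt_eqF.
have cv0 := lE t (ltW y1); rewrite -(pseriesE l t) in cv0.
have cv := hd t _ y2 cv0.
rewrite pressure_holder; split=> //=.
rewrite LE lnM ?posrE//; last first.
  have Ly : 0 < lam br (wt alpha (y *: phi)).
    by have [Ay Ay0 phiAy] := holder_nrm (y *: phi); exact: lam_wt_gt0 phiAy.
  by move: Ly; rewrite LE pmulr_rgt0.
have -> : pseries a' t = fun N => pseries (affc (ln (lam br (wt alpha (b *: phi)))) 0) t N + pseries d t N.
  apply/funext => N; rewrite !pseriesE -big_split /=; apply: eq_bigr => -[[|[|i]] hi] _ /=;
  by rewrite -mulrDl ?add0r.
apply: cvgD => //; have := @pseries_affc _ (ln (lam br (wt alpha (b *: phi)))) 0 t.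
by rewrite mul0r addr0.
Qed.

End holder_potential.

Section stationary.
Variables (R : realType) (alpha g : {posnum R}).
Hypothesis g1 : g%:num <= 1.
Local Notation I := (uitv R).
Local Notation br := (br alpha).
Local Notation im := (im alpha).
Local Notation side := (side alpha).
Local Notation y0 := (uitv0 R).
Local Notation dirac0 := (\d_ (uitv0 R) : probability I R).

Lemma entropy_dirac0 : entropy_wrt dirac0 im side = 0.
Proof.
have inv := dirac0_invariant alpha.
apply/eqP; rewrite eq_le (entropy_wrt_side_ge0 inv) andbT.
apply: (entropy_full_zero inv) => m; rewrite /qz expect_dirac; last exact: bm_zer.
by rewrite /zer word0P /= cyl_ge0.
Qed.

Lemma free_energy_dirac0 (phi : holder_space g) : free_energy im phi dirac0 = (phi y0)%:E.
Proof.
have [A A0 phiA] := holder_nrm phi.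
rewrite (free_energyE phiA (dirac0_invariant alpha)) entropy_dirac0 add0r.
by rewrite expect_dirac//; exact: bm_phi phiA.
Qed.

Lemma pressure_ge (phi : holder_space g) : ((phi y0)%:E <= pressure im phi)%E.
Proof.
rewrite -free_energy_dirac0; apply: ereal_sup_ubound.
by exists dirac0 => //; exact: dirac0_invariant.
Qed.

Lemma pressure_leP (phi : holder_space g) (c : R) : (pressure im phi <= c%:E)%E <->
  forall nu : probability I R, invariant_measure im nu ->
    entropy_wrt nu im side + expect nu phi <= c.
Proof.
have [A A0 phiA] := holder_nrm phi.
split=> [h nu inv|h].
  rewrite -lee_fin -(free_energyE phiA inv); apply: le_trans h.
  by apply: ereal_sup_ubound; exists nu.
by apply: ge_ereal_sup => _ [nu inv <-]; rewrite (free_energyE phiA inv) lee_fin; exact: h.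
Qed.

Lemma expect_scale (nu : probability I R) (phi : holder_space g) (b : R) :
  expect nu (b *: phi : holder_space g) = b * expect nu phi.
Proof.
have [A A0 phiA] := holder_nrm phi.
exact: (mposfunZ (expect_pos nu) b (bm_phi phiA)).
Qed.

Definition weight (x : I) : R := set_val x `^ g%:num.

Fact weight_holder : weight \in holder_pred g.
Proof.
rewrite inE; apply/holderP; exists 1 => // x y _; rewrite mul1r.
wlog xy : x y / set_val y <= set_val x.
  by move=> h; have [/h//|/ltW/h] := leP (set_val y) (set_val x); rewrite distrC (distrC (set_val x)).
have g0 : 0 <= g%:num by [].
rewrite ger0_norm ?subr_ge0 ?powR_le ?uitv_ge0// [X in X `^ _]ger0_norm ?subr_ge0//.
have [x0|x0] := leP (set_val x) 0.
  have e : set_val y = set_val x.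
    by apply/eqP; rewrite eq_le xy (le_trans x0 (uitv_ge0 y)).
  by rewrite /weight e subrr powR_ge0.
have xg : 0 < set_val x `^ g%:num by rewrite powR_gt0.
have h z : 0 <= z <= set_val x -> z / set_val x <= z `^ g%:num / set_val x `^ g%:num.
  move=> /andP[z0 z1].
  have -> : z `^ g%:num / set_val x `^ g%:num = (z / set_val x) `^ g%:num.
    rewrite powRM ?invr_ge0 ?(ltW x0)//; congr (_ * _).
    have xn : set_val x `^ g%:num != 0 by rewrite gt_eqF.
    apply: (mulfI xn); rewrite divff// -powRM ?invr_ge0 ?(ltW x0)//.
    by rewrite divff ?gt_eqF// powR1.
  by apply: ge_powR => //; rewrite divr_ge0 ?(ltW x0)//= ler_pdivrMr// mul1r.
have h1 := h (set_val y) (introT andP (conj (uitv_ge0 y) xy)).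
have h2 : (set_val x - set_val y) / set_val x <= (set_val x - set_val y) `^ g%:num / set_val x `^ g%:num.
  by apply: h; rewrite subr_ge0 xy gerBl uitv_ge0.
have h3 : 1 <= (set_val y `^ g%:num + (set_val x - set_val y) `^ g%:num) / set_val x `^ g%:num.
  rewrite mulrDl; apply: le_trans (lerD h1 h2).
  by rewrite -mulrDl addrC subrK divff// gt_eqF.
by move: h3; rewrite ler_pdivlMr// mul1r lerBlDl.
Qed.

Definition weightH : holder_space g := Holder weight_holder.

(** The function [weight] thus dominates, near [0] and with the norm as a factor, every perturbation
    in the Hölder space. *)
Lemma holder_dist0 (phi : holder_space g) (x : I) : `|phi x - phi y0| <= `|phi| * weight x.
Proof.
have hp : holder g%:num phi by have := holder_funP phi; rewrite inE.
have N1 : holder_seminorm g%:num phi <= `|phi|.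
  rewrite -[`|phi|]/(holder_norm phi) /holder_norm lerDr.
  apply: le_trans (normr_ge0 (phi y0)) _; apply: ub_le_sup; last by exists y0.
  exact: holder_bounded hp.
have [->|xy] := eqVneq x y0; first by rewrite subrr normr0 mulr_ge0// powR_ge0.
apply: le_trans (_ : holder_seminorm g%:num phi * weight x <= _); last first.
  by rewrite ler_wpM2r// powR_ge0.
have -> : weight x = `|set_val x - set_val y0| `^ g%:num.
  by rewrite /weight /= subr0 ger0_norm// uitv_ge0.
rewrite -ler_pdivrMr; last by rewrite powR_gt0// normr_gt0 uitv_dist_neq0.
by apply: ub_le_sup => //; exists (x, y0).
Qed.

Lemma bm_weight : bm weight.
Proof. by have [A A0 wA] := holder_nrm weightH; exact: bm_phi wA. Qed.

(** Markov's inequality puts full mass on each [[0, c]] with [c > 0], continuity from above on the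
    point [0], and half-lines determine the measure. *)
Lemma expect_weight0 (nu : probability I R) : expect nu weight <= 0 ->
  forall A, measurable A -> nu A = dirac0 A.
Proof.
move=> w0; have pE := expect_pos nu; have pD := expect_pos dirac0.
have lowpos c : 0 < c -> expect nu (low c) = 1.
  move=> c0; have cg : 0 < c `^ g%:num by rewrite powR_gt0.
  have b1 : bm (fun x : I => 1 - low c x) by apply: bmB; [exact: bm_cst|exact: bm_low].
  have : expect nu (fun x => 1 - low c x) <= 0.
    apply: le_trans (_ : (c `^ g%:num)^-1 * expect nu weight <= _); last first.
      by rewrite pmulr_rle0// invr_gt0.
    rewrite -(mposfunZ pE _ bm_weight); apply: (mposfun_le pE) => //; first exact/bmZ/bm_weight.
    move=> x; rewrite /low; case: (leP (set_val x) c) => xc.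
      by rewrite subrr mulr_ge0 ?invr_ge0 ?powR_ge0.
    by rewrite subr0 ler_pdivlMl// mulr1 powR_le// ltW.
  have : expect nu (low c) <= 1.
    rewrite -[leRHS](mposfun_cst pE); apply: (mposfun_le pE).
    - exact: bm_low.
    - exact: bm_cst.
    - by move=> x; rewrite /low lern1 leq_b1.
  rewrite (mposfunB pE (bm_cst _ _) (bm_low c)) (mposfun_cst pE); lra.
have low0 : expect nu (low 0) = 1.
  pose A n : set I := [set y : I | 0 < set_val y <= n.+1%:R^-1].
  have AE n : \1_(A n) = (fun x => low n.+1%:R^-1 x - low 0 x) :> (I -> R).
    apply/funext => x; rewrite -iv_low ?invr_ge0// indicE /iv; congr (_%:R); congr nat_of_bool.
    by apply/idP/idP => [/set_mem//|h]; exact: mem_set.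
  have mA n : measurable (A n).
    have -> : A n = [set y : I | set_val y <= n.+1%:R^-1] `\` [set y : I | set_val y <= 0].
      apply/seteqP; split => x /=; first by move=> /andP[h1 h2]; split=> //; apply/negP; rewrite -ltNge.
      by move=> [h1 h2]; apply/andP; split=> //; rewrite ltNge; exact/negP.
    by apply: measurableD; exact: measurable_le.
  have := @expect_cont _ nu A mA; have EA n : expect nu \1_(A n) = 1 - expect nu (low 0).
    by rewrite AE (mposfunB pE (bm_low _) (bm_low _)) lowpos ?invr_gt0.
  have -> : (fun n => expect nu \1_(A n)) = fun=> 1 - expect nu (low 0) by apply/funext.
  move=> h; have : (fun=> 1 - expect nu (low 0)) @ \oo --> (0 : R).
    apply: h => [n x /andP[x0 xn]|].
      apply/andP; split=> //; apply: le_trans xn _.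
      by rewrite lef_pV2 ?posrE// ler_nat.
    apply/seteqP; split => // x hx.
    have x0 : 0 < set_val x by have /andP[] := hx 0%N Logic.I.
    pose n := Num.bound (set_val x)^-1.
    have := hx n Logic.I => /andP[_]; apply/negP; rewrite -ltNge invf_plt ?posrE//.
    have : (set_val x)^-1 < n%:R by apply: archi_boundP; rewrite invr_ge0 ltW.
    by move=> /lt_trans; apply; rewrite ltr_nat.
  move=> /cvg_lim; rewrite lim_cst// => h'.
  by apply/eqP; rewrite eq_sym -subr_eq0 h'.
have E : forall u, bm u -> expect nu u = expect dirac0 u.
  apply: (mposfun_eq_le pE pD (@expect_cont _ nu) (@expect_cont _ dirac0)) => c.
  rewrite -low_indic expect_dirac; last exact: bm_low.
  have [c0|c0|<-] := ltgtP 0 c; last by rewrite low0 /low /= lexx.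
    by rewrite lowpos// /low /= (ltW c0).
  rewrite /low /= leNgt c0 /= -[RHS](mposfun0 pE); congr expect; apply/funext => x.
  by rewrite /low leNgt (lt_le_trans c0 (uitv_ge0 _)).
move=> A mA; have := E _ (bm_indic R mA).
rewrite (expect_indic nu mA) (expect_indic dirac0 mA) => h.
by rewrite -[LHS]fineK ?fin_num_measure// h fineK// fin_num_measure.
Qed.

(** A perturbation [eta] of norm at most [e / 2] consumes at most half of the penalty [e * weight].
    What remains bounds each free energy by [psi 0 - e / 2 * expect nu weight], with equality only
    if the mean of [weight] vanishes, that is, for the Dirac mass. *)
Lemma weight_stationary (phi : holder_space g) (e : R) : 0 < e ->
  pressure im phi = (phi y0)%:E ->
  stationary_phase alpha g (phi - e *: weightH).
Proof.
move=> e0 Pphi.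
have h0 nu : invariant_measure im nu -> entropy_wrt nu im side + expect nu phi <= phi y0.
  by move: nu; apply/pressure_leP; rewrite Pphi.
rewrite /stationary_phase /interior; apply/nbhs_ballP; exists (e / 2) => /=; first by rewrite divr_gt0.
move=> psi; rewrite -ball_normE /= => hpsi.
pose eta : holder_space g := psi - (phi - e *: weightH).
have neta : `|eta| <= e / 2 by apply: ltW; rewrite /eta distrC.
have psiE x : psi x = phi x - e * weight x + eta x.
  rewrite -[eta x]/(psi x - (phi x - e * weight x)); ring.
have [Aw Aw0 wA] := holder_nrm weightH; have bw : bm weight := bm_phi wA.
have [Ap Ap0 pA] := holder_nrm phi; have bp := bm_phi pA.
have [Ae Ae0 eA] := holder_nrm eta; have be := bm_phi eA.
have w00 : weight y0 = 0 by rewrite /weight /= powR0// gt_eqF.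
have ub (nu : probability I R) : invariant_measure im nu ->
    entropy_wrt nu im side + expect nu psi <= psi y0 - e / 2 * expect nu weight.
  move=> inv; have pE := expect_pos nu.
  have -> : expect nu psi = expect nu phi - e * expect nu weight + expect nu eta.
    have -> : (psi : I -> R) = fun x => (fun x => phi x - e * weight x) x + eta x.
      by apply/funext => x; exact: psiE.
    rewrite (mposfunD pE (bmB bp (bmZ e bw)) be) (mposfunB pE bp (bmZ e bw)).
    by rewrite (mposfunZ pE _ bw).
  have h1 : expect nu eta <= eta y0 + e / 2 * expect nu weight.
    rewrite -(mposfun_cst pE (eta y0)) -(mposfunZ pE _ bw) -(mposfunD pE (bm_cst _ _) (bmZ _ bw)).
    apply: (mposfun_le pE) => //; first by apply: bmD; [exact: bm_cst|exact: bmZ].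
    move=> x; rewrite -lerBlDl; apply: le_trans (ler_norm _) _.
    by apply: le_trans (holder_dist0 eta x) _; rewrite ler_wpM2r// powR_ge0.
  have := h0 nu inv; rewrite psiE w00 mulr0 subr0; move: h1.
  have -> : e * expect nu weight = e / 2 * expect nu weight + e / 2 * expect nu weight.
    by rewrite -mulrDl; congr (_ * _); field.
  lra.
have wge (nu : probability I R) : 0 <= expect nu weight.
  by case: (expect_pos nu) => _ pos _; apply: pos => // x; exact: powR_ge0.
have P : pressure im psi = (psi y0)%:E.
  apply/eqP; rewrite eq_le pressure_ge andbT; apply/pressure_leP => nu inv.
  apply: le_trans (ub nu inv) _; rewrite gerBl mulr_ge0//.
  by rewrite divr_ge0// ltW.
split.
  split; first exact: dirac0_invariant.
  by rewrite -[intermittent alpha]/im free_energy_dirac0 P.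
move=> mu [inv]; rewrite -[intermittent alpha]/im P.
have [As As0 sA] := holder_nrm psi.
rewrite (free_energyE sA inv) => -[] fe; apply: expect_weight0.
have := ub mu inv; rewrite fe.
by rewrite lerBrDr gerDl pmulr_rle0// divr_gt0.
Qed.

End stationary.

(** * The transition parameter *)

Section transition.
Variables (R : realType) (alpha g : {posnum R}).
Hypothesis g1 : g%:num <= 1.
Variable phi : holder_space g.
Local Notation I := (uitv R).
Local Notation im := (im alpha).
Local Notation y0 := (uitv0 R).
Local Notation p0 := (phi (uitv0 R)).
Local Notation P b := (pressure im (b *: phi : holder_space g)).
Local Notation side := (side alpha).

Lemma intermittentE (b : R) :
  intermittent_phase alpha g (b *: phi) <-> ((b * p0)%:E < P b)%E.
Proof.
have L0 : 0 < lam (br alpha) (wt alpha (b *: phi : holder_space g)).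
  by have [A A0 phiA] := holder_nrm (b *: phi); exact: lam_wt_gt0 phiA.
have e : (b *: phi : holder_space g) y0 = b * p0 by [].
have E : ((b * p0)%:E < P b)%E = (expR ((b *: phi : holder_space g) y0) < lam (br alpha) (wt alpha (b *: phi : holder_space g))).
  rewrite -e -[im]/(intermittent alpha) pressure_holder lte_fin -[X in _ = (_ < X)](lnK L0).
  by rewrite ltr_expR.
rewrite E; split=> h; first exact: (@intermittent_lam R alpha g (b *: phi) h).
exact: (@lam_intermittent R alpha g (b *: phi) g1 h).
Qed.

Lemma pressure_dichotomy (b : R) : ((b * p0)%:E < P b)%E \/ P b = (b * p0)%:E.
Proof.
have := pressure_ge alpha (b *: phi); rewrite le_eqVlt => /predU1P[<-|]; last by left.
by right.
Qed.

(** For each measure the condition is linear in [b], and with nonnegative entropy it forces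
    [p0 >= expect nu phi]; this is why it is monotone and closed in [b]. *)
Lemma pressure_eqP (b : R) : P b = (b * p0)%:E <->
  forall nu : probability I R, invariant_measure im nu ->
    entropy_wrt nu im side <= b * (p0 - expect nu phi).
Proof.
split=> [Pb nu inv|h].
  have := (pressure_leP alpha (b *: phi) (b * p0)).1 _ nu inv; rewrite Pb lexx expect_scale.
  by move=> /(_ isT); lra.
apply/eqP; rewrite eq_le (pressure_ge alpha (b *: phi)) andbT; apply/pressure_leP => nu inv.
by rewrite expect_scale; have := h nu inv; lra.
Qed.

Lemma pressure_mono (b1 b2 : R) : 0 < b1 -> b1 <= b2 ->
  P b1 = (b1 * p0)%:E -> P b2 = (b2 * p0)%:E.
Proof.
move=> b10 b12 /pressure_eqP h; apply/pressure_eqP => nu inv.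
have h1 := h nu inv; apply: le_trans h1 _; apply: ler_wpM2r => //.
by have := le_trans (entropy_wrt_side_ge0 inv) (h nu inv); rewrite pmulr_rge0.
Qed.

Lemma pressure_closed (b0 : R) : (forall b, b0 < b -> P b = (b * p0)%:E) -> P b0 = (b0 * p0)%:E.
Proof.
move=> h; apply/pressure_eqP => nu inv; apply/ler_addgt0Pr => e e0.
set d := p0 - expect nu phi.
have d0 : 0 < `|d| + 1 by rewrite ltr_wpDl.
have e1 : 0 < e / (`|d| + 1) by rewrite divr_gt0.
have hb : b0 < b0 + e / (`|d| + 1) by rewrite ltrDl.
apply: le_trans ((pressure_eqP _).1 (h _ hb) nu inv) _; rewrite mulrDl lerD2l.
rewrite mulrAC ler_pdivrMr// ler_pM2l//; apply: le_trans (ler_norm d) _.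
by rewrite lerDl.
Qed.

Lemma pressure_small : exists2 b : R, 0 < b &
  forall b', 0 < b' -> b' <= b -> ((b' * p0)%:E < P b')%E.
Proof.
have [A A0 phiA] := holder_nrm phi.
have l2 : 0 < ln 2 :> R by rewrite ln_gt0// ltr1n.
(* Up to this bound [2 * (b * A) < ln 2], so that [ln 2 - b * A], a lower bound of the pressure,
   exceeds [b * p0]. *)
exists (ln 2 / (4 * A)); first by rewrite divr_gt0// mulr_gt0.
move=> b b0 bA; have phibA : nrm (hdist g) (b *: phi : holder_space g) (b * A).
  have E x : (b *: phi : holder_space g) x = b * phi x by [].
  split=> [x|x y]; rewrite !E.
    by rewrite normrM (gtr0_norm b0) ler_pM2l//; exact: phiA.1.
  by rewrite -mulrBr normrM (gtr0_norm b0) -mulrA ler_pM2l//; exact: phiA.2.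
rewrite -[im]/(intermittent alpha) pressure_holder lte_fin.
have bA2 : 2 * (b * A) < ln 2.
  by move: bA; rewrite ler_pdivlMr ?mulr_gt0//; move: l2; lra.
have pA : b * p0 <= b * A by rewrite ler_pM2l//; exact: le_trans (ler_norm _) (phiA.1 _).
have c0 : 0 < expR (- (b * A)) by exact: expR_gt0.
have Wc b' x : expR (- (b * A)) <= wt alpha (b *: phi : holder_space g) b' x <= expR (b * A).
  by rewrite /wt !ler_expR -ler_norml; exact: phibA.1.
have h : 2 * expR (- (b * A)) <= lam (br alpha) (wt alpha (b *: phi : holder_space g)).
  exact: (@lam_ge2c _ _ _ y0 _ _ _ c0 Wc).
apply: lt_le_trans (_ : ln (2 * expR (- (b * A))) <= _); last first.
  by rewrite ler_ln ?posrE ?mulr_gt0//; apply: lt_le_trans h; rewrite mulr_gt0.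
by rewrite lnM ?posrE// expRK; lra.
Qed.

Lemma pressure_not_analytic (b0 : R) : 0 < b0 ->
  (forall b, b0 <= b -> P b = (b * p0)%:E) ->
  (forall b, 0 < b < b0 -> ((b * p0)%:E < P b)%E) ->
  ~ analytic_at (fun b : R => P b) b0.
Proof.
move=> b00 hge hlt [a [r [r0 ha]]].
have key : forall t, pseries a t @ \oo --> b0 * p0 + p0 * t.
  apply: (pseries_affine r0) => t /andP[t0 tr].
  have := ha (b0 + t); rewrite [b0 + t - b0]addrAC subrr add0r ger0_norm// => /(_ tr)[_].
  rewrite hge ?lerDl//= => h.
  by have -> : b0 * p0 + p0 * t = (b0 + t) * p0 by ring.
(* A point to the left of [b0], inside the disc of convergence and still at a positive parameter. *)
pose t := - (Num.min r b0 / 2).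
have m0 : 0 < Num.min r b0 by rewrite lt_min r0.
have mr : Num.min r b0 <= r by rewrite ge_min lexx.
have mb : Num.min r b0 <= b0 by rewrite ge_min lexx orbT.
have tr : `|t| < r by rewrite /t normrN gtr0_norm ?divr_gt0//; lra.
have := ha (b0 + t); rewrite [b0 + t - b0]addrAC subrr add0r => /(_ tr)[fin h].
have e : fine (P (b0 + t)) = b0 * p0 + p0 * t.
  by apply: cvg_unique h (key t); exact: Rhausdorff.
have : ((b0 + t) * p0)%:E = P (b0 + t).
  by rewrite -(fineK fin) e; congr EFin; ring.
have /hlt : 0 < b0 + t < b0 by rewrite /t; apply/andP; split; lra.
by move=> + e'; rewrite -e' ltxx.
Qed.

Lemma closure_from_below (b0 : R) (D : set (holder_space g)) : 0 < b0 ->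
  (forall b, 0 < b < b0 -> D (b *: phi)) -> closure D (b0 *: phi).
Proof.
move=> b00 hD B /nbhs_ballP[e /= e0 eB].
have d0 : 0 < `|phi| + 1 by rewrite ltr_wpDl.
pose t := Num.min (b0 / 2) (e / (2 * (`|phi| + 1))).
have t0 : 0 < t by rewrite lt_min !divr_gt0// mulr_gt0.
have tb : t <= b0 / 2 by rewrite ge_min lexx.
have te : t <= e / (2 * (`|phi| + 1)) by rewrite ge_min lexx orbT.
exists ((b0 - t) *: phi); split; first by apply: hD; apply/andP; split; lra.
apply: eB; rewrite -ball_normE /= -scalerBl opprB addrC subrK normrZ (gtr0_norm t0).
move: te; rewrite ler_pdivlMr ?mulr_gt0// => te.
have : t * `|phi| <= t * (`|phi| + 1) by rewrite ler_pM2l// lerDl.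
by move: te e0; lra.
Qed.

(** Perturbing by the weight shows that [b0 *: phi] is in the closure. The phase being open, it
    remains to see that it does not contain [b0 *: phi]: arbitrarily close on the ray, at [b < b0],
    the Dirac mass is not a Gibbs state. *)
Lemma boundary_stationary (b0 : R) : 0 < b0 -> P b0 = (b0 * p0)%:E ->
  (forall b, 0 < b < b0 -> ((b * p0)%:E < P b)%E) ->
  boundary (stationary_phase alpha g) (b0 *: phi).
Proof.
move=> b00 Pb hlt; split.
  move=> B /nbhs_ballP[e /= e0 eB].
  have d0 : 0 < `|weightH g1| + 1 by rewrite ltr_wpDl.
  pose t := e / (2 * (`|weightH g1| + 1)).
  have t0 : 0 < t by rewrite divr_gt0// mulr_gt0.
  exists (b0 *: phi - t *: weightH g1); split; first exact: weight_stationary.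
  apply: eB; rewrite -ball_normE /= opprB addrC subrK normrZ (gtr0_norm t0).
  have : t * `|weightH g1| <= t * (`|weightH g1| + 1) by rewrite ler_pM2l// lerDl.
  have -> : t * (`|weightH g1| + 1) = e / 2 by rewrite /t; field; rewrite gt_eqF.
  by move: e0; lra.
have so : open (stationary_phase alpha g) by exact: open_interior.
rewrite (_ : interior (stationary_phase alpha g) = stationary_phase alpha g); last first.
  by apply/seteqP; split; [exact: interior_subset|rewrite -open_subsetE].
rewrite /stationary_phase /interior /= => nb.
have [psi [[b [b01 ->]] [gs _]]] := @closure_from_below b0
  [set psi | exists b, 0 < b < b0 /\ psi = b *: phi] b00
  (fun b hb => ex_intro _ b (conj hb erefl)) _ nb.
move: gs => [_]; rewrite -[intermittent alpha]/im free_energy_dirac0 => e.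
by have := hlt b b01; rewrite -e ltxx.
Qed.

End transition.
Theorem corollary1 (R : realType) (alpha gamma : {posnum R})
    (gamma_le1 : gamma%:num <= 1) (phi : holder_space gamma) :
  let P := fun beta : R => pressure (intermittent alpha) (beta *: phi) in
  exactly_one
    [/\ forall beta : R, 0 < beta ->
          intermittent_phase alpha gamma (beta *: phi),
        analytic_on [set beta : R | 0 < beta] P
      & forall beta : R, 0 < beta -> ((beta * phi (uitv0 R))%:E < P beta)%E]
    (exists beta0 : R, 0 < beta0 /\
      [/\ forall beta : R, 0 < beta ->
            (beta < beta0 -> intermittent_phase alpha gamma (beta *: phi)) /\
            (beta0 <= beta -> ~ intermittent_phase alpha gamma (beta *: phi)),
          phase_transition_locus alpha gamma (beta0 *: phi),
          analytic_on [set beta : R | 0 < beta < beta0] P /\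
          (forall beta : R, 0 < beta < beta0 ->
             ((beta * phi (uitv0 R))%:E < P beta)%E),
          forall beta : R, beta0 <= beta -> P beta = (beta * phi (uitv0 R))%:E
        & forall beta : R, 0 < beta -> (~ analytic_at P beta <-> beta = beta0)]).
Proof.
move=> P.
have PE b : P b = pressure (im alpha) (b *: phi : holder_space gamma) by [].
have gapI b := intermittentE alpha gamma_le1 phi b.
(* The two alternatives conflict at the transition parameter itself. *)
split; last first.
  move=> [[h1 _ _] [b0 [b00 [h2 _ _ _ _]]]].
  by have [_ no] := h2 b0 b00; apply: no (lexx _) (h1 b0 b00).
have anal b : ((b * phi (uitv0 R))%:E < P b)%E -> analytic_at P b.
  by move=> /gapI/intermittent_lam; exact: pressure_analytic.
(* The parameters at which the Dirac mass is a Gibbs state; the transition parameter is their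
   infimum. *)
pose S := [set b : R | 0 < b /\ P b = (b * phi (uitv0 R))%:E].
have [[b1 [b10 Pb1]]|S0] := pselect (S !=set0); last first.
  left; have gap b : 0 < b -> ((b * phi (uitv0 R))%:E < P b)%E.
    move=> b0; have [//|e] := pressure_dichotomy alpha phi b.
    by exfalso; apply: S0; exists b.
  by split=> [b b0|b /= b0|//]; [apply/gapI/gap|apply/anal/gap].
right; have [bs bs0 small] := pressure_small alpha phi.
have hinf : has_inf S by split; [exists b1|exists 0 => b [/ltW]].
pose b0 := inf S.
have bsb : bs <= b0.
  apply: lb_le_inf; first exact: hinf.1.
  move=> b [b'0 Pb]; rewrite leNgt; apply/negP => bb.
  by have := small b b'0 (ltW bb); rewrite -PE Pb ltxx.
have b00 : 0 < b0 by exact: lt_le_trans bsb.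
have above b : b0 < b -> P b = (b * phi (uitv0 R))%:E.
  rewrite -subr_gt0 => /(inf_adherent)/(_ hinf)[b' [b'0 Pb']].
  by rewrite addrC subrK => /ltW b'b; exact: pressure_mono Pb'.
have Pb0 : P b0 = (b0 * phi (uitv0 R))%:E by exact: pressure_closed above.
have ge b : b0 <= b -> P b = (b * phi (uitv0 R))%:E.
  by move=> hb; exact: pressure_mono Pb0.
have lt b : 0 < b < b0 -> ((b * phi (uitv0 R))%:E < P b)%E.
  move=> /andP[b'0 bb]; have [//|e] := pressure_dichotomy alpha phi b.
  by have : b0 <= b; [apply: ge_inf; [exact: hinf.2|]|rewrite leNgt bb].
have notI b : b0 <= b -> ~ intermittent_phase alpha gamma (b *: phi).
  by move=> hb /gapI; rewrite -PE ge// ltxx.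
exists b0; split=> //; split=> //.
- move=> b b'0; split; last exact: notI.
  by move=> bb; apply/gapI/lt; rewrite b'0.
- split; last exact: boundary_stationary.
  split; last by move=> /interior_subset; exact: notI.
  by apply: closure_from_below => // b hb; exact/gapI/lt.
- by split=> [b hb|//]; apply/anal/lt.
- move=> b b'0; split=> [na|->]; last exact: pressure_not_analytic.
  apply/eqP; rewrite eq_le !leNgt; apply/andP; split; apply/negP => hb; apply: na; last first.
    by apply/anal/lt; rewrite b'0.
  (* To the right of [b0] the pressure is affine on the whole disc of radius [b - b0] around [b]. *)
  exists (affc (b * phi (uitv0 R)) (phi (uitv0 R))), (b - b0); split; first by rewrite subr_gt0.
  move=> y; rewrite ltr_norml => /andP[yb _].
  rewrite ge; last by move: yb; lra.
  split=> //=; have -> : y * phi (uitv0 R) = b * phi (uitv0 R) + phi (uitv0 R) * (y - b) by ring.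
  exact: pseries_affc.
Qed.
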